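(* Let $n\geq 2$, $R\geq 1$ and $\ell > \max\{n+1, \frac{n}{2}+4\}$ be integers. Let $\mathbf{x}_0\in\mathbb{R}^n$ and let $f_1,\ldots,f_R\in C^{\ell}(\mathbb{R}^n)$ satisfy the curvature condition: for every $(t_1,\ldots,t_R)\in\mathbb{R}^R\setminus\{\mathbf{0}\}$, $$\det H_{t_1f_1+\cdots+t_Rf_R}(\mathbf{x}_0)\neq 0.$$ Let $w\in C_0^\infty(\mathbb{R}^n)$ be a non-negative weight function whose support is contained in a sufficiently small (depending on $f_1,\dots,f_R$ and $\mathbf{x}_0$) open neighbourhood of $\mathbf{x}_0$. For $Q\in\mathbb{N}$ and $0\leq\delta\leq \frac12$ define $$\mathcal{N}_w(Q,\delta)=\sum_{\substack{\mathbf{a}\in\mathbb{Z}^n,\ 1\le q\leq Q\\ \|qf_r(\mathbf{a}/q)\|\leq\delta\ (1\leq r\leq R)}} w\left(\frac{\mathbf{a}}{q}\right),\qquad N_0=\sum_{\substack{\mathbf{a}\in\mathbb{Z}^n,\ 1\le q\leq Q}} w\left(\frac{\mathbf{a}}{q}\right).$$ Then $$\left|\mathcal{N}_w(Q,\delta)-(2\delta)^RN_0\right|\ll\begin{cases}\delta^{\frac{(R-1)(n-2)}{n}}Q^n\,\mathcal{E}_n(Q) & \text{if } \delta\geq Q^{-\frac{n}{n+2(R-1)}},\\ Q^{\,n-\frac{(n-2)(R-1)}{n+2(R-1)}}\,\mathcal{E}_n(Q) & \text{if } \delta< Q^{-\frac{n}{n+2(R-1)}},\end{cases}$$ where $\mathcal{E}_n(Q)=\exp(\mathfrak{c}_1\sqrt{\log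 Q})$ if $n=2$ and $\mathcal{E}_n(Q)=(\log Q)^{\mathfrak{c}_2}$ if $n\geq 3$, for some positive constants $\mathfrak{c}_1,\mathfrak{c}_2$. The constants $\mathfrak{c}_1,\mathfrak{c}_2$ and the implied constants depend only on the $f_r$ and $w$.
   Context: $H_f(\mathbf{x})$ denotes the Hessian matrix of $f$ at $\mathbf{x}$, i.e. the $n\times n$ matrix with $(i,j)$-entry $\frac{\partial^2 f}{\partial x_i\partial x_j}(\mathbf{x})$. $\|\cdot\|$ denotes the distance to the nearest integer. $A\ll B$ means $|A|\le CB$ for a constant $C>0$.
   Formalization: For n ≥ 3 the bound is stated only for Q ≥ 2, because at Q = 1 the factor (log Q)^{c_2} is 0 and the printed inequality fails (e.g. R = 1, f = |x|², x_0 = 0, w(0) > 0, δ = 0); for n = 2 all Q ≥ 1 are kept. *)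

(* Defs.v *)
From HB Require Import structures.
From mathcomp Require Import all_boot all_order all_algebra.
From mathcomp Require Import all_classical all_reals all_analysis.

Set Implicit Arguments.
Unset Strict Implicit.
Unset Printing Implicit Defensive.

Import Order.TTheory GRing.Theory Num.Theory.
Import numFieldNormedType.Exports.

Local Open Scope classical_set_scope.
Local Open Scope ring_scope.

Section Calculus.
Context {R : realType} {n : nat}.
Implicit Types (f w : 'rV[R]_n -> R) (x : 'rV[R]_n).

Definition partial (i : 'I_n) f : 'rV[R]_n -> R :=
  fun x => 'D_(delta_mx 0 i) f x.

(* The topology of 'rV[R]_n comes from the sup norm. *)
Fixpoint Ck (k : nat) f : Prop :=
  if k is k'.+1 then
    continuous f /\
    forall i : 'I_n,
      (forall x, derivable f x (delta_mx 0 i)) /\ Ck k' (partial i f)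
  else continuous f.

Definition Cinfty f : Prop := forall k, Ck k f.

Definition supp f : set 'rV[R]_n := closure [set x | f x != 0].

Definition Cc_infty f : Prop := Cinfty f /\ compact (supp f).

Definition hessian f x : 'M[R]_n :=
  \matrix_(i < n, j < n) partial i (partial j f) x.

Definition curvature_condition (r : nat) (f : 'I_r -> 'rV[R]_n -> R) x0 : Prop :=
  forall t : 'rV[R]_r, t != 0 ->
    \det (hessian (fun x => \sum_(k < r) t 0 k * f k x) x0) != 0.

End Calculus.

Definition dist_int {R : realType} (x : R) : R :=
  inf [set `|x - m%:~R| | m in [set: int]].

Section Counting.
Context {R : realType} {n : nat}.
Implicit Types (w : 'rV[R]_n -> R) (Q : nat).

Definition ratpt (a : 'rV[int]_n) (q : nat) : 'rV[R]_n :=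
  q%:R^-1 *: map_mx intr a.

(* A sum over (i \in A) is 0 when infinitely many terms are nonzero; this does
   not occur for compactly supported w. *)
Definition N_w (r : nat) (f : 'I_r -> 'rV[R]_n -> R) w Q (delta : R) : R :=
  \sum_(1 <= q < Q.+1)
    \sum_(a \in [set a : 'rV[int]_n |
                 forall k, dist_int (q%:R * f k (ratpt a q)) <= delta])
      w (ratpt a q).

Definition N_0 w Q : R :=
  \sum_(1 <= q < Q.+1) \sum_(a \in [set: 'rV[int]_n]) w (ratpt a q).

End Counting.

Section Bound.
Context {R : realType}.

(* For n >= 3 this vanishes at Q = 1, where the estimate fails in general; hence
   the restriction 2 <= Q in that case. *)
Definition En (n : nat) (c1 c2 : R) (Q : nat) : R :=
  if n == 2%N then expR (c1 * Num.sqrt (ln Q%:R)) else (ln Q%:R) `^ c2.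

Definition error_bound (n r : nat) (c1 c2 : R) (Q : nat) (delta : R) : R :=
  let N : R := n%:R in
  let S : R := r%:R - 1 in
  if Q%:R `^ (- (N / (N + 2 * S))) <= delta then
    delta `^ (S * (N - 2) / N) * Q%:R ^+ n * En n c1 c2 Q
  else
    Q%:R `^ (N - (N - 2) * S / (N + 2 * S)) * En n c1 c2 Q.

End Bound.

(* Main.v *)
(** The constraint on [q f_r(a/q)] is expanded in trigonometric polynomials and [q] is cut
    dyadically.  A nonzero frequency [j] contributes an exponential sum with phase
    [q (j . f)(a/q)].  Poisson summation in [a] turns it into a sum over dual vectors [k],
    which is negligible unless the gradient of [j . f] comes close to [k], and there the
    geometric sum over [q] is controlled by the distance to the nearest integer of the value
    of [j . f - k . x].  It remains to count integer vectors [(m, k, j)], viewed as affine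
    functions, that are small to first order at some point.  By the curvature condition such
    vectors are separated by the point at which they are small, and a duality on the
    corresponding lattice boxes, iterated a number of times depending on [log Q], bounds their
    number up to a factor [exp (c sqrt (log Q))] if [n = 2] and [(log Q)^c] if [n >= 3].
    Choosing the degree of the trigonometric polynomials so that the two errors balance gives
    the estimate for one dyadic range, and these estimates add up geometrically. *)

Require Import Defs.
From HB Require Import structures.
From mathcomp Require Import all_boot all_order all_algebra.
From mathcomp Require Import all_classical all_reals all_analysis.
From mathcomp Require Import perm finmap complex ring lra zify.

Set Implicit Arguments.
Unset Strict Implicit.
Unset Printing Implicit Defensive.

Import Order.TTheory GRing.Theory Num.Theory.
Import numFieldNormedType.Exports.

Local Open Scope classical_set_scope.
Local Open Scope ring_scope.

(** Neither integrals nor an inverse gradient map occur. All fractions a/q with q <= Q lie in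
    (1/L)Z^n for one common multiple [L], so Poisson summation is orthogonality of characters modulo
    L/q, and the analysis takes place on that fine lattice. The gradient is inverted by relabelling:
    a [system] is a finite family that carries a point [X y], a gradient [G y] and a value [g y];
    swapping [X] with [G] and replacing [g] by its Legendre transform [dualg] gives a system again,
    so each estimate holds on both sides. The frequency vector j varies in one coordinate at a time.
    With all coordinates frozen except a largest one j_l, the others only translate the lattice
    boxes, and differences of two solutions are governed by f_l alone. The curvature of all
    combinations of the f_k enters when the points at which one vector is small are separated. The
    obstacle is that dualising costs a factor for each dyadic shell, about log Q of them, and this
    would be paid again at every change of scale. [sigma_dichotomy] trades the shells for counts at
    a larger radius, and about log log Q iterations remove the loss. *)

Section Cis.
Context {R : realType}.
Implicit Types (x y : R) (z : R[i]).

(** * The additive character e(x) and the distance to the nearest integer *)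

Definition cis x : R[i] := (cos (2 * pi * x) +i* sin (2 * pi * x))%C.
Definition nrm z : R := Num.sqrt (complex.Re z ^+ 2 + complex.Im z ^+ 2).

Lemma nrmE z : `|z| = (nrm z)%:C%C.
Proof. by rewrite normc_def. Qed.

Lemma nrm_ge0 z : 0 <= nrm z. Proof. exact: sqrtr_ge0. Qed.

Lemma nrm_inj x y : x%:C%C = y%:C%C -> x = y.
Proof. by case. Qed.

Lemma nrmM z z' : nrm (z * z') = nrm z * nrm z'.
Proof. by apply: nrm_inj; rewrite -nrmE normrM !nrmE rmorphM. Qed.

Lemma nrmD z z' : nrm (z + z') <= nrm z + nrm z'.
Proof. by have := ler_normD z z'; rewrite !nrmE -rmorphD lecR. Qed.

Lemma nrmN z : nrm (- z) = nrm z.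
Proof. by apply: nrm_inj; rewrite -!nrmE normrN. Qed.

Lemma nrm0 : nrm 0 = 0.
Proof. by apply: nrm_inj; rewrite -nrmE normr0. Qed.

Lemma nrm_sum I (r : seq I) (P : pred I) (F : I -> R[i]) :
  nrm (\sum_(i <- r | P i) F i) <= \sum_(i <- r | P i) nrm (F i).
Proof.
elim/big_rec2: _ => [|i b a _ h]; first by rewrite nrm0.
by apply: (le_trans (nrmD _ _)); rewrite lerD2l.
Qed.

Lemma nrm_real x : nrm (x%:C%C) = `|x|.
Proof. by rewrite /nrm /= expr0n addr0 sqrtr_sqr. Qed.

Lemma nrmX z n : nrm (z ^+ n) = nrm z ^+ n.
Proof. by apply: nrm_inj; rewrite -nrmE normrX nrmE rmorphXn. Qed.

Lemma sqr_nrm z : nrm z ^+ 2 = complex.Re z ^+ 2 + complex.Im z ^+ 2.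
Proof. by rewrite sqr_sqrtr // addr_ge0 // sqr_ge0. Qed.

Lemma sqr_nrmC z : (nrm z ^+ 2)%:C%C = z * (z^*)%C.
Proof. by rewrite rmorphXn /= -nrmE sqr_normc. Qed.

Lemma Re_le_nrm z : `|complex.Re z| <= nrm z.
Proof. by have := normc_ge_Re z; rewrite nrmE lecR. Qed.

Lemma nrm_le_ReIm z : nrm z <= `|complex.Re z| + `|complex.Im z|.
Proof.
rewrite -(@ler_pXn2r _ 2) ?nnegrE ?nrm_ge0 ?addr_ge0 // sqr_nrm sqrrD.
rewrite !real_normK ?num_real // -subr_ge0.
have -> : forall a b c : R, a + c + b - (a + b) = c by move=> a b c; ring.
by rewrite mulrn_wge0 // mulr_ge0.
Qed.

Lemma cisD x y : cis (x + y) = cis x * cis y.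
Proof.
rewrite /cis mulrDr cosD sinD; apply/eqP; rewrite eq_complex /=.
by apply/andP; split; apply/eqP; ring.
Qed.

Lemma cis0 : cis 0 = 1.
Proof. by rewrite /cis mulr0 cos0 sin0. Qed.

Lemma cisN x : cis (- x) = ((cis x)^*)%C.
Proof. by rewrite /cis mulrN cosN sinN. Qed.

Lemma nrm_cis x : nrm (cis x) = 1.
Proof. by rewrite /nrm /= cos2Dsin2 sqrtr1. Qed.

Lemma cis1 : cis 1 = 1.
Proof. by rewrite /cis mulr1 mulr_natl cos2pi sin2pi. Qed.

Lemma cis_nat n : cis n%:R = 1.
Proof. by elim: n => [|n IH]; rewrite ?cis0 // -addn1 natrD cisD IH cis1 mulr1. Qed.

Lemma cis_int (m : int) : cis m%:~R = 1.
Proof.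
by case: m => n; rewrite ?NegzE ?mulrNz -?pmulrn ?cisN cis_nat // conjc1.
Qed.

Lemma cisDint x (m : int) : cis (x + m%:~R) = cis x.
Proof. by rewrite cisD cis_int mulr1. Qed.

Lemma cisMn x n : cis (n%:R * x) = cis x ^+ n.
Proof.
elim: n => [|n IH]; first by rewrite mul0r cis0.
by rewrite -addn1 natrD mulrDl cisD IH mul1r addn1 exprSr.
Qed.

Lemma cis_sum I (r : seq I) (P : pred I) (F : I -> R) :
  cis (\sum_(i <- r | P i) F i) = \prod_(i <- r | P i) cis (F i).
Proof. by elim/big_rec2: _ => [|i b a _ <-]; rewrite ?cis0 ?cisD. Qed.

Lemma dist_int_ge0 x : 0 <= dist_int x.
Proof.
apply: lb_le_inf; first by exists `|x - 0%:~R|, 0.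
by move=> _ [m _ <-].
Qed.

Lemma dist_int_le x (m : int) : dist_int x <= `|x - m%:~R|.
Proof.
apply: inf_lbound; last by exists m.
by exists 0 => _ [k _ <-].
Qed.

Lemma dist_intP x : exists m : int, dist_int x = `|x - m%:~R| /\ `|x - m%:~R| <= 1 / 2.
Proof.
pose k := Num.floor (x + 1/2).
have hk1 : k%:~R <= x + 1/2 by exact: ge_floor.
have hk2 : x + 1/2 < k%:~R + 1 by have := lt_succ_floor (x + 1/2); rewrite intrD.
have hk : `|x - k%:~R| <= 1/2 by rewrite ler_norml; apply/andP; split; lra.
exists k; split => //; apply/eqP; rewrite eq_le dist_int_le /=.
apply: lb_le_inf; first by exists `|x - 0%:~R|, 0.
move=> _ [m _ <-].
have [->//|mk] := eqVneq m k.
have : 1 <= `|m - k| by move/eqP: mk; lia.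
rewrite -(ler_int R) intr_norm intrB => h.
have := ler_distD x m%:~R (k%:~R : R); rewrite (distrC m%:~R x) => h2; lra.
Qed.

Lemma dist_int_half x : dist_int x <= 1 / 2.
Proof. by have [m [-> ?]] := dist_intP x. Qed.

Lemma dist_intDint x (m : int) : dist_int (x + m%:~R) = dist_int x.
Proof.
have H y k : dist_int (y + k%:~R) <= dist_int y.
  have [p [-> _]] := dist_intP y.
  apply: (le_trans (dist_int_le _ (p + k))).
  by rewrite intrD opprD addrACA subrr addr0.
apply/eqP; rewrite eq_le H /= -{1}(addrK m%:~R x) -mulrNz.
exact: H.
Qed.

Lemma dist_intN x : dist_int (- x) = dist_int x.
Proof.
have H y : dist_int (- y) <= dist_int y.
  have [p [-> _]] := dist_intP y; apply: (le_trans (dist_int_le _ (- p))).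
  by rewrite mulrNz opprK addrC distrC.
by apply/eqP; rewrite eq_le H /= -{1}(opprK x) H.
Qed.

Lemma dist_intD x y : dist_int (x + y) <= dist_int x + `|y|.
Proof.
have [p [-> _]] := dist_intP x; apply: (le_trans (dist_int_le _ p)).
by rewrite addrAC; exact: ler_normD.
Qed.

Lemma sin_le_id (y : R) : 0 <= y -> sin y <= y.
Proof.
rewrite le_eqVlt => /orP[/eqP<-|y0]; first by rewrite sin0.
have [c _] := @MVT_segment _ sin cos 0 y (ltW y0) (fun _ _ => is_derive_sin _)
   (continuous_subspaceT (@continuous_sin R)).
by rewrite sin0 !subr0 => ->; rewrite ler_piMl ?cos_le1 // ltW.
Qed.

Lemma cos_pi4 : cos (pi / 4) ^+ 2 = 1 / 2 :> R.
Proof.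
have := cos_mulr2n (pi / 4 : R).
have -> : pi / 4 *+ 2 = pi / 2 :> R by lra.
by rewrite cos_pihalf => h; lra.
Qed.

Lemma cos_ge_half (y : R) : `|y| <= pi / 4 -> 1 / 2 <= cos y ^+ 2 /\ 1 / 2 <= cos y.
Proof.
move=> hy.
have p0 := pi_gt0 R.
have h : cos (pi / 4) <= cos `|y|.
  rewrite leNgt; apply/negP => hlt.
  suff : pi / 4 < `|y| by rewrite ltNge hy.
  rewrite -ltr_cos ?in_itv //=; apply/andP; split; try lra.
  - by rewrite normr_ge0.
have c0 : 0 < cos (pi / 4 : R) by apply: cos_gt0_pihalf; apply/andP; split; lra.
rewrite cos_norm in h.
have := cos_pi4; move: c0 h; set a := cos _; set b := cos y => a0 ab a2.
have b2 : 1/2 <= b ^+ 2 by rewrite -a2; nra.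
by split => //; have bb : b <= 1 by [exact: cos_le1]; nra.
Qed.

(** Doubling formula for sin y and the mean value theorem for sin on [0, y/2]: the two cosines that
    appear belong to angles in [0, pi/4], so their product is at least 1/2. The constant 1/2 stands
    in for the sharp 2/pi. *)
Lemma sin_ge_half (y : R) : 0 <= y <= pi / 2 -> y / 2 <= sin y.
Proof.
move=> /andP[y0 y1].
have [->|yn0] := eqVneq y 0; first by rewrite sin0 mul0r.
have yp : 0 < y / 2 by rewrite divr_gt0 // lt_neqAle eq_sym yn0.
have [c] := @MVT_segment _ sin cos 0 (y / 2) (ltW yp) (fun _ _ => is_derive_sin _)
   (continuous_subspaceT (@continuous_sin R)).
rewrite in_itv /= sin0 !subr0 => /andP[c0 c1] h.
have -> : y = (y / 2) *+ 2 by rewrite -mulr_natr divfK.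
rewrite sin_mulr2n h -(mulr_natr (y/2)).
have cc : `|c| <= pi / 4 by rewrite ger0_norm //; lra.
have cy : `|y / 2| <= pi / 4 by rewrite ger0_norm //; lra.
have [c2 c3] := cos_ge_half cc; have [d2 d3] := cos_ge_half cy.
have dd : cos (y / 2) <= 1 by exact: cos_le1.
have ccc : cos (y/2) <= cos c.
  rewrite leNgt; apply/negP => hlt.
  suff : y / 2 < c by rewrite ltNge c1.
  rewrite -ltr_cos ?in_itv //=; apply/andP; split; have := pi_gt0 R; lra.
move: c2 c3 d2 d3 dd ccc; set A := cos (y/2); set B := cos c => c2 c3 d2 d3 dd ccc.
have : 1/2 <= A * B by apply: le_trans d2 _; rewrite expr2 ler_pM //; lra.
move=> AB; rewrite -(mulr_natr (A * _)).
have -> : A * (B * (y / 2)) * 2 = (A * B) * y by field.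
have -> : y / 2 * 2 / 2 = (1/2) * y by field.
by rewrite ler_wpM2r.
Qed.

Lemma nrm_1Bcis x : nrm (1 - cis x) = 2 * `|sin (pi * x)|.
Proof.
apply/eqP; rewrite -(@eqrXn2 _ 2) ?nrm_ge0 ?mulr_ge0 //; apply/eqP.
rewrite sqr_nrm exprMn real_normK ?num_real //= sub0r sqrrN.
have -> : 2 * pi * x = (pi * x) *+ 2 by ring.
rewrite cos_mulr2n sin_mulr2n; have := cos2Dsin2 (pi * x).
move: (cos (pi * x)) (sin (pi * x)) => c s h.
have -> : s ^+ 2 = 1 - c ^+ 2 by lra.
have -> : (c * s *+ 2) ^+ 2 = 4 * c ^+ 2 * s ^+ 2 by ring.
have -> : s ^+ 2 = 1 - c ^+ 2 by lra.
by ring.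
Qed.

Lemma nrm_1Bcis_dist x : exists t : R, [/\ t = dist_int x, 0 <= t <= 1/2 &
  nrm (1 - cis x) = 2 * sin (pi * t)].
Proof.
exists (dist_int x); split; rewrite ?dist_int_ge0 ?dist_int_half //.
have [m [-> hm]] := dist_intP x.
have -> : cis x = cis (x - m%:~R) by rewrite -{1}(subrK m%:~R x) cisDint.
rewrite nrm_1Bcis; congr (_ * _).
have p0 := pi_gt0 R.
have h0 : 0 <= sin (pi * `|x - m%:~R|).
  by apply: sin_ge0_pi; rewrite mulr_ge0 ?pi_ge0 //=; nra.
case: (ger0P (x - m%:~R)) h0 => h h0; first by rewrite ger0_norm.
by rewrite -[in LHS](opprK (x - _)) mulrN sinN normrN ger0_norm.
Qed.

Lemma nrm_1Bcis_ge x : 2 * dist_int x <= nrm (1 - cis x).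
Proof.
have [t [-> /andP[t0 t1] ->]] := nrm_1Bcis_dist x.
rewrite ler_pM2l //.
have p0 := pi_ge2 R.
apply: (@le_trans _ _ (pi * dist_int x / 2)); first by nra.
by apply: sin_ge_half; apply/andP; split; nra.
Qed.

Lemma nrm_1Bcis_le x : nrm (1 - cis x) <= 8 * dist_int x.
Proof.
have [t [-> /andP[t0 t1] ->]] := nrm_1Bcis_dist x.
have p0 := pi_ge2 R; have p4 := pihalf_lt2 R.
have := @sin_le_id (pi * dist_int x) ltac:(nra) => h; nra.
Qed.

Lemma cis_eq1 x : cis x = 1 -> exists m : int, x = m%:~R.
Proof.
move=> h; have := nrm_1Bcis_ge x; rewrite h subrr nrm0 => h0.
have [m [hm _]] := dist_intP x; exists m.
have : `|x - m%:~R| <= 0 by rewrite -hm; lra.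
by rewrite normr_le0 subr_eq0 => /eqP.
Qed.

Lemma geom_cis x n : (1 - cis x) * \sum_(t < n) cis (t%:R * x) = 1 - cis (n%:R * x).
Proof.
rewrite cisMn -(expr1n _ n) subrXX; congr (_ * _); first by rewrite expr1n.
by apply: eq_bigr => i _; rewrite !expr1n mul1r cisMn.
Qed.

Lemma geom_cis_le x n : dist_int x * nrm (\sum_(t < n) cis (t%:R * x)) <= 1.
Proof.
have h := nrm_1Bcis_ge x.
have := congr1 nrm (geom_cis x n); rewrite nrmM => g.
have g2 : nrm (1 - cis (n%:R * x)) <= 2.
  by apply: le_trans (nrmD _ _) _; rewrite nrmN nrm_cis (nrm_real 1) normr1.
have := nrm_ge0 (\sum_(t < n) cis (t%:R * x)); move: g g2 h.
set a := nrm _; set b := nrm _; set c := nrm _ => g g2 h b0.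
have : 2 * dist_int x * b <= a * b by rewrite ler_wpM2r.
by lra.
Qed.

Lemma cis_orth (M : nat) (w : int) : (0 < M)%N ->
  \sum_(t < M) cis (w%:~R * t%:R / M%:R) = if (M%:Z %| w)%Z then M%:R else 0.
Proof.
move=> M0; have Mn0 : M%:R != 0 :> R by rewrite pnatr_eq0 -lt0n.
have E : \sum_(t < M) cis (w%:~R * t%:R / M%:R) =
   \sum_(t < M) cis (t%:R * (w%:~R / M%:R)).
  by apply: eq_bigr => t _; congr cis; field.
rewrite E; case: ifPn => [/dvdzP[k ->]|ndv].
  rewrite (eq_bigr (fun _ => 1)) ?sumr_const ?card_ord // => t _.
  rewrite rmorphM /= -pmulrn (mulfK Mn0) -[t%:R]/((t : nat)%:Z%:~R) -rmorphM /=.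
  exact: cis_int.
have h := geom_cis (w%:~R / M%:R) M.
have e1 : cis (M%:R * (w%:~R / M%:R)) = 1 by rewrite mulrC (divfK Mn0) cis_int.
move/eqP: h; rewrite e1 subrr mulf_eq0 => /orP[|/eqP //].
rewrite subr_eq0 eq_sym => /eqP/cis_eq1[m hm]; case/negP: ndv.
apply/dvdzP; exists m.
have : w%:~R = (m * M%:Z)%:~R :> R by rewrite rmorphM /= -hm -pmulrn (divfK Mn0).
by move/intr_inj.
Qed.

Lemma Re_sum I (r : seq I) (P : pred I) (F : I -> R[i]) :
  complex.Re (\sum_(i <- r | P i) F i) = \sum_(i <- r | P i) complex.Re (F i).
Proof. by elim/big_rec2: _ => [|i b a _ <-] //; case: (F i) => ? ?; case: a. Qed.

Lemma Re_cis_ge x : `|x| <= 1 / 8 -> 1 / 2 <= complex.Re (cis x).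
Proof.
move=> h /=; apply: (cos_ge_half _).2.
rewrite !normrM (ger0_norm (pi_ge0 R)) ger0_norm //; have := pi_gt0 R; nra.
Qed.

End Cis.
Arguments cis {R} x : simpl never.

Ltac pos := match goal with
 | |- is_true (0 < _ * _) => apply: mulr_gt0; pos
 | |- is_true (0 <= _ * _) => apply: mulr_ge0; pos
 | |- is_true (0 < _ ^+ _) => apply: exprn_gt0; pos
 | |- is_true (0 <= _ ^+ _) => apply: exprn_ge0; pos
 | |- is_true (0 < _^-1) => rewrite invr_gt0; pos
 | |- is_true (0 <= _^-1) => rewrite invr_ge0; pos
 | |- is_true (0 <= _ + _) => first [assumption | apply: addr_ge0; pos | lra]
 | |- is_true (0 < _ + _) => first [assumption | apply: addr_gt0; pos | lra]
 | |- is_true (0 <= _%:R) => exact: ler0n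
 | |- is_true (0 <= `|_|) => exact: normr_ge0
 | |- is_true (0 <= \sum_(_ <- _ | _) _) => apply: sumr_ge0 => ? ?; pos
 | |- _ => first [assumption | by [] | apply: ltW; assumption | lra]
 end.

(** * Counting finite sets, and double counting *)

Section Cnt.
Context {R : realType}.

(** An infinite set has count 0, so monotonicity asks for finiteness of the larger set only. *)
Definition cnt {T : choiceType} (A : set T) : R := (size (fset_set A))%:R.

Lemma cnt_ge0 {T : choiceType} (A : set T) : 0 <= cnt A.
Proof. exact: ler0n. Qed.

Lemma cnt_infinite {T : choiceType} (A : set T) : ~ finite_set A -> cnt A = 0.
Proof. by move=> nf; rewrite /cnt /fset_set; case: pselect. Qed.

Lemma mem_fset {T : choiceType} (A : set T) u : finite_set A -> (u \in fset_set A) -> A u.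
Proof. by move=> fA; rewrite in_fset_set //; exact: set_mem. Qed.

Lemma fset_mem {T : choiceType} (A : set T) u : finite_set A -> A u -> u \in fset_set A.
Proof. by move=> fA h; rewrite in_fset_set //; exact: mem_set. Qed.

Lemma cnt_inj {T T' : choiceType} (f : T -> T') (A : set T) (B : set T') :
  finite_set B -> (forall u, A u -> B (f u)) ->
  (forall u v, A u -> A v -> f u = f v -> u = v) -> cnt A <= cnt B.
Proof.
move=> fB AB inj; have [fA|nfA] := pselect (finite_set A); last first.
  by rewrite (cnt_infinite nfA) cnt_ge0.
rewrite ler_nat -(size_map f); apply: uniq_leq_size.
  rewrite map_inj_in_uniq ?fset_uniq // => u v hu hv.
  by apply: inj; apply: (mem_fset fA).
by move=> _ /mapP[u hu ->]; apply: fset_mem => //; apply: AB; apply: (mem_fset fA).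
Qed.

Lemma cnt_le {T : choiceType} (A B : set T) : finite_set B -> A `<=` B -> cnt A <= cnt B.
Proof. by move=> fB AB; apply: (cnt_inj (f := id)). Qed.

Lemma cntE {T : choiceType} (A B : set T) : finite_set B -> A `<=` B ->
  cnt A = \sum_(u <- fset_set B) (`[< A u >])%:R.
Proof.
move=> fB AB; have fA := sub_finite_set AB fB.
rewrite -natr_sum -big_mkcond /= sum1_count -size_filter /cnt; congr (_%:R).
apply: perm_size; apply: uniq_perm; rewrite ?filter_uniq ?fset_uniq // => u.
rewrite mem_filter; apply/idP/andP => [h|[/asboolP h _]]; last exact: fset_mem.
by have h' := mem_fset fA h; split; [apply/asboolP|apply: fset_mem => //; exact: AB].
Qed.

Lemma cntU {T : choiceType} (A B C : set T) : finite_set B -> finite_set C ->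
  A `<=` B `|` C -> cnt A <= cnt B + cnt C.
Proof.
move=> fB fC h; have fBC : finite_set (B `|` C) by rewrite finite_setU.
rewrite (cntE fBC h) (cntE fBC (@subsetUl _ B C)) (cntE fBC (@subsetUr _ B C)).
rewrite -big_split; apply: ler_sum => u _.
case: (asboolP (A u)) => hA; last by rewrite addr_ge0.
have [hB|hC] := h _ hA.
  by rewrite (asboolT hB) lerDl.
by rewrite (asboolT hC) lerDr.
Qed.

Lemma cnt_fin {I : finType} (P : pred I) : cnt [set i | P i] = #|P|%:R.
Proof.
rewrite /cnt cardE; congr (_%:R); apply: perm_size; apply: uniq_perm.
- exact: fset_uniq.
- exact: enum_uniq.
by move=> i; rewrite mem_enum; apply/idP/idP => [/(mem_fset finite_finset)|h] //; exact: (fset_mem finite_finset).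
Qed.

Lemma double_count_le {Y : finType} {T : choiceType} (P : Y -> T -> Prop) (A : set T) (b : R) :
  finite_set A -> (forall y u, P y u -> A u) ->
  (forall u, A u -> (#|[pred y | `[< P y u >]]|)%:R <= b) ->
  \sum_y cnt [set u | P y u] <= cnt A * b.
Proof.
move=> fA PA hb.
rewrite (eq_bigr (fun y => \sum_(u <- fset_set A) (`[< P y u >])%:R)); last first.
  by move=> y _; rewrite (@cntE _ _ A) // => u /PA.
rewrite exchange_big /= /cnt -sum1_size natr_sum mulr_suml.
rewrite big_seq [leRHS]big_seq; apply: ler_sum => u hu.
by rewrite mul1r -natr_sum -big_mkcond /= sum1_card; apply: hb; apply: (mem_fset fA).
Qed.

Lemma double_count_ge {Y : finType} {T : choiceType} (P : Y -> T -> Prop) (A : set T) (b : R) :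
  finite_set A -> (forall y, finite_set [set u | P y u]) ->
  (forall u, A u -> b <= (#|[pred y | `[< P y u >]]|)%:R) ->
  cnt A * b <= \sum_y cnt [set u | P y u].
Proof.
move=> fA fP hb.
apply: (@le_trans _ _ (\sum_y cnt [set u | A u /\ P y u])); last first.
  by apply: ler_sum => y _; apply: cnt_le => // u [].
rewrite (eq_bigr (fun y => \sum_(u <- fset_set A) (`[< A u /\ P y u >])%:R)); last first.
  by move=> y _; rewrite (@cntE _ _ A) // => u [].
rewrite exchange_big /= /cnt -sum1_size natr_sum mulr_suml.
rewrite big_seq [leRHS]big_seq; apply: ler_sum => u hu.
have Au := mem_fset fA hu.
rewrite mul1r -natr_sum -big_mkcond /= sum1_card; apply: le_trans (hb _ Au) _.
rewrite ler_nat; apply/subset_leq_card/fintype.subsetP => y; rewrite !inE.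
by move=> /asboolP h; apply/asboolP; split.
Qed.

End Cnt.

(** * Boxes of lattice points and their duality *)

Section Lattice.
Context {R : realType} {n : nat}.
Implicit Types (x G : 'rV[R]_n) (g S T K : R).

Definition lat : Type := (int * 'rV[int]_n * int)%type.
Implicit Types u v z : lat.

Definition dot x G : R := \sum_i x 0 i * G 0 i.
(** For u = (q, a, b), [tau] measures the distance from a/q to x and [kap] the distance from b/q to
    the plane through (x, g) with slope G, both multiplied by q. The coordinates (q, tau, kap)
    depend linearly and unimodularly on u, and [inbox] is a box in them. *)
Definition tau x u (i : 'I_n) : R := (u.1.2 0 i)%:~R - (u.1.1)%:~R * x 0 i.
Definition kap x G g u : R :=
  (u.2)%:~R - (u.1.1)%:~R * g - \sum_i G 0 i * tau x u i.
Definition inbox x G g S T K : set lat :=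
  [set u | [/\ `|(u.1.1)%:~R| <= S, (forall i, `|tau x u i| <= T) & `|kap x G g u| <= K]].

Definition latbox (B : nat) : set lat :=
  [set u : lat | [/\ (`|u.1.1| <= B)%N, (forall i : 'I_n, (`|u.1.2 0%R i| <= B)%N) & (`|u.2| <= B)%N]].

Lemma finite_latbox B : finite_set (latbox B).
Proof.
pose m := (2 * B)%N.
pose F (z : 'I_m.+1 * {ffun 'I_n -> 'I_m.+1} * 'I_m.+1) : lat :=
  ((z.1.1 : nat)%:Z - B%:Z, \row_i ((z.1.2 i : nat)%:Z - B%:Z), (z.2 : nat)%:Z - B%:Z).
have K (k : int) : (`|k| <= B)%N -> ((inord `|(k + B%:Z)%R|%N : 'I_m.+1) : nat)%:Z - B%:Z = k.
  by move=> h; rewrite inordK; rewrite /m; lia.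
apply: (sub_finite_set (B := range F)); last exact/finite_image/finite_finset.
move=> [[q a] b] [/= h1 h2 h3].
exists (inord `|(q + B%:Z)%R|%N, [ffun i => inord `|(a 0%R i + B%:Z)%R|%N], inord `|(b + B%:Z)%R|%N) => //.
rewrite /F /= !K //; congr (_, _, _); apply/rowP => i.
by rewrite !mxE ffunE K.
Qed.

Lemma inbox_latbox x G g S T K : exists B, inbox x G g S T K `<=` latbox B.
Proof.
pose s : R := \sum_i `|x 0 i|; pose t : R := \sum_i `|G 0 i|.
have s0 : 0 <= s by apply: sumr_ge0.
have t0 : 0 <= t by apply: sumr_ge0.
pose M : R := `|S| + `|T| + `|K| + `|S| * s + `|S| * `|g| + `|T| * t.
have M0 : 0 <= M by rewrite /M !addr_ge0 ?mulr_ge0.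
exists (Num.bound M) => u [h1 h2 h3].
have HB (k : int) : `|k%:~R| <= M -> (`|k| <= Num.bound M)%N.
  move=> h; have := le_lt_trans h (archi_boundP M0).
  by rewrite -intr_norm -abszE -pmulrn ltr_nat => /ltnW.
have a1 := ler_norm S; have a2 := ler_norm T; have a3 := ler_norm K.
have p1 : 0 <= `|S| * s by rewrite mulr_ge0.
have p2 : 0 <= `|S| * `|g| by rewrite mulr_ge0.
have p3 : 0 <= `|T| * t by rewrite mulr_ge0.
have n1 := normr_ge0 S; have n2 := normr_ge0 T; have n3 := normr_ge0 K.
split.
- by apply: HB; rewrite /M; lra.
- move=> i; apply: HB; have := h2 i; rewrite /tau.
  have xi : `|x 0 i| <= s by rewrite /s (bigD1 i) //= lerDl sumr_ge0.
  have : `|(u.1.1)%:~R * x 0 i| <= `|S| * s.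
    by rewrite normrM ler_pM // (le_trans h1).
  set C := _ * x 0 i; set A : R := (u.1.2 0 i)%:~R => hC hA.
  have := ler_normD (A - C) C; rewrite subrK /M => h; lra.
- apply: HB; move: h3; rewrite /kap.
  have : `|(u.1.1)%:~R * g| <= `|S| * `|g|.
    by rewrite normrM ler_wpM2r // (le_trans h1).
  have : `|\sum_i G 0 i * tau x u i| <= `|T| * t.
    apply: le_trans (ler_norm_sum _ _ _) _; rewrite /t mulr_sumr.
    apply: ler_sum => i _; rewrite normrM mulrC ler_wpM2r //.
    exact: (le_trans (h2 i)).
  set A : R := (u.2)%:~R; set C := _ * g; set D := \sum_i _ => hD hC hA.
  have := ler_normD (A - C - D) (C + D); have := ler_normD C D.
  have -> : A - C - D + (C + D) = A by ring.
  by rewrite /M => h h'; lra.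
Qed.

Lemma finite_inbox x G g S T K : finite_set (inbox x G g S T K).
Proof.
have [B h] := inbox_latbox x G g S T K.
exact: sub_finite_set h (finite_latbox B).
Qed.

(** The bilinear form under which the coordinates (q, tau, kap) at (x, G, g) are dual to those at
    (G, x, dot x G - g), see [pairingE]: point and slope change places, and g becomes its Legendre
    transform. *)
Definition pairing u z : int :=
  u.2 * z.1.1 - \sum_i u.1.2 0 i * z.1.2 0 i + u.1.1 * z.2.

Lemma pairingE x G g u z : (pairing u z)%:~R =
  (z.1.1)%:~R * kap x G g u - \sum_i tau x u i * tau G z i
  + (u.1.1)%:~R * kap G x (dot x G - g) z :> R.
Proof.
rewrite /pairing /kap /tau !rmorphD rmorphN /= !rmorphM /= rmorph_sum /=.
set q := u.1.1%:~R; set j := z.1.1%:~R; set b := u.2%:~R; set m := z.2%:~R.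
rewrite (eq_bigr (fun i => (u.1.2 0 i)%:~R * (z.1.2 0 i)%:~R : R)); last first.
  by move=> i _; rewrite rmorphM.
have -> : \sum_i ((u.1.2 0 i)%:~R - q * x 0 i) * ((z.1.2 0 i)%:~R - j * G 0 i) =
  \sum_i (u.1.2 0 i)%:~R * (z.1.2 0 i)%:~R
  - q * \sum_i x 0 i * ((z.1.2 0 i)%:~R - j * G 0 i)
  - j * \sum_i G 0 i * ((u.1.2 0 i)%:~R - q * x 0 i)
  - q * j * dot x G.
  rewrite /dot !mulr_sumr -!sumrB; apply: eq_bigr => i _; ring.
by ring.
Qed.

Definition subl u v : lat := (u.1.1 - v.1.1, u.1.2 - v.1.2, u.2 - v.2).

Lemma subl_injl u v w : subl u w = subl v w -> u = v.
Proof. by case: u v w => [[a b] c] [[a' b'] c'] [[? ?] ?] [/addIr-> /addIr-> /addIr->]. Qed.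

Lemma tau_subl x u v i : tau x (subl u v) i = tau x u i - tau x v i.
Proof. by rewrite /tau /= !mxE !rmorphB /=; ring. Qed.

Lemma kap_subl x G g u v : kap x G g (subl u v) = kap x G g u - kap x G g v.
Proof.
rewrite /kap /=; under eq_bigr do rewrite tau_subl mulrBr.
by rewrite sumrB !rmorphB /=; ring.
Qed.

Definition scalel (M : int) u : lat := (M * u.1.1, \row_i (M * u.1.2 0 i), M * u.2).

Lemma tau_scalel x M u i : tau x (scalel M u) i = M%:~R * tau x u i.
Proof. by rewrite /tau /= !mxE !rmorphM /=; ring. Qed.

Lemma kap_scalel x G g M u : kap x G g (scalel M u) = M%:~R * kap x G g u.
Proof.
rewrite /kap /=; under eq_bigr do rewrite tau_scalel mulrCA.
by rewrite -mulr_sumr !rmorphM /=; ring.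
Qed.

Lemma pairing_subl u v z : pairing (subl u v) z = pairing u z - pairing v z.
Proof.
rewrite /pairing /=; under eq_bigr do rewrite !mxE mulrBl.
by rewrite sumrB; ring.
Qed.

Lemma pairing_addscale u z v M :
  pairing u (z.1.1 + M * v.1.1, z.1.2 + \row_i (M * v.1.2 0 i), z.2 + M * v.2) =
  pairing u z + M * pairing u v.
Proof.
rewrite /pairing /=.
under eq_bigr do rewrite !mxE mulrDr (mulrCA _ M).
by rewrite big_split /= -mulr_sumr; ring.
Qed.

Section Parseval.
Variables (M : nat) (U : seq lat).
Hypothesis M0 : (0 < M)%N.
Hypothesis uU : uniq U.
Hypothesis UM : forall u v, u \in U -> v \in U ->
  [/\ (`|u.1.1 - v.1.1| < M)%N, (forall i, (`|u.1.2 0%R i - v.1.2 0%R i| < M)%N)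
     & (`|u.2 - v.2| < M)%N].

Definition expsum z : R[i] := \sum_(u <- U) cis ((pairing u z)%:~R / M%:R).

Definition res : finType := ('I_M * {ffun 'I_n -> 'I_M} * 'I_M)%type.
Definition emb (r : res) : lat :=
  ((r.1.1 : nat)%:Z, \row_i (r.1.2 i : nat)%:Z, (r.2 : nat)%:Z).

Lemma sum_res_cis (w : lat) : \sum_r cis ((pairing w (emb r))%:~R / M%:R) =
  (\sum_(t < M) cis ((w.2)%:~R * t%:R / M%:R))
  * (\prod_i \sum_(t < M) cis ((- w.1.2 0 i)%:~R * t%:R / M%:R))
  * (\sum_(t < M) cis ((w.1.1)%:~R * t%:R / M%:R)) :> R[i].
Proof.
have Mn0 : M%:R != 0 :> R by rewrite pnatr_eq0 -lt0n.
rewrite bigA_distr_bigA /= big_distrlr /= pair_bigA /= big_distrlr /= pair_bigA /=.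
apply: eq_bigr => -[[a f] c] _ /=.
rewrite -cis_sum -!cisD; congr cis.
rewrite /pairing /= -!mulr_suml -!mulrDl; congr (_ / _).
rewrite !rmorphD rmorphN /= !rmorphM /= rmorph_sum /= -sumrN.
congr (_ + _ + _); apply: eq_bigr => i _.
by rewrite !mxE rmorphM /= rmorphN /= mulNr.
Qed.

Lemma sum_res_cis0 u v : u \in U -> v \in U -> u != v ->
  \sum_r cis ((pairing (subl u v) (emb r))%:~R / M%:R) = 0 :> R[i].
Proof.
move=> hu hv uv; have [h1 h2 h3] := UM hu hv.
have D (w : int) : (`|w| < M)%N -> w != 0 ->
    \sum_(t < M) cis (w%:~R * t%:R / M%:R) = 0 :> R[i].
  move=> hw w0; rewrite cis_orth // ifF //; apply/negbTE/negP => /dvdzP[k hk].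
  move: w0 hw; rewrite hk; case: (eqVneq k 0) => [->|k0]; first by rewrite mul0r eqxx.
  by move=> _; rewrite abszM /=; have : (0 < `|k|)%N by [rewrite absz_gt0]; nia.
rewrite sum_res_cis /=.
have [e1|n1] := eqVneq u.1.1 v.1.1; last by rewrite (D (u.1.1 - v.1.1)) ?subr_eq0 // mulr0.
have [e2|n2] := eqVneq u.2 v.2; last by rewrite (D (u.2 - v.2)) ?subr_eq0 // !mul0r.
have [e3|n3] := eqVneq u.1.2 v.1.2.
  by case/negP: uv; case: u v e1 e2 e3 {hu hv h1 h2 h3} => [[? ?] ?] [[? ?] ?] /= -> -> ->.
have [i hi] : exists i, u.1.2 0 i != v.1.2 0 i.
  apply/existsP; apply: contraNT n3; rewrite negb_exists => /forallP h.
  by apply/eqP/rowP => i; apply/eqP; have := h i; rewrite negbK.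
rewrite (bigD1 i) //= !mxE (D (- (u.1.2 0 i - v.1.2 0 i))) ?mul0r ?mulr0 ?mul0r //.
- by have := h2 i; rewrite abszN.
- by rewrite oppr_eq0 subr_eq0.
Qed.

Lemma conj_expsum z :
  ((expsum z)^*)%C = \sum_(u <- U) cis (- ((pairing u z)%:~R / M%:R)).
Proof. by rewrite rmorph_sum; apply: eq_bigr => u _; rewrite cisN. Qed.

(** Expanding the square leaves the diagonal. Two different points of [U] have all coordinate
    differences below [M] and one of them nonzero, so the corresponding character of the residues
    modulo [M] is nontrivial and sums to 0. *)
Lemma parseval : \sum_r nrm (expsum (emb r)) ^+ 2 = (size U)%:R * M%:R ^+ n.+2.
Proof.
apply: nrm_inj; rewrite rmorph_sum /=.
under eq_bigr do rewrite sqr_nrmC conj_expsum big_distrlr.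
rewrite exchange_big /=; under eq_bigr do rewrite exchange_big /=.
rewrite (eq_big_seq (fun=> (M%:R ^+ n.+2)%:C%C)) => [|u hu].
  by rewrite big_const_seq count_predT iter_addr_0 -rmorphMn mulr_natl.
rewrite (bigD1_seq u) //= [X in _ + X]big1_seq ?addr0; last first.
  move=> v /andP[vu hv]; rewrite -[RHS](@sum_res_cis0 u v) // 1?eq_sym //; apply: eq_bigr => r _.
  by rewrite pairing_subl rmorphB /= mulrBl cisD.
  under eq_bigr do rewrite -cisD subrr cis0.
  rewrite sumr_const !card_prod card_ffun !card_ord rmorphXn /= rmorph_nat.
  by rewrite -natrX; congr (_%:R); rewrite -expnS -expnSr.
Qed.

Lemma expsum_period z v :
  expsum (z.1.1 + M%:Z * v.1.1, z.1.2 + \row_i (M%:Z * v.1.2 0 i), z.2 + M%:Z * v.2)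
  = expsum z.
Proof.
have Mn0 : M%:R != 0 :> R by rewrite pnatr_eq0 -lt0n.
apply: eq_bigr => u _; rewrite pairing_addscale rmorphD rmorphM /= -pmulrn.
by rewrite mulrDl (mulrC M%:R) mulfK // cisDint.
Qed.

End Parseval.

Lemma sum_by_res (I : finType) (M : nat) (rz : I -> res M) (H : res M -> R) (mu : R) :
  (forall r, 0 <= H r) -> (forall r, (#|[pred i | rz i == r]|)%:R <= mu) ->
  \sum_i H (rz i) <= mu * \sum_r H r.
Proof.
move=> H0 hmu; rewrite (partition_big rz xpredT) //= mulr_sumr.
apply: ler_sum => r _.
rewrite (eq_bigr (fun _ => H r)) => [|i /eqP -> //].
have -> : \sum_(i | rz i == r) H r = H r *+ #|[pred i | rz i == r]|.
  by rewrite -sumr_const; apply: eq_bigl => i; rewrite inE.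
by rewrite -mulr_natl ler_wpM2r.
Qed.

(** With c = [cN] the three parts of the pairing are at most cM, 2ncM and 2cM. Their sum is at most
    2(n + 2)cM = M/8, which is what [Re_cis_ge] asks for after division by M. *)
Definition cN : R := (16 * (n%:R + 2))^-1.

Lemma cN_gt0 : 0 < cN.
Proof. by rewrite invr_gt0 mulr_gt0 // ltr_wpDl. Qed.

Section DualFamily.
Variables (x G : 'rV[R]_n) (g S T K : R) (M : nat).
Hypotheses (S0 : 0 < S) (T0 : 0 < T) (K0 : 0 < K).
Hypotheses (MT : T <= cN * M%:R) (MS : S <= cN * M%:R).
Let g' := dot x G - g.
Let A0 := (Num.truncn (cN * M%:R / K)).+1.
Let B0 := (Num.truncn (cN * M%:R / T)).+1.
Let C0 := (Num.truncn (cN * M%:R / S)).+1.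

Let cM0 : 0 <= cN * M%:R.
Proof. by rewrite mulr_ge0 // ltW // cN_gt0. Qed.

Definition dualI : finType := ('I_A0 * {ffun 'I_n -> 'I_B0} * 'I_C0)%type.

(** These are points of the dual box blown up by M. Rounding up and then adding nonnegative offsets
    keeps [tau] and [kap] nonnegative, so the difference of two such points obeys the same bound as
    each of them. *)
Definition dzk (i : dualI) : 'rV[int]_n :=
  \row_l (Num.ceil ((i.1.1 : nat)%:R * G 0 l) + (i.1.2 l : nat)%:Z).
Definition dzm (i : dualI) : R :=
  (i.1.1 : nat)%:R * g' + \sum_l x 0 l * tau G ((i.1.1 : nat)%:Z, dzk i, 0) l.
Definition dz (i : dualI) : lat :=
  ((i.1.1 : nat)%:Z, dzk i, Num.ceil (dzm i) + (i.2 : nat)%:Z).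

Lemma dz_inj : injective dz.
Proof.
move=> [[a f] c] [[a' f'] c'] h.
have e1 : a = a' by apply: val_inj; case: h => -[].
subst a'; have e2 : f = f'.
  apply/ffunP => l; apply: val_inj; case: h => /rowP/(_ l) + _.
  by rewrite !mxE /= => /addrI[].
subst f'; congr (_, _, _); apply: val_inj.
by case: h => /addrI[].
Qed.

Lemma ceil_off (y : R) (t : nat) (b : R) : 1 <= b -> (t < (Num.truncn b).+1)%N ->
  0 <= (Num.ceil y + t%:Z)%:~R - y <= 2 * b.
Proof.
move=> b1 ht; have b0 : 0 <= b by lra.
have t1 : t%:R <= b.
  by apply: (@le_trans _ _ (Num.truncn b)%:R); rewrite ?truncn_le // ler_nat -ltnS.
rewrite intrD -pmulrn; have /andP[] := ceil_itv y; rewrite intrB => h2 h1.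
by have t0 : (0 : R) <= t%:R by []; apply/andP; split; lra.
Qed.

Lemma dz_s i : 0 <= ((dz i).1.1)%:~R * K <= cN * M%:R.
Proof.
rewrite /= -pmulrn; apply/andP; split; first by rewrite mulr_ge0 // ltW.
rewrite -ler_pdivlMr //.
have h : 0 <= cN * M%:R / K by rewrite divr_ge0 // ltW.
apply: (@le_trans _ _ (Num.truncn (cN * M%:R / K))%:R); last by rewrite truncn_le.
by rewrite ler_nat -ltnS; exact: ltn_ord.
Qed.

Lemma dz_tau i l : 0 <= tau G (dz i) l * T <= 2 * (cN * M%:R).
Proof.
have := @ceil_off ((i.1.1 : nat)%:R * G 0 l) (i.1.2 l) (cN * M%:R / T).
rewrite ler_pdivlMr // mul1r => /(_ MT (ltn_ord _)) /andP[h1 h2].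
rewrite /tau /= !mxE -pmulrn; apply/andP; split; first by rewrite mulr_ge0 // ltW.
by rewrite -ler_pdivlMr // -mulrA.
Qed.

Lemma dz_kap i : 0 <= kap G x g' (dz i) * S <= 2 * (cN * M%:R).
Proof.
have := @ceil_off (dzm i) i.2 (cN * M%:R / S).
rewrite ler_pdivlMr // mul1r => /(_ MS (ltn_ord _)) /andP[h1 h2].
have -> : kap G x g' (dz i) = (Num.ceil (dzm i) + (i.2 : nat)%:Z)%:~R - dzm i.
  by rewrite /kap /= -pmulrn /dzm opprD addrA.
apply/andP; split; first by rewrite mulr_ge0 // ltW.
by rewrite -ler_pdivlMr // -mulrA.
Qed.

Lemma card_dualI : (cN * M%:R) ^+ n.+2 <= #|dualI|%:R * (S * T ^+ n * K).
Proof.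
rewrite !card_prod card_ffun !card_ord !natrM natrX.
have F (y : R) : 0 <= y -> y <= ((Num.truncn y).+1)%:R.
  by move=> y0; apply: ltW; exact: truncnS_gt.
have q (a : R) : 0 < a -> 0 <= cN * M%:R / a by move=> a0; rewrite divr_ge0 // ltW.
have h1 : cN * M%:R <= A0%:R * K by rewrite -ler_pdivrMr //; exact: F (q _ K0).
have h2 : cN * M%:R <= B0%:R * T by rewrite -ler_pdivrMr //; exact: F (q _ T0).
have h3 : cN * M%:R <= C0%:R * S by rewrite -ler_pdivrMr //; exact: F (q _ S0).
have -> : A0%:R * B0%:R ^+ n * C0%:R * (S * T ^+ n * K) =
   (A0%:R * K) * ((B0%:R * T) ^+ n * (C0%:R * S)) by rewrite exprMn; ring.
rewrite exprS exprSr; apply: ler_pM => //; first by rewrite mulr_ge0 ?exprn_ge0.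
by apply: ler_pM => //; rewrite ?exprn_ge0 // lerXn2r ?nnegrE // (le_trans _ h2).
Qed.

Lemma pairing_dz u i : inbox x G g S T K u -> `|(pairing u (dz i))%:~R| <= M%:R / 8 :> R.
Proof.
move=> [h1 h2 h3]; rewrite (pairingE x G g).
have /andP[a0 a1] := dz_s i; have /andP[b0 b1] := dz_kap i.
set A := _ * kap x G g u; set B := \sum_i0 _; set C := _ * kap G x _ _.
have hA : `|A| <= cN * M%:R.
  rewrite /A normrM; apply: le_trans a1; rewrite ger0_norm ?ler_wpM2l //.
have hC : `|C| <= 2 * (cN * M%:R).
  rewrite /C normrM mulrC; apply: le_trans b1.
  have k0 : 0 <= kap G x g' (dz i) by rewrite -(pmulr_lge0 _ S0).
  by rewrite -/g' (ger0_norm k0) ler_wpM2l.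
have hB : `|B| <= n%:R * (2 * (cN * M%:R)).
  apply: le_trans (ler_norm_sum _ _ _) _.
  apply: (@le_trans _ _ (\sum_(l < n) 2 * (cN * M%:R))); last first.
    by rewrite sumr_const card_ord -[leLHS]mulr_natl.
  apply: ler_sum => l _; have /andP[c0 c1] := dz_tau i l.
  rewrite normrM mulrC; apply: le_trans c1.
  have k0 : 0 <= tau G (dz i) l by rewrite -(pmulr_lge0 _ T0).
  by rewrite (ger0_norm k0) ler_wpM2l.
have := ler_normD (A - B) C; have := ler_normB A B => q1 q2.
have E : M%:R / 8 = 2 * (n%:R + 2) * (cN * M%:R).
  rewrite /cN; have : (0 : R) <= n%:R by []; move: (n%:R : R) (M%:R : R) => N m N0.
  by field; lra.
rewrite E; lra.
Qed.

Hypothesis M0 : (0 < M)%N.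

Definition quol (z : lat) : lat :=
  ((z.1.1 %/ M%:Z)%Z, \row_i (z.1.2 0%R i %/ M%:Z)%Z, (z.2 %/ M%:Z)%Z).

Let ordM (k : int) : 'I_M := Ordinal (ltn_pmod `|(k %% M%:Z)%Z| M0).

Let ordME (k : int) : (ordM k : nat)%:Z = (k %% M%:Z)%Z.
Proof.
rewrite /ordM /= modn_small ?gez0_abs ?modz_ge0 //; first by rewrite lt0n_neq0.
have := @ltz_pmod k M%:Z; have := @modz_ge0 k M%:Z; lia.
Qed.

Definition rdz (i : dualI) : res M :=
  (ordM (dz i).1.1, [ffun l => ordM ((dz i).1.2 0 l)], ordM (dz i).2).

Lemma dz_res i : dz i = ((emb (rdz i)).1.1 + M%:Z * (quol (dz i)).1.1,
   (emb (rdz i)).1.2 + \row_l (M%:Z * (quol (dz i)).1.2 0 l),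
   (emb (rdz i)).2 + M%:Z * (quol (dz i)).2).
Proof.
have E k : k = (ordM k : nat)%:Z + M%:Z * (k %/ M%:Z)%Z.
  by rewrite ordME addrC mulrC -divz_eq.
rewrite /rdz; move: (dz i) => -[[a b] c]; congr (_, _, _); [exact: E| |exact: E].
by apply/rowP => l; rewrite !mxE ffunE; exact: E.
Qed.

Lemma dz_diff i j : rdz i = rdz j ->
  subl (dz i) (dz j) = scalel M%:Z (subl (quol (dz i)) (quol (dz j))).
Proof.
move=> h; rewrite {1}(dz_res i) {1}(dz_res j) h /subl /scalel /=.
congr (_, _, _); [by ring| |by ring].
by apply/rowP => l; rewrite !mxE; ring.
Qed.

(** Two points with the same residue differ by M times a lattice vector, and dividing by M brings
    this vector from the blown-up box into the dual box. *)
Lemma dz_fiber r : (#|[pred i | rdz i == r]|)%:R <=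
  cnt (inbox G x g' (2 * cN / K) (2 * cN / T) (2 * cN / S)) :> R.
Proof.
have Mp : 0 < M%:R :> R by rewrite ltr0n.
case: (pickP [pred i | rdz i == r]) => [i0 /eqP h0|h]; last first.
  by rewrite eq_card0 // ?cnt_ge0.
rewrite -cnt_fin.
apply: (cnt_inj (f := fun i => subl (quol (dz i)) (quol (dz i0)))).
- exact: finite_inbox.
- move=> i /eqP hi; have hd : rdz i = rdz i0 by rewrite hi h0.
  have d := dz_diff hd.
  have B (a b c t : R) : 0 <= a <= c -> 0 <= b <= c -> a - b = M%:R * t -> `|t| <= c / M%:R.
    move=> /andP[a0 a1] /andP[b0 b1] e.
    rewrite ler_pdivlMr // -[X in _ * X](ger0_norm (ltW Mp)) -normrM mulrC -e ler_norml.
    by apply/andP; split; lra.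
  have Q (t a : R) : 0 < a -> `|t * a| <= 2 * (cN * M%:R) / M%:R -> `|t| <= 2 * cN / a.
    move=> a0; rewrite normrM (gtr0_norm a0) => h; rewrite ler_pdivlMr //.
    apply: le_trans h _; rewrite le_eqVlt; apply/orP; left; apply/eqP.
    by field; rewrite lt0r_neq0.
  split.
  + apply: Q K0 _.
    have h2 : cN * M%:R <= 2 * (cN * M%:R).
      by have : 0 <= cN * M%:R :> R by [rewrite mulr_ge0 // ltW // cN_gt0]; lra.
    have /andP[p0 p1] := dz_s i; have /andP[q0 q1] := dz_s i0.
    apply: (B (((dz i).1.1)%:~R * K) (((dz i0).1.1)%:~R * K)).
    * by rewrite p0 (le_trans p1).
    * by rewrite q0 (le_trans q1).
    * have /(congr1 (fun z => (z.1.1)%:~R : R)) := d.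
      by rewrite /= rmorphB rmorphM /= -pmulrn -mulrBl mulrA => ->.
  + move=> l; apply: Q T0 _.
    apply: (B _ _ _ _ (dz_tau i l) (dz_tau i0 l)).
    by rewrite -mulrBl -tau_subl d tau_scalel -pmulrn mulrA.
  + apply: Q S0 _.
    apply: (B _ _ _ _ (dz_kap i) (dz_kap i0)).
    by rewrite -mulrBl -kap_subl d kap_scalel -pmulrn mulrA.
- move=> i j /eqP hi /eqP hj e; apply: dz_inj.
  have di := @dz_diff i i0 ltac:(by rewrite hi h0).
  have dj := @dz_diff j i0 ltac:(by rewrite hj h0).
  by apply: (@subl_injl _ _ (dz i0)); rewrite di dj e.
Qed.

End DualFamily.

(** A large sieve argument. At each of the at least (cM)^(n+2) / (S T^n K) points of the blown-up
    dual box, the exponential sum over the N points of the primal box is at least N/2 in absolute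
    value. The squares over all residues add up to N M^(n+2) by [parseval], and a residue is hit at
    most as often as the dual box has points. Comparison gives the bound, with the volume as a
    factor. *)
Theorem lattice_duality x G g S T K : 0 < S -> 0 < T -> 0 < K ->
  cnt (inbox x G g S T K) <= 4 / cN ^+ n.+2 * (S * T ^+ n * K) *
    cnt (inbox G x (dot x G - g) (2 * cN / K) (2 * cN / T) (2 * cN / S)) :> R.
Proof.
move=> S0 T0 K0; set mu := cnt (inbox G _ _ _ _ _).
have [B hB] := inbox_latbox x G g S T K.
have c0 := cN_gt0.
(* M exceeds all coordinate differences within the box, as [parseval] requires, and is so large that
   the blown-up dual box has sides at least 1 in the directions of [tau] and [kap]. *)
pose M := (2 * B + 1 + Num.bound ((S + T) / cN))%N.
have M0 : (0 < M)%N by rewrite /M; lia.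
have Mb : (S + T) / cN <= M%:R.
  have h : 0 <= (S + T) / cN by rewrite divr_ge0 ?addr_ge0 ?ltW.
  apply: le_trans (ltW (archi_boundP h)) _; rewrite ler_nat /M; lia.
have MST : S + T <= cN * M%:R by rewrite -ler_pdivrMl // mulrC.
have MT : T <= cN * M%:R by lra.
have MS : S <= cN * M%:R by lra.
set A := inbox x G g S T K in hB *.
have fA : finite_set A := finite_inbox _ _ _ _ _ _.
pose U : seq lat := fset_set A.
have UA u : u \in U -> A u by move=> h; apply: (mem_fset fA).
have UM u v : u \in U -> v \in U ->
  [/\ (`|u.1.1 - v.1.1| < M)%N, (forall i, (`|u.1.2 0%R i - v.1.2 0%R i| < M)%N)
     & (`|u.2 - v.2| < M)%N].
  move=> /UA/hB[a1 a2 a3] /UA/hB[b1 b2 b3]; rewrite /M; split; [lia| |lia].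
  by move=> i; have := a2 i; have := b2 i; lia.
have P := @parseval M U M0 (fset_uniq _) UM.
pose rz := @rdz x G g S T K M M0.
pose H (r : res M) := nrm (expsum M U (emb r)) ^+ 2.
have h1 := @sum_by_res _ M rz H mu (fun r => sqr_ge0 _)
  (@dz_fiber x G g S T K M S0 T0 K0 MT MS M0).
have h2 : \sum_(i : dualI S T K M) ((size U)%:R / 2) ^+ 2 <= \sum_i H (rz i).
  apply: ler_sum => i _; rewrite /H.
  have -> : expsum M U (emb (rz i)) = expsum M U (@dz x G g S T K M i).
    by rewrite (congr1 (expsum M U) (@dz_res x G g S T K M S0 T0 K0 MT MS M0 i)) expsum_period.
  rewrite lerXn2r ?nnegrE ?nrm_ge0 ?divr_ge0 //.
  apply: le_trans (Re_le_nrm _); apply: le_trans (ler_norm _).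
  rewrite /expsum Re_sum -sum1_size natr_sum mulr_suml big_seq [leRHS]big_seq.
  apply: ler_sum => u /UA hu; apply: Re_cis_ge.
  have Mp : 0 < M%:R :> R by rewrite ltr0n.
  rewrite normrM normfV (gtr0_norm Mp) ler_pdivrMr // mulrC mulrA mulr1.
  exact: (pairing_dz S0 T0 K0 MT MS).
rewrite sumr_const /= -[leLHS]mulr_natl in h2.
have h3 := le_trans h2 h1; rewrite P in h3.
have h4 := @card_dualI S T K M S0 T0 K0.
rewrite -/A; have -> : cnt A = (size U)%:R by [].
have [->|s0] := eqVneq (size U) 0%N.
  rewrite !mulr_ge0 ?cnt_ge0 ?invr_ge0 ?exprn_ge0 ?ltW //.
have s1 : 0 < (size U)%:R :> R by rewrite ltr0n lt0n.
set V := S * T ^+ n * K in h4 *; have V0 : 0 < V by rewrite !mulr_gt0 ?exprn_gt0.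
set s := (size U)%:R in h3 s1 *.
set I := (#|_|)%:R in h3; have EI : I = #|@dualI S T K M|%:R by [].
rewrite -EI exprMn in h4.
have Mn : 0 < M%:R ^+ n.+2 :> R by rewrite exprn_gt0 // ltr0n.
have cn : 0 < cN ^+ n.+2 :> R by rewrite exprn_gt0.
have k1 : I * s <= 4 * mu * M%:R ^+ n.+2.
  by rewrite -(ler_pM2r s1); move: h3; rewrite expr2; lra.
have mu0 : 0 <= mu by exact: cnt_ge0.
have k2 : cN ^+ n.+2 * M%:R ^+ n.+2 * s <= 4 * mu * M%:R ^+ n.+2 * V.
  apply: le_trans (_ : I * V * s <= _); first by rewrite ler_pM2r.
  by rewrite mulrAC ler_pM2r.
have k3 : cN ^+ n.+2 * s <= 4 * mu * V.
  by rewrite -(ler_pM2r Mn); move: k2; set a := cN ^+ _; set b := M%:R ^+ _; lra.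
have -> : 4 / cN ^+ n.+2 * V * mu = 4 * mu * V / cN ^+ n.+2 by ring.
by rewrite ler_pdivlMr // mulrC.
Qed.

End Lattice.
Arguments lat n : clear implicits.

(** * Systems of points, slopes and values, and their near-tangent lattice points *)

Section System.
Context {R : realType} {n : nat}.
Implicit Types (Q r t L : R).

Definition supd (x x' : 'rV[R]_n) d : Prop := forall i, `|x 0 i - x' 0 i| <= d.

Definition nearY {Y : finType} (X : Y -> 'rV[R]_n) r y : pred Y :=
  [pred y' | `[< supd (X y') (X y) r >]].

(** A discrete substitute for a function on a cube: second-order Taylor expansion, Lipschitz
    gradient, and points about as dense as those of (1/L)Z^n at every scale from 1/L to 1. The two
    halves required in [system] make the gradient map bi-Lipschitz; this is the form in which
    curvature is available here. *)
Definition half_system {Y : finType} (X G : Y -> 'rV[R]_n) (g : Y -> R) (L C : R) : Prop :=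
  [/\ forall y y' d, supd (X y') (X y) d ->
        `|g y' - g y - \sum_i G y 0 i * (X y' 0 i - X y 0 i)| <= C * d ^+ 2,
      forall y y' d, supd (X y') (X y) d -> supd (G y') (G y) (C * d),
      forall y r, L^-1 <= r <= 1 -> (r * L) ^+ n <= C * #|nearY X r y|%:R &
      forall y r, 0 <= r -> #|nearY X r y|%:R <= C * (1 + r * L) ^+ n].

(** The Legendre transform of g, as a function of the label y instead of the slope [G y]. *)
Definition dualg {Y : finType} (X G : Y -> 'rV[R]_n) (g : Y -> R) y : R :=
  dot (X y) (G y) - g y.

Definition system {Y : finType} (X G : Y -> 'rV[R]_n) (g : Y -> R) (L C : R) : Prop :=
  [/\ 1 <= C, 1 <= L, #|Y|%:R <= C * L ^+ n, half_system X G g L C &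
      half_system G X (dualg X G g) L C].

Lemma dotC (x y : 'rV[R]_n) : dot x y = dot y x.
Proof. by apply: eq_bigr => i _; rewrite mulrC. Qed.

Lemma dualgK {Y : finType} (X G : Y -> 'rV[R]_n) (g : Y -> R) :
  dualg G X (dualg X G g) = g.
Proof. by apply/funext => y; rewrite /dualg dotC subKr. Qed.

Lemma system_dual {Y : finType} (X G : Y -> 'rV[R]_n) (g : Y -> R) (L C : R) :
  system X G g L C -> system G X (dualg X G g) L C.
Proof. by case=> *; split=> //; rewrite dualgK. Qed.

(* The tolerances Q r and Q r^2 are balanced so that membership is stable when
   the base point moves by r. *)
Definition nset {Y : finType} (X G : Y -> 'rV[R]_n) (g : Y -> R) Q r : set (lat n) :=
  [set u | Q < `|(u.1.1)%:~R| <= 2 * Q /\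
     exists y, (forall i, `|tau (X y) u i| <= Q * r) /\
       `|kap (X y) (G y) (g y) u| <= Q * r ^+ 2].

Definition nu {Y : finType} (X G : Y -> 'rV[R]_n) (g : Y -> R) Q r : R :=
  cnt (nset X G g Q r).

Lemma finite_bigcup_inbox {Y : finType} (X G : Y -> 'rV[R]_n) (g : Y -> R) S T K :
  finite_set [set u | exists y, inbox (X y) (G y) (g y) S T K u].
Proof.
apply: (sub_finite_set (B := \bigcup_(y in [set: Y]) inbox (X y) (G y) (g y) S T K)).
  by move=> u [y h]; exists y.
by apply: bigcup_finite; [exact: finite_finset|move=> y _; exact: finite_inbox].
Qed.

Lemma finite_nset {Y : finType} (X G : Y -> 'rV[R]_n) (g : Y -> R) Q r :
  finite_set (nset X G g Q r).
Proof.
apply: (sub_finite_set _ (finite_bigcup_inbox X G g (2 * Q) (Q * r) (Q * r ^+ 2))).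
by move=> u [/andP[_ h] [y [h1 h2]]]; exists y; split.
Qed.

Lemma nu_ge0 {Y : finType} (X G : Y -> 'rV[R]_n) (g : Y -> R) Q r : 0 <= nu X G g Q r.
Proof. exact: cnt_ge0. Qed.

Lemma nu_mono {Y : finType} (X G : Y -> 'rV[R]_n) (g : Y -> R) Q r r' :
  0 <= Q -> 0 <= r -> r <= r' -> nu X G g Q r <= nu X G g Q r'.
Proof.
move=> Q0 r0 rr; apply: cnt_le; first exact: finite_nset.
move=> u [h [y [h1 h2]]]; split=> //; exists y; split.
  by move=> i; apply: le_trans (h1 i) _; rewrite ler_wpM2l.
by apply: le_trans h2 _; rewrite ler_wpM2l // lerXn2r // nnegrE // (le_trans r0).
Qed.

Lemma nu_small {Y : finType} (X G : Y -> 'rV[R]_n) (g : Y -> R) Q r :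
  2 * Q < 1 -> nu X G g Q r = 0.
Proof.
move=> Q1; rewrite /nu (_ : nset _ _ _ _ _ = set0); last first.
  rewrite -subset0 => u [/andP[h1 h2] _].
  have : `|u.1.1| < 1 by rewrite -(ltr_int R) intr_norm (le_lt_trans h2).
  move=> h3; have u0 : u.1.1 = 0 by lia.
  by move: h1 h2; rewrite u0 normr0 => h1 h2; lra.
by rewrite /cnt fset_set0.
Qed.

Definition shellbox (x G : 'rV[R]_n) (g : R) Q Q' S T K : set (lat n) :=
  [set u | Q < `|(u.1.1)%:~R| <= Q' /\ inbox x G g S T K u].

Lemma finite_shellbox x G g Q Q' S T K : finite_set (shellbox x G g Q Q' S T K).
Proof. by apply: (sub_finite_set _ (finite_inbox x G g S T K)) => u []. Qed.

(** Each u is counted for few y only. Its first coordinate exceeds Q, so all y whose box contains u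
    have [X y] within 2T/Q of one another, and the upper density bounds their number. *)
Lemma sum_shellbox_le {Y : finType} (X G : Y -> 'rV[R]_n) (g : Y -> R) (L C : R) Q r S T K :
  0 < Q -> 0 <= T -> 0 <= C -> 0 <= L -> half_system X G g L C -> T <= Q * r -> K <= Q * r ^+ 2 ->
  \sum_y cnt (shellbox (X y) (G y) (g y) Q (2 * Q) S T K) <=
  nu X G g Q r * (C * (1 + 2 * T / Q * L) ^+ n).
Proof.
move=> Q0 T0 C0 L0 [_ _ _ hup] TQ KQ.
have d0 : 0 <= 2 * T / Q by rewrite divr_ge0 ?mulr_ge0 // ltW.
apply: double_count_le; first exact: finite_nset.
  move=> y u [h [_ h2 h3]]; split=> //; exists y; split.
    by move=> i; apply: le_trans (h2 i) TQ.
  exact: le_trans h3 KQ.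
move=> u _; set P := [pred y | _].
case: (pickP P) => [y0 /asboolP [/andP[hs _] [_ ht0 _]]|P0]; last first.
  by rewrite eq_card0 // mulr_ge0 // exprn_ge0 // addr_ge0 // mulr_ge0.
apply: le_trans (hup y0 _ d0); rewrite ler_nat; apply/subset_leq_card/fintype.subsetP.
move=> y /asboolP [_ [_ ht _]]; apply/asboolP => i.
rewrite ler_pdivlMr //.
have h1 := ht i; have h2 := ht0 i.
have E : (X y 0 i - X y0 0 i) * (u.1.1)%:~R = tau (X y0) u i - tau (X y) u i.
  by rewrite /tau; ring.
have h3 := ler_normB (tau (X y0) u i) (tau (X y) u i); rewrite -E normrM in h3.
apply: (@le_trans _ _ (`|X y 0 i - X y0 0 i| * `|(u.1.1)%:~R|)); last by lra.
by rewrite ler_wpM2l // ltW.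
Qed.

(** The first-order terms cancel: what is left is a Taylor remainder and two products of first-order
    quantities. *)
Lemma kap_stable (x G x' G' : 'rV[R]_n) (g g' : R) (u : lat n) :
  kap x' G' g' u - kap x G g u =
  - (u.1.1)%:~R * (g' - g - \sum_i G 0 i * (x' 0 i - x 0 i))
  - \sum_i (G' 0 i - G 0 i) * tau x u i
  + (u.1.1)%:~R * \sum_i (G' 0 i - G 0 i) * (x' 0 i - x 0 i).
Proof.
rewrite /kap; set s := (u.1.1)%:~R.
have -> : \sum_i G' 0 i * tau x' u i = \sum_i G 0 i * tau x u i
   + \sum_i (G' 0 i - G 0 i) * tau x u i - s * \sum_i G 0 i * (x' 0 i - x 0 i)
   - s * \sum_i (G' 0 i - G 0 i) * (x' 0 i - x 0 i).
  rewrite !mulr_sumr -!big_split -!sumrB /=; apply: eq_bigr => i _.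
  by rewrite /tau -/s; ring.
by ring.
Qed.

Lemma sum_norm_le (F : 'I_n -> R) b : (forall i, `|F i| <= b) -> `|\sum_i F i| <= n%:R * b.
Proof.
move=> h; apply: le_trans (ler_norm_sum _ _ _) _.
apply: (@le_trans _ _ (\sum_(i < n) b)); first exact: ler_sum.
by rewrite sumr_const card_ord -[leLHS]mulr_natl.
Qed.

(** The 1 comes from the box at the old base point, the rest bounds the three terms of [kap_stable]
    with some slack. The value is at least 3, which is what [tau] needs. *)
Definition C1 (C : R) : R := 1 + 2 * C + 5 * n%:R * C.

(** A vector that qualifies at y0 lies in the enlarged box of every y within r of y0, and the lower
    density provides at least (rL)^n / C such y. *)
Lemma nu_le_sum {Y : finType} (X G : Y -> 'rV[R]_n) (g : Y -> R) (L C : R) Q r :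
  0 < Q -> 1 <= C -> half_system X G g L C -> L^-1 <= r <= 1 -> 0 < r ->
  nu X G g Q r * ((r * L) ^+ n / C) <=
  \sum_y cnt (shellbox (X y) (G y) (g y) Q (2 * Q) (2 * Q) (C1 C * (Q * r)) (C1 C * (Q * r ^+ 2))).
Proof.
move=> Q0 hC [hq hlip hlo _] hr r0; have C0 : 0 < C by lra.
apply: double_count_ge => [|y|]; [exact: finite_nset|exact: finite_shellbox|].
move=> u [hs [y0 [ht hk]]].
rewrite ler_pdivrMr // [leRHS]mulrC; apply: le_trans (hlo y0 r hr) _.
rewrite ler_pM2l // ler_nat; apply/subset_leq_card/fintype.subsetP => y /asboolP hy.
apply/asboolP; split=> //.
have Qr0 : 0 <= Q * r by rewrite mulr_ge0 ?ltW.
have Qrr0 : 0 <= Q * r ^+ 2 by rewrite mulr_ge0 ?exprn_ge0 ?ltW.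
have nC : 0 <= n%:R * C by rewrite mulr_ge0 // ltW.
have /andP[hs1 hs2] := hs.
split => //.
- move=> i.
  have -> : tau (X y) u i = tau (X y0) u i - (u.1.1)%:~R * (X y 0 i - X y0 0 i).
    by rewrite /tau; ring.
  apply: le_trans (ler_normB _ _) _; rewrite normrM.
  have : `|(u.1.1)%:~R| * `|X y 0 i - X y0 0 i| <= 2 * Q * r.
    by apply: ler_pM => //; exact: hy.
  have := ht i; rewrite /C1 => a b.
  by apply: (@le_trans _ _ (3 * (Q * r))); [lra|rewrite ler_wpM2r //; lra].
- have e := kap_stable (X y0) (G y0) (X y) (G y) (g y0) (g y) u.
  have -> : kap (X y) (G y) (g y) u = kap (X y0) (G y0) (g y0) u +
    (kap (X y) (G y) (g y) u - kap (X y0) (G y0) (g y0) u) by ring.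
  rewrite e; clear e.
  set A := _ * (_ - _ - _); set B := \sum_i _; set D := _ * \sum_i _.
  have hA : `|A| <= 2 * Q * (C * r ^+ 2).
    by rewrite /A normrM normrN; apply: ler_pM => //; exact: hq.
  have hG := hlip _ _ _ hy.
  have hB : `|B| <= n%:R * (C * r * (Q * r)).
    apply: sum_norm_le => i; rewrite normrM; apply: ler_pM => //; exact: hG.
  have hD : `|D| <= 2 * Q * (n%:R * (C * r * r)).
    rewrite /D normrM; apply: ler_pM => //; apply: sum_norm_le => i.
    rewrite normrM; apply: ler_pM => //; exact: hG.
  have h1 := ler_normD (kap (X y0) (G y0) (g y0) u) (A - B + D).
  have h2 := ler_normD (A - B) D; have h3 := ler_normB A B.
  have -> : C1 C * (Q * r ^+ 2) = Q * r ^+ 2 + 2 * Q * (C * r ^+ 2) +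
     n%:R * (C * r * (Q * r)) + 2 * Q * (n%:R * (C * r * r)) + 2 * (n%:R * C * (Q * r^+2)).
    by rewrite /C1; ring.
  have : 0 <= n%:R * C * (Q * r ^+ 2) by rewrite mulr_ge0.
  by lra.
Qed.

Lemma shell_split (A : set (lat n)) (S : R) H : finite_set A ->
  cnt [set u | A u /\ `|(u.1.1)%:~R| <= S] <=
  cnt [set u | A u /\ `|(u.1.1)%:~R| <= S / 2 ^+ H] +
  \sum_(h < H) cnt [set u | A u /\ S / 2 ^+ h.+1 < `|(u.1.1)%:~R| <= S / 2 ^+ h] :> R.
Proof.
move=> fA; elim: H => [|H IH]; first by rewrite big_ord0 addr0 expr0 divr1.
apply: le_trans IH _; rewrite big_ord_recr /= [X in _ <= _ + X]addrC addrA lerD2r.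
have f (P : lat n -> Prop) : finite_set [set u | A u /\ P u].
  by apply: sub_finite_set fA => u [].
apply: cntU; [exact: f|exact: f|].
move=> u [Au hu]; case: (lerP `|(u.1.1)%:~R| (S / 2 ^+ H.+1)) => h; [left|right] => //.
by split => //; rewrite h hu.
Qed.

(** Only the zero vector is left: the first coordinate vanishes, after which [tau] and then [kap]
    are integers less than 1. *)
Lemma cnt_tiny_box (x G : 'rV[R]_n) (g S T K : R) :
  S < 1 -> T < 1 -> K < 1 -> cnt (inbox x G g S T K) <= 1 :> R.
Proof.
move=> S1 T1 K1; rewrite -[leRHS](_ : cnt [set (0, 0, 0) : lat n] = 1); last first.
  by rewrite /cnt fset_set1 cardfs1.
have small (k : int) (b : R) : b < 1 -> `|k%:~R| <= b -> k = 0 :> int.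
  move=> b1 h; have : `|k| < 1 by rewrite -(ltr_int R) intr_norm (le_lt_trans h).
  by lia.
apply: cnt_le; first exact: finite_set1.
move=> [[q a] b] [/= h1 h2 h3].
have q0 := small _ _ S1 h1; subst q.
have a0 : a = 0.
  apply/rowP => i; rewrite mxE; apply: small T1 _.
  by have := h2 i; rewrite /tau /= mul0r subr0.
subst a; have b0 : b = 0.
  apply: small K1 _; move: h3; rewrite /kap /= mul0r subr0.
  rewrite big1 ?subr0 // => i _; rewrite /tau /= mxE mul0r subr0 mulr0 //.
by rewrite b0.
Qed.

(** [cD] and [C2] are the constants of [lattice_duality], for the sides of the dual box and for the
    factor in front. *)
Definition cD : R := 2 * @cN R n.
Definition C2 : R := 4 / @cN R n ^+ n.+2.

Lemma cD_gt0 : 0 < cD.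
Proof. by rewrite mulr_gt0 // cN_gt0. Qed.

Lemma cD_le : cD <= 1 / 16.
Proof.
rewrite /cD /cN; have h : 2 <= (n%:R + 2 : R) by rewrite lerDr.
have : (16 * (n%:R + 2 : R))^-1 <= (32)^-1.
  by rewrite lef_pV2 ?posrE; lra.
by lra.
Qed.

Lemma C2_gt0 : 0 < C2.
Proof. by rewrite divr_gt0 // exprn_gt0 // cN_gt0. Qed.

Lemma C1_ge C : 1 <= C -> 3 <= C1 C.
Proof.
move=> h; rewrite /C1; have : 0 <= n%:R * C by rewrite mulr_ge0 //; lra.
by rewrite -mulrA; lra.
Qed.

(** * Primal counts in terms of dual counts *)

Section Recursion.
Context {Y : finType} (X G : Y -> 'rV[R]_n) (g : Y -> R) (L C Q r : R).
Hypotheses (hS : system X G g L C) (Q0 : 0 < Q) (W2 : 1 / 2 <= Q * r) (r1 : r <= 1).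
Hypothesis (rL : C1 C / cD <= r * L).

Let g' := dualg X G g.
Let W := Q * r.
Let dl := Q * r ^+ 2.
Let c := C1 C.
(** [D0], [t0], [k0] are the sides of the box dual to the one with sides 2Q, cW, c dl. The
    hypothesis Q r >= 1/2 makes the last two less than 1, so that only the first coordinate has to
    be cut into shells. *)
Let D0 := cD / (c * dl).
Let t0 := cD / (c * W).
Let k0 := cD / (2 * Q).

Let hC : 1 <= C. Proof. by case: hS. Qed.
Let C0 : 0 < C. Proof. by have := hC; lra. Qed.
Let hL : 1 <= L. Proof. by case: hS. Qed.
Let L0 : 0 < L. Proof. by have := hL; lra. Qed.
Let W0 : 0 < W. Proof. by have := W2; rewrite /W; lra. Qed.
Let r0 : 0 < r. Proof. by rewrite -(pmulr_rgt0 _ Q0). Qed.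
Let dl0 : 0 < dl. Proof. by rewrite mulr_gt0 // exprn_gt0. Qed.
Let c3 : 3 <= c. Proof. exact: C1_ge. Qed.
Let c0 : 0 < c. Proof. by have := c3; lra. Qed.
Let d0 : 0 < cD := cD_gt0.
Let d1 : cD <= 1 / 16 := cD_le.
Let D00 : 0 < D0. Proof. by rewrite divr_gt0 // mulr_gt0. Qed.
Let t00 : 0 < t0. Proof. by rewrite divr_gt0 // mulr_gt0. Qed.
Let k00 : 0 < k0. Proof. by rewrite divr_gt0 // mulr_gt0. Qed.
Let Q2 : 1 / 2 <= Q.
Proof. by apply: le_trans W2 _; rewrite ler_piMr // ltW. Qed.
Let t01 : t0 < 1.
Proof.
rewrite /t0 ltr_pdivrMr ?mulr_gt0 // mul1r; have : 1 / 2 <= W by []; have := c3; have := d1; nra.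
Qed.
Let k01 : k0 < 1.
Proof. by rewrite /k0 ltr_pdivrMr ?mulr_gt0 // mul1r; have := Q2; have := d1; lra. Qed.
Let rLc : c <= r * L.
Proof.
apply: le_trans rL; rewrite ler_pdivlMr // -/c -[leRHS]mulr1 ler_wpM2l ?ltW //.
by have := d1; lra.
Qed.
Let Wdl : dl = W * r. Proof. by rewrite /dl /W expr2 mulrA. Qed.

Let V := C2 * (2 * Q * (c * W) ^+ n * (c * dl)).
Let V0 : 0 < V.
Proof. by rewrite mulr_gt0 ?C2_gt0 // mulr_gt0 ?mulr_gt0 ?exprn_gt0 ?mulr_gt0. Qed.

Definition sigma y : R :=
  cnt (shellbox (X y) (G y) (g y) Q (2 * Q) (2 * Q) (c * W) (c * dl)).

Let hr : L^-1 <= r <= 1.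
Proof.
rewrite r1 andbT -(ler_pM2r L0) mulVf ?gt_eqF //; have := rLc; have := c3; lra.
Qed.

Lemma nu_sum_sigma : nu X G g Q r * ((r * L) ^+ n / C) <= \sum_y sigma y.
Proof. by apply: nu_le_sum => //; case: hS. Qed.

Lemma sigma_dual y : sigma y <=
  C2 * (2 * Q * (c * W) ^+ n * (c * dl)) * cnt (inbox (G y) (X y) (g' y) D0 t0 k0).
Proof.
apply: (@le_trans _ _ (cnt (inbox (X y) (G y) (g y) (2 * Q) (c * W) (c * dl)))).
  by apply: cnt_le; [exact: finite_inbox|move=> u []].
by apply: lattice_duality; rewrite mulr_gt0.
Qed.

(** The radius 1/(WD) is dictated by the dual box. Multiplied by D it is 1/W, which dominates t0;
    its square multiplied by D is 1/(W^2 D), which dominates k0 because D is at most of order Q/W^2.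
    The fibres over y then contribute (L/(WD))^n, which cancels D^n. *)
Lemma sum_dual_shell (D T K : R) m : 0 < D -> D <= 2 * D0 -> 0 <= T <= 3 * t0 -> K <= 3 * k0 ->
  nu G X g' D (1 / (W * D)) <= m * D ^+ n ->
  \sum_y cnt (shellbox (G y) (X y) (g' y) D (2 * D) (2 * D) T K) <= m * C * (L / W) ^+ n.
Proof.
move=> D_gt0 hD /andP[T0 T1] K1 hm.
have hG : half_system G X g' L C by case: hS.
have WD0 : 0 < W * D by rewrite mulr_gt0.
apply: le_trans (@sum_shellbox_le _ _ _ _ _ _ _ (1 / (W * D)) _ _ _ D_gt0 T0 (ltW C0) (ltW L0) hG _ _) _.
- apply: le_trans T1 _; have -> : D * (1 / (W * D)) = W^-1 by field; rewrite !gt_eqF.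
  rewrite /t0 invfM mulrA mulrA -[leRHS]mul1r ler_wpM2r ?invr_ge0 ?(ltW W0) //.
  by rewrite ler_pdivrMr // mul1r; have := c3; have := d1; lra.
- apply: le_trans K1 _.
  have -> : D * (1 / (W * D)) ^+ 2 = 1 / (W ^+ 2 * D).
    by field; rewrite !gt_eqF.
  rewrite ler_pdivlMr ?mulr_gt0 ?exprn_gt0 //.
  have h : W ^+ 2 * D <= W ^+ 2 * (2 * D0) by rewrite ler_wpM2l ?sqr_ge0.
  have e : W ^+ 2 * (2 * D0) = 2 * cD * Q / c.
    by rewrite /D0 Wdl /W; field; rewrite !gt_eqF.
  apply: (@le_trans _ _ (3 * k0 * (2 * cD * Q / c))).
    by rewrite ler_wpM2l -?e // mulr_ge0 // ltW.
  have -> : 3 * k0 * (2 * cD * Q / c) = 3 * (cD * cD) / c.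
    by rewrite /k0; field; rewrite !gt_eqF.
  by rewrite ler_pdivrMr // mul1r; have := c3; have := d1; have := d0; nra.
- have h1 : 1 + 2 * T / D * L <= L / (W * D).
    have a1 : 1 <= 1 / 4 * (L / (W * D)).
      rewrite mulrA ler_pdivlMr // [1 * (W * D)]mul1r.
      have : W * D <= 2 * cD / (c * r).
        apply: (@le_trans _ _ (W * (2 * D0))); first by rewrite ler_wpM2l // ltW.
        rewrite le_eqVlt; apply/orP; left; apply/eqP.
        by rewrite /D0 Wdl; field; rewrite !gt_eqF.
      move=> h; apply: le_trans h _; rewrite ler_pdivrMr ?mulr_gt0 //.
      have h2 : 1 <= c * (r * L) by have := c3; have := rLc; nra.
      have -> : 1 / 4 * L * (c * r) = 1 / 4 * (c * (r * L)) by ring.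
      by have := d1; lra.
    have a2 : 2 * T / D * L <= 1 / 2 * (L / (W * D)).
      have : T <= 3 * cD / c / W.
        by apply: le_trans T1 _; rewrite /t0 invfM !mulrA.
      have b : 3 * cD / c <= 1 / 4 by rewrite ler_pdivrMr //; have := c3; have := d1; lra.
      move=> h; have {}h : T <= 1 / 4 / W.
        by apply: le_trans h _; rewrite ler_pM2r ?invr_gt0.
      have -> : 2 * T / D * L = T * (2 * L / D) by field; rewrite gt_eqF.
      have -> : 1 / 2 * (L / (W * D)) = 1 / 4 / W * (2 * L / D).
        by field; rewrite !gt_eqF.
      by rewrite ler_wpM2r // divr_ge0 // ?mulr_ge0 // ltW.
    have : 0 < L / (W * D) by rewrite divr_gt0.
    by lra.
  have h0 : 0 <= 1 + 2 * T / D * L.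
    by rewrite addr_ge0 // mulr_ge0 ?divr_ge0 ?mulr_ge0 // ltW.
  apply: (@le_trans _ _ (m * D ^+ n * (C * (L / (W * D)) ^+ n))).
    apply: ler_pM => //; first by rewrite mulr_ge0 ?exprn_ge0 // ltW.
    by rewrite ler_wpM2l ?(ltW C0) // lerXn2r // nnegrE // (le_trans h0).
  have -> : L / (W * D) = (L / W) / D by rewrite invfM mulrA.
  rewrite [X in C * X]expr_div_n le_eqVlt; apply/orP; left; apply/eqP.
  by field; rewrite gt_eqF // exprn_gt0.
Qed.

Definition Cll : R := 2 * C2 * c ^+ n.+1 * C ^+ 2.

Let simp_final A : nu X G g Q r * ((r * L) ^+ n / C) <=
   C2 * (2 * Q * (c * W) ^+ n * (c * dl)) * (C * L ^+ n * A) ->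
   nu X G g Q r * r ^+ n <= Cll * W ^+ 2 * (W ^+ n * A).
Proof.
move=> h; have Ln : 0 < L ^+ n by rewrite exprn_gt0.
rewrite -(ler_pM2r Ln) -(ler_pM2r (_ : 0 < C^-1)) ?invr_gt0 //.
have -> : nu X G g Q r * r ^+ n * L ^+ n / C = nu X G g Q r * ((r * L) ^+ n / C).
  by rewrite exprMn; ring.
apply: le_trans h _; rewrite le_eqVlt; apply/orP; left; apply/eqP.
have eW : W ^+ 2 = Q * (W * r) by rewrite /W; ring.
by rewrite /Cll Wdl eW exprMn exprS; field; rewrite gt_eqF.
Qed.

Lemma nu_lossy H m : D0 < 2 ^+ H -> 0 <= m ->
  (forall h, (h < H)%N -> nu G X g' (D0 / 2 ^+ h.+1) (1 / (W * (D0 / 2 ^+ h.+1)))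
     <= m * (D0 / 2 ^+ h.+1) ^+ n) ->
  nu X G g Q r * r ^+ n <= Cll * W ^+ 2 * (W ^+ n + H%:R * m).
Proof.
move=> hH m0 hm.
have -> : W ^+ n + H%:R * m = W ^+ n * (1 + H%:R * m / W ^+ n).
  by field; rewrite gt_eqF // exprn_gt0.
apply: simp_final; apply: le_trans nu_sum_sigma _.
apply: (@le_trans _ _ (\sum_y C2 * (2 * Q * (c * W) ^+ n * (c * dl)) *
   (1 + \sum_(h < H) cnt (shellbox (G y) (X y) (g' y) (D0 / 2 ^+ h.+1)
        (2 * (D0 / 2 ^+ h.+1)) (2 * (D0 / 2 ^+ h.+1)) t0 k0)))).
  apply: ler_sum => y _; apply: le_trans (sigma_dual y) _.
  apply: ler_wpM2l; first exact: ltW.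
  set A := inbox _ _ _ _ _ _; have fA : finite_set A := finite_inbox _ _ _ _ _ _.
  have fP (P : lat n -> Prop) : finite_set [set u | A u /\ P u].
    by apply: sub_finite_set fA => u [].
  apply: (@le_trans _ _ (cnt [set u | A u /\ `|(u.1.1)%:~R| <= D0])).
    by apply: cnt_le; [exact: fP|move=> u h; split=> //; case: h].
  apply: le_trans (shell_split D0 H fA) _; apply: lerD.
    apply: le_trans (@cnt_tiny_box (G y) (X y) (g' y) (D0 / 2 ^+ H) t0 k0 _ t01 k01).
      by apply: cnt_le; [exact: finite_inbox|move=> u [[_ h1 h2] h3]; split].
    by rewrite ltr_pdivrMr ?mul1r // exprn_gt0.
  apply: ler_sum => h _; apply: cnt_le; first exact: finite_shellbox.
  have -> : 2 * (D0 / 2 ^+ h.+1) = D0 / 2 ^+ h.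
    by rewrite exprS; field; rewrite gt_eqF // exprn_gt0.
  by move=> u [[_ h1 h2] /andP[h3 h4]]; split; [rewrite h3 h4|split].
rewrite -mulr_sumr ler_wpM2l ?(ltW V0) //.
rewrite big_split /= exchange_big /= mulrDr mulr1; apply: lerD.
  by rewrite sumr_const; case: hS.
apply: (@le_trans _ _ (\sum_(h < H) m * C * (L / W) ^+ n)).
  apply: ler_sum => h _; apply: sum_dual_shell; rewrite ?lexx //.
  - by rewrite divr_gt0 // exprn_gt0.
  - rewrite ler_pdivrMr ?exprn_gt0 //.
    have q : (1 : R) <= 2 ^+ h.+1 by rewrite exprn_ege1 // ler1n.
    by have := D00; nra.
  - by rewrite (ltW t00) /=; have := t00; lra.
  - by have := k00; lra.
  - exact: hm.
rewrite sumr_const card_ord -[leLHS]mulr_natl expr_div_n.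
rewrite le_eqVlt; apply/orP; left; apply/eqP.
by field; rewrite gt_eqF // exprn_gt0.
Qed.

(** Dualising twice in the second case of the dichotomy lengthens the last side of the box by 4^lam.
    That side scales like the square of the radius, so the radius grows by 2^lam. *)
Definition rho (lam : nat) : R := 4 * c * 2 ^+ lam.

Lemma sum_primal_shell (lam : nat) (D T K : R) : Q <= D -> 0 <= T <= 4 * c * W ->
  K <= 4 * (4 ^+ lam * c * dl) ->
  \sum_y cnt (shellbox (X y) (G y) (g y) D (2 * D) (2 * D) T K)
  <= nu X G g D (rho lam * r) * (C * (9 * c * (r * L)) ^+ n).
Proof.
move=> QD /andP[T0 T1] K1; have D_gt0 : 0 < D by apply: lt_le_trans QD.
have hX : half_system X G g L C by case: hS.
have l1 : 1 <= 2 ^+ lam :> R by rewrite exprn_ege1 // ler1n.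
have e4 : 4 ^+ lam = 2 ^+ lam * 2 ^+ lam :> R.
  by rewrite -exprMn; congr (_ ^+ _); ring.
apply: le_trans (@sum_shellbox_le _ _ _ _ _ _ _ (rho lam * r) _ _ _ D_gt0 T0 (ltW C0) (ltW L0) hX _ _) _.
- apply: le_trans T1 _; rewrite /rho.
  have -> : 4 * c * W = Q * (4 * c * 1 * r) by rewrite /W; ring.
  apply: ler_pM => //; first by rewrite ltW.
    by rewrite !mulr_ge0 ?ltW.
  by rewrite ler_wpM2r ?(ltW r0) // ler_wpM2l // mulr_ge0 // ltW.
- apply: le_trans K1 _; rewrite /rho e4.
  have -> : 4 * (2 ^+ lam * 2 ^+ lam * c * dl) = Q * (1 * (4 * c * (2 ^+ lam) ^+ 2 * r ^+ 2)).
    by rewrite /dl; ring.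
  have -> : (4 * c * 2 ^+ lam * r) ^+ 2 = (4 * c) * (4 * c * (2 ^+ lam) ^+ 2 * r ^+ 2).
    by ring.
  have p : 0 <= 4 * c * (2 ^+ lam) ^+ 2 * r ^+ 2.
    by rewrite !mulr_ge0 ?sqr_ge0 ?exprn_ge0 // ltW.
  apply: ler_pM => //; [exact: ltW|by rewrite mul1r|].
  by rewrite mul1r ler_peMl //; have := c3; lra.
- apply: ler_wpM2l; first exact: nu_ge0.
  apply: ler_wpM2l; first exact: ltW.
  have a : 0 <= 2 * T / D * L.
    by rewrite mulr_ge0 ?divr_ge0 ?mulr_ge0 // ltW.
  have rLp : 0 < r * L by rewrite mulr_gt0.
  rewrite lerXn2r ?nnegrE ?addr_ge0 //; first by rewrite mulr_ge0 ?mulr_ge0 // ltW.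
  have b : 2 * T / D * L <= 8 * c * (r * L).
    rewrite mulrA ler_wpM2r ?(ltW L0) // ler_pdivrMr //.
    apply: (@le_trans _ _ (8 * c * r * Q)).
      by move: T1; rewrite /W; lra.
    by rewrite ler_wpM2l // mulr_ge0 ?mulr_ge0 // ltW.
  have : 1 <= c * (r * L) by have := c3; have := rLc; nra.
  by move: b; lra.
Qed.

Lemma shell_nonempty_or (A : set (lat n)) (S : R) : finite_set A ->
  (exists2 v, A v & S < `|(v.1.1)%:~R|) \/
  (forall v, A v -> `|(v.1.1)%:~R| <= S).
Proof.
move=> _; have [[v Av h]|h] := pselect (exists2 v, A v & S < `|(v.1.1)%:~R|).
  by left; exists v.
by right=> v Av; rewrite leNgt; apply/negP => hv; apply: h; exists v.
Qed.

Definition addm (m : int) (u u0 : lat n) : lat n := subl u (scalel (- m) u0).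

Lemma addm_s m u u0 : ((addm m u u0).1.1)%:~R = (u.1.1)%:~R + m%:~R * (u0.1.1)%:~R :> R.
Proof. by rewrite /= rmorphB rmorphM /= rmorphN /=; ring. Qed.

Lemma addm_tau x m u u0 i : tau x (addm m u u0) i = tau x u i + m%:~R * tau x u0 i :> R.
Proof. by rewrite tau_subl tau_scalel rmorphN /=; ring. Qed.

Lemma addm_kap x x' h m u u0 : kap x x' h (addm m u u0) = kap x x' h u + m%:~R * kap x x' h u0 :> R.
Proof. by rewrite kap_subl kap_scalel rmorphN /=; ring. Qed.

Lemma norm_addm (a b A B : R) (m : nat) : `|a| <= A -> `|b| <= B -> `|a + m%:R * b| <= A + m%:R * B.
Proof.
move=> hA hB; apply: le_trans (ler_normD _ _) _; apply: lerD => //.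
by rewrite normrM ger0_norm // ler_wpM2l.
Qed.

Definition CB : R := C2 ^+ 2 * cD ^+ n.+2.

(* The dichotomy: either the dual box has a point with large first coordinate,
   and translating by it moves all dual points into the top shells, or the dual
   box can be shortened for free, and dualising back gains the factor 4^lam. *)
Lemma sigma_dichotomy (lam : nat) y :
  sigma y <= V * (2 * \sum_(h < (2 * lam).+2)
      cnt (shellbox (G y) (X y) (g' y) (4 * D0 / 2 ^+ h.+1) (2 * (4 * D0 / 2 ^+ h.+1))
             (2 * (4 * D0 / 2 ^+ h.+1)) (3 * t0) (3 * k0)))
   + CB / 4 ^+ lam * \sum_(h < 3)
      cnt (shellbox (X y) (G y) (g y) (8 * Q / 2 ^+ h.+1) (2 * (8 * Q / 2 ^+ h.+1))
             (2 * (8 * Q / 2 ^+ h.+1)) (4 * c * W) (4 * (4 ^+ lam * c * dl))).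
Proof.
have p4 : 0 < 4 ^+ lam :> R by rewrite exprn_gt0.
have CB0 : 0 < CB by rewrite mulr_gt0 ?exprn_gt0 ?C2_gt0.
have nn1 : 0 <= V * (2 * \sum_(h < (2 * lam).+2)
      cnt (shellbox (G y) (X y) (g' y) (4 * D0 / 2 ^+ h.+1) (2 * (4 * D0 / 2 ^+ h.+1))
             (2 * (4 * D0 / 2 ^+ h.+1)) (3 * t0) (3 * k0))).
  by rewrite mulr_ge0 ?(ltW V0) // mulr_ge0 // sumr_ge0 // => h _; exact: cnt_ge0.
have nn2 : 0 <= CB / 4 ^+ lam * \sum_(h < 3)
      cnt (shellbox (X y) (G y) (g y) (8 * Q / 2 ^+ h.+1) (2 * (8 * Q / 2 ^+ h.+1))
             (2 * (8 * Q / 2 ^+ h.+1)) (4 * c * W) (4 * (4 ^+ lam * c * dl))) :> R.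
  by rewrite mulr_ge0 ?divr_ge0 ?(ltW CB0) ?(ltW p4) // sumr_ge0 // => h _; exact: cnt_ge0.
set A := inbox (G y) (X y) (g' y) D0 t0 k0.
have fA : finite_set A by exact: finite_inbox.
have [[v0 Av0 hv0]|hA] := @shell_nonempty_or A (D0 / 4 ^+ lam) fA.
  rewrite -[leLHS]addr0; apply: lerD => //; apply: le_trans (sigma_dual y) _.
  apply: ler_wpM2l; first exact: ltW.
  pose B : set (lat n) := [set v | inbox (G y) (X y) (g' y) (4 * D0) (3 * t0) (3 * k0) v
     /\ D0 / 4 ^+ lam < `|(v.1.1)%:~R|].
  have fB : finite_set B.
    by apply: (sub_finite_set _ (finite_inbox (G y) (X y) (g' y) (4 * D0) (3 * t0) (3 * k0))) => u [].
  have hB : cnt B <= \sum_(h < (2 * lam).+2)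
      cnt (shellbox (G y) (X y) (g' y) (4 * D0 / 2 ^+ h.+1) (2 * (4 * D0 / 2 ^+ h.+1))
             (2 * (4 * D0 / 2 ^+ h.+1)) (3 * t0) (3 * k0)) :> R.
    have fP (P : lat n -> Prop) : finite_set [set u | B u /\ P u].
      by apply: sub_finite_set fB => u [].
    apply: (@le_trans _ _ (cnt [set u | B u /\ `|(u.1.1)%:~R| <= 4 * D0])).
      by apply: cnt_le; [exact: fP|move=> u h; split=> //; case: h => -[]].
    apply: le_trans (shell_split (4 * D0) (2 * lam).+2 fB) _.
    rewrite -[leRHS]add0r; apply: lerD.
      rewrite (_ : [set _ | _] = set0) ?/cnt ?fset_set0 // -subset0 => u [[_ h1] h2].
      have : D0 / 4 ^+ lam < 4 * D0 / 2 ^+ (2 * lam).+2 := lt_le_trans h1 h2.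
      have -> : (2 : R) ^+ (2 * lam).+2 = 4 * 4 ^+ lam.
        by rewrite 2!exprS exprM (_ : (2 : R) ^+ 2 = 4); ring.
      by rewrite (_ : 4 * D0 / _ = D0 / 4 ^+ lam) ?ltxx //; field; rewrite gt_eqF.
    apply: ler_sum => h _; apply: cnt_le; first exact: finite_shellbox.
    have -> : 2 * (4 * D0 / 2 ^+ h.+1) = 4 * D0 / 2 ^+ h.
      by rewrite exprS; field; rewrite gt_eqF // exprn_gt0.
    by move=> u [[[_ h1 h2] _] /andP[h3 h4]]; split; [rewrite h3 h4|split].
  apply: (@le_trans _ _ (2 * cnt B)); last by rewrite ler_wpM2l.
  have -> : 2 * cnt B = cnt B + cnt B :> R by ring.
  pose A1 : set (lat n) := [set v | A v /\ `|(v.1.1)%:~R| <= D0 / 4 ^+ lam].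
  have fA1 : finite_set A1 by apply: sub_finite_set fA => u [].
  have AA : A `<=` A1 `|` B.
    move=> u Au; case: (lerP `|(u.1.1)%:~R| (D0 / 4 ^+ lam)) => h; [by left|right].
    case: Au => a1 a2 a3; split=> //; split.
    - by apply: le_trans a1 _; have := D00; lra.
    - by move=> i; apply: le_trans (a2 i) _; have := t00; lra.
    - by apply: le_trans a3 _; have := k00; lra.
  apply: le_trans (cntU fA1 fB AA) _; rewrite lerD2r.
  case: Av0 => b1 b2 b3.
  (* Adding 2 v0 to a point with first coordinate at most D0 / 4^lam lifts it above that threshold
     and keeps it within 3 D0. *)
  apply: (cnt_inj (f := fun u => addm 2%:Z u v0)) => //.
    move=> u [[a1 a2 a3] a4]; split; first split.
    - rewrite addm_s -pmulrn; apply: le_trans (@norm_addm _ _ D0 D0 2 a1 b1) _.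
      by have := D00; lra.
    - move=> i; rewrite addm_tau -pmulrn.
      by apply: le_trans (@norm_addm _ _ t0 t0 2 (a2 i) (b2 i)) _; lra.
    - rewrite addm_kap -pmulrn.
      by apply: le_trans (@norm_addm _ _ k0 k0 2 a3 b3) _; lra.
    - rewrite addm_s -pmulrn.
      have := ler_normB ((u.1.1)%:~R + 2%:R * (v0.1.1)%:~R) ((u.1.1)%:~R : R).
      rewrite addrC addKr normrM ger0_norm // => h.
      by move: h hv0 a4; lra.
  by move=> u v _ _; exact: subl_injl.
rewrite -[leLHS]add0r; apply: lerD => //.
set S := shellbox (X y) (G y) (g y) Q (2 * Q) (2 * Q) (c * W) (c * dl).
have [[u0 Su0]|S0] := pselect (exists u, S u); last first.
  rewrite /sigma -/S (_ : S = set0) ?/cnt ?fset_set0 // -subset0 => u Su.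
  by apply: S0; exists u.
apply: le_trans (sigma_dual y) _.
have D1 : 0 < D0 / 4 ^+ lam by rewrite divr_gt0.
have h1 : cnt A <= cnt (inbox (G y) (X y) (g' y) (D0 / 4 ^+ lam) t0 k0) :> R.
  apply: cnt_le; first exact: finite_inbox.
  by move=> u Au; split; [exact: hA|case: Au|case: Au].
have h2 := lattice_duality (G y) (X y) (g' y) D1 t00 k00.
have h3 := le_trans h1 h2.
apply: (@le_trans _ _ (V * (4 / @cN R n ^+ n.+2 * (D0 / 4 ^+ lam * t0 ^+ n * k0) *
    cnt (inbox (X y) (G y) (dot (G y) (X y) - g' y) (2 * @cN R n / k0) (2 * @cN R n / t0)
           (2 * @cN R n / (D0 / 4 ^+ lam)))))).
  by rewrite -/V -/A; apply: ler_wpM2l; [exact: ltW|exact: h3].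
have -> : 2 * @cN R n / k0 = 2 * Q by rewrite /k0 -/cD; field; rewrite !gt_eqF.
have -> : 2 * @cN R n / t0 = c * W by rewrite /t0 -/cD; field; rewrite !gt_eqF.
have -> : 2 * @cN R n / (D0 / 4 ^+ lam) = 4 ^+ lam * c * dl.
  by rewrite /D0 -/cD; field; rewrite !gt_eqF.
have -> : dot (G y) (X y) - g' y = g y by rewrite /g' /dualg dotC subKr.
rewrite [leLHS]mulrA.
have -> : V * (4 / @cN R n ^+ n.+2 * (D0 / 4 ^+ lam * t0 ^+ n * k0)) = CB / 4 ^+ lam.
  rewrite /V -/C2 /D0 /t0 /k0 /CB expr_div_n exprMn !exprS.
  by field; rewrite !gt_eqF ?exprn_gt0.
apply: ler_wpM2l; first by rewrite divr_ge0 ?(ltW CB0) ?(ltW p4).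
case: Su0 => /andP[s1 s2] [_ b2 b3].
pose B : set (lat n) := [set v | inbox (X y) (G y) (g y) (8 * Q) (4 * c * W)
   (4 * (4 ^+ lam * c * dl)) v /\ Q < `|(v.1.1)%:~R|].
have fB : finite_set B.
  by apply: (sub_finite_set _ (finite_inbox (X y) (G y) (g y) (8 * Q) (4 * c * W) (4 * (4 ^+ lam * c * dl)))) => u [].
have l1 : 1 <= 4 ^+ lam :> R by rewrite exprn_ege1 // ler1n.
apply: (@le_trans _ _ (cnt B)).
  (* The first coordinate of u0 lies between Q and 2Q and that of u is at most 2Q in absolute value,
     so the first coordinate of u + 3 u0 lies between Q and 8Q: three shells suffice. *)
  apply: (cnt_inj (f := fun u => addm 3%:Z u u0)) => //.
    move=> u [a1 a2 a3]; split; first split.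
    - rewrite addm_s -pmulrn; apply: le_trans (@norm_addm _ _ _ _ 3 a1 s2) _.
      by lra.
    - move=> i; rewrite addm_tau -pmulrn.
      by apply: le_trans (@norm_addm _ _ _ _ 3 (a2 i) (b2 i)) _; lra.
    - rewrite addm_kap -pmulrn.
      apply: le_trans (@norm_addm _ _ _ _ 3 a3 b3) _.
      have : c * dl <= 4 ^+ lam * c * dl by rewrite -mulrA ler_peMl // mulr_ge0 // ltW.
      by lra.
    - rewrite addm_s -pmulrn.
      have := ler_normB ((u.1.1)%:~R + 3%:R * (u0.1.1)%:~R) ((u.1.1)%:~R : R).
      rewrite addrC addKr normrM ger0_norm // => h.
      by move: h s1 a1; lra.
  by move=> u v _ _; exact: subl_injl.
have fP (P : lat n -> Prop) : finite_set [set u | B u /\ P u].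
  by apply: sub_finite_set fB => u [].
apply: (@le_trans _ _ (cnt [set u | B u /\ `|(u.1.1)%:~R| <= 8 * Q])).
  by apply: cnt_le; [exact: fP|move=> u h; split=> //; case: h => -[]].
apply: le_trans (shell_split (8 * Q) 3 fB) _.
rewrite -[leRHS]add0r; apply: lerD.
  rewrite (_ : [set _ | _] = set0) ?/cnt ?fset_set0 // -subset0 => u [[_ q1] q2].
  have := lt_le_trans q1 q2.
  by rewrite (_ : 8 * Q / 2 ^+ 3 = Q) ?ltxx //; field.
apply: ler_sum => h _; apply: cnt_le; first exact: finite_shellbox.
have -> : 2 * (8 * Q / 2 ^+ h.+1) = 8 * Q / 2 ^+ h.
  by rewrite exprS; field; rewrite gt_eqF // exprn_gt0.
by move=> u [[[_ q1 q2] _] /andP[q3 q4]]; split; [rewrite q3 q4|split].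
Qed.

Definition CA : R := 4 * C2 * c ^+ n.+1 * C ^+ 2.
Definition CE : R := CB * C ^+ 2 * (9 * c) ^+ n.

(** In contrast to [nu_lossy] the number of shells is the constant 2 lam + 2. The price is a term of
    the same kind at a larger radius, with the small factor 4^-lam. *)
Lemma nu_dichotomy (lam : nat) m : 0 <= m ->
  (forall h, (h < (2 * lam).+2)%N ->
     nu G X g' (4 * D0 / 2 ^+ h.+1) (1 / (W * (4 * D0 / 2 ^+ h.+1)))
     <= m * (4 * D0 / 2 ^+ h.+1) ^+ n) ->
  nu X G g Q r * r ^+ n <= CA * W ^+ 2 * ((2 * lam).+2%:R * m)
   + CE / 4 ^+ lam * r ^+ n * \sum_(h < 3) nu X G g (8 * Q / 2 ^+ h.+1) (rho lam * r).
Proof.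
move=> m0 hm.
have p4 : 0 < 4 ^+ lam :> R by rewrite exprn_gt0.
have CB0 : 0 < CB by rewrite mulr_gt0 ?exprn_gt0 ?C2_gt0.
have p2 h : 0 < 2 ^+ h :> R by rewrite exprn_gt0.
have h1 := nu_sum_sigma.
have h2 : \sum_y sigma y <= V * (2 * ((2 * lam).+2%:R * (m * C * (L / W) ^+ n)))
  + CB / 4 ^+ lam * \sum_(h < 3) (nu X G g (8 * Q / 2 ^+ h.+1) (rho lam * r) *
       (C * (9 * c * (r * L)) ^+ n)).
  apply: (le_trans (ler_sum _ (fun y _ => sigma_dichotomy lam y))).
  rewrite big_split /= -!mulr_sumr; apply: lerD; apply: ler_wpM2l.
  - exact: ltW.
  - rewrite ler_wpM2l // exchange_big /=.
    apply: (@le_trans _ _ (\sum_(h < (2 * lam).+2) (m * C * (L / W) ^+ n))).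
      apply: ler_sum => h _; apply: sum_dual_shell => //.
      + by apply: divr_gt0; rewrite ?p2 // mulr_gt0.
      + have : (2 : R) <= 2 ^+ h.+1 by rewrite exprS ler_peMr // exprn_ege1 // ler1n.
        by move=> q; rewrite ler_pdivrMr //; have := D00; nra.
      + by rewrite mulr_ge0 ?(ltW t00) // lexx.
      + exact: hm.
    by rewrite sumr_const card_ord -[leLHS]mulr_natl.
  - by rewrite divr_ge0 ?(ltW CB0) ?(ltW p4).
  - rewrite exchange_big /=; apply: ler_sum => h _; apply: sum_primal_shell => //.
    + have : (2 : R) ^+ h.+1 <= 8.
        have -> : (8 : R) = 2 ^+ 3 by ring.
        by rewrite ler_weXn2l // ler1n.
      by move=> q; rewrite ler_pdivlMr //; have := Q0; nra.
    + by rewrite lexx andbT !mulr_ge0 // ltW.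
have {h1}h2 := le_trans h1 h2.
have Ln : 0 < L ^+ n by rewrite exprn_gt0.
rewrite -(ler_pM2r Ln) -(ler_pM2r (_ : 0 < C^-1)) ?invr_gt0 //.
have -> : nu X G g Q r * r ^+ n * L ^+ n / C = nu X G g Q r * ((r * L) ^+ n / C).
  by rewrite exprMn; ring.
apply: le_trans h2 _; rewrite -mulr_suml le_eqVlt; apply/orP; left; apply/eqP.
have eW : W ^+ 2 = Q * (W * r) by rewrite /W; ring.
have e9 : (9 * c * (r * L)) ^+ n = (9 * c) ^+ n * (r ^+ n * L ^+ n).
  by rewrite exprMn [(r * L) ^+ n]exprMn.
have key (a q cn wn b x N d e l p s f k t : R) : e != 0 -> wn != 0 -> p != 0 ->
    a * (2 * q * (cn * wn) * (b * x)) * (2 * (N * (d * e * (l / wn)))) +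
    f / p * (s * (e * (k * (t * l)))) =
    (4 * a * (b * cn) * e ^+ 2 * (q * x) * (N * d) + f * e ^+ 2 * k / p * t * s) * l / e.
  by move=> e0 w0 p0; field; rewrite e0 w0 p0.
rewrite /CA /CE /V Wdl eW e9 [(c * W) ^+ n]exprMn expr_div_n [c ^+ n.+1]exprS.
by apply: key; rewrite gt_eqF // exprn_gt0.
Qed.

End Recursion.

End System.

(** * Solving the recursion *)

Section Solve.
Context {R : realType} {n : nat} (C : R).
Implicit Types (Q r D W m k A B : R).
Hypotheses (n2 : (2 <= n)%N) (hC : 1 <= C).

Notation c := (@C1 R n C).
Notation cD := (@cD R n).
Notation C2 := (@C2 R n).
Notation rho := (@rho R n).

Let c3 : 3 <= c := C1_ge hC.
Let d0 : 0 < cD := cD_gt0.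
Let d1 : cD <= 1 / 16 := cD_le.
Let C20 : 0 < C2 := C2_gt0.

Definition dstar (Q r : R) : R := cD / (c * (Q * r ^+ 2)).

Lemma dstar_lt Q r : 0 < Q -> 0 < r -> 2 * dstar Q r < 1 / (Q * r ^+ 2).
Proof.
move=> Q0 r0; have p : 0 < Q * r ^+ 2 by rewrite mulr_gt0 ?exprn_gt0.
have h : 2 * cD < c by have := c3; have := d1; lra.
have hc := c3; rewrite /dstar mulrA ltr_pdivrMr; last by pos.
have -> : 1 / (Q * r ^+ 2) * (c * (Q * r ^+ 2)) = c by field; rewrite !gt_eqF.
by [].
Qed.

Definition aE : R := @CE R n C.

Lemma aE_gt0 : 0 < aE.
Proof.
by rewrite /aE /CE /CB; have hc := c3; have hC' := hC; have := d0; have := C20 => *; pos.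
Qed.

(** Three shells, each with Q replaced by at most 4Q, cost 3 times 4^n; with this [lam] the term at
    the larger radius contributes at most half of the previous secondary coefficient in
    [step_iter]. *)
Lemma exists_lam : exists lam : nat, 6 * 4 ^+ n * aE <= 4 ^+ lam.
Proof.
have aE0 := aE_gt0; have h : 0 <= 6 * 4 ^+ n * aE by pos.
exists (Num.bound (6 * 4 ^+ n * aE)); apply: le_trans (ltW (archi_boundP h)) _.
by move: (Num.bound _) => b; rewrite -natrX ler_nat ltnW // ltn_expl.
Qed.

Lemma div_pow_le A (h : nat) : 0 <= A -> A / 2 ^+ h.+1 <= A / 2.
Proof.
move=> A0; apply: ler_wpM2l => //; rewrite lef_pV2 ?posrE ?exprn_gt0 //.
by rewrite exprS ler_peMr // exprn_ege1 // ler1n.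
Qed.

Lemma div_pow_ge A (h : 'I_3) : 0 <= A -> A / 8 <= A / 2 ^+ h.+1.
Proof.
move=> A0; apply: ler_wpM2l => //; rewrite lef_pV2 ?posrE ?exprn_gt0 //.
have -> : (8 : R) = 2 ^+ 3 by ring.
by rewrite ler_weXn2l // ler1n.
Qed.

(** The gain k^(n-2) of one step comes from here. It equals 1 for n = 2, which is the reason for the
    weaker bound in that dimension. *)
Lemma pow_shift (W m k : R) : 0 < k -> k <= W -> 0 <= m ->
  W ^+ 2 * m <= W ^+ n * (m / k ^+ (n - 2)).
Proof.
move=> k0 kW m0; have W0 : 0 < W by exact: lt_le_trans kW.
have -> : W ^+ n = W ^+ 2 * W ^+ (n - 2) by rewrite -exprD subnKC.
rewrite -mulrA ler_wpM2l ?sqr_ge0 // mulrA ler_pdivlMr ?exprn_gt0 //.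
by rewrite mulrC ler_wpM2r // lerXn2r // nnegrE ltW.
Qed.

Section Step.
Context {Y : finType} (X G : Y -> 'rV[R]_n) (g : Y -> R) (L k m Z : R) (lam H : nat).
Hypotheses (hS : system X G g L C) (k2 : 2 <= k) (m0 : 0 <= m).
Hypothesis hm : forall D, 0 < D -> D < Z ->
  nu G X (dualg X G g) D (Num.min 1 (k / D)) <= m * D ^+ n.
Hypothesis hlam : 6 * 4 ^+ n * aE <= 4 ^+ lam.
Hypothesis hZ : Z <= 2 ^+ H.

Let m' := m / k ^+ (n - 2).
Let m'0 : 0 <= m'.
Proof. by have := k2 => h; rewrite divr_ge0 ?exprn_ge0 //; lra. Qed.

Lemma nu_dual_shell Q r D : 0 < Q -> k <= Q * r -> 0 < D -> D < Z ->
  nu G X (dualg X G g) D (1 / (Q * r * D)) <= m * D ^+ n.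
Proof.
move=> Q0 kW D0 DZ; have hk := k2.
have [D1|D1] := ltP (2 * D) 1.
  by rewrite nu_small // mulr_ge0 // exprn_ge0 // ltW.
apply: le_trans (hm D0 DZ).
have W0 : 0 < Q * r by lra.
apply: nu_mono; first exact: ltW.
  by rewrite div1r invr_ge0 mulr_ge0 // ltW.
rewrite le_min; apply/andP; split.
  by rewrite ler_pdivrMr ?mulr_gt0 //; nra.
rewrite ler_pdivlMr // (_ : 1 / (Q * r * D) * D = 1 / (Q * r)); last first.
  by field; rewrite !gt_eqF // -(pmulr_rgt0 _ Q0).
by rewrite ler_pdivrMr //; nra.
Qed.

Lemma divX_le (A Q r B : R) : 0 < r -> 0 <= B -> A * r ^+ n <= B * (Q * r) ^+ n -> A <= B * Q ^+ n.
Proof.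
move=> r0 B0; rewrite exprMn mulrA ler_pM2r ?exprn_gt0 //.
Qed.

Lemma step_base Q r : 0 < Q -> k <= Q * r -> r <= 1 -> 1 / (Q * r ^+ 2) <= Z ->
  c / cD <= r * L ->
  nu X G g Q r <= @Cll R n C * Q ^+ n * (Q ^+ 2 * r ^+ 2) + @Cll R n C * H%:R * m' * Q ^+ n.
Proof.
move=> Q0 kW r1 rZ rL; have hk := k2.
have W0 : 0 < Q * r by lra.
have r0 : 0 < r by rewrite -(pmulr_rgt0 _ Q0).
have W2 : 1 / 2 <= Q * r by lra.
have dl := dstar_lt Q0 r0.
have ds0 : 0 < dstar Q r.
  by rewrite /dstar; have := d0; have := c3 => *; pos.
have Cll0 : 0 <= @Cll R n C.
  by rewrite /Cll; have := c3; have := hC; have := C20 => *; pos.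
have := @nu_lossy _ _ _ X G g L C Q r hS Q0 W2 r1 rL H m.
rewrite -/(dstar Q r) => /(_ _ m0 _) h.
have {}h : nu X G g Q r * r ^+ n <= @Cll R n C * (Q * r) ^+ 2 * ((Q * r) ^+ n + H%:R * m).
  apply: h; first by apply: lt_le_trans hZ; lra.
  move=> h _; have p : (0 : R) < 2 ^+ h.+1 by rewrite exprn_gt0.
  apply: nu_dual_shell => //; first by rewrite divr_gt0.
  apply: (@le_lt_trans _ _ (dstar Q r)); last by lra.
  by rewrite ler_pdivrMr // ler_peMr ?(ltW ds0) // exprn_ege1 // ler1n.
have ps := @pow_shift (Q * r) m k ltac:(lra) kW m0.
rewrite (_ : _ + _ = (@Cll R n C * (Q ^+ 2 * r ^+ 2) + @Cll R n C * H%:R * m') * Q ^+ n); last by ring.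
apply: (@divX_le _ _ r) => //.
  by pos.
apply: le_trans h _; rewrite -/m' in ps.
have -> : @Cll R n C * (Q * r) ^+ 2 * ((Q * r) ^+ n + H%:R * m) =
  @Cll R n C * (Q ^+ 2 * r ^+ 2) * (Q * r) ^+ n + @Cll R n C * H%:R * ((Q * r) ^+ 2 * m) by ring.
rewrite mulrDl lerD2l -[leRHS]mulrA; apply: ler_wpM2l; first by pos.
by apply: le_trans ps _; rewrite mulrC.
Qed.

(** The growth of the main term in one iteration. It does not depend on [lam], since the gain 4^-lam
    cancels the square of 2^lam in [rho]. *)
Definition aA : R := 48 * 4 ^+ n.+2 * c ^+ 2 * aE.
Definition bB : R := @CA R n C * (2 * lam).+2%:R.

(** Under [nu_dichotomy] the secondary coefficient evolves as B -> bB + B/2. The fixed point is 2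
    bB, and the initial loss H shrinks to H / 2^i. Each iteration multiplies the radius by [rho],
    hence the condition on its i-th power. *)
Lemma step_iter i : forall Q r, 0 < Q -> k <= Q * r -> rho C lam ^+ i * r <= 1 -> r <= 1 ->
  1 / (Q * r ^+ 2) <= Z -> c / cD <= r * L ->
  nu X G g Q r <= @Cll R n C * aA ^+ i * Q ^+ n * (Q ^+ 2 * r ^+ 2)
    + (2 * bB + @Cll R n C * H%:R / 2 ^+ i) * m' * Q ^+ n.
Proof.
have hk := k2; have hc := c3; have hCC := hC.
have Cll0 : 0 <= @Cll R n C.
  by rewrite /Cll; have := C20 => ?; pos.
have CA0 : 0 <= @CA R n C.
  by rewrite /CA; have := C20 => ?; pos.
have bB0 : 0 <= bB by rewrite mulr_ge0.
have aE0 := aE_gt0.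
have aA0 : 0 <= aA by rewrite /aA; pos.
elim: i => [|i IH] Q r Q0 kW rr r1 rZ rL.
  apply: le_trans (step_base Q0 kW r1 rZ rL) _.
  rewrite !expr0 mulr1 divr1 lerD2l ler_wpM2r ?exprn_ge0 ?(ltW Q0) // ler_wpM2r //.
  by rewrite lerDr mulr_ge0.
have W0 : 0 < Q * r by lra.
have r0 : 0 < r by rewrite -(pmulr_rgt0 _ Q0).
have W2 : 1 / 2 <= Q * r by lra.
have dl := dstar_lt Q0 r0.
have ds0 : 0 < dstar Q r.
  by rewrite /dstar; have := d0 => ?; pos.
have p2 h : (0 : R) < 2 ^+ h by rewrite exprn_gt0.
have l1 : 1 <= rho C lam.
  by rewrite /rho -[1]mulr1 ler_pM ?exprn_ege1 ?ler1n // ; lra.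
have p4 : (0 : R) < 4 ^+ lam by rewrite exprn_gt0.
have := @nu_dichotomy _ _ _ X G g L C Q r hS Q0 W2 r1 rL lam m m0.
rewrite -/(dstar Q r) => h.
have {}h : nu X G g Q r * r ^+ n <= @CA R n C * (Q * r) ^+ 2 * ((2 * lam).+2%:R * m)
   + aE / 4 ^+ lam * r ^+ n * \sum_(h < 3) nu X G g (8 * Q / 2 ^+ h.+1) (rho C lam * r).
  apply: h => h _; apply: nu_dual_shell => //; first by have := p2 h.+1 => ?; pos.
  apply: (@le_lt_trans _ _ (2 * dstar Q r)); last by lra.
  by apply: le_trans (div_pow_le _ _) _; lra.
set B := 2 * bB + @Cll R n C * H%:R / 2 ^+ i in IH.
set A := @Cll R n C * aA ^+ i in IH.
have A0 : 0 <= A by rewrite mulr_ge0 ?exprn_ge0.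
have B0 : 0 <= B by rewrite /B; pos.
pose P := A * (4 * Q) ^+ n * ((4 * Q) ^+ 2 * (rho C lam * r) ^+ 2) + B * m' * (4 * Q) ^+ n.
have hP (h' : 'I_3) : nu X G g (8 * Q / 2 ^+ h'.+1) (rho C lam * r) <= P.
  set Q' := 8 * Q / _.
  have QQ : Q <= Q'.
    by apply: le_trans (@div_pow_ge _ h' _) ; lra.
  have Q4 : Q' <= 4 * Q.
    by apply: le_trans (div_pow_le _ _) _; lra.
  have Q'0 : 0 < Q' by lra.
  have rr' : r <= rho C lam * r by rewrite ler_peMl // ltW.
  have rr0 : 0 < rho C lam * r by lra.
  have rr1 : rho C lam * r <= 1.
    apply: le_trans rr; rewrite ler_pM2r // exprSr ler_peMl ?exprn_ege1 //; lra.
  have QrQr : Q * r <= Q' * (rho C lam * r) by apply: ler_pM => //; exact: ltW.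
  apply: le_trans (IH Q' _ Q'0 _ _ rr1 _ _) _.
  - by apply: le_trans kW _.
  - by rewrite mulrA -exprSr.
  - apply: le_trans rZ.
    have e1 : 0 < Q * r ^+ 2 by pos.
    have e2 : 0 < Q' * (rho C lam * r) ^+ 2 by apply: mulr_gt0 => //; apply: exprn_gt0.
    rewrite !div1r lef_pV2 ?posrE //.
    apply: ler_pM; rewrite ?exprn_ge0 ?(ltW Q0) ?(ltW r0) //.
    by rewrite lerXn2r // nnegrE ltW.
  - by apply: le_trans rL _; rewrite ler_wpM2r //; case: hS => _; lra.
  have q1 : Q' ^+ n <= (4 * Q) ^+ n by rewrite lerXn2r // nnegrE; lra.
  have q2 : Q' ^+ 2 <= (4 * Q) ^+ 2 by rewrite lerXn2r // nnegrE; lra.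
  rewrite /P; apply: lerD; last by apply: ler_wpM2l => //; apply: mulr_ge0.
  apply: ler_pM; [by pos|by pos|exact: ler_wpM2l|].
  by apply: ler_wpM2r => //; exact: sqr_ge0.
have hsum : \sum_(h < 3) nu X G g (8 * Q / 2 ^+ h.+1) (rho C lam * r) <= 3 * P.
  apply: le_trans (ler_sum _ (fun h _ => hP h)) _.
  by rewrite sumr_const card_ord -[leLHS]mulr_natl.
have ps := @pow_shift (Q * r) m k ltac:(lra) kW m0; rewrite -/m' in ps.
have {hsum}h := le_trans h (lerD (lexx _) (ler_wpM2l (_ : 0 <= aE / 4 ^+ lam * r ^+ n) hsum)).
have {}h : nu X G g Q r <= (bB * m' + aE / 4 ^+ lam * (3 * P) / Q ^+ n) * Q ^+ n.
  have Qn : 0 < Q ^+ n by rewrite exprn_gt0.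
  apply: (@divX_le _ _ r) => //.
    by rewrite /P; pos.
  apply: le_trans (h _) _; first by pos.
  have -> : (bB * m' + aE / 4 ^+ lam * (3 * P) / Q ^+ n) * (Q * r) ^+ n =
     @CA R n C * (2 * lam).+2%:R * ((Q * r) ^+ n * m') + aE / 4 ^+ lam * r ^+ n * (3 * P).
    by rewrite /bB exprMn; field; rewrite !gt_eqF.
  rewrite lerD2r; have -> : @CA R n C * (Q * r) ^+ 2 * ((2 * lam).+2%:R * m) =
     @CA R n C * (2 * lam).+2%:R * ((Q * r) ^+ 2 * m) by ring.
  by apply: ler_wpM2l => //; apply: mulr_ge0.
apply: le_trans h _.
have Qn : 0 < Q ^+ n by rewrite exprn_gt0.
have e4 : (rho C lam) ^+ 2 = 16 * c ^+ 2 * 4 ^+ lam.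
  rewrite /rho !exprMn -exprM mulnC exprM (_ : (2 : R) ^+ 2 = 4); ring.
have -> : (bB * m' + aE / 4 ^+ lam * (3 * P) / Q ^+ n) * Q ^+ n =
   @Cll R n C * aA ^+ i.+1 * Q ^+ n * (Q ^+ 2 * r ^+ 2)
   + (bB + (3 * 4 ^+ n * aE / 4 ^+ lam) * B) * m' * Q ^+ n.
  rewrite /P exprMn [(rho C lam * r) ^+ 2]exprMn e4 /A /aA !exprS !exprMn.
  by field; rewrite !gt_eqF.
rewrite lerD2l ler_wpM2r ?(ltW Qn) // ler_wpM2r //.
have hl : 3 * 4 ^+ n * aE / 4 ^+ lam <= 1 / 2.
  by rewrite ler_pdivrMr //; have := hlam; lra.
have : (3 * 4 ^+ n * aE / 4 ^+ lam) * B <= 1 / 2 * B by rewrite ler_wpM2r.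
have -> : 1 / 2 * B = bB + @Cll R n C * H%:R / 2 ^+ i.+1.
  by rewrite /B exprS; field; rewrite gt_eqF.
by lra.
Qed.

End Step.

Definition cG (lam : nat) : R := 2 * bB lam + @Cll R n C.
Definition aG (lam : nat) : R := aA + (rho C lam) ^+ 2.

Lemma aA_ge0 : 0 <= aA.
Proof.
have hc := c3; have aE0 := aE_gt0; rewrite /aA; pos.
Qed.

Lemma Cll_ge0 : 0 <= @Cll R n C.
Proof.
have hc := c3; have hCC := hC.
by rewrite /Cll; have := C20 => ?; pos.
Qed.

Lemma bB_ge0 lam : 0 <= bB lam.
Proof.
have hc := c3; have hCC := hC; rewrite mulr_ge0 //.
by rewrite /CA; have := C20 => ?; pos.
Qed.

(* The loss 2^i in the number of shells is beaten by iterating the dichotomy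
   i times, at the price of a factor exponential in i on the main term only. *)
Lemma one_step {Y : finType} (X G : Y -> 'rV[R]_n) (g : Y -> R) (L k m Z : R) (lam i : nat) :
  system X G g L C -> 2 <= k -> 0 <= m -> 6 * 4 ^+ n * aE <= 4 ^+ lam ->
  Z <= 2 ^+ (2 ^ i)%N ->
  (forall D, 0 < D -> D < Z -> nu G X (dualg X G g) D (Num.min 1 (k / D)) <= m * D ^+ n) ->
  forall Q, 0 < Q -> Q / k ^+ 2 <= Z -> c / cD <= L -> c / cD * Q <= k * L ->
  nu X G g Q (Num.min 1 (k / Q)) <=
    (cG lam * aG lam ^+ i * k ^+ 2 + cG lam * (m / k ^+ (n - 2))) * Q ^+ n.
Proof.
move=> hS k2 m0 hlam hZ hm Q Q0 QZ L1 L2.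
have hc := c3; have k0 : 0 < k by lra.
have CG0 : 0 <= cG lam by rewrite addr_ge0 ?Cll_ge0 // mulr_ge0 // bB_ge0.
have aG0 : 0 <= aG lam by rewrite addr_ge0 ?aA_ge0 ?sqr_ge0.
have m'0 : 0 <= m / k ^+ (n - 2) by rewrite divr_ge0 ?exprn_ge0 // ltW.
have Qn : 0 < Q ^+ n by rewrite exprn_gt0.
have l1 : 1 <= rho C lam.
  by rewrite /rho -[1]mulr1 ler_pM ?exprn_ege1 ?ler1n //; lra.
have [Q2|Q2] := ltP (2 * Q) 1.
  by rewrite nu_small //; pos.
(* If the radius cannot be enlarged i times without exceeding 1, then Q is at most rho^i k, and the
   count at radius 1 suffices: there the dual box contains only the zero vector and no dual input is
   required. *)
have [big|small] := leP (rho C lam ^+ i * (k / Q)) 1.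
  have kQ1 : k / Q <= 1.
    by apply: le_trans big; rewrite ler_peMl ?exprn_ege1 // divr_ge0 // ltW.
  have -> : Num.min 1 (k / Q) = k / Q by apply/min_idPr.
  have kW : k <= Q * (k / Q) by rewrite mulrC divfK ?gt_eqF.
  apply: le_trans (step_iter hS k2 m0 hm hlam hZ Q0 kW big kQ1 _ _) _.
  - rewrite (_ : 1 / _ = Q / k ^+ 2) //; field; rewrite !gt_eqF //.
  - by rewrite mulrAC ler_pdivlMr.
  rewrite [leRHS]mulrDl; apply: lerD.
    have -> : Q ^+ 2 * (k / Q) ^+ 2 = k ^+ 2 by field; rewrite gt_eqF.
    rewrite mulrAC ler_wpM2r ?(ltW Qn) // ler_wpM2r ?exprn_ge0 ?(ltW k0) //.
    apply: ler_pM; rewrite ?exprn_ge0 ?Cll_ge0 ?aA_ge0 //.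
      by rewrite /cG lerDr mulr_ge0 // bB_ge0.
    by rewrite lerXn2r ?nnegrE ?aA_ge0 // /aG lerDl sqr_ge0.
  rewrite ler_wpM2r ?(ltW Qn) // ler_wpM2r // /cG natrX mulfK //.
have h1 : nu X G g Q 1 <= @Cll R n C * Q ^+ 2 * Q ^+ n.
  have W2 : 1 / 2 <= Q * 1 by rewrite mulr1; lra.
  have := @nu_lossy _ _ _ X G g L C Q 1 hS Q0 W2 (lexx 1) _ 0 0.
  rewrite !expr1n !mulr1 mul1r mul0r addr0; apply=> //.
  by rewrite expr0 ltr_pdivrMr ?mulr_gt0 ?mul1r; have := d1; nra.
apply: (@le_trans _ _ (nu X G g Q 1)).
  apply: nu_mono; rewrite ?(ltW Q0) ?ge_min ?lexx //.
  by rewrite le_min ler01 divr_ge0 // ltW.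
apply: le_trans h1 _; rewrite ler_wpM2r ?(ltW Qn) //.
rewrite -[leLHS]addr0; apply: lerD; last by rewrite mulr_ge0.
have Qk : Q <= rho C lam ^+ i * k.
  by apply: ltW; move: small; rewrite mulrA ltr_pdivlMr // mul1r.
apply: (@le_trans _ _ (@Cll R n C * (rho C lam ^+ i * k) ^+ 2)).
  by rewrite ler_wpM2l ?Cll_ge0 // lerXn2r ?nnegrE ?mulr_ge0 ?exprn_ge0 ?(ltW Q0) ?(ltW k0) //; lra.
rewrite exprMn mulrA ler_wpM2r ?exprn_ge0 ?(ltW k0) //.
apply: ler_pM; rewrite ?Cll_ge0 ?sqr_ge0 //.
  by rewrite /cG lerDr mulr_ge0 // bB_ge0.
rewrite -exprM mulnC exprM lerXn2r ?nnegrE ?sqr_ge0 //.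
by rewrite /aG lerDr aA_ge0.
Qed.

(** The system and its dual are treated together, because a step for one of them at Q uses the other
    at sizes up to about Q / k^2. The induction on s starts from Q < 1/2, where both counts
    vanish. *)
Lemma iterate_steps {Y : finType} (X G : Y -> 'rV[R]_n) (g : Y -> R) (L k Z0 : R) (lam i : nat) :
  system X G g L C -> 2 <= k -> 6 * 4 ^+ n * aE <= 4 ^+ lam ->
  Z0 <= 2 ^+ (2 ^ i)%N -> c / cD <= L -> c / cD * Z0 <= k * L ->
  forall s Q, 0 < Q -> Q < (k ^+ 2) ^+ s / 2 -> Q <= Z0 ->
  nu X G g Q (Num.min 1 (k / Q)) <=
    cG lam * aG lam ^+ i * k ^+ 2 * (\sum_(t < s) (cG lam / k ^+ (n - 2)) ^+ t) * Q ^+ n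
  /\ nu G X (dualg X G g) Q (Num.min 1 (k / Q)) <=
    cG lam * aG lam ^+ i * k ^+ 2 * (\sum_(t < s) (cG lam / k ^+ (n - 2)) ^+ t) * Q ^+ n.
Proof.
move=> hS k2 hlam hZ L1 L2; elim=> [|s IH] Q Q0 Qs QZ.
  by move: Qs; rewrite expr0 => Qs; rewrite !nu_small ?big_ord0 ?mulr0 ?mul0r //; lra.
have k0 : 0 < k by lra.
have CG0 : 0 <= cG lam by rewrite addr_ge0 ?Cll_ge0 // mulr_ge0 // bB_ge0.
have aG0 : 0 <= aG lam by rewrite addr_ge0 ?aA_ge0 ?sqr_ge0.
set th := cG lam / k ^+ (n - 2); have th0 : 0 <= th by rewrite divr_ge0 ?exprn_ge0 // ltW.
set B := cG lam * aG lam ^+ i * k ^+ 2.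
have B0 : 0 <= B by rewrite !mulr_ge0 ?exprn_ge0 // ltW.
set S := \sum_(t < s) th ^+ t in IH.
have S0 : 0 <= S by apply: sumr_ge0 => t _; rewrite exprn_ge0.
have m0 : 0 <= B * S by rewrite mulr_ge0.
pose Z := Num.min Z0 ((k ^+ 2) ^+ s / 2).
have ZZ : Z <= 2 ^+ (2 ^ i)%N by rewrite (le_trans _ hZ) // ge_min lexx.
have k21 : 1 <= k ^+ 2 by rewrite expr2; nra.
have QZZ : Q / k ^+ 2 <= Z.
  rewrite le_min; apply/andP; split.
    by apply: le_trans QZ; rewrite ler_pdivrMr ?exprn_gt0 // ler_peMr // ltW.
  rewrite ler_pdivrMr ?exprn_gt0 //; apply: ltW; move: Qs; rewrite exprS; lra.
have QL : c / cD * Q <= k * L.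
  apply: le_trans L2; rewrite ler_wpM2l //; have hc := c3.
  by rewrite divr_ge0 ?(ltW d0) //; lra.
have E : B * (\sum_(t < s.+1) th ^+ t) = B + cG lam * (B * S / k ^+ (n - 2)).
  rewrite big_ord_recl expr0 mulrDr mulr1; congr (_ + _).
  under eq_bigr do rewrite lift0 exprS.
  by rewrite -mulr_sumr -/S /th; ring.
rewrite E.
have one := fun Y0 X0 G0 g0 hS0 hm => @one_step Y0 X0 G0 g0 L k (B * S) Z lam i hS0 k2 m0 hlam ZZ hm Q Q0 QZZ L1 QL.
split.
  apply: one => // D D0; rewrite lt_min => /andP[D1 D2].
  by apply: (IH D D0 D2 (ltW D1)).2.
apply: one; first exact: system_dual.
move=> D D0; rewrite lt_min => /andP[D1 D2]; rewrite dualgK.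
by apply: (IH D D0 D2 (ltW D1)).1.
Qed.

End Solve.

(** * The growth function and elementary estimates for it *)

Section Growth.
Context {R : realType}.
Implicit Types (X a b p : R).

(** Up to constants the logarithm of E_n: exp (b phi) is exp (b sqrt (log X)) for n = 2 and (1 + log
    X)^b for n >= 3, times exp b. Constants and powers of log X are absorbed by enlarging b. *)
Definition phi (n : nat) X : R :=
  if n == 2%N then 1 + Num.sqrt (ln X) else 1 + ln (1 + ln X).

Lemma phi_ge1 n X : 1 <= X -> 1 <= phi n X.
Proof.
move=> X1; rewrite /phi; case: ifP => _; rewrite lerDl ?sqrtr_ge0 //.
by rewrite ln_ge0 // lerDl ln_ge0.
Qed.

Lemma ln_le_phi n X : 1 <= X -> 1 + ln X <= expR (2 * phi n X).
Proof.
move=> X1; have l0 : 0 <= ln X by rewrite ln_ge0.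
rewrite /phi; case: ifP => _.
  have s0 := sqrtr_ge0 (ln X); have := sqr_sqrtr l0.
  move: (Num.sqrt (ln X)) s0 => s s0 <-.
  apply: (@le_trans _ _ (expR s ^+ 2)).
    by have := expR_ge1Dx s; nra.
  by rewrite -expRM_natr ler_expR; lra.
have p1 : 0 < 1 + ln X by lra.
rewrite -{1}(lnK (p1 : 1 + ln X \in Num.pos)) ler_expR.
by have : 0 <= ln (1 + ln X) by [rewrite ln_ge0 // lerDl]; lra.
Qed.

Lemma le_expR_phi a p : 0 <= a -> 1 <= p -> a <= expR (a * p).
Proof.
move=> a0 p1; apply: (@le_trans _ _ (expR a)); first by have := expR_ge1Dx a; lra.
by rewrite ler_expR ler_peMr.
Qed.

Lemma expR_half_le2 : expR (1 / 2) <= 2 :> R.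
Proof.
have := expR_ge1Dx (- (1 / 2) : R); rewrite expRN => h.
have e0 := expR_gt0 (1 / 2 : R).
have : (1 / 2) * expR (1 / 2) <= 1 :> R.
  by rewrite -ler_pdivlMr // [leRHS]div1r; lra.
by lra.
Qed.

Lemma le_2pow X : 1 <= X -> X <= 2 ^+ (Num.truncn (2 * ln X)).+1.
Proof.
move=> X1; set j := (Num.truncn _).+1.
have X0 : 0 < X by lra.
have h : 2 * ln X < j%:R by exact: truncnS_gt.
apply: (@le_trans _ _ (expR (1 / 2) ^+ j)).
  rewrite -expRM_natr -{1}(lnK (X0 : X \in Num.pos)) ler_expR; lra.
by rewrite lerXn2r ?nnegrE ?expR_ge0 // expR_half_le2.
Qed.

(** So i is about log log X: 2^i dyadic shells cover the range up to X, as [one_step] requires,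
    while factors exponential in i are powers of log X. *)
Lemma exists_i X : 1 <= X -> exists i : nat, X <= 2 ^+ (2 ^ i)%N /\ (2 ^ i)%:R <= 4 * (1 + ln X).
Proof.
move=> X1; have l0 : 0 <= ln X by rewrite ln_ge0.
pose j := (Num.truncn (2 * ln X)).+1.
exists (trunc_log 2 j).+1; split.
  apply: le_trans (le_2pow X1) _; rewrite ler_weXn2l ?ler1n //.
  by apply: ltnW; apply: trunc_log_ltn.
apply: (@le_trans _ _ (2 * j%:R)).
  rewrite expnS natrM ler_wpM2l // ler_nat; exact: trunc_logP.
have : (Num.truncn (2 * ln X))%:R <= 2 * ln X by rewrite truncn_le mulr_ge0.
by rewrite /j -addn1 natrD; lra.
Qed.

Lemma geom_half (th : R) s : 0 <= th <= 1 / 2 -> \sum_(t < s) th ^+ t <= 2.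
Proof.
move=> /andP[t0 t1]; suff : \sum_(t < s) th ^+ t <= 2 - 2 * (1 / 2) ^+ s.
  by have : 0 <= (1 / 2 : R) ^+ s by [apply: exprn_ge0; lra]; lra.
elim: s => [|s IH]; first by rewrite big_ord0 expr0; lra.
rewrite big_ord_recr /= exprSr.
have : th ^+ s <= (1 / 2) ^+ s by rewrite lerXn2r // nnegrE; lra.
by move: IH; lra.
Qed.

Lemma sqr_le2 a b : 0 <= a -> a <= b -> a * a <= 2 * a * b.
Proof. by move=> a0 ab; nra. Qed.

Lemma expR2_ge4 p : 1 <= p -> 4 <= expR (2 * p).
Proof.
move=> p1; have h := expR_ge1Dx p.
have -> : 2 * p = p + p by ring.
by rewrite expRD; nra.
Qed.

End Growth.

(** * The bound for the number of near-tangent lattice points *)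

Section NuBound.
Context {R : realType} {n : nat} (C : R).
Hypotheses (n2 : (2 <= n)%N) (hC : 1 <= C).

(** The choice of k decides. For n >= 3 a constant k with ratio cG / k^(n-2) at most 1/2 makes the
    sum over the steps converge. For n = 2 the ratio is cG whatever k is, so the number of steps has
    to be small: with k = 2 exp (sqrt (log Z)) about sqrt (log Z) steps suffice, and k^2 is paid
    only once. *)
Theorem nu_bound : exists2 b : R, 0 < b & forall (Y : finType) (X G : Y -> 'rV[R]_n)
  (g : Y -> R) (L Z : R), system X G g L C -> 1 <= Z -> @C1 R n C / @cD R n * Z <= L ->
  forall Q, 0 < Q -> Q <= Z ->
  nu X G g Q (Num.min 1 (1 / Q)) <= expR (b * phi n Z) * Q ^+ n.
Proof.
have [lam hlam] := @exists_lam R n C hC.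
set cg : R := @cG R n C lam; set ag : R := @aG R n C lam.
have cg0 : 0 <= cg by rewrite /cg /cG addr_ge0 ?Cll_ge0 // mulr_ge0 // bB_ge0.
have ag0 : 0 <= ag by rewrite /ag /aG addr_ge0 ?aA_ge0 ?sqr_ge0.
pose p := Num.bound ag.
have agp : ag <= 2 ^+ p.
  apply: le_trans (ltW (archi_boundP ag0)) _; rewrite -/p.
  by move: p => q; rewrite -natrX ler_nat ltnW // ltn_expl.
have agi (Z : R) i : 1 <= Z -> (2 ^ i)%:R <= 4 * (1 + ln Z) -> ag ^+ i <= expR (4 * p%:R * phi n Z).
  move=> Z1 hi; have ph := phi_ge1 n Z1; have l0 : 0 <= ln Z by rewrite ln_ge0.
  apply: (@le_trans _ _ ((2 ^+ p) ^+ i)); first by rewrite lerXn2r ?nnegrE ?exprn_ge0.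
  rewrite -exprM mulnC exprM -natrX.
  apply: (@le_trans _ _ (expR (4 * phi n Z) ^+ p)); last first.
    by rewrite -expRM_natr ler_expR; lra.
  rewrite lerXn2r ?nnegrE ?expR_ge0 //; apply: le_trans hi _.
  have e2 : 4 <= expR (2 * phi n Z).
    exact: expR2_ge4.
  rewrite (_ : 4 * phi n Z = 2 * phi n Z + 2 * phi n Z); last by ring.
  by rewrite expRD ler_pM //; [lra|exact: ln_le_phi].
pose k0 : R := 2 + 2 * cg.
have nub (Y : finType) (X G : Y -> 'rV[R]_n) (g : Y -> R) (L Z k : R) (s i : nat) Q :
    system X G g L C -> 1 <= Z -> @C1 R n C / @cD R n * Z <= L -> 2 <= k ->
    Z <= 2 ^+ (2 ^ i)%N -> 0 < Q -> Q <= Z -> Q < (k ^+ 2) ^+ s / 2 ->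
    nu X G g Q (Num.min 1 (1 / Q)) <=
    cg * ag ^+ i * k ^+ 2 * (\sum_(t < s) (cg / k ^+ (n - 2)) ^+ t) * Q ^+ n.
  move=> hS Z1 hL k2 hi Q0 QZ Qs.
  have cc : 0 <= @C1 R n C / @cD R n.
    by have := @C1_ge R n C hC; have := @cD_gt0 R n => *; pos.
  have L1 : @C1 R n C / @cD R n <= L by apply: le_trans hL; rewrite ler_peMr.
  have L0 : 0 <= L by apply: le_trans L1.
  have L2 : @C1 R n C / @cD R n * Z <= k * L.
    by apply: le_trans hL _; rewrite ler_peMl //; lra.
  have [h _] := iterate_steps n2 hC hS k2 hlam hi L1 L2 Q0 Qs QZ.
  apply: le_trans h; apply: nu_mono; first exact: ltW.
    by rewrite le_min ler01 divr_ge0 // ltW.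
  rewrite le_min ge_min lexx /= ge_min; apply/orP; right.
  by rewrite ler_wpM2r ?invr_ge0 ?(ltW Q0) //; lra.
have [n2e|n3] := eqVneq n 2%N.
  exists (cg + 4 * p%:R + 2 + (1 + (1 + cg))); first by have : (0 : R) <= p%:R by []; lra.
  move=> Y X G g L Z hS Z1 hL Q Q0 QZ.
  have [i [hi1 hi2]] := exists_i Z1.
  have ph := phi_ge1 n Z1.
  have l0 : 0 <= ln Z by rewrite ln_ge0.
  have Z0 : 0 < Z by lra.
  pose sq := Num.sqrt (ln Z); have sq0 : 0 <= sq by exact: sqrtr_ge0.
  have phE : phi n Z = 1 + sq by rewrite /phi n2e.
  have [s [s1 s2 s3]] : exists s : nat, [/\ sq < s%:R, s%:R <= phi n Z & (0 < s)%N].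
    exists (Num.truncn sq).+1; split => //; first exact: truncnS_gt.
    by rewrite phE -addn1 natrD addrC lerD2l truncn_le.
  (* Each step gains 4 exp (2 sqrt (log Z)), and s exceeds sqrt (log Z), so the s-th power is at
     least 4Z. The factor 2 in k provides the 4, which covers the division by 2 in the range of
     Q. *)
  pose k := 2 * expR sq.
  have e1 : 1 <= expR sq by have := expR_ge1Dx sq; lra.
  have k2 : 2 <= k by rewrite /k; lra.
  have k2E : k ^+ 2 = 4 * expR (2 * sq).
    rewrite /k exprMn (_ : 2 ^+ 2 = 4 :> R); last by ring.
    by rewrite -expRM_natr mulrC [2 * sq]mulrC mulrC.
  have Qs : Q < (k ^+ 2) ^+ s / 2.
    apply: (@lt_le_trans _ _ (2 * Z)); first by lra.
    rewrite k2E exprMn -expRM_natr ler_pdivlMr //.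
    have a4 : 4 <= 4 ^+ s :> R.
      by rewrite -(prednK s3) exprS ler_peMr // exprn_ege1 // ler1n.
    have aZ : Z <= expR (2 * sq * s%:R).
      rewrite -{1}(lnK (Z0 : Z \in Num.pos)) ler_expR -(sqr_sqrtr l0) -/sq expr2.
      by apply: sqr_le2 => //; exact: ltW.
    have h4 : 4 * Z <= 4 ^+ s * expR (2 * sq * s%:R).
      by apply: ler_pM => //; exact: ltW.
    by apply: le_trans h4; rewrite mulrAC; lra.
  apply: le_trans (nub _ _ _ _ _ _ _ _ _ _ hS Z1 hL k2 hi1 Q0 QZ Qs) _.
  rewrite ler_wpM2r ?exprn_ge0 ?(ltW Q0) //.
  have -> : (cg + 4 * p%:R + 2 + (1 + (1 + cg))) * phi n Z =
    cg * phi n Z + 4 * p%:R * phi n Z + 2 * phi n Z + (1 + (1 + cg)) * phi n Z by ring.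
  rewrite 3!expRD.
  have kn : k ^+ (n - 2) = 1 by rewrite n2e expr0.
  have agi0 : 0 <= ag ^+ i by apply: exprn_ge0.
  have cga : 0 <= cg * ag ^+ i by apply: mulr_ge0.
  apply: ler_pM.
  - by apply: mulr_ge0 => //; exact: sqr_ge0.
  - by apply: sumr_ge0 => t _; rewrite kn divr1 exprn_ge0.
  - apply: ler_pM => //; first exact: sqr_ge0.
      by apply: ler_pM => //; [exact: le_expR_phi|exact: agi].
    rewrite k2E phE mulrDr mulr1 expRD ler_wpM2r ?expR_ge0 //.
    by have := @expR2_ge4 R 1 (lexx 1); rewrite mulr1.
  - rewrite kn divr1.
    apply: (@le_trans _ _ (\sum_(t < s) expR ((1 + cg) * phi n Z))).
      apply: ler_sum => t _.
      apply: (@le_trans _ _ (expR cg ^+ t)).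
        by rewrite lerXn2r ?nnegrE ?expR_ge0 //; have := expR_ge1Dx cg; lra.
      rewrite -expRM_natr ler_expR.
      have : (t : nat)%:R <= phi n Z by apply: le_trans s2; rewrite ler_nat ltnW.
      move=> /(ler_wpM2l cg0); lra.
    rewrite sumr_const card_ord -[leLHS]mulr_natl.
    have -> : (1 + (1 + cg)) * phi n Z = phi n Z + (1 + cg) * phi n Z by ring.
    rewrite [leRHS]expRD; apply: ler_wpM2r; first exact: expR_ge0.
    by apply: le_trans s2 _; have := expR_ge1Dx (phi n Z); lra.
exists (2 * cg * k0 ^+ 2 + 4 * p%:R + 1).
  have : 0 <= 2 * cg * k0 ^+ 2.
    by apply: mulr_ge0; [apply: mulr_ge0|exact: sqr_ge0].
  by have : (0 : R) <= p%:R by []; lra.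
move=> Y X G g L Z hS Z1 hL Q Q0 QZ.
have [i [hi1 hi2]] := exists_i Z1.
have ph := phi_ge1 n Z1.
have k2 : 2 <= k0 by rewrite /k0; lra.
have [s hs] : exists s : nat, 2 * Q < s%:R.
  by exists (Num.bound (2 * Q)); apply: archi_boundP; lra.
have Qs : Q < (k0 ^+ 2) ^+ s / 2.
  have h2 : s%:R <= 2 ^+ s :> R by rewrite -natrX ler_nat ltnW // ltn_expl.
  have h3 : 2 ^+ s <= (k0 ^+ 2) ^+ s.
    rewrite lerXn2r ?nnegrE ?sqr_ge0 // expr2.
    have : 2 * 2 <= k0 * k0 by apply: ler_pM; lra.
    by lra.
  by lra.
apply: le_trans (nub _ _ _ _ _ _ _ _ _ _ hS Z1 hL k2 hi1 Q0 QZ Qs) _.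
rewrite ler_wpM2r ?exprn_ge0 ?(ltW Q0) //.
set th := cg / _.
have kn : k0 <= k0 ^+ (n - 2).
  have -> : (n - 2)%N = (n - 3).+1 by move: n2 n3; clear; lia.
  by rewrite exprS ler_peMr ?exprn_ege1 //; lra.
have th1 : 0 <= th <= 1 / 2.
  rewrite /th; apply/andP; split; first by rewrite divr_ge0 ?exprn_ge0 //; lra.
  rewrite ler_pdivrMr; last by lra.
  by move: kn; rewrite {1}/k0; lra.
have gh := geom_half s th1.
apply: (@le_trans _ _ ((2 * cg * k0 ^+ 2) * ag ^+ i)).
  have -> : 2 * cg * k0 ^+ 2 * ag ^+ i = cg * ag ^+ i * k0 ^+ 2 * 2 by ring.
  by rewrite ler_wpM2l // !mulr_ge0 ?exprn_ge0 //; lra.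
apply: (@le_trans _ _ (expR (2 * cg * k0 ^+ 2 * phi n Z) * expR (4 * p%:R * phi n Z))).
  have cgk : 0 <= 2 * cg * k0 ^+ 2.
    by apply: mulr_ge0; [apply: mulr_ge0|exact: sqr_ge0].
  apply: ler_pM => //; first exact: exprn_ge0.
    exact: le_expR_phi.
  exact: agi.
by rewrite -expRD ler_expR; lra.
Qed.

End NuBound.

(** * Finitely supported sums over Z^n *)

Section LatticeSums.
Context {n : nat}.

Definition bpos (b : 'rV[int]_n) (N : nat) (v : {ffun 'I_n -> 'I_N}) : 'rV[int]_n :=
  \row_i (b 0 i + (v i)%:Z).

Lemma bpos_inj b N : injective (@bpos b N).
Proof.
move=> v v' /rowP h; apply/ffunP => i; apply: val_inj => /=.
by have := h i; rewrite !mxE => /addrI [].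
Qed.

Lemma bpos_surj (b : 'rV[int]_n) N (a : 'rV[int]_n) : (forall i, b 0 i <= a 0 i < b 0 i + N%:Z) ->
  exists v : {ffun 'I_n -> 'I_N}, bpos b v = a.
Proof.
move=> h.
have hb i : (`|(a 0 i - b 0 i)%R| < N)%N.
  by have /andP[] := h i; lia.
exists [ffun i => Ordinal (hb i)]; apply/rowP => i; rewrite !mxE ffunE /=.
by have /andP[] := h i; lia.
Qed.

Lemma zsE (V : zmodType) (b : 'rV[int]_n) N (phi : 'rV[int]_n -> V) :
  (forall a, phi a != 0 -> forall i, b 0 i <= a 0 i < b 0 i + N%:Z) ->
  \sum_(a \in [set: 'rV[int]_n]) phi a = \sum_(v : {ffun 'I_n -> 'I_N}) phi (bpos b v).
Proof.
move=> h.
rewrite -(@fsbig_widen _ _ _ _ ((@bpos b N) @` [set: _]) [set: _]) //; last first.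
  move=> a [_ na] /=; apply/eqP/negPn/negP => /h /bpos_surj[v hv].
  by apply: na; exists v.
rewrite fsbig_image; last by move=> v v' _ _; exact: bpos_inj.
have -> : [set: {ffun 'I_n -> 'I_N}] = [set` index_enum {ffun 'I_n -> 'I_N}].
  by apply/seteqP; split=> // v _ /=; rewrite mem_index_enum.
by rewrite -fsbig_seq // index_enum_uniq.
Qed.

Lemma zs_shift (V : zmodType) h (phi : 'rV[int]_n -> V) :
  \sum_(a \in [set: 'rV[int]_n]) phi (a + h) = \sum_(a \in [set: 'rV[int]_n]) phi a.
Proof.
apply/esym; apply: (reindex_fsbigT (fun a => a + h)).
by exists (fun a => a - h) => a; [exact: addrK|exact: subrK].
Qed.

Definition bnd {V : zmodType} (M : nat) (phi : 'rV[int]_n -> V) : Prop :=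
  forall a, phi a != 0 -> forall j, (`|a 0%R j| <= M)%N.

Definition cpos (M : nat) (v : {ffun 'I_n -> 'I_(2 * M).+1}) : 'rV[int]_n :=
  bpos (const_mx (- M%:Z)) v.
Arguments cpos : clear implicits.

Lemma zs_bnd (V : zmodType) M (phi : 'rV[int]_n -> V) : bnd M phi ->
  \sum_(a \in [set: 'rV[int]_n]) phi a = \sum_v phi (cpos M v).
Proof.
by move=> h; apply: zsE => a /h ha i; rewrite !mxE; have := ha i; lia.
Qed.

Lemma bnd_leq (V : zmodType) M M' (phi : 'rV[int]_n -> V) : (M <= M')%N -> bnd M phi -> bnd M' phi.
Proof. by move=> hM h a /h ha j; apply: leq_trans hM. Qed.

Definition ei (i : 'I_n) : 'rV[int]_n := delta_mx 0 i.
Definition DG {V : zmodType} (i : 'I_n) (phi : 'rV[int]_n -> V) a := phi a - phi (a - ei i).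

Lemma bnd_DG (V : zmodType) M i (phi : 'rV[int]_n -> V) : bnd M phi -> bnd M.+1 (DG i phi).
Proof.
move=> h a; rewrite /DG => ha j.
have [/eqP h0|/h /(_ j)] := boolP (phi a == 0); last by lia.
have /h /(_ j) : phi (a - ei i) != 0 by move: ha; rewrite h0 sub0r oppr_eq0.
by rewrite !mxE; case: (_ && _) => /=; lia.
Qed.

Lemma bnd_iterDG (V : zmodType) M A i (phi : 'rV[int]_n -> V) :
  bnd M phi -> bnd (M + A)%N (iter A (DG i) phi).
Proof.
by move=> h; elim: A => [|A IH] /=; rewrite ?addn0 // addnS; exact: bnd_DG.
Qed.

End LatticeSums.

(** * Summation by parts in one coordinate *)

Section SummationByParts.
Context {R : realType} {n : nat}.
Implicit Types (phi : 'rV[int]_n -> R[i]) (th : 'I_n -> R).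

Definition zdot th (a : 'rV[int]_n) : R := \sum_j th j * (a 0 j)%:~R.
Definition tw th phi a : R[i] := phi a * cis (zdot th a).
Definition zs phi : R[i] := \sum_(a \in [set: 'rV[int]_n]) phi a.

Lemma bnd_tw M th phi : bnd M phi -> bnd M (tw th phi).
Proof. by move=> h a ha; apply: h; move: ha; apply: contra_neq => h0; rewrite /tw h0 mul0r. Qed.

Lemma zdotD th a b : zdot th (a + b) = zdot th a + zdot th b.
Proof. by rewrite -big_split; apply: eq_bigr => j _; rewrite mxE rmorphD mulrDr. Qed.

Lemma zdot_ei th i : zdot th (ei i) = th i.
Proof.
rewrite /zdot (bigD1 i) //= big1 => [|j ji]; first by rewrite mxE !eqxx mulr1 addr0.
by rewrite mxE (negbTE ji) andbF mulr0.
Qed.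

Lemma zs_sbp M th i phi : bnd M phi ->
  (1 - cis (th i)) * zs (tw th phi) = zs (tw th (DG i phi)).
Proof.
move=> h.
have h1 : zs (tw th (fun a => phi (a - ei i))) = cis (th i) * zs (tw th phi).
  rewrite /zs -(zs_shift (ei i)) !(zs_bnd (M := M)); last 2 first.
  - exact: bnd_tw.
  - by move=> a ha; apply: h; move: ha; apply: contra_neq => h0; rewrite /tw addrK h0 mul0r.
  rewrite mulr_sumr; apply: eq_bigr => v _.
  by rewrite /tw addrK zdotD cisD zdot_ei; ring.
rewrite mulrBl mul1r -h1 /zs !(@zs_bnd _ _ M.+1); last 3 first.
- by apply: bnd_tw; exact: bnd_DG.
- apply: bnd_tw => a /h ha j; have := ha j.
  by rewrite !mxE; case: (_ && _) => /=; lia.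
- by apply: (@bnd_leq _ _ M M.+1 _ (leqnSn M)); exact: bnd_tw.
by rewrite -sumrB; apply: eq_bigr => v _; rewrite /tw /DG mulrBl.
Qed.

Lemma zs_sbp_iter A M th i phi : bnd M phi ->
  (1 - cis (th i)) ^+ A * zs (tw th phi) = zs (tw th (iter A (DG i) phi)).
Proof.
move=> h; elim: A => [|A IH]; first by rewrite expr0 mul1r.
by rewrite exprS -mulrA IH (zs_sbp _ _ (bnd_iterDG (A := A) (i := i) h)).
Qed.

Lemma nrm_zs M phi B : bnd M phi -> (forall a, nrm (phi a) <= B) ->
  nrm (zs phi) <= ((2 * M).+1)%:R ^+ n * B.
Proof.
move=> h hB; rewrite /zs (zs_bnd h); apply: le_trans (nrm_sum _ _ _) _.
apply: le_trans (ler_sum _ (fun v _ => hB _)) _.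
by rewrite sumr_const card_ffun !card_ord -[leLHS]mulr_natl natrX.
Qed.

Lemma nrm_tw th phi a : nrm (tw th phi a) = nrm (phi a).
Proof. by rewrite /tw nrmM nrm_cis mulr1. Qed.

End SummationByParts.

(** * Quantitative smoothness in one variable *)

Section Smooth.
Context {R : realType}.
Implicit Types (g h : R -> R).

Lemma mvt_le g g' (a b K : R) : a <= b -> (forall t : R, is_derive t 1 g (g' t)) ->
  (forall t, a <= t <= b -> `|g' t| <= K) -> `|g b - g a| <= K * (b - a).
Proof.
move=> ab hg hK.
have [|c hc ->] := @MVT_segment _ g g' a b ab (fun x _ => hg x).
  by apply: derivable_within_continuous => x _; have [] := hg x.
rewrite normrM [X in _ * X]ger0_norm ?subr_ge0 // ler_wpM2r ?subr_ge0 //.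
by apply: hK; move: hc; rewrite in_itv.
Qed.

(* Bounds are only required on [-2, 2], the range in which a kernel supported
   on [-1, 1] can be seen by a difference operator of small step. *)
Fixpoint Sm (a : nat) (C : R) g : Prop := (forall t, `|t| <= 2 -> `|g t| <= C) /\
  (if a is a'.+1 then exists g', (forall t : R, is_derive t 1 g (g' t)) /\ Sm a' C g' else True).

Lemma Sm_bound a C g : Sm a C g -> forall t, `|t| <= 2 -> `|g t| <= C.
Proof. by case: a => [|a] []. Qed.

Lemma Sm_mono a C C' g : C <= C' -> Sm a C g -> Sm a C' g.
Proof.
move=> CC; elim: a g => [|a IH] g [hb hd]; split=> //.
- by move=> t /hb h; apply: le_trans CC.
- by move=> t /hb h; apply: le_trans CC.
by have [g' [h1 h2]] := hd; exists g'; split=> //; exact: IH.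
Qed.

Lemma Sm_pred a C g : Sm a.+1 C g -> Sm a C g.
Proof.
elim: a g => [|a IH] g [hb [g' [h1 h2]]]; split=> //.
by exists g'; split=> //; exact: IH.
Qed.

Lemma Sm_ge0 a C g : Sm a C g -> 0 <= C.
Proof. by move/Sm_bound/(_ 0); rewrite normr0 => /(_ (ler0n _ _)); exact: le_trans. Qed.

Lemma SmD a C C' g h : Sm a C g -> Sm a C' h -> Sm a (C + C') (g + h).
Proof.
elim: a g h => [|a IH] g h [gb gd] [hb hd]; split=> //.
- by move=> t ht; apply: le_trans (ler_normD _ _) _; apply: lerD; [exact: gb|exact: hb].
- by move=> t ht; apply: le_trans (ler_normD _ _) _; apply: lerD; [exact: gb|exact: hb].
have [g' [h1 h2]] := gd; have [h' [h3 h4]] := hd.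
by exists (g' + h'); split=> [t|]; [exact: is_deriveD|exact: IH].
Qed.

Lemma SmN a C g : Sm a C g -> Sm a C (- g).
Proof.
elim: a g => [|a IH] g [gb gd]; split=> //.
- by move=> t ht; rewrite /= normrN; exact: gb.
- by move=> t ht; rewrite /= normrN; exact: gb.
have [g' [h1 h2]] := gd.
by exists (- g'); split=> [t|]; [exact: is_deriveN|exact: IH].
Qed.

Lemma SmM a C C' g h : Sm a C g -> Sm a C' h -> Sm a (2 ^+ a * (C * C')) (g * h).
Proof.
elim: a g h => [|a IH] g h hg hh.
  split=> // t ht; rewrite expr0 mul1r /= normrM.
  by apply: ler_pM => //; [exact: (Sm_bound hg)|exact: (Sm_bound hh)].
have C0 := Sm_ge0 hg; have C'0 := Sm_ge0 hh.
split.
  move=> t ht; rewrite /= normrM; apply: (@le_trans _ _ (C * C')).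
    by apply: ler_pM => //; [exact: (Sm_bound hg)|exact: (Sm_bound hh)].
  by rewrite ler_peMl ?mulr_ge0 // exprn_ege1 // ler1n.
have [_ [g' [h1 h2]]] := hg; have [_ [h' [h3 h4]]] := hh.
exists (g * h' + g' * h); split.
  move=> t; have := @is_deriveM _ _ _ _ t 1 _ _ (h1 t) (h3 t).
  by move=> /is_derive_eq; apply; rewrite /= /GRing.scale /= [X in _ + X]mulrC.
apply: Sm_mono (SmD (IH _ _ (Sm_pred hg) h4) (IH _ _ h2 (Sm_pred hh))).
by rewrite exprS; lra.
Qed.

Lemma Sm_cst a C (c : R) : `|c| <= C -> Sm a C (cst c).
Proof.
elim: a c => [|a IH] c hc; split=> //.
exists (cst 0); split; first by move=> t; exact: is_derive_cst.
by apply: IH; rewrite normr0; apply: le_trans hc.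
Qed.

Lemma is_derive_shift g d (s t : R) : is_derive (t - s) 1 g d -> is_derive t 1 (fun t => g (t - s)) d.
Proof.
move=> hg; have h : is_derive t 1 (fun t : R => t - s) 1.
  have := @is_deriveB _ _ _ id (cst s) t 1 _ _ (is_derive_id _ _) (is_derive_cst _ _ _).
  by rewrite subr0.
by have := @is_derive1_comp _ g (fun t : R => t - s) t _ _ hg h; rewrite mulr1.
Qed.

Definition dlt {V : zmodType} (s : R) (g : R -> V) : R -> V := fun t => g t - g (t - s).

Lemma is_derive_dlt A s g g' : (forall t : R, is_derive t 1 g (g' t)) ->
  forall t : R, is_derive t 1 (iter A (dlt s) g) (iter A (dlt s) g' t).
Proof.
move=> h; elim: A => [|A IH] t /=; first exact: h.
by apply: is_deriveB; exact: is_derive_shift.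
Qed.

(** By the mean value theorem each difference of step s costs one derivative and gains s. The
    hypotheses keep all points t, t - s, ..., t - A s within [-2, 2]. *)
Lemma Sm_dlt A C s g : 0 <= s -> Sm A C g ->
  forall t, -2 <= t - A%:R * s -> t <= 2 -> `|iter A (dlt s) g t| <= C * s ^+ A.
Proof.
move=> s0; elim: A g => [|A IH] g hg t t1 t2 /=.
  by rewrite expr0 mulr1; apply: (Sm_bound hg); rewrite ler_norml t2 andbT; move: t1; rewrite mul0r; lra.
have [_ [g' [h1 h2]]] := hg.
rewrite /dlt exprSr mulrA.
apply: le_trans (mvt_le (K := C * s ^+ A) _ (is_derive_dlt A s h1) _) _; first by lra.
- move=> t' /andP[t3 t4]; apply: IH => //; last by lra.
  by move: t1; rewrite -(natr1 A) mulrDl mul1r; lra.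
- by have -> : t - (t - s) = s by ring.
Qed.

Lemma Sm_trig a C : 0 <= C -> exists2 K, 1 <= K & forall Phi Phi',
  (forall t : R, is_derive t 1 Phi (Phi' t)) -> Sm a C Phi' ->
  Sm a.+1 K (cos \o Phi) /\ Sm a.+1 K (sin \o Phi).
Proof.
move=> C0; elim: a => [|a [K K1 IH]].
  exists (1 + C); first by lra.
  move=> Phi Phi' h1 h2; have hb := Sm_bound h2; split; split.
  - by move=> t _ /=; apply: le_trans (_ : 1 <= _); [rewrite ler_norml cos_geN1 cos_le1|lra].
  - exists (fun t => - sin (Phi t) * Phi' t); split=> [t|]; first exact: is_derive1_comp.
    split=> // t ht; rewrite normrM normrN.
    have : `|sin (Phi t)| <= 1 by rewrite ler_norml sin_geN1 sin_le1.
    by move=> /ler_pM /(_ (hb t ht)) -/(_ (normr_ge0 _) (normr_ge0 _)); lra.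
  - by move=> t _ /=; apply: le_trans (_ : 1 <= _); [rewrite ler_norml sin_geN1 sin_le1|lra].
  - exists (fun t => cos (Phi t) * Phi' t); split=> [t|]; first exact: is_derive1_comp.
    split=> // t ht; rewrite normrM.
    have : `|cos (Phi t)| <= 1 by rewrite ler_norml cos_geN1 cos_le1.
    by move=> /ler_pM /(_ (hb t ht)) -/(_ (normr_ge0 _) (normr_ge0 _)); lra.
have e0 : 0 <= 2 ^+ a.+1 * (K * C) by rewrite mulr_ge0 ?exprn_ge0 ?mulr_ge0 //; lra.
exists (1 + 2 ^+ a.+1 * (K * C)); first by lra.
move=> Phi Phi' h1 h2; have [hc hs] := IH _ _ h1 (Sm_pred h2); split; split.
- by move=> t _ /=; apply: le_trans (_ : 1 <= _); [rewrite ler_norml cos_geN1 cos_le1|lra].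
- exists ((- (sin \o Phi)) * Phi'); split=> [t|]; first exact: is_derive1_comp.
  by apply: Sm_mono (SmM (SmN hs) h2); lra.
- by move=> t _ /=; apply: le_trans (_ : 1 <= _); [rewrite ler_norml sin_geN1 sin_le1|lra].
- exists ((cos \o Phi) * Phi'); split=> [t|]; first exact: is_derive1_comp.
  by apply: Sm_mono (SmM hc h2); lra.
Qed.

Lemma abs_sin_le (x : R) : `|sin x| <= `|x|.
Proof.
have H (y : R) : 0 <= y -> `|sin y| <= y.
  move=> y0; have := @mvt_le sin cos 0 y 1 y0 (fun t => is_derive_sin t).
  by rewrite sin0 !subr0 mul1r; apply=> t _; rewrite ler_norml cos_geN1 cos_le1.
have [x0|x0] := leP 0 x; first by rewrite (ger0_norm x0); exact: H.
by have := H (- x) ltac:(lra); rewrite sinN normrN (ltr0_norm x0).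
Qed.

Lemma abs_cosB1_le (x : R) : `|cos x - 1| <= `|x|.
Proof.
have H (y : R) : 0 <= y -> `|cos y - 1| <= y.
  move=> y0; have := @mvt_le cos (fun t => - sin t) 0 y 1 y0 (fun t => is_derive_cos t).
  by rewrite cos0 !subr0 mul1r; apply=> t _; rewrite normrN ler_norml sin_geN1 sin_le1.
have [x0|x0] := leP 0 x; first by rewrite (ger0_norm x0); exact: H.
by have := H (- x) ltac:(lra); rewrite cosN (ltr0_norm x0).
Qed.

(** For a small phase the bound is linear in c; this makes the increment in [amp2] small and not
    merely bounded. *)
Lemma Sm_trig_small a B : 0 <= B -> exists2 K, 1 <= K & forall c eta eta', 0 <= c <= B ->
  (forall t : R, is_derive t 1 eta (eta' t)) -> (forall t, `|t| <= 2 -> `|eta t| <= c) ->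
  Sm a c eta' -> Sm a.+1 (K * c) ((cos \o eta) - cst 1) /\ Sm a.+1 (K * c) (sin \o eta).
Proof.
move=> B0; have [K0 K1 hK] := Sm_trig a B0.
have e0 : 0 <= 2 ^+ a * K0 by rewrite mulr_ge0 ?exprn_ge0 //; lra.
exists (1 + 2 ^+ a * K0); first by lra.
move=> c eta eta' /andP[c0 cB] h1 hb h2.
have [hc hs] := hK _ _ h1 (Sm_mono cB h2).
have e1 : c <= (1 + 2 ^+ a * K0) * c by rewrite mulrDl mul1r lerDl mulr_ge0.
have e2 : 2 ^+ a * (K0 * c) <= (1 + 2 ^+ a * K0) * c.
  by rewrite mulrDl mul1r mulrA lerDr.
split; split.
- by move=> t ht; apply: le_trans (abs_cosB1_le _) _; apply: le_trans (hb t ht) _.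
- exists ((- (sin \o eta)) * eta'); split=> [t|].
    have := @is_deriveB _ _ _ _ (cst (1 : R)) t 1 _ _ (is_derive1_comp (is_derive_cos (eta t)) (h1 t)) (is_derive_cst _ _ _).
    by rewrite subr0.
  by apply: Sm_mono (SmM (SmN (Sm_pred hs)) h2).
- by move=> t ht; apply: le_trans (abs_sin_le _) _; apply: le_trans (hb t ht) _.
- exists ((cos \o eta) * eta'); split=> [t|]; first exact: is_derive1_comp.
  by apply: Sm_mono (SmM (Sm_pred hc) h2).
Qed.

(** Serves the kink of [ppart]: the square of the positive part satisfies a quadratic estimate at 0
    although the positive part is not differentiable there. *)
Lemma is_derive_quad g (d x K : R) :
  (forall y, `|g y - g x - d * (y - x)| <= K * (y - x) ^+ 2) -> is_derive x 1 g d.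
Proof.
move=> h.
have K0 : 0 <= K.
  have := h (x + 1); have -> : x + 1 - x = 1 by ring.
  by rewrite expr1n !mulr1; exact: le_trans (normr_ge0 _).
have cv : (fun t : R => t^-1 *: ((g \o shift x) (t *: (1 : R)) - g x)) @ (0 : R)^' --> d.
  apply/cvgrPdist_le => e e0.
  have hn : \forall t \near (0 : R)^', `|t| * K <= e.
    have K1 : 0 < K + 1 by lra.
    have ek : 0 < e / (K + 1) by rewrite divr_gt0.
    have := @dnbhs0_le R R _ ek; apply: filterS => t ht.
    apply: le_trans (_ : `|t| * (K + 1) <= _); first by rewrite ler_wpM2l //; lra.
    by rewrite -ler_pdivlMr.
  near=> t.
  have t0 : t != 0 by near: t; exact: nbhs_dnbhs_neq.
  have te : `|t| * K <= e by near: t.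
  rewrite /= /GRing.scale /= mulr1.
  have := h (t + x); rewrite addrK => {}h.
  rewrite -(ler_pM2l (_ : 0 < `|t|)) ?normr_gt0 // -normrM.
  have -> : t * (d - t^-1 * (g (t + x) - g x)) = - (g (t + x) - g x - d * t) by field.
  rewrite normrN; apply: le_trans h _.
  by rewrite -[t ^+ 2]real_normK ?num_real // expr2 mulrCA ler_wpM2l // mulrC.
apply: DeriveDef; first by apply/cvg_ex; exists d.
exact: cvg_lim cv.
Unshelve. all: by end_near.
Qed.

Definition ppart (x : R) : R := Num.max x 0.

Lemma ppart_ge0 x : 0 <= ppart x. Proof. by rewrite /ppart le_max lexx orbT. Qed.

Lemma mul_ppart x : x * ppart x = ppart x ^+ 2.
Proof. by rewrite /ppart; case: (leP x 0) => h; rewrite ?mulr0 ?expr0n ?expr2. Qed.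

Lemma is_derive_ppart m (x : R) :
  is_derive x (1 : R) (fun t => ppart t ^+ m.+2) (m.+2%:R * ppart x ^+ m.+1).
Proof.
elim: m => [|m IH].
  apply: (@is_derive_quad _ _ _ 1) => y; rewrite mul1r expr1.
  have [hx|hx] := leP x 0; have [hy|hy] := leP y 0; rewrite /ppart.
  - by rewrite !(max_r hx, max_r hy) expr0n mulr0 mul0r !subr0 normr0 sqr_ge0.
  - rewrite (max_r hx) (max_l (ltW hy)) expr0n mulr0 mul0r !subr0 ger0_norm ?sqr_ge0 //; nra.
  - rewrite (max_l (ltW hx)) (max_r hy) ler_norml expr0n /=; apply/andP; split; nra.
  - rewrite (max_l (ltW hx)) (max_l (ltW hy)).
    have -> : y ^+ 2 - x ^+ 2 - 2 * x * (y - x) = (y - x) ^+ 2 by ring.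
    by rewrite ger0_norm ?sqr_ge0.
have := @is_deriveM _ _ id (fun t => ppart t ^+ m.+2) x 1 _ _ (is_derive_id _ _) IH.
have -> : id * (fun t => ppart t ^+ m.+2) = (fun t => ppart t ^+ m.+3) :> (R -> R).
  apply/funext => t; by rewrite -[LHS]/(t * ppart t ^+ m.+2) [ppart t ^+ m.+2]exprS mulrA mul_ppart -exprD.
move=> /is_derive_eq; apply.
rewrite /= /GRing.scale /= mulr1 mulrCA exprS [x * _]mulrA mul_ppart -exprD.
have -> : m.+3%:R = m.+2%:R + 1 :> R by rewrite natr1.
by rewrite -[(2 + m)%N]/(m.+2); ring.
Qed.

(** A bump with finitely many derivatives. Its derivative is a linear function times the bump with
    the next smaller exponent, so that all bounds follow by induction in [Sm_rho]. *)
Definition rho0 (A : nat) (t : R) : R := ppart (1 - t ^+ 2) ^+ A.+1.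

Lemma rho0_out A t : 1 <= `|t| -> rho0 A t = 0.
Proof.
move=> h; rewrite /rho0 /ppart; have -> : Num.max (1 - t ^+ 2) 0 = 0.
  apply/max_idPr; rewrite subr_le0 -real_normK ?num_real // -(expr1n _ 2).
  by rewrite lerXn2r ?nnegrE.
by rewrite expr0n.
Qed.

Lemma rho0_ge0 A t : 0 <= rho0 A t.
Proof. by rewrite exprn_ge0 // ppart_ge0. Qed.

Lemma rho0_le1 A t : rho0 A t <= 1.
Proof.
rewrite exprn_ile1 ?ppart_ge0 // /ppart ge_max ler01 andbT.
by rewrite lerBlDr lerDl sqr_ge0.
Qed.

Lemma rho0_ge A t : `|t| <= 1 / 2 -> (3 / 4) ^+ A.+1 <= rho0 A t.
Proof.
move=> h; rewrite /rho0 lerXn2r ?nnegrE ?ppart_ge0 //.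
rewrite /ppart le_max; apply/orP; left.
have : t ^+ 2 <= (1 / 2) ^+ 2 by rewrite -real_normK ?num_real // lerXn2r // nnegrE; lra.
by rewrite expr2; lra.
Qed.

Lemma Sm_lin a (c : R) : Sm a (2 * `|c|) (fun t : R => c * t).
Proof.
case: a => [|a]; (split; [by move=> t ht; rewrite normrM mulrC ler_wpM2r|]) => //.
exists (cst c); split=> [t|]; last by apply: Sm_cst; rewrite mulrC ler_peMr //; lra.
have := @is_deriveZ _ _ _ id c t 1 _ (is_derive_id _ _).
by move=> /is_derive_eq; apply; rewrite /GRing.scale /= mulr1.
Qed.

Lemma Sm_rho a m : (a <= m)%N -> exists2 C, 1 <= C & Sm a C (rho0 m).
Proof.
elim: a m => [|a IH] m am.
  exists 1 => //; split=> // t _; rewrite ger0_norm ?rho0_ge0 //; exact: rho0_le1.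
case: m am => // m am; have [C C1 hC] := IH m am.
set c : R := - (2 * m.+2%:R).
have e0 : 0 <= 2 ^+ a * (2 * `|c| * C) by rewrite !mulr_ge0 ?exprn_ge0 //; lra.
exists (1 + 2 ^+ a * (2 * `|c| * C)); first by lra.
split=> [t _|].
  by rewrite ger0_norm ?rho0_ge0 //; have := rho0_le1 m.+1 t; lra.
exists ((fun t => c * t) * rho0 m); split=> [t|]; last first.
  by apply: Sm_mono (SmM (Sm_lin a c) hC); lra.
have h1 := @is_deriveB _ _ _ _ _ t 1 _ _ (is_derive_cst (1 : R) _ _)
  (@is_deriveX _ _ id 2 t 1 _ (is_derive_id _ _)).
have := @is_derive1_comp _ (fun t => ppart t ^+ m.+2) _ t _ _ (is_derive_ppart m _) h1.
have -> : (fun t => ppart t ^+ m.+2) \o (cst 1 - id ^+ 2) = rho0 m.+1.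
  by apply/funext => u; rewrite /rho0 /=.
move=> /is_derive_eq; apply.
rewrite /= /GRing.scale /= expr1 mulr1 sub0r /c /rho0 -[(_ * _) t]/(_ * _).
by ring.
Qed.

End Smooth.

(** * Decay of smooth exponential sums over Z^n *)

Section Oscillation.
Context {R : realType} {n : nat}.

Definition CSm A (C : R) (g : R -> R[i]) : Prop :=
  Sm A C (fun t => complex.Re (g t)) /\ Sm A C (fun t => complex.Im (g t)).

Definition upd (u : 'rV[R]_n) (i : 'I_n) (t : R) : 'rV[R]_n :=
  \row_j (if j == i then t else u 0 j).

Definition scl (E : nat) (a : 'rV[int]_n) : 'rV[R]_n := \row_j ((a 0 j)%:~R / E%:R).

Definition kern A (E : nat) (a : 'rV[int]_n) : R := \prod_j rho0 A (scl E a 0 j).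

Lemma kern_out A E a : (0 < E)%N -> kern A E a != 0 -> forall j, (`|a 0%R j| <= E)%N.
Proof.
move=> E0; apply: contra_neqP => /existsNP[j /negP]; rewrite -ltnNge => hj.
rewrite /kern (bigD1 j) //= rho0_out ?mul0r // mxE normrM [X in _ * X]ger0_norm ?invr_ge0 //.
rewrite ler_pdivlMr ?ltr0n // mul1r -intr_norm -[E%:R]/(E%:~R) ler_int; lia.
Qed.

(** Differences in direction i see only the restriction of [phi] to a line, so estimates for
    functions of one variable are enough. *)
Lemma iterDG_line A i (phi : 'rV[int]_n -> R[i]) (gam : R -> R[i]) (E : nat) a : 
  (forall t : int, phi (a + t *: ei i) = gam (((a 0 i + t)%:~R) / E%:R)) ->
  forall t : int, iter A (DG i) phi (a + t *: ei i) = iter A (dlt E%:R^-1) gam (((a 0 i + t)%:~R) / E%:R).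
Proof.
elim: A phi gam => [|A IH] phi gam h t; first exact: h.
rewrite !iterSr; apply: IH => t'; rewrite /DG /dlt h.
have -> : a + t' *: ei i - ei i = a + (t' - 1) *: ei i by rewrite scalerBl scale1r addrA.
by rewrite h !rmorphD /= rmorphN /= !mulrDl mulN1r addrA.
Qed.

Lemma Re_dlt A s (gam : R -> R[i]) t :
  complex.Re (iter A (dlt s) gam t) = iter A (dlt s) (fun t => complex.Re (gam t)) t.
Proof.
elim: A gam t => [|A IH] gam t //; rewrite !iterSr IH; congr (iter _ _ _ _).
by apply/funext => u; rewrite /dlt raddfB.
Qed.

Lemma Im_dlt A s (gam : R -> R[i]) t :
  complex.Im (iter A (dlt s) gam t) = iter A (dlt s) (fun t => complex.Im (gam t)) t.
Proof.
elim: A gam t => [|A IH] gam t //; rewrite !iterSr IH; congr (iter _ _ _ _).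
by apply/funext => u; rewrite /dlt raddfB.
Qed.

Lemma CSm_dlt A C s g : 0 <= s -> CSm A C g ->
  forall t, -2 <= t - A%:R * s -> t <= 2 -> nrm (iter A (dlt s) g t) <= 2 * C * s ^+ A.
Proof.
move=> s0 [h1 h2] t t1 t2; apply: le_trans (nrm_le_ReIm _) _.
rewrite Re_dlt Im_dlt; have := Sm_dlt s0 h1 t1 t2; have := Sm_dlt s0 h2 t1 t2; lra.
Qed.

Lemma CSm_scale A C C' (k : R -> R) g : Sm A C' k -> CSm A C g ->
  CSm A (2 ^+ A * (C' * C)) (fun t => (k t)%:C%C * g t).
Proof.
move=> hk [h1 h2]; split.
  have -> : (fun t => complex.Re ((k t)%:C%C * g t)) = k * (fun t => complex.Re (g t)).
    apply/funext => t; rewrite -[RHS]/(k t * complex.Re (g t)); by case: (g t) => ? ? /=; rewrite mul0r subr0.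
  exact: SmM.
have -> : (fun t => complex.Im ((k t)%:C%C * g t)) = k * (fun t => complex.Im (g t)).
  apply/funext => t; rewrite -[RHS]/(k t * complex.Im (g t)).
  by case: (g t) => ? ? /=; rewrite mul0r addr0.
exact: SmM.
Qed.

Lemma pow1D_le A (x : R) : 0 <= x -> (1 + x) ^+ A <= 2 ^+ A * (1 + x ^+ A).
Proof.
move=> x0; have [x1|x1] := leP x 1.
  apply: (@le_trans _ _ (2 ^+ A)); first by rewrite lerXn2r ?nnegrE; lra.
  by rewrite ler_peMr ?exprn_ge0 // lerDl exprn_ge0.
apply: (@le_trans _ _ ((2 * x) ^+ A)); first by rewrite lerXn2r ?nnegrE; lra.
by rewrite exprMn ler_wpM2l ?exprn_ge0 // lerDr.
Qed.

(** Summation by parts A times in the single coordinate i: each difference of step 1/E gains 1/E,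
    and each division by 1 - e(th i) costs the inverse of [dist_int]. The bound holds for every i
    separately, hence with the largest component of the phase. *)
Lemma osc A : exists2 K, 0 <= K & forall (E : nat) (B : R) (g : 'rV[R]_n -> R[i]) (th : 'I_n -> R),
  (0 < E)%N -> (A <= E)%N ->
  (forall (u : 'rV[R]_n) (i : 'I_n), (forall j, j != i -> `|u 0 j| <= 1) -> CSm A B (fun t => g (upd u i t))) ->
  forall i, nrm (zs (tw th (fun a => (kern A E a)%:C%C * g (scl E a)))) * (1 + E%:R * dist_int (th i)) ^+ A
    <= K * B * E%:R ^+ n.
Proof.
have [C C1 hC] := @Sm_rho R A A (leqnn A).
pose K1 := 2 * (2 ^+ A * C).
have K10 : 0 <= K1 by rewrite /K1 !mulr_ge0 ?exprn_ge0 //; lra.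
exists (2 ^+ A * (5 ^+ n * (1 + 2 * K1))); first by rewrite !mulr_ge0 ?exprn_ge0 //; lra.
move=> E B g th E0 AE hg i.
set phi := fun a => _.
have ER : 0 < E%:R :> R by rewrite ltr0n.
have bphi : bnd E phi.
  move=> a; rewrite /phi => h; apply: (@kern_out A) => //.
  by apply: contra_neq h => ->; rewrite mul0r.
have scl_upd a t : scl E (a + t *: ei i) = upd (scl E a) i ((a 0 i + t)%:~R / E%:R).
  apply/rowP => j; rewrite !mxE eqxx /=; case: eqP => [->|_]; first by rewrite mulr1.
  by rewrite mulr0 addr0.
have small a : (exists2 j, j != i & 1 < `|scl E a 0 j|) -> forall t : int, phi (a + t *: ei i) = 0.
  move=> [j ji hj] t; rewrite /phi /kern (bigD1 j) //= scl_upd mxE (negbTE ji) rho0_out ?mul0r //.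
  exact: ltW.
have B0 : 0 <= B.
  have [+ _] := hg 0 i (fun j _ => ltac:(by rewrite mxE normr0)).
  exact: Sm_ge0.
have line a : (forall j, j != i -> `|scl E a 0 j| <= 1) -> exists2 gam, CSm A (2 ^+ A * (C * B)) gam &
   forall t : int, phi (a + t *: ei i) = gam ((a 0 i + t)%:~R / E%:R).
  move=> ha; pose c : R := \prod_(j | j != i) rho0 A (scl E a 0 j).
  have c1 : 0 <= c <= 1.
    apply/andP; split; first by apply: prodr_ge0 => j _; exact: rho0_ge0.
    by apply: prodr_ile1 => j _; rewrite rho0_ge0 rho0_le1.
  exists (fun t => (rho0 A t)%:C%C * (c%:C%C * g (upd (scl E a) i t))).
    apply: CSm_scale => //; have [h1 h2] := hg (scl E a) i ha.
    have Hc (k : R -> R) : Sm A B k -> Sm A B (fun t => c * k t).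
      elim: (A) k => [|A' IH] k [kb kd]; split=> //.
      - move=> t /kb h; rewrite normrM ger0_norm; last by case/andP: c1.
        by apply: le_trans h; rewrite ler_piMl //; case/andP: c1.
      - move=> t /kb h; rewrite normrM ger0_norm; last by case/andP: c1.
        by apply: le_trans h; rewrite ler_piMl //; case/andP: c1.
      have [k' [h3 h4]] := kd; exists (fun t => c * k' t); split=> [t|]; last exact: IH.
      exact: (@is_deriveZ _ _ _ k c t 1 _ (h3 t)).
    split.
      have -> : (fun t => complex.Re (c%:C%C * g (upd (scl E a) i t))) = fun t => c * complex.Re (g (upd (scl E a) i t)).
        by apply/funext => t; case: (g _) => ? ? /=; rewrite mul0r subr0.
      exact: Hc.
    have -> : (fun t => complex.Im (c%:C%C * g (upd (scl E a) i t))) = fun t => c * complex.Im (g (upd (scl E a) i t)).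
      by apply/funext => t; case: (g _) => ? ? /=; rewrite mul0r addr0.
    exact: Hc.
  move=> t; rewrite /phi scl_upd /kern scl_upd (bigD1 i) //= mxE eqxx rmorphM /= mulrA.
  congr (_ * _ * _); congr (_ %:C)%C; apply: eq_bigr => j ji.
  by rewrite mxE (negbTE ji).
have a0E a : a = a + 0 *: ei i by rewrite scale0r addr0.
have bd0 a : nrm (phi a) <= K1 * B.
  have [/forallP ha|] := boolP [forall j, (j != i) ==> (`|scl E a 0 j| <= 1)].
    have [|gam hgam hl] := line a; first by move=> j ji; exact: (implyP (ha j)).
    have [->|/bphi/(_ i) hai] := eqVneq (phi a) 0; first by rewrite nrm0 mulr_ge0.
    rewrite [a in phi a]a0E hl addr0.
    have ht : `|(a 0 i)%:~R / E%:R : R| <= 1.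
      rewrite normrM [X in _ * X]ger0_norm ?invr_ge0 // ler_pdivrMr // mul1r.
      by rewrite -intr_norm -[E%:R]/(E%:~R) ler_int; lia.
    have [h1 h2] := hgam; apply: le_trans (nrm_le_ReIm _) _.
    have := Sm_bound h1 (le_trans ht (ltac:(lra) : (1 : R) <= 2)).
    by have := Sm_bound h2 (le_trans ht (ltac:(lra) : (1 : R) <= 2)); rewrite /K1; lra.
  move=> /forallPn[j]; rewrite negb_imply -ltNge => /andP[ji hj].
  by have := small a (ex_intro2 _ _ j ji hj) 0; rewrite -a0E => ->; rewrite nrm0 mulr_ge0.
have bdA a : nrm (iter A (DG i) phi a) <= K1 * B * E%:R^-1 ^+ A.
  have r0 : 0 <= K1 * B * E%:R^-1 ^+ A by apply: mulr_ge0; [exact: mulr_ge0|rewrite exprn_ge0 ?invr_ge0].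
  have [/forallP ha|] := boolP [forall j, (j != i) ==> (`|scl E a 0 j| <= 1)].
    have [|gam hgam hl] := line a; first by move=> j ji; exact: (implyP (ha j)).
    have [->|/(bnd_iterDG bphi)/(_ i) hai] := eqVneq (iter A (DG i) phi a) 0; first by rewrite nrm0.
    (* Backward differences extend the support upwards only, so the result still vanishes below -E.
       This confines the points seen by [CSm_dlt] to [-2, 2]. *)
    have [hge|hlt] := boolP (a 0 i < - E%:Z).
      have -> : iter A (DG i) phi a = 0; last by rewrite nrm0.
      suff H m (psi : 'rV[int]_n -> R[i]) : (forall b : 'rV[int]_n, b 0 i < - E%:Z -> psi b = 0) ->
         forall b : 'rV[int]_n, b 0 i < - E%:Z -> iter m (DG i) psi b = 0.
        apply: H hge => b hb; apply/eqP/negPn/negP => /bphi /(_ i); lia.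
      elim: m psi => [|m IH] psi h b hb; first exact: h.
      rewrite iterSr; apply: IH => // b' hb'; rewrite /DG !h ?subrr // !mxE !eqxx /=; lia.
    rewrite [a in iter _ _ _ a]a0E (iterDG_line A hl) addr0.
    have -> : K1 * B = 2 * (2 ^+ A * (C * B)) by rewrite /K1; ring.
    have E1 : (A%:R <= E%:R :> R) by rewrite ler_nat.
    have a1 : - E%:R <= (a 0 i)%:~R :> R.
      by rewrite -[E%:R]/(E%:~R) -rmorphN /= ler_int; lia.
    have a2 : (a 0 i)%:~R <= E%:R + A%:R :> R.
      by rewrite -natrD -[(_ + _)%:R]/((_ + _)%N%:~R) ler_int; lia.
    apply: CSm_dlt => //.
      by rewrite -mulrBl ler_pdivlMr //; lra.
    by rewrite ler_pdivrMr //; lra.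
  move=> /forallPn[j]; rewrite negb_imply -ltNge => /andP[ji hj].
  rewrite [a in iter _ _ _ a]a0E (@iterDG_line A i phi (fun=> 0) E a).
    have -> : iter A (dlt E%:R^-1) (fun=> 0) = (fun=> 0) :> (R -> R[i]); last by rewrite nrm0.
    by elim: (A) => // m IH; rewrite iterS IH; apply/funext => t; rewrite /dlt subrr.
  by move=> t; apply: small; exists j.
have n1 : nrm (zs (tw th phi)) <= (5 * E%:R) ^+ n * (K1 * B).
  apply: le_trans (nrm_zs (@bnd_tw _ _ E th _ bphi) _) _; first by move=> a; rewrite nrm_tw.
  apply: ler_wpM2r; first exact: mulr_ge0.
  rewrite lerXn2r ?nnegrE ?mulr_ge0 //.
  by rewrite -natrM ler_nat; lia.
have n2 : nrm (zs (tw th phi)) * (E%:R * dist_int (th i)) ^+ A <= (5 * E%:R) ^+ n * (K1 * B).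
  have h1 : nrm ((1 - cis (th i)) ^+ A * zs (tw th phi)) <= (5 * E%:R) ^+ n * (K1 * B * E%:R^-1 ^+ A).
    rewrite (@zs_sbp_iter _ _ A E th i phi bphi).
    apply: le_trans (nrm_zs (@bnd_tw _ _ _ th _ (@bnd_iterDG _ _ _ A i _ bphi)) _) _; first by move=> a; rewrite nrm_tw.
    apply: ler_wpM2r; first by apply: mulr_ge0; [exact: mulr_ge0|rewrite exprn_ge0 ?invr_ge0].
    rewrite lerXn2r ?nnegrE ?mulr_ge0 //.
    by rewrite -natrM ler_nat; lia.
  have EA : 0 < E%:R ^+ A :> R by rewrite exprn_gt0.
  rewrite exprMn mulrCA -(ler_pM2l (_ : 0 < E%:R^-1 ^+ A)) ?exprn_gt0 ?invr_gt0 //.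
  rewrite [leLHS]mulrA -[X in X * _]exprMn mulVf ?gt_eqF // expr1n mul1r.
  rewrite [leRHS]mulrCA [E%:R^-1 ^+ A * _]mulrC; apply: le_trans h1.
  rewrite nrmM nrmX mulrC ler_wpM2r ?nrm_ge0 // lerXn2r ?nnegrE ?dist_int_ge0 ?nrm_ge0 //.
  by have := nrm_1Bcis_ge (th i); have := dist_int_ge0 (th i); lra.
apply: (@le_trans _ _ (2 ^+ A * (nrm (zs (tw th phi)) * (1 + (E%:R * dist_int (th i)) ^+ A)))).
  rewrite [leRHS]mulrCA ler_wpM2l ?nrm_ge0 //; apply: pow1D_le.
  by rewrite mulr_ge0 ?dist_int_ge0.
rewrite mulrDr mulr1 -!mulrA ler_wpM2l ?exprn_ge0 //.
apply: le_trans (lerD n1 n2) _; rewrite exprMn.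
have := K10; move: (K1) => k k0.
have e1 : 0 <= 5 ^+ n * E%:R ^+ n * B.
  by apply: mulr_ge0 => //; apply: mulr_ge0; exact: exprn_ge0.
suff : 2 * (k * (5 ^+ n * E%:R ^+ n * B)) <= (1 + 2 * k) * (5 ^+ n * E%:R ^+ n * B) by lra.
by rewrite mulrA ler_wpM2r //; lra.
Qed.

End Oscillation.

(** * Trigonometric approximation of an interval modulo 1 *)

Section Trig.
Context {R : realType}.
Implicit Types (x d : R) (m N : nat).

Definition fr N (j : 'I_(2 * N).+1) : int := j%:Z - N%:Z.
Arguments fr : clear implicits.

Lemma nrm1 : nrm (1 : R[i]) = 1.
Proof. by rewrite -(@cis0 R) nrm_cis. Qed.

Lemma fr_inj N : injective (fr N).
Proof. by move=> i j; rewrite /fr => /addIr [] h; exact: val_inj. Qed.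

Lemma fr_abs N j : `|(fr N j)%:~R| <= N%:R :> R.
Proof.
rewrite -intr_norm -[N%:R]/(N%:~R) ler_int /fr.
by have := ltn_ord j; lia.
Qed.

Lemma tp_collect N (V : finType) (phi : V -> int) (c : V -> R[i]) x :
  (forall v, `|phi v| <= N)%N ->
  \sum_v c v * cis ((phi v)%:~R * x) =
  \sum_(j < (2 * N).+1) (\sum_(v | phi v == fr N j) c v) * cis ((fr N j)%:~R * x).
Proof.
move=> h.
have hb v : (`|(phi v + N%:Z)%R| < (2 * N).+1)%N by have := h v; lia.
pose p v : 'I_(2 * N).+1 := Ordinal (hb v).
have hp v j : (phi v == fr N j) = (p v == j).
  apply/eqP/eqP => [e|<-]; last by rewrite /fr /p /=; have := h v; lia.
  by apply: val_inj; rewrite /= e /fr; lia.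
rewrite (partition_big p predT) //=; apply: eq_bigr => j _.
rewrite big_distrl /= (eq_bigl (fun v => phi v == fr N j)) => [|v]; last by rewrite hp.
by apply: eq_bigr => v /eqP ->.
Qed.

(** Sampling at M equidistant points is exact for frequencies below M: only frequency 0 survives. *)
Lemma sample_sum (M : nat) (V : finType) (phi : V -> int) x : (0 < M)%N ->
  (forall v, `|phi v| < M)%N ->
  \sum_(p < M) \sum_v cis ((phi v)%:~R * (x - p%:R / M%:R)) = (M * #|[pred v | phi v == 0]|)%:R.
Proof.
move=> M0 h; rewrite exchange_big /=.
have e v : \sum_(p < M) cis ((phi v)%:~R * (x - p%:R / M%:R)) = if phi v == 0 then M%:R else 0.
  under eq_bigr => p _ do rewrite mulrBr cisD.
  rewrite -mulr_sumr.
  under eq_bigr => p _ do rewrite mulrA -mulNr -mulNr -rmorphN.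
  rewrite cis_orth //.
  case: eqP => [->|/eqP ne]; first by rewrite oppr0 dvdz0 mul0r cis0 mul1r.
  rewrite (_ : (_ %| _)%Z = false) ?mulr0 //; apply/negbTE/negP => /dvdzP[q e].
  have := h v; rewrite -abszN e abszM absz_nat => {}h; have q0 : q = 0.
    by apply/eqP; rewrite -absz_eq0; nia.
  by move: ne; rewrite -oppr_eq0 e q0 mul0r eqxx.
rewrite (eq_bigr _ (fun v _ => e v)) -big_mkcond /= sumr_const natrM mulr_natr.
by congr (_ *+ _); apply: eq_card => v.
Qed.

(** The Fejer kernel, normalised to have the value 1 at 0. *)
Definition fe m x : R := nrm (\sum_(t < m) cis (t%:R * x)) ^+ 2 / m%:R ^+ 2.

Lemma fe_ge0 m x : 0 <= fe m x.
Proof. by rewrite /fe divr_ge0 ?exprn_ge0 ?nrm_ge0. Qed.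

Lemma fe_geom m x : (0 < m)%N ->
  fe m x * (m%:R ^+ 2 * nrm (1 - cis x) ^+ 2) = nrm (1 - cis (m%:R * x)) ^+ 2.
Proof.
move=> m0; rewrite -geom_cis nrmM exprMn /fe mulrACA.
have m1 : m%:R != 0 :> R by rewrite pnatr_eq0 -lt0n.
by field.
Qed.

Lemma fe_decay m x : (0 < m)%N -> fe m x * (m%:R * dist_int x) ^+ 2 <= 1.
Proof.
move=> m0; have := fe_geom x m0.
have h1 := nrm_1Bcis_ge x; have d0 := dist_int_ge0 x; have f0 := fe_ge0 m x.
have h2 : nrm (1 - cis (m%:R * x)) <= 2.
  by apply: le_trans (nrmD _ _) _; rewrite nrmN nrm_cis nrm1; lra.
have h3 : nrm (1 - cis (m%:R * x)) ^+ 2 <= 4.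
  by have := nrm_ge0 (1 - cis (m%:R * x)); nra.
have h4 : (2 * dist_int x) ^+ 2 <= nrm (1 - cis x) ^+ 2.
  by rewrite lerXn2r ?nnegrE ?nrm_ge0 ?mulr_ge0.
have m1 : 0 <= m%:R ^+ 2 :> R by rewrite exprn_ge0.
have := ler_wpM2l f0 (ler_wpM2l m1 h4); rewrite !exprMn; lra.
Qed.

(** The Fejer kernel has zeros at multiples of 1/m. A shift by 1/(2m) moves m x by 1/2, so the two
    numerators add up to 4, and the pair has a lower bound that matches the decay in [fe_decay]. *)
Lemma fe_pair m x : (0 < m)%N ->
  1 <= 16 * (fe m x + fe m (x + (2 * m%:R)^-1)) * (m%:R * dist_int x + 1 / 2) ^+ 2.
Proof.
move=> m0; have m1 : 0 < m%:R :> R by rewrite ltr0n.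
set h := (2 * m%:R)^-1; have h0 : 0 < h by rewrite invr_gt0; lra.
have mh : m%:R * h = 1 / 2 by rewrite /h; field; rewrite gt_eqF.
set s := dist_int x + h; have d0 := dist_int_ge0 x.
have s1 : nrm (1 - cis x) <= 8 * s by have := nrm_1Bcis_le x; rewrite /s; lra.
have s2 : nrm (1 - cis (x + h)) <= 8 * s.
  apply: le_trans (nrm_1Bcis_le _) _; have := dist_intD x h.
  by rewrite (gtr0_norm h0) /s; lra.
have g1 := fe_geom x m0; have g2 := fe_geom (x + h) m0.
have par : nrm (1 - cis (m%:R * x)) ^+ 2 + nrm (1 - cis (m%:R * (x + h))) ^+ 2 = 4.
  have -> : m%:R * (x + h) = m%:R * x + 1 / 2 by rewrite mulrDr mh.
  rewrite cisD !sqr_nrm /=.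
  have -> : 2 * pi * (1 / 2) = pi :> R by lra.
  rewrite cospi sinpi; have := cos2Dsin2 (2 * pi * (m%:R * x)); lra.
have -> : m%:R * dist_int x + 1 / 2 = m%:R * s by rewrite /s mulrDr mh.
have q1 : nrm (1 - cis x) ^+ 2 <= 64 * s ^+ 2.
  by have := nrm_ge0 (1 - cis x); nra.
have q2 : nrm (1 - cis (x + h)) ^+ 2 <= 64 * s ^+ 2.
  by have := nrm_ge0 (1 - cis (x + h)); nra.
have m2 : 0 <= m%:R ^+ 2 :> R by rewrite exprn_ge0.
have := ler_wpM2l (fe_ge0 m x) (ler_wpM2l m2 q1).
have := ler_wpM2l (fe_ge0 m (x + h)) (ler_wpM2l m2 q2).
by rewrite g1 g2 exprMn; lra.
Qed.

Lemma fe_expand m x :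
  (fe m x)%:C%C = \sum_(v : 'I_m * 'I_m) ((m%:R ^+ 2)^-1)%:C%C * cis ((v.1%:Z - v.2%:Z)%:~R * x).
Proof.
rewrite /fe rmorphM /= sqr_nrmC -mulr_sumr mulrC; congr (_ * _).
have -> : ((\sum_(t < m) cis (t%:R * x))^* = \sum_(t < m) cis (- (t%:R * x)))%C.
  by rewrite rmorph_sum; apply: eq_bigr => t _; rewrite cisN.
rewrite big_distrlr /= pair_big /=; apply: eq_bigr => v _.
by rewrite -cisD rmorphB /= mulrBl.
Qed.

Lemma fe2_expand m x : (fe m x ^+ 2)%:C%C =
  \sum_(v : ('I_m * 'I_m) * ('I_m * 'I_m)) ((m%:R ^+ 4)^-1)%:C%C *
     cis ((v.1.1%:Z - v.1.2%:Z + (v.2.1%:Z - v.2.2%:Z))%:~R * x).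
Proof.
rewrite rmorphXn /= fe_expand expr2 big_distrlr /= pair_big /=; apply: eq_bigr => v _.
rewrite mulrACA -rmorphM /= -cisD -mulrDl -rmorphD /=; congr (_%:C%C * _).
by rewrite -invfM -exprD.
Qed.

Section Fejer2.
Variables (m : nat) (d : R).
Hypotheses (m0 : (0 < m)%N) (hd : 0 <= d <= 1 / 2).
Let N := (2 * m)%N.
Let M := (2 * N).+1.
Let P0 := Num.truncn (d * M%:R).
Let V4 : finType := (('I_m * 'I_m) * ('I_m * 'I_m))%type.
Let ph4 (v : V4) : int := v.1.1%:Z - v.1.2%:Z + (v.2.1%:Z - v.2.2%:Z).
Let ph2 (v : 'I_m * 'I_m) : int := v.1%:Z - v.2%:Z.

Let mR : 0 < m%:R :> R. Proof. by rewrite ltr0n. Qed.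
Let MR : M%:R = 4 * m%:R + 1 :> R.
Proof. by rewrite /M /N -natr1 !natrM; ring. Qed.
Let m1R : 1 <= m%:R :> R. Proof. by rewrite ler1n. Qed.

Let ph4_lt v : (`|ph4 v| <= N)%N.
Proof.
case: v => [[a b] [c e]]; rewrite /ph4 /N /=.
by have := ltn_ord a; have := ltn_ord b; have := ltn_ord c; have := ltn_ord e; lia.
Qed.

Let ph2_lt v : (`|ph2 v| <= N)%N.
Proof.
case: v => [a b]; rewrite /ph2 /N /=.
by have := ltn_ord a; have := ltn_ord b; lia.
Qed.

Definition fZ : R := \sum_(p < M) fe m (0 - p%:R / M%:R) ^+ 2.

Lemma sample_fe2 x : \sum_(p < M) fe m (x - p%:R / M%:R) ^+ 2 = fZ.
Proof.
have E y : (\sum_(p < M) fe m (y - p%:R / M%:R) ^+ 2)%:C%C =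
   ((m%:R ^+ 4)^-1)%:C%C * ((M * #|[pred v | ph4 v == 0]|)%:R : R[i]).
  rewrite rmorph_sum /= -(sample_sum (M := M) y) => [||v] //; last by have := ph4_lt v; lia.
  rewrite mulr_sumr; apply: eq_bigr => p _.
  by rewrite fe2_expand mulr_sumr; apply: eq_bigr => v _.
by apply: nrm_inj; rewrite /fZ !E.
Qed.

Lemma sample_fe x : \sum_(p < M) fe m (x - p%:R / M%:R) = M%:R / m%:R.
Proof.
apply: nrm_inj; rewrite rmorph_sum /=.
rewrite (eq_bigr _ (fun p _ => fe_expand _ _)).
have -> : (M%:R / m%:R : R)%:C%C = ((m%:R ^+ 2)^-1)%:C%C * ((M * m)%:R : R[i]).
  rewrite -[(M * m)%:R](rmorph_nat (real_complex R)) -rmorphM /=; congr (_%:C)%C.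
  by rewrite natrM; field; rewrite gt_eqF.
have cm : #|[pred v | ph2 v == 0]| = m.
  have -> : #|[pred v | ph2 v == 0]| = #|[set (a, a) | a : 'I_m]|.
    apply: eq_card => -[a b]; rewrite inE /ph2 /= subr_eq0 eqz_nat.
    apply/eqP/imsetP => [e|[c _ [-> ->]]] //.
    by exists a => //; congr pair; apply: val_inj; rewrite /= e.
  by rewrite card_imset ?card_ord // => a b [].
rewrite -[X in (M * X)%N]cm -(sample_sum (M := M) x) => [||v] //; last by have := ph2_lt v; lia.
rewrite mulr_sumr; apply: eq_bigr => p _.
by rewrite mulr_sumr; apply: eq_bigr => v _.
Qed.

Lemma fZ_ge1 : 1 <= fZ.
Proof.
rewrite /fZ big_ord_recl /= mul0r subr0.
have -> : fe m 0 = 1.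
  rewrite /fe (eq_bigr (fun=> 1)) => [|i _]; last by rewrite mulr0 cis0.
  rewrite sumr_const card_ord -(rmorph_nat (real_complex R)) nrm_real ger0_norm //.
  by rewrite divff // expf_eq0 /= gt_eqF.
by rewrite expr1n lerDl; apply: sumr_ge0 => i _; exact: exprn_ge0 (fe_ge0 _ _).
Qed.

Let P0le : P0%:R <= d * M%:R.
Proof. by rewrite truncn_le // mulr_ge0 //; case/andP: hd. Qed.

Let P0gt : d * M%:R < P0%:R + 1.
Proof. by have := truncnS_gt (d * M%:R); rewrite natr1. Qed.

Lemma P0M : (2 * P0 < M)%N.
Proof.
have [d0 d1] := andP hd.
have : 2 * P0%:R <= M%:R :> R.
  by apply: le_trans (ler_wpM2l _ P0le) _ => //; have : 0 <= M%:R :> R by []; nra.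
by rewrite -natrM ler_nat /M; lia.
Qed.

(* sampled at the p with |p| <= P0 modulo M *)
Definition insamp (p : 'I_M) := (p <= P0)%N || (M <= p + P0)%N.

(** A discrete convolution of the squared Fejer kernel with the interval, over the multiples of 1/M.
    Since M = 4m + 1 exceeds the degree, the sum over all samples is the constant [fZ], and the
    quotient lies in [0, 1]. *)
Definition tT x : R := (\sum_(p < M | insamp p) fe m (x - p%:R / M%:R) ^+ 2) / fZ.

(** A majorant of the error, concentrated at the two endpoints of the interval. The pairs bridge the
    zeros of the kernel, and the coefficients are O(1/m), as for a Selberg majorant. *)
Definition tE x : R := 256 * (fe m (x - d) + fe m (x - d + (2 * m%:R)^-1)
  + (fe m (x + d) + fe m (x + d + (2 * m%:R)^-1))).

Lemma tT_ge0 x : 0 <= tT x.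
Proof.
apply: divr_ge0; last by have := fZ_ge1; lra.
by apply: sumr_ge0 => p _; exact: exprn_ge0 (fe_ge0 _ _).
Qed.

Lemma tT_compl x : 1 - tT x = (\sum_(p < M | ~~ insamp p) fe m (x - p%:R / M%:R) ^+ 2) / fZ.
Proof.
have z := fZ_ge1; have zn : fZ != 0 by rewrite gt_eqF //; lra.
apply: (mulIf zn); rewrite mulrBl mul1r !divfK // -(sample_fe2 x).
by apply/eqP; rewrite subr_eq [X in X == _](bigID insamp) /= addrC.
Qed.

Lemma tT_le1 x : tT x <= 1.
Proof.
rewrite -subr_ge0 tT_compl; apply: divr_ge0; last by have := fZ_ge1; lra.
by apply: sumr_ge0 => p _; exact: exprn_ge0 (fe_ge0 _ _).
Qed.

Lemma tE_ge0 x : 0 <= tE x.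
Proof.
have f0 y := fe_ge0 m y; apply: mulr_ge0; first exact: ler0n.
by apply: addr_ge0; apply: addr_ge0.
Qed.

Lemma tE_ge x s : (s = x - d \/ s = x + d) ->
  256 * (fe m s + fe m (s + (2 * m%:R)^-1)) <= tE x.
Proof.
have f0 y := fe_ge0 m y; rewrite /tE.
move=> [->|->]; apply: (ler_wpM2l (ler0n _ _)); first by rewrite lerDl; apply: addr_ge0.
by rewrite lerDr; apply: addr_ge0.
Qed.

(** One factor of the squared kernel supplies the decay; the other is summed over all samples, which
    gives M/m <= 5. *)
Lemma tail_bound x (P : pred 'I_M) y :
  (forall p, P p -> dist_int y <= dist_int (x - p%:R / M%:R)) ->
  (\sum_(p < M | P p) fe m (x - p%:R / M%:R) ^+ 2) / fZ * (m%:R * dist_int y) ^+ 2 <= 5.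
Proof.
move=> h; have z := fZ_ge1; have zp : 0 < fZ by lra.
rewrite mulrAC ler_pdivrMr // mulr_suml.
apply: (@le_trans _ _ (\sum_(p < M) fe m (x - p%:R / M%:R))).
  rewrite [leRHS](bigID P) /= ler_wpDr ?sumr_ge0 // => [p _|]; first exact: fe_ge0.
  apply: ler_sum => p /h hp; rewrite expr2 -mulrA ler_piMr ?fe_ge0 //.
  apply: le_trans (fe_decay (x - p%:R / M%:R) m0); rewrite ler_wpM2l ?fe_ge0 //.
  rewrite lerXn2r ?nnegrE ?mulr_ge0 ?dist_int_ge0 // ler_wpM2l //.
rewrite sample_fe ler_pdivrMr // MR; have m1 := m1R.
have : m%:R * 1 <= m%:R * fZ by rewrite ler_pM2l.
by lra.
Qed.

Lemma edge_bound x (A : R) y : 0 <= A <= 1 -> (y = x - d \/ y = x + d) ->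
  A * (m%:R * dist_int y) ^+ 2 <= 5 -> A <= tE x.
Proof.
move=> /andP[A0 A1] hy hA; apply: le_trans (tE_ge hy).
have := fe_pair y m0; have d0 := dist_int_ge0 y.
set f := fe m y + _; have f0 : 0 <= f by rewrite /f addr_ge0 ?fe_ge0.
set s := m%:R * dist_int y in hA *; have s0 : 0 <= s by rewrite mulr_ge0.
move=> hf; have h1 : A * (s + 1 / 2) ^+ 2 <= 11.
  have : A * (s + 1 / 2) ^+ 2 <= A * (2 * s ^+ 2 + 1 / 2).
    by rewrite ler_wpM2l //; have := sqr_ge0 (s - 1 / 2); nra.
  by lra.
have s2 : 0 < (s + 1 / 2) ^+ 2 by apply: exprn_gt0; lra.
rewrite -(ler_pM2r s2); lra.
Qed.

Lemma tT_tE x : `|(dist_int x <= d)%R%:R - tT x| <= tE x.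
Proof.
have [d0 d1] := andP hd; have [k [dk dk1]] := dist_intP x; have m1 := m1R.
set z := x - k%:~R; have zx : x = z + k%:~R by rewrite /z subrK.
have MM : 0 < M%:R :> R by rewrite MR; lra.
have dz (p : 'I_M) : dist_int (x - p%:R / M%:R) = dist_int (z - p%:R / M%:R).
  by rewrite zx addrAC dist_intDint.
have dzd s : dist_int (x + s) = dist_int (z + s) by rewrite zx addrAC dist_intDint.
have pM (p : 'I_M) : p%:R + 1 <= M%:R :> R by rewrite natr1 ler_nat.
have [hx|hx] := leP (dist_int x) d.
  rewrite ger0_norm ?subr_ge0 ?tT_le1 // tT_compl.
  have zd : - d <= z <= d by rewrite -ler_norml -dk.
  suff [y hy hb] : exists2 y, (y = x - d \/ y = x + d) &
      forall p : 'I_M, ~~ insamp p -> dist_int y <= dist_int (x - p%:R / M%:R).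
    apply: (edge_bound _ hy); last exact: tail_bound.
    by rewrite -tT_compl; have := tT_ge0 x; have := tT_le1 x; lra.
  (* Seen from x, a sample outside the interval lies beyond one of the endpoints and is at least as
     far away as that endpoint. The nearer endpoint then serves for all samples. *)
  have H (p : 'I_M) : ~~ insamp p -> dist_int (x - d) <= dist_int (x - p%:R / M%:R) \/
      dist_int (x + d) <= dist_int (x - p%:R / M%:R).
    rewrite negb_or -!ltnNge => /andP[p1 p2].
    have q1 : d < p%:R / M%:R.
      rewrite ltr_pdivlMr //; apply: lt_le_trans P0gt _; rewrite natr1 ler_nat //.
    have q2 : p%:R / M%:R < 1 - d.
      rewrite ltr_pdivrMr // mulrBl mul1r ltrBrDr.
      apply: le_lt_trans (_ : p%:R + (d * M%:R) < _) => //.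
      have : (p%:R + P0%:R + 1 : R) <= M%:R by rewrite -natrD natr1 ler_nat.
      by move: P0gt; lra.
    rewrite dz; have [e [-> _]] := dist_intP (z - p%:R / M%:R).
    have [e0|e0] := leP 0 e.
      have eR : 0 <= e%:~R :> R by rewrite ler0z.
      left; rewrite dzd; apply: le_trans (dist_int_le _ 0) _; rewrite subr0.
      by rewrite !ler0_norm; lra.
    have eR : e%:~R <= -1 :> R by rewrite -[-1]/((-1)%:~R) ler_int; move: e0; clear; lia.
    right; rewrite dzd; apply: le_trans (dist_int_le _ 0) _; rewrite subr0.
    by rewrite !ger0_norm; lra.
  have [h|h] := leP (dist_int (x - d)) (dist_int (x + d)).
    exists (x - d); first by left.
    by move=> p /H [] // h2; exact: le_trans h2.
  exists (x + d); first by right.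
  by move=> p /H [] // h2; apply: le_trans h2; exact: ltW.
rewrite sub0r normrN ger0_norm ?tT_ge0 // /tT.
suff [y hy hb] : exists2 y, (y = x - d \/ y = x + d) &
    forall p : 'I_M, insamp p -> dist_int y <= dist_int (x - p%:R / M%:R).
  apply: (edge_bound _ hy); last exact: tail_bound.
  by rewrite -/(tT x) tT_ge0 tT_le1.
have H (p : 'I_M) : insamp p -> dist_int (x - d) <= dist_int (x - p%:R / M%:R) \/
    dist_int (x + d) <= dist_int (x - p%:R / M%:R).
  move=> hp.
  have [e0 [q1 q2]] : exists e0 : int, - d <= p%:R / M%:R + e0%:~R /\ p%:R / M%:R + e0%:~R <= d.
    have p0 : 0 <= p%:R / M%:R :> R by rewrite divr_ge0.
    case/orP: hp => hp.
      exists 0; rewrite addr0; split; first by lra.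
      by rewrite ler_pdivrMr //; apply: le_trans P0le; rewrite ler_nat.
    exists (-1); split.
      rewrite lerBrDr ler_pdivlMr // mulrDl mul1r mulNr.
      have : (M%:R <= p%:R + P0%:R :> R) by rewrite -natrD ler_nat.
      by move: P0le; lra.
    by rewrite rmorphN /= lerBlDr ler_pdivrMr // mulrDl mul1r; have := pM p; have : 0 <= d * M%:R; [by rewrite mulr_ge0 // ltW|lra]. 
  have [e [-> _]] := dist_intP (x - p%:R / M%:R).
  (* x lies in (d, 1 - d) + k1 *)
  pose e1 := e - e0; set w := p%:R / M%:R + e0%:~R in q1 q2.
  have -> : x - p%:R / M%:R - e%:~R = x - e1%:~R - w by rewrite /w /e1 rmorphB /=; ring.
  have hx1 : d < `|x - e1%:~R| by apply: lt_le_trans hx (dist_int_le _ _).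
  have L1 : dist_int (x - d) <= `|x - d - e1%:~R| by exact: dist_int_le.
  have L2 : dist_int (x + d) <= `|x + d - e1%:~R| by exact: dist_int_le.
  have [s0|s0] := leP 0 (x - e1%:~R).
    left; apply: le_trans L1 _; move: hx1; rewrite (ger0_norm s0) => hx1.
    by rewrite !ger0_norm; lra.
  right; apply: le_trans L2 _; move: hx1; rewrite (ltr0_norm s0) => hx1.
  by rewrite !ler0_norm; lra.
have [h|h] := leP (dist_int (x - d)) (dist_int (x + d)).
  exists (x - d); first by left.
  by move=> p /H [] // h2; exact: le_trans h2.
exists (x + d); first by right.
by move=> p /H [] // h2; apply: le_trans h2; exact: ltW.
Qed.

(** The usual size of the Fourier coefficients of an interval of length 2d smoothed at scale 1/m. *)
Definition beta (j : 'I_M) : R := Num.min (d + m%:R^-1) (Num.max 1 `|(fr N j)%:~R|)^-1.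

Lemma beta_ge0 j : 0 <= beta j.
Proof.
rewrite le_min invr_ge0 le_max ler01 andbT /= addr_ge0 ?invr_ge0 //.
by case/andP: hd.
Qed.

Lemma minv_beta j : m%:R^-1 <= 2 * beta j.
Proof.
have d0 : 0 <= d by case/andP: hd.
have m1 := m1R; have mi : 0 < m%:R^-1 :> R by rewrite invr_gt0.
rewrite /beta /Num.min; case: ifP => _; first by lra.
have h : (Num.max 1 `|(fr N j)%:~R| : R) <= 2 * m%:R.
  rewrite ge_max; apply/andP; split; first by lra.
  by have := @fr_abs N j; rewrite /N natrM.
have p0 : 0 < (Num.max 1 `|(fr N j)%:~R| : R) by rewrite lt_max ltr01.
have -> : m%:R^-1 = 2 * (2 * m%:R)^-1 :> R by field; rewrite gt_eqF.
by apply: ler_wpM2l => //; rewrite lef_pV2 ?posrE //; lra.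
Qed.

Definition cF (s : R) (j : 'I_M) : R[i] :=
  \sum_(v | ph2 v == fr N j) ((m%:R ^+ 2)^-1)%:C%C * cis (- ((ph2 v)%:~R * s)).

Lemma fe_shift_expand s x : (fe m (x - s))%:C%C = \sum_j cF s j * cis ((fr N j)%:~R * x).
Proof.
rewrite fe_expand /cF -(tp_collect _ _ ph2_lt); apply: eq_bigr => v _.
by rewrite mulrBr cisD mulrA mulrAC.
Qed.

Lemma card_ph2 j : (#|[pred v | ph2 v == fr N j]| <= m)%N.
Proof.
rewrite -[X in (_ <= X)%N]card_ord.
rewrite -(card_in_imset (f := fst) (D := [pred v | ph2 v == fr N j])); first exact: max_card.
move=> [a b] [a' b']; rewrite !inE /= => /eqP h1 /eqP h2 e; rewrite -e in h2 *.
by congr pair; apply: val_inj; move: h1 h2; rewrite /ph2 /=; lia.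
Qed.

Lemma cF_le s j : nrm (cF s j) <= m%:R^-1.
Proof.
apply: le_trans (nrm_sum _ _ _) _.
rewrite (eq_bigr (fun=> (m%:R ^+ 2)^-1)) => [|v _]; last first.
  by rewrite nrmM nrm_cis mulr1 nrm_real ger0_norm // invr_ge0 exprn_ge0.
rewrite sumr_const -[leLHS]mulr_natl.
have -> : m%:R^-1 = m%:R * (m%:R ^+ 2)^-1 :> R by field; rewrite gt_eqF.
by rewrite ler_wpM2r ?invr_ge0 ?exprn_ge0 // ler_nat; exact: card_ph2.
Qed.

Definition cE (j : 'I_M) : R[i] := 256%:R * (cF d j + cF (d - (2 * m%:R)^-1) j
  + (cF (- d) j + cF (- d - (2 * m%:R)^-1) j)).

Lemma tE_expand x : (tE x)%:C%C = \sum_j cE j * cis ((fr N j)%:~R * x).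
Proof.
rewrite /tE rmorphM /= (rmorph_nat (real_complex R)).
have -> : x - d + (2 * m%:R)^-1 = x - (d - (2 * m%:R)^-1) by ring.
have -> : x + d + (2 * m%:R)^-1 = x - (- d - (2 * m%:R)^-1) by ring.
have -> : x + d = x - - d by ring.
rewrite !rmorphD /= !fe_shift_expand -!big_split mulr_sumr.
by apply: eq_bigr => j _; rewrite /= /cE; ring.
Qed.

Lemma cE_le j : nrm (cE j) <= 1024 * m%:R^-1.
Proof.
rewrite /cE -[256%:R](rmorph_nat (real_complex R)) nrmM nrm_real (ger0_norm (ler0n _ _)).
have H (a b c e : R[i]) : nrm (a + b + (c + e)) <= nrm a + nrm b + (nrm c + nrm e).
  by apply: le_trans (nrmD _ _) _; apply: lerD; exact: nrmD.
have := H (cF d j) (cF (d - (2 * m%:R)^-1) j) (cF (- d) j) (cF (- d - (2 * m%:R)^-1) j).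
have := cF_le d j; have := cF_le (d - (2 * m%:R)^-1) j.
have := cF_le (- d) j; have := cF_le (- d - (2 * m%:R)^-1) j; lra.
Qed.

Definition cT (j : 'I_M) : R[i] := \sum_(v | ph4 v == fr N j)
  (((m%:R ^+ 4)^-1 / fZ)%:C%C * \sum_(p < M | insamp p) cis (- ((ph4 v)%:~R * (p%:R / M%:R)))).

Lemma tT_expand x : (tT x)%:C%C = \sum_j cT j * cis ((fr N j)%:~R * x).
Proof.
rewrite /tT rmorphM /= rmorph_sum /= (eq_bigr _ (fun p _ => fe2_expand _ _)).
rewrite /cT -(tp_collect _ _ ph4_lt) exchange_big /= mulr_suml; apply: eq_bigr => v _.
rewrite mulr_suml [in RHS]mulr_sumr mulr_suml; apply: eq_bigr => p _.
by rewrite mulrBr cisD rmorphM /=; ring.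
Qed.

Lemma card_ph4 j : (#|[pred v | ph4 v == fr N j]| <= m ^ 3)%N.
Proof.
have -> : (m ^ 3 = #|{: 'I_m * 'I_m * 'I_m}|)%N by rewrite !card_prod !card_ord expnS expnS expn1 mulnA.
rewrite -(card_in_imset (f := fun v : V4 => (v.1, v.2.1)) (D := [pred v | ph4 v == fr N j])); first exact: max_card.
move=> [[a b] [c e]] [[a' b'] [c' e']]; rewrite !inE /= => /eqP h1 /eqP h2 [ea eb ec].
rewrite -ea -eb -ec in h2 *; congr (_, (_, _)); apply: val_inj; move: h1 h2; rewrite /ph4 /=; lia.
Qed.

(* the indices p > M - 1 - P0 are shifted to p - M *)
Lemma sum_insamp (w : int) : \sum_(p < M | insamp p) cis (- (w%:~R * (p%:R / M%:R))) =
  cis (w%:~R * P0%:R / M%:R) * \sum_(p < (2 * P0).+1) cis (p%:R * (- (w%:~R / M%:R)) : R).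
Proof.
have m1 := m1R; have MM : M%:R != 0 :> R by rewrite gt_eqF // MR; lra.
pose F (q : int) : R[i] := cis (- (w%:~R * (q%:~R / M%:R))).
have FM q : F (q + M%:Z) = F q.
  rewrite /F rmorphD /= mulrDl divff // mulrDr mulr1 opprD -rmorphN /=.
  by rewrite cisDint.
have hP := P0M.
have -> : \sum_(p < M | insamp p) cis (- (w%:~R * (p%:R / M%:R))) =
   \sum_(0 <= p < M | (p <= P0)%N || (M <= p + P0)%N) F p%:Z.
  by rewrite big_mkord; apply: eq_bigr.
rewrite (@big_cat_nat _ _ _ P0.+1) //=; last by rewrite /M in hP *; lia.
rewrite (@big_cat_nat _ _ _ (M - P0)%N P0.+1) //=; [|by rewrite /M in hP *; lia|by rewrite /M in hP *; lia].
have -> : \sum_(P0.+1 <= p < M - P0 | (p <= P0)%N || (M <= p + P0)%N) F p%:Z = 0.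
  rewrite big_nat_cond big_pred0 // => p; apply/negbTE/negP => /andP[]; lia.
rewrite add0r.
have -> : \sum_(0 <= p < P0.+1 | (p <= P0)%N || (M <= p + P0)%N) F p%:Z = \sum_(0 <= p < P0.+1) F p%:Z.
  by rewrite big_nat_cond [RHS]big_nat_cond; apply: eq_bigl => p; lia.
have -> : \sum_(M - P0 <= p < M | (p <= P0)%N || (M <= p + P0)%N) F p%:Z = \sum_(0 <= p < P0) F (p%:Z - P0%:Z).
  rewrite big_nat_cond [LHS](eq_bigl (fun p => (M - P0 <= p < M)%N)) => [|p]; last by lia.
  rewrite -big_nat -{1}[(M - P0)%N]add0n big_addn.
  have -> : (M - (M - P0) = P0)%N by lia.
  rewrite big_nat [RHS]big_nat; apply: eq_bigr => p /andP[_ hp].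
  rewrite -[RHS]FM; congr F; lia.
have -> : \sum_(0 <= p < P0.+1) F p%:Z = \sum_(P0 <= p < (2 * P0).+1) F (p%:Z - P0%:Z).
  rewrite -{2}[P0]add0n big_addn.
  have -> : ((2 * P0).+1 - P0 = P0.+1)%N by lia.
  by apply: eq_bigr => p _; congr F; lia.
rewrite addrC -big_cat_nat //=; last by lia.
rewrite big_mkord mulr_sumr; apply: eq_bigr => p _.
by rewrite /F -cisD; congr cis; rewrite rmorphB /=; field.
Qed.

Lemma cT_le j : nrm (cT j) <= 10 * beta j.
Proof.
have z := fZ_ge1; have d0 : 0 <= d by case/andP: hd.
have m1 := m1R.
have MM : 0 < M%:R :> R by rewrite MR; lra.
set S := fun w : int => nrm (\sum_(p < M | insamp p) cis (- (w%:~R * (p%:R / M%:R))) : R[i]).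
have S1 w : S w <= 2 * P0%:R + 1.
  rewrite /S sum_insamp nrmM nrm_cis mul1r; apply: le_trans (nrm_sum _ _ _) _.
  rewrite (eq_bigr (fun=> 1)) => [|i _]; last exact: nrm_cis.
  by rewrite sumr_const card_ord -natrM natr1.
have S2 : `|(fr N j)%:~R| * S (fr N j) <= M%:R.
  rewrite /S sum_insamp nrmM nrm_cis mul1r.
  have := @geom_cis_le R (- ((fr N j)%:~R / M%:R)) (2 * P0).+1.
  have jN : `|(fr N j)%:~R| <= 2 * m%:R :> R by have := @fr_abs N j; rewrite /N natrM.
  have -> : dist_int (- ((fr N j)%:~R / M%:R)) = `|(fr N j)%:~R| / M%:R :> R.
    rewrite dist_intN; have [k [-> hk]] := dist_intP ((fr N j)%:~R / M%:R : R).
    have [->|k0] := eqVneq k 0.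
      by rewrite subr0 normrM [X in _ * X]ger0_norm ?invr_ge0.
    have k1 : 1 <= `|k%:~R| :> R by rewrite -intr_norm -[1]/(1%:~R) ler_int; move: k0; clear; lia.
    have jo : `|(fr N j)%:~R / M%:R| < 1 / 2 :> R.
      rewrite normrM [X in _ * X]ger0_norm ?invr_ge0 // ltr_pdivrMr // MR; lra.
    exfalso; have := lerB_dist (k%:~R : R) ((fr N j)%:~R / M%:R); rewrite distrC; lra.
  by rewrite mulrAC ler_pdivrMr // mul1r.
have key : nrm (cT j) <= m%:R^-1 * S (fr N j).
  apply: le_trans (nrm_sum _ _ _) _.
  rewrite (eq_bigr (fun=> (m%:R ^+ 4)^-1 / fZ * S (fr N j))) => [|v /eqP ->]; last first.
    rewrite nrmM nrm_real ger0_norm // divr_ge0 ?invr_ge0 ?exprn_ge0 //; lra.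
  rewrite sumr_const -[leLHS]mulr_natl mulrA ler_wpM2r ?nrm_ge0 // mulrA ler_pdivrMr; last by lra.
  apply: (@le_trans _ _ m%:R^-1); last first.
    by rewrite ler_peMr // invr_ge0.
  have -> : m%:R^-1 = m%:R ^+ 3 * (m%:R ^+ 4)^-1 :> R by field; rewrite gt_eqF.
  by rewrite ler_wpM2r ?invr_ge0 ?exprn_ge0 // -natrX ler_nat; exact: card_ph4.
have mi : 0 < m%:R^-1 :> R by rewrite invr_gt0.
have miM : m%:R^-1 * M%:R <= 5 :> R by rewrite mulrC ler_pdivrMr // MR; lra.
apply: le_trans key _; rewrite /beta /Num.min; case: ifP => _.
  apply: le_trans (ler_wpM2l (ltW mi) (S1 (fr N j))) _.
  have : m%:R^-1 * P0%:R <= m%:R^-1 * (d * M%:R) by rewrite ler_pM2l.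
  have : d * (m%:R^-1 * M%:R) <= d * 5 by rewrite ler_wpM2l.
  by lra.
have [j1|j1] := leP 1 `|(fr N j)%:~R : R|.
  have jp : 0 < `|(fr N j)%:~R : R| by lra.
  rewrite -(ler_pM2l jp) mulrCA [leRHS]mulrCA divff ?gt_eqF // mulr1.
  by apply: le_trans (ler_wpM2l (ltW mi) S2) _; lra.
rewrite invr1 mulr1; apply: le_trans (ler_wpM2l (ltW mi) (S1 (fr N j))) _.
have hP : 2 * P0%:R + 1 <= M%:R :> R by rewrite -natrM natr1 ler_nat; exact: P0M.
by have := ler_wpM2l (ltW mi) hP; lra.
Qed.

Lemma fr_ord0 (j : 'I_M) : fr N j = 0 -> #|[pred v : V4 | ph4 v == 0]|%:R * ((m%:R ^+ 4)^-1) * M%:R = fZ.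
Proof.
move=> _; apply: nrm_inj; have := sample_fe2 0; rewrite /fZ => <-.
rewrite rmorph_sum /= (eq_bigr _ (fun p _ => fe2_expand _ _)).
transitivity (((m%:R ^+ 4)^-1)%:C%C * ((M * #|[pred v | ph4 v == 0]|)%:R : R[i])).
  rewrite -(rmorph_nat (real_complex R)) -rmorphM /=; congr (_%:C)%C.
  by rewrite natrM; ring.
rewrite -(sample_sum (M := M) 0) => [||v] //; last by have := ph4_lt v; lia.
rewrite mulr_sumr; apply: eq_bigr => p _.
by rewrite mulr_sumr; apply: eq_bigr => v _.
Qed.

Lemma cT0 (j : 'I_M) : fr N j = 0 -> cT j = (((2 * P0).+1)%:R / M%:R)%:C%C.
Proof.
move=> j0; have e := fr_ord0 j0; have z := fZ_ge1; have m1 := m1R.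
have MM : 0 < M%:R :> R by rewrite MR; lra.
rewrite /cT (eq_bigr (fun=> (((m%:R ^+ 4)^-1 / fZ) * ((2 * P0).+1)%:R)%:C%C)) => [|v /eqP ->]; last first.
  rewrite j0 sum_insamp !mul0r cis0 mul1r [RHS]rmorphM /=; congr (_ * _).
  rewrite (eq_bigr (fun=> 1)) => [|i _]; last by rewrite oppr0 mulr0 cis0.
  by rewrite sumr_const card_ord (rmorph_nat (real_complex R)).
rewrite (eq_bigl (fun v => v \in [pred v | ph4 v == 0])) => [|v]; last by rewrite j0 inE.
rewrite sumr_const -(rmorphMn (real_complex R)) /=; congr (_%:C)%C.
rewrite -[LHS]mulr_natl -e.
have : (#|[pred v : V4 | ph4 v == 0]|%:R : R) != 0.
  by apply/eqP => h; move: e; rewrite h !mul0r => e0; move: z; rewrite -e0; lra.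
have m4 : m%:R != 0 :> R by rewrite gt_eqF.
by move=> an; field; rewrite an m4 gt_eqF.
Qed.

Lemma cT0_near (j : 'I_M) : fr N j = 0 -> `|((2 * P0).+1)%:R / M%:R - 2 * d| <= m%:R^-1.
Proof.
move=> j0; have m1 := m1R; have MM : 0 < M%:R :> R by rewrite MR; lra.
have -> : ((2 * P0).+1)%:R / M%:R - 2 * d = (2 * P0%:R + 1 - 2 * (d * M%:R)) / M%:R :> R.
  by rewrite -natr1 natrM; field; rewrite gt_eqF.
rewrite normrM [X in _ * X]ger0_norm ?invr_ge0 //.
apply: (@le_trans _ _ (1 * M%:R^-1)).
  by rewrite ler_pM2r ?invr_gt0 // ler_norml; move: P0le P0gt; lra.
by rewrite mul1r lef_pV2 ?posrE // MR; lra.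
Qed.

End Fejer2.
Arguments cT : clear implicits.
Arguments cE : clear implicits.
Arguments tT : clear implicits.
Arguments tE : clear implicits.
Arguments beta : clear implicits.

Lemma coef_bounds : exists2 K : R, 2 <= K & forall m d j, (0 < m)%N -> 0 <= d <= 1 / 2 ->
  [/\ nrm (cT m d j) <= K * beta m d j, nrm (cE m d j) <= K * m%:R^-1 &
      nrm (cT m d j + cE m d j) <= K * beta m d j].
Proof.
exists 2058; first by rewrite (ler_nat R 2 2058).
move=> m d j m0 hd; have h1 := cT_le m0 hd j; have h2 := @cE_le m d m0 hd j.
have h3 := minv_beta m0 hd j; have b0 : 0 <= beta m d j by exact: beta_ge0.
have mi : 0 <= m%:R^-1 :> R by rewrite invr_ge0.
split; [lra|lra|].
by apply: le_trans (nrmD _ _) _; lra.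
Qed.

(** The right-hand side consists of products of trigonometric polynomials once more, so that the
    error, too, reduces to exponential sums. *)
Lemma prod_diff_le (I : Type) (s : seq I) (chi T E : I -> R) :
  (forall k, 0 <= T k) -> (forall k, 0 <= E k) -> (forall k, 0 <= chi k) ->
  (forall k, `|chi k - T k| <= E k) ->
  `|\prod_(k <- s) chi k - \prod_(k <- s) T k| <=
   \prod_(k <- s) (T k + E k) - \prod_(k <- s) T k.
Proof.
move=> T0 E0 c0 h.
have X0 s' : 0 <= \prod_(k <- s') chi k by apply: prodr_ge0.
have cTE k : chi k <= T k + E k by have := h k; rewrite ler_norml; lra.
have XZ s' : \prod_(k <- s') chi k <= \prod_(k <- s') (T k + E k).
  by apply: ler_prod => k _; rewrite c0 cTE.
elim: s => [|k s IH]; first by rewrite !big_nil subrr normr0.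
rewrite !big_cons; have := XZ s; have := X0 s; move: IH.
set X := \prod_(k <- s) chi k; set Y := \prod_(k <- s) T k; set Z := \prod_(k <- s) _.
move=> IH x0 xz.
have -> : chi k * X - T k * Y = (chi k - T k) * X + T k * (X - Y) by ring.
apply: le_trans (ler_normD _ _) _; rewrite !normrM (ger0_norm x0) (ger0_norm (T0 k)).
have h1 : `|chi k - T k| * X <= E k * Z by apply: ler_pM.
have h2 : T k * `|X - Y| <= T k * (Z - Y) by apply: ler_wpM2l.
by lra.
Qed.

Lemma pow_diff_le (a b : R[i]) (K : R) r : nrm a <= K -> nrm b <= K ->
  nrm (a ^+ r - b ^+ r) <= r%:R * nrm (a - b) * K ^+ r.-1.
Proof.
move=> ha hb; have K0 : 0 <= K := le_trans (nrm_ge0 _) ha.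
elim: r => [|r IH]; first by rewrite !expr0 subrr nrm0 !mul0r.
have -> : a ^+ r.+1 - b ^+ r.+1 = a * (a ^+ r - b ^+ r) + (a - b) * b ^+ r.
  by rewrite !exprS; ring.
apply: le_trans (nrmD _ _) _; rewrite !nrmM nrmX.
have h2 : nrm (a - b) * nrm b ^+ r <= nrm (a - b) * K ^+ r.
  by apply: ler_wpM2l; [exact: nrm_ge0|rewrite lerXn2r ?nnegrE ?nrm_ge0].
have h1 : nrm a * nrm (a ^+ r - b ^+ r) <= r%:R * nrm (a - b) * K ^+ r.
  case: r IH {h2} => [|r] IH; first by rewrite !expr0 subrr nrm0 mulr0 !mul0r.
  apply: (@le_trans _ _ (K * (r.+1%:R * nrm (a - b) * K ^+ r))).
    by apply: ler_pM; rewrite ?nrm_ge0.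
  by rewrite exprS; lra.
by rewrite -natr1 /=; lra.
Qed.

Section Main.
Variables (r : nat) (I : finType) (w : I -> R) (x : I -> 'I_r -> R) (m : nat) (d : R).
Hypotheses (m0 : (0 < m)%N) (hd : 0 <= d <= 1 / 2) (w0 : forall i, 0 <= w i).
Let N := (2 * m)%N.

Definition tS (J : {ffun 'I_r -> 'I_(2 * N).+1}) : R[i] :=
  \sum_i (w i)%:C%C * cis (\sum_k (fr N (J k))%:~R * x i k).

Lemma prod_expand (p : R -> R) (c : 'I_(2 * N).+1 -> R[i]) : (forall y, (p y)%:C%C = \sum_j c j * cis ((fr N j)%:~R * y)) ->
  (\sum_i w i * \prod_k p (x i k))%:C%C = \sum_(J : {ffun 'I_r -> 'I_(2 * N).+1}) (\prod_k c (J k)) * tS J.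
Proof.
move=> h; rewrite rmorph_sum /=.
under eq_bigr => i _.
  rewrite rmorphM rmorph_prod /= (eq_bigr _ (fun k _ => h (x i k))) bigA_distr_bigA mulr_sumr.
  under eq_bigr => J _ do rewrite big_split -cis_sum.
  over.
rewrite exchange_big /=; apply: eq_bigr => J _; rewrite /tS mulr_sumr.
by apply: eq_bigr => i _; rewrite mulrCA.
Qed.

Definition tJ0 : {ffun 'I_r -> 'I_(2 * N).+1} := [ffun _ => inord N].

Lemma fr0 : fr N (inord N) = 0.
Proof. by rewrite /fr inordK ?subrr //; lia. Qed.

Lemma tS0 : tS tJ0 = (\sum_i w i)%:C%C.
Proof.
rewrite rmorph_sum; apply: eq_bigr => i _.
by rewrite big1 => [|k _]; rewrite ?cis0 ?mulr1 // ffunE fr0 mul0r.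
Qed.

(** The approximating product and the majorant of its error are both expanded. The zero frequency
    differs from (2d)^r by the errors O(1/m) in [cT0_near] and in the coefficients [cE]; at every
    other frequency the coefficients are bounded through [beta]. *)
Lemma trig_bound K : 2 <= K -> (forall j, 
  [/\ nrm (cT m d j) <= K * beta m d j, nrm (cE m d j) <= K * m%:R^-1 &
      nrm (cT m d j + cE m d j) <= K * beta m d j]) ->
  `|\sum_i w i * \prod_k (dist_int (x i k) <= d)%R%:R - (2 * d) ^+ r * \sum_i w i| <=
  (3 * (r%:R + 1) * K ^+ r.+1) * ((d + m%:R^-1) ^+ r.-1 * m%:R^-1 * \sum_i w i +
     \sum_(J | J != tJ0) (\prod_k beta m d (J k)) * nrm (tS J)).
Proof.
move=> K1 hK; have [d0 d1] := andP hd.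
have mi : 0 < m%:R^-1 :> R by rewrite invr_gt0 ltr0n.
set W := \sum_i w i; have W0 : 0 <= W by apply: sumr_ge0.
set B := \sum_(J | J != tJ0) _.
pose cU j := cT m d j + cE m d j.
have hT y : (tT m d y)%:C%C = \sum_j cT m d j * cis ((fr N j)%:~R * y) by exact: (tT_expand m0 hd).
have hU y : (tT m d y + tE m d y)%:C%C = \sum_j cU j * cis ((fr N j)%:~R * y).
  rewrite rmorphD /= hT (tE_expand m0 hd) -big_split.
  by apply: eq_bigr => j _; rewrite /= -mulrDl.
have P0 J : 0 <= \prod_k beta m d (J k) by apply: prodr_ge0 => k _; exact: beta_ge0.
have prodle (c : 'I_(2 * N).+1 -> R[i]) (J : {ffun 'I_r -> 'I_(2 * N).+1}) :
    (forall j, nrm (c j) <= K * beta m d j) ->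
    nrm (\prod_k c (J k)) <= K ^+ r * \prod_k beta m d (J k).
  move=> hc; have -> : nrm (\prod_k c (J k)) = \prod_k nrm (c (J k)).
    by elim/big_rec2: _ => [|k y1 y2 _ <-]; rewrite ?nrm1 ?nrmM.
  rewrite -[X in K ^+ X](card_ord r) -prodr_const -big_split; apply: ler_prod => k _.
  by rewrite nrm_ge0 /= hc.
set K' := K * (d + m%:R^-1).
pose j0 : 'I_(2 * N).+1 := inord N.
have b0 : beta m d j0 <= d + m%:R^-1 by rewrite /beta ge_min lexx.
have [t1 e1 u1] := hK j0.
have t2 : nrm (cT m d j0) <= K' by apply: le_trans t1 _; apply: ler_wpM2l => //; lra.
have u2 : nrm (cU j0) <= K' by apply: le_trans u1 _; apply: ler_wpM2l => //; lra.
have K1' : 0 <= K by lra.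
have d2 : nrm ((2 * d)%:C%C) <= K'.
  rewrite nrm_real ger0_norm; last by lra.
  have : K * m%:R^-1 >= 0 by rewrite mulr_ge0 // ltW.
  by have := ler_wpM2r d0 K1; rewrite /K'; lra.
have near2 : nrm (cT m d j0 - (2 * d)%:C%C) <= m%:R^-1.
  have f0 : fr N j0 = 0 by exact: fr0.
  rewrite (cT0 m0 hd f0) -rmorphB nrm_real.
  exact: (cT0_near m0 hd f0).
set X := \sum_i w i * \prod_k _.
pose XT := \sum_i w i * \prod_k tT m d (x i k).
pose XU := \sum_i w i * \prod_k (tT m d (x i k) + tE m d (x i k)).
have h1 : `|X - XT| <= XU - XT.
  rewrite /X /XT /XU -!sumrB; apply: le_trans (ler_norm_sum _ _ _) _.
  apply: ler_sum => i _; rewrite -!mulrBr normrM ger0_norm // ler_wpM2l //.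
  apply: prod_diff_le => k; [exact: tT_ge0|exact: tE_ge0|exact: ler0n|exact: tT_tE].
have at0 (c : 'I_(2 * N).+1 -> R[i]) : \prod_k c (tJ0 k) = c j0 ^+ r.
  by rewrite (eq_bigr (fun=> c j0)) => [|k _]; rewrite ?ffunE // prodr_const card_ord.
have rest (F : {ffun 'I_r -> 'I_(2 * N).+1} -> R[i]) (a : R) : 0 <= a ->
    (forall J, nrm (F J) <= a * \prod_k beta m d (J k)) ->
    nrm (\sum_(J | J != tJ0) F J * tS J) <= a * B.
  move=> a0 hF; apply: le_trans (nrm_sum _ _ _) _; rewrite /B mulr_sumr.
  by apply: ler_sum => J _; rewrite nrmM mulrA ler_wpM2r ?nrm_ge0.
have KX : 0 <= K ^+ r by apply: exprn_ge0.
have h2 : XU - XT <= r%:R * (K * m%:R^-1) * K' ^+ r.-1 * W + 2 * K ^+ r * B.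
  apply: le_trans (ler_norm _) _; rewrite -nrm_real rmorphB /=.
  rewrite (prod_expand hT) (prod_expand hU) -sumrB.
  rewrite (eq_bigr (fun J : {ffun 'I_r -> 'I_(2 * N).+1} => (\prod_k cU (J k) - \prod_k cT m d (J k)) * tS J)); last first.
    by move=> J _; rewrite mulrBl.
  rewrite (bigD1 tJ0) //=; apply: le_trans (nrmD _ _) _; apply: lerD.
    rewrite !at0 tS0 nrmM nrm_real (ger0_norm W0) ler_wpM2r //.
    apply: le_trans (pow_diff_le r u2 t2) _.
    have -> : cU j0 - cT m d j0 = cE m d j0 by rewrite /cU addrC addKr.
    rewrite ler_wpM2r ?exprn_ge0 ?(le_trans (nrm_ge0 _) t2) // ler_wpM2l //.
  apply: rest => [|J]; first by rewrite mulr_ge0.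
  apply: le_trans (nrmD _ _) _; rewrite nrmN.
  have q1 := @prodle cU J (fun j => let: And3 _ _ h := hK j in h).
  have q2 := @prodle (cT m d) J (fun j => let: And3 h _ _ := hK j in h).
  by apply: le_trans (lerD q1 q2) _; lra.
have h3 : `|XT - (2 * d) ^+ r * W| <= r%:R * m%:R^-1 * K' ^+ r.-1 * W + K ^+ r * B.
  rewrite -nrm_real rmorphB /= (prod_expand hT) (bigD1 tJ0) //= at0 tS0 addrAC.
  rewrite rmorphM rmorphXn /= -mulrBl; apply: le_trans (nrmD _ _) _; apply: lerD.
    rewrite nrmM nrm_real (ger0_norm W0) ler_wpM2r //.
    apply: le_trans (pow_diff_le r t2 d2) _.
    by rewrite ler_wpM2r ?exprn_ge0 ?(le_trans (nrm_ge0 _) t2) // ler_wpM2l.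
  apply: rest => // J; exact: (@prodle (cT m d) J (fun j => let: And3 h _ _ := hK j in h)).
have B0 : 0 <= B.
  by apply: sumr_ge0 => J _; rewrite mulr_ge0 ?nrm_ge0.
have h4 : `|X - (2 * d) ^+ r * W| <= `|X - XT| + `|XT - (2 * d) ^+ r * W|.
  by rewrite -[X in `|X| <= _](subrKA XT) ler_normD.
apply: le_trans h4 _; apply: le_trans (lerD (le_trans h1 h2) h3) _.
set q := (d + m%:R^-1) ^+ r.-1 * m%:R^-1 * W.
have q0 : 0 <= q by rewrite /q !mulr_ge0 ?exprn_ge0 ?addr_ge0 // ltW.
have ee1 : r%:R * (K * m%:R^-1) * K' ^+ r.-1 * W = r%:R * (K * K ^+ r.-1) * q.
  by rewrite /q /K' exprMn; ring.
have ee2 : r%:R * m%:R^-1 * K' ^+ r.-1 * W = r%:R * K ^+ r.-1 * q.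
  by rewrite /q /K' exprMn; ring.
rewrite ee1 ee2 mulrDr.
have k1 : K ^+ r <= K ^+ r.+1 by rewrite exprS ler_peMl //; lra.
have k2 : K ^+ r.-1 <= K ^+ r by rewrite ler_weXn2l ?leq_pred //; lra.
have k3 : K * K ^+ r.-1 <= K ^+ r.+1 by rewrite exprS ler_wpM2l.
have r0 : 0 <= r%:R :> R by [].
have KS : 0 <= K ^+ r.+1 by apply: exprn_ge0.
have f1 : r%:R * (K * K ^+ r.-1) * q <= r%:R * K ^+ r.+1 * q by rewrite ler_wpM2r // ler_wpM2l.
have f2 : r%:R * K ^+ r.-1 * q <= r%:R * K ^+ r.+1 * q.
  by rewrite ler_wpM2r // ler_wpM2l //; apply: le_trans k1.
have f3 : 0 <= K ^+ r.+1 * q by apply: mulr_ge0.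
have f3' : 0 <= r%:R * K ^+ r.+1 * q by rewrite -mulrA; apply: mulr_ge0.
have f4 : K ^+ r * B <= K ^+ r.+1 * B by rewrite ler_wpM2r.
have f5 : 0 <= K ^+ r.+1 * B by apply: mulr_ge0.
have f6 : 0 <= r%:R * (K ^+ r.+1 * B) by apply: mulr_ge0.
by lra.
Qed.

End Main.
End Trig.

Lemma sum_le_ord (R : realType) (n : nat) (F : 'I_n -> R) (B : R) :
  (forall i, F i <= B) -> \sum_i F i <= n%:R * B.
Proof.
move=> h; apply: le_trans (ler_sum _ (fun i _ => h i)) _.
by rewrite sumr_const card_ord -[leLHS]mulr_natl.
Qed.

Lemma continuous_sum (R : realType) (T : topologicalType) (I : Type) (s : seq I) (F : I -> T -> R) :
  (forall i, continuous (F i)) -> continuous (fun t => \sum_(i <- s) F i t).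
Proof.
move=> h; elim: s => [|i s IH].
  have -> : (fun t => \sum_(i <- [::]) F i t) = cst 0 by apply/funext => t; rewrite big_nil.
  by move=> t; exact: cvg_cst.
have -> : (fun t => \sum_(j <- i :: s) F j t) = (fun t => F i t + \sum_(j <- s) F j t).
  by apply/funext => t; rewrite big_cons.
by move=> t; apply: cvgD; [exact: h|exact: IH].
Qed.

Lemma continuous_prod (R : realType) (T : topologicalType) (I : Type) (s : seq I) (F : I -> T -> R) :
  (forall i, continuous (F i)) -> continuous (fun t => \prod_(i <- s) F i t).
Proof.
move=> h; elim: s => [|i s IH].
  have -> : (fun t => \prod_(i <- [::]) F i t) = cst 1 by apply/funext => t; rewrite big_nil.
  by move=> t; exact: cvg_cst.
have -> : (fun t => \prod_(j <- i :: s) F j t) = (fun t => F i t * \prod_(j <- s) F j t).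
  by apply/funext => t; rewrite big_cons.
by move=> t; apply: cvgM; [exact: h|exact: IH].
Qed.

Lemma continuous_normr (R : realType) (T : topologicalType) (g : T -> R) :
  continuous g -> continuous (fun t => `|g t|).
Proof. by move=> h t; apply: continuous_comp; [exact: h|exact: norm_continuous]. Qed.

Lemma norm_near (R : realType) (a b M : R) : `|a - b| <= 1 -> `|b| + 1 <= M -> `|a| <= M.
Proof. by move=> h1 h2; have := ler_normD (a - b) b; rewrite subrK; lra. Qed.

Lemma ler_sum_term (R : realType) (I : finType) (F : I -> R) i :
  (forall j, 0 <= F j) -> F i <= \sum_j F j.
Proof. by move=> h; rewrite (bigD1 i) //= lerDl sumr_ge0. Qed.

(** * Partial derivatives and estimates along coordinate paths *)

Section Partial.
Context {R : realType} {n : nat}.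
Implicit Types (g : 'rV[R]_n -> R) (x z : 'rV[R]_n).

Notation dv i := (delta_mx 0 i : 'rV[R]_n).

Lemma partialP g i x : derivable g x (dv i) -> is_derive x (dv i) g (partial i g x).
Proof. by move=> h; apply: DeriveDef. Qed.

Lemma is_derive_line g gi i x : (forall y, is_derive y (dv i) g (gi y)) -> forall t : R,
  is_derive t (1 : R) (fun t : R => g (x + t *: dv i)) (gi (x + t *: dv i)).
Proof.
move=> h t; have [h1 h2] := h (x + t *: dv i).
have E : (fun u : R => u^-1 *: (((fun t : R => g (x + t *: dv i)) \o shift t) (u *: (1 : R)) - g (x + t *: dv i))) =
         (fun u : R => u^-1 *: ((g \o shift (x + t *: dv i)) (u *: dv i) - g (x + t *: dv i))).
  apply/funext => u /=; congr (_ *: (g _ - _)).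
  have -> : u *: (1 : R) = u by rewrite /GRing.scale /= mulr1.
  by rewrite scalerDl addrCA.
apply: DeriveDef; first by rewrite /derivable E.
by rewrite -h2 /derive E.
Qed.

Lemma is_derive_affine g (v : 'rV[R]_n) (c : R) x : (forall u : R, g (u *: v + x) = u * c + g x) ->
  is_derive x v g c.
Proof.
move=> h.
have cv : (fun u : R => u^-1 *: ((g \o shift x) (u *: v) - g x)) @ (0 : R)^' --> c.
  apply/cvgrPdist_le => e e0; near=> u.
  have u0 : u != 0 by near: u; exact: nbhs_dnbhs_neq.
  rewrite /= h addrK /GRing.scale /= mulKf // subrr normr0; exact: ltW.
apply: DeriveDef; first by apply/cvg_ex; exists c.
exact: cvg_lim cv.
Unshelve. all: by end_near.
Qed.

Definition btw x x' z : Prop := forall j, Num.min (x 0 j) (x' 0 j) <= z 0 j <= Num.max (x 0 j) (x' 0 j).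

Lemma btw_supd x x' z d : btw x x' z -> supd x' x d -> supd z x d.
Proof.
move=> h hd j; have := h j; have := hd j.
by rewrite /Num.min /Num.max; case: ltP => hx; rewrite !ler_norml; lra.
Qed.

Lemma btw_cube x x' z c d : btw x x' z -> supd x c d -> supd x' c d -> supd z c d.
Proof.
move=> h hd hd' j; have := h j; have := hd j; have := hd' j.
by rewrite /Num.min /Num.max; case: ltP => hx; rewrite !ler_norml; lra.
Qed.

(** The path from x to x' changes one coordinate at a time: partial derivatives suffice, and every
    intermediate point stays in the box spanned by x and x', the only place where the bound M is
    required. *)
Lemma lip_path g (gi : 'I_n -> 'rV[R]_n -> R) (M d : R) x x' :
  (forall i y, is_derive y (dv i) g (gi i y)) -> supd x' x d ->
  (forall z i, btw x x' z -> `|gi i z| <= M) -> `|g x' - g x| <= n%:R * (M * d).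
Proof.
move=> hg hd hM.
pose z (k : nat) : 'rV[R]_n := \row_j (if (j < k)%N then x' 0 j else x 0 j).
have z0 : z 0%N = x by apply/rowP => j; rewrite mxE.
have zn : z n = x' by apply/rowP => j; rewrite mxE ltn_ord.
rewrite -{1}zn -{1}z0 -(telescope_sumr (fun k => g (z k))) // big_mkord.
apply: le_trans (ler_norm_sum _ _ _) _.
apply: sum_le_ord => i.
have zS : z i.+1 = z i + (x' 0 i - x 0 i) *: dv i.
  apply/rowP => j; rewrite !mxE eqxx /=.
  case: (ltngtP j i) => hji.
  - by rewrite ltnS (ltnW hji) (_ : (j == i) = false) ?mulr0 ?addr0 //; apply/eqP => e; move: hji; rewrite e ltnn.
  - by rewrite ltnNge hji /= (_ : (j == i) = false) ?mulr0 ?addr0 //; apply/eqP => e; move: hji; rewrite e ltnn.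
  - have -> : j = i by exact: val_inj.
    by rewrite ltnSn eqxx mulr1 addrC subrK.
have M0 : 0 <= M.
  apply: le_trans (normr_ge0 _) (hM x i _) => j.
  by rewrite /Num.min /Num.max; case: ltP => hx; rewrite lexx ?(ltW hx) //= hx.
pose s := x' 0 i - x 0 i.
have hb t : Num.min 0 s <= t <= Num.max 0 s -> `|gi i (z i + t *: dv i)| <= M.
  move=> ht; apply: hM => j; rewrite !mxE eqxx /=.
  have [->|ji] := eqVneq j i.
    rewrite ltnn mulr1; move: ht; rewrite /s /Num.min /Num.max.
    by case: ltP => h1; case: ltP => h2; lra.
  rewrite mulr0 addr0 /Num.min /Num.max.
  by case: ltP => h1; case: ifP => _; lra.
have hs := hd i; rewrite -/s in hs.
have hder := is_derive_line (z i) (hg i).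
rewrite zS -/s; have [s0|s0] := leP 0 s.
  have := @mvt_le _ _ _ 0 s M s0 hder; rewrite scale0r addr0 subr0 => h.
  apply: le_trans (h _) _; last by rewrite ler_wpM2l //; move: hs; rewrite ger0_norm.
  by move=> t ht; apply: hb; rewrite (min_l s0) (max_r s0).
have := @mvt_le _ _ _ s 0 M (ltW s0) hder; rewrite scale0r addr0 sub0r distrC => h.
apply: le_trans (h _) _; last by rewrite ler_wpM2l //; move: hs; rewrite ltr0_norm.
by move=> t ht; apply: hb; rewrite (min_r (ltW s0)) (max_l (ltW s0)).
Qed.

Lemma is_derive_comb r (t : 'I_r -> R) (f fi : 'I_r -> 'rV[R]_n -> R) x (v : 'rV[R]_n) :
  (forall l, is_derive x v (f l) (fi l x)) ->
  is_derive x v (fun y => \sum_l t l * f l y) (\sum_l t l * fi l x).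
Proof.
move=> h.
have -> : (fun y => \sum_l t l * f l y) = \sum_l (t l \*: f l).
  by apply/funext => y; rewrite fct_sumE.
by apply: is_derive_sum => l; apply: is_deriveZ.
Qed.

Definition iparts (i : 'I_n) m g := iter m (partial i) g.

Lemma Ck_pred k g : Ck k.+1 g -> Ck k g.
Proof.
elim: k g => [|k IH] g; first by case.
move=> [h1 h2]; split=> // i; have [h3 h4] := h2 i; split=> //; exact: IH.
Qed.

Lemma Ck_le k k' g : (k <= k')%N -> Ck k' g -> Ck k g.
Proof.
move=> /subnK <-; elim: (k' - k)%N => // m IH /Ck_pred; exact: IH.
Qed.

Lemma Ck_cont k g : Ck k g -> continuous g.
Proof. by case: k => // k []. Qed.

Lemma Ck_partial k g i : Ck k.+1 g -> Ck k (partial i g).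
Proof. by move=> [_ /(_ i)[]]. Qed.

Lemma Ck_is_derive k g i x : Ck k.+1 g -> is_derive x (dv i) g (partial i g x).
Proof. by move=> [_ /(_ i)[h _]]; exact: partialP. Qed.

Lemma Ck_iparts k m g i : Ck (k + m) g -> Ck k (iparts i m g).
Proof.
elim: m k g => [|m IH] k g; first by rewrite addn0.
by rewrite addnS => h; rewrite /iparts iterSr; apply: IH; exact: Ck_partial.
Qed.

Lemma cont_near g x0 (e : R) : continuous g -> 0 < e ->
  \forall d \near (0 : R)^'+, forall z, supd z x0 d -> `|g z - g x0| <= e.
Proof.
move=> hg e0; have /cvgrPdist_le /(_ e e0) /nbhs_ballP[d /= d0 hd] := hg x0.
near=> d' => z hz; rewrite distrC; apply: hd.
split=> // i j; rewrite ord1 /ball /= distrC.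
apply: le_lt_trans (hz j) _; near: d'; exact: nbhs_right_lt.
Unshelve. all: by end_near.
Qed.

End Partial.

(** * A uniform inverse bound from nonvanishing determinants *)

Section InverseBound.
Context {R : realType} {n r : nat}.

Lemma det_continuous (H : 'I_r -> 'M[R]_n) :
  continuous (fun t : 'rV[R]_r => \det (\sum_l t 0 l *: H l)).
Proof.
have ent i j : continuous (fun t : 'rV[R]_r => (\sum_l t 0 l *: H l) i j).
  have -> : (fun t : 'rV[R]_r => (\sum_l t 0 l *: H l) i j) = fun t => \sum_l t 0 l * H l i j.
    by apply/funext => t; rewrite summxE; apply: eq_bigr => l _; rewrite mxE.
  apply: continuous_sum => l.
  have hc : continuous (fun t : 'rV[R]_r => t 0 l) by exact: coord_continuous.
  by move=> t; apply: (@continuousM R _ (fun t : 'rV[R]_r => t 0 l) (cst (H l i j))); [exact: hc|exact: cst_continuous].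
rewrite /determinant; apply: continuous_sum => s.
have hp : continuous (fun t : 'rV[R]_r => \prod_i (\sum_l t 0 l *: H l) i (s i)).
  by apply: continuous_prod => i; exact: ent.
move=> t; apply: (@continuousM R _ (cst ((-1) ^+ s)) (fun t : 'rV[R]_r => \prod_i (\sum_l t 0 l *: H l) i (s i))); [exact: cst_continuous|exact: hp].
Qed.

Lemma sum_bound (t : 'rV[R]_r) (H : 'I_r -> 'M[R]_n) (B : R) i j : (forall l, `|t 0 l| <= 1) ->
  (forall l i j, `|H l i j| <= B) -> `|(\sum_l t 0 l *: H l) i j| <= r%:R * B.
Proof.
move=> ht hH; rewrite summxE; apply: le_trans (ler_norm_sum _ _ _) _.
apply: sum_le_ord => l.
rewrite mxE normrM -[leRHS]mul1r; apply: ler_pM => //; exact: ht.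
Qed.

Lemma det_le m (A : 'M[R]_m) (B : R) : (forall i j, `|A i j| <= B) -> `|\det A| <= m`!%:R * B ^+ m.
Proof.
move=> h; apply: le_trans (ler_norm_sum _ _ _) _.
have -> : m`!%:R * B ^+ m = \sum_(s : 'S_m) B ^+ m by rewrite sumr_const card_Sn -[RHS]mulr_natl.
apply: ler_sum => s _; rewrite normrM normr_sign mul1r normr_prod.
rewrite -[X in _ <= _ ^+ X](card_ord m) -prodr_const; apply: ler_prod => i _.
by rewrite normr_ge0 h.
Qed.

Lemma adj_le (A : 'M[R]_n) (B : R) : (forall i j, `|A i j| <= B) ->
  forall i j, `|(\adj A) i j| <= n.-1`!%:R * B ^+ n.-1.
Proof.
move=> h i j; rewrite mxE /cofactor normrM normrX normrN normr1 expr1n mul1r.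
by apply: det_le => i' j'; rewrite !mxE.
Qed.

(** After division of t by an entry of largest absolute value, t ranges over a compact set on which
    the determinant is bounded away from 0, and the adjugate gives v by Cramer's rule. Bounding
    products of entries of t and v makes the statement homogeneous, so t = 0 needs no exception. *)
Lemma inv_bound (H : 'I_r -> 'M[R]_n) :
  (forall t : 'rV[R]_r, t != 0 -> \det (\sum_l t 0 l *: H l) != 0) ->
  exists2 C : R, 0 < C & forall (t : 'rV[R]_r) (v : 'rV[R]_n) (e : R),
    (forall j, `|(v *m (\sum_l t 0 l *: H l)) 0 j| <= e) -> forall l i, `|t 0 l| * `|v 0 i| <= C * e.
Proof.
move=> hH.
pose B : R := \sum_l \sum_i \sum_j `|H l i j|.
have hB l i j : `|H l i j| <= B.
  rewrite /B (bigD1 l) //= (bigD1 i) //= (bigD1 j) //= -!addrA lerDl.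
  by rewrite !addr_ge0 ?sumr_ge0 // => *; rewrite ?sumr_ge0 // => *; rewrite ?sumr_ge0.
have [c c0 hc] : exists2 c : R, 0 < c & forall l (t : 'rV[R]_r), (forall k, `|t 0 k| <= 1) -> t 0 l = 1 ->
    c <= `|\det (\sum_l t 0 l *: H l)|.
  have hl l : exists2 c : R, 0 < c & forall (t : 'rV[R]_r), (forall k, `|t 0 k| <= 1) -> t 0 l = 1 ->
      c <= `|\det (\sum_l t 0 l *: H l)|.
    pose A := [set t : 'rV[R]_r | forall k, (if k == l then `[1, 1] else `[-1, 1])%classic (t ord0 k)].
    have cA : compact A.
      apply: (@rV_compact R r (fun k => if k == l then `[1, 1]%classic else `[-1, 1]%classic)) => k.
      by case: ifP => _; exact: segment_compact.
    have cf : {within A, continuous (fun t : 'rV[R]_r => `|\det (\sum_l t 0 l *: H l)|)}.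
      apply: continuous_subspaceT.
      have hdet : continuous (fun t : 'rV[R]_r => \det (\sum_l t 0 l *: H l)) by exact: det_continuous.
      exact: continuous_normr hdet.
    have A0 : A !=set0.
      exists (delta_mx 0 l) => k; rewrite mxE eqxx /=; case: eqP => _ /=; rewrite in_itv /=; lra.
    have [t0 tA hmin] := EVT_min_rV A0 cA cf.
    exists `|\det (\sum_l t0 0 l *: H l)|.
      rewrite normr_gt0; apply: hH; apply/eqP => t00; have /(_ l) := set_mem tA.
      by rewrite eqxx t00 mxE /= in_itv /=; lra.
    move=> t t1 tl; apply: hmin; apply/mem_set => k; case: eqP => [->|_] /=; rewrite in_itv /=.
      by rewrite tl lexx.
    by have := t1 k; rewrite ler_norml.
  have [c hc] := choice (fun l => let: ex_intro2 c h1 h2 := hl l in ex_intro (fun c => 0 < c /\ forall (t : 'rV[R]_r), (forall k, `|t 0 k| <= 1) -> t 0 l = 1 -> c <= `|\det (\sum_l t 0 l *: H l)|) c (conj h1 h2)).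
  exists (\big[Num.min/1]_l c l).
    by elim/big_ind: _ => // [x y hx hy|l _]; [rewrite lt_min hx|case: (hc l)].
  move=> l t h1 h2; apply: le_trans ((hc l).2 t h1 h2).
  by rewrite (bigD1 l) //= ge_min lexx.
pose K : R := n.-1`!%:R * (r%:R * B) ^+ n.-1.
have B0 : 0 <= B by rewrite /B; do 3 (apply: sumr_ge0 => ? _).
have K0 : 0 <= K by rewrite mulr_ge0 ?exprn_ge0 ?mulr_ge0.
exists (1 + n%:R * K / c).
  apply: ltr_pwDl; first exact: ltr01.
  by apply: divr_ge0; [exact: mulr_ge0|exact: ltW].
move=> t v e he l i.
have e0 : 0 <= e by apply: le_trans (normr_ge0 _) (he i).
have Kc : 0 <= n%:R * K / c by apply: divr_ge0; [exact: mulr_ge0|exact: ltW].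
suff : `|t 0 l| * `|v 0 i| <= n%:R * K / c * e by lra.
pose m := \big[Num.max/0]_k `|t 0 k|.
have hm k : `|t 0 k| <= m by rewrite /m (bigD1 k) //= le_max lexx.
apply: (@le_trans _ _ (m * `|v 0 i|)); first by rewrite ler_wpM2r.
have [m0|mn0] := eqVneq m 0.
  by rewrite m0 mul0r mulr_ge0.
have mp : 0 < m by rewrite lt_neqAle eq_sym mn0; apply: le_trans (hm l).
have [l0 hl0] : exists l0, m = `|t 0 l0|.
  have : m = 0 \/ exists l0, m = `|t 0 l0|.
    rewrite /m; elim/big_ind: _ => [|x y [->|[a ->]] [->|[b ->]]|k _].
    - by left.
    - by left; rewrite maxxx.
    - by right; exists b; rewrite max_r.
    - by right; exists a; rewrite max_l.
    - by right; rewrite /Num.max; case: ifP => _; [exists b|exists a].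
    - by right; exists k.
  by case=> // m0; move: mp; rewrite m0 ltxx.
pose s := (t 0 l0)^-1; have tl0 : t 0 l0 != 0 by rewrite -normr_gt0 -hl0.
pose t' := s *: t.
have ht' k : `|t' 0 k| <= 1.
  by rewrite mxE normrM normfV -hl0 mulrC ler_pdivrMr // mul1r.
have t'l : t' 0 l0 = 1 by rewrite mxE mulVf.
have hd := hc l0 t' ht' t'l.
have E : \sum_l t' 0 l *: H l = s *: \sum_l t 0 l *: H l.
  by rewrite scaler_sumr; apply: eq_bigr => k _; rewrite mxE scalerA.
set A := \sum_l t' 0 l *: H l in hd E.
have hA := @sum_bound t' H B _ _ ht' hB.
have hadj := adj_le hA.
have e1 : `|\det A| * `|v 0 i| <= n%:R * (K * (m^-1 * e)).
  have -> : `|\det A| * `|v 0 i| = `|(v *m A *m \adj A) 0 i|.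
    by rewrite -mulmxA mul_mx_adj mul_mx_scalar mxE normrM.
  rewrite mxE; apply: le_trans (ler_norm_sum _ _ _) _.
  apply: sum_le_ord => j.
  rewrite normrM mulrC; apply: (ler_pM (normr_ge0 _) (normr_ge0 _) (hadj j i)).
  rewrite E -scalemxAr mxE normrM normfV -hl0 ler_wpM2l // invr_ge0; exact: ltW.
have e2 : c * `|v 0 i| <= n%:R * (K * (m^-1 * e)).
  by apply: le_trans e1; rewrite ler_wpM2r.
rewrite -(ler_pM2l c0) mulrCA.
apply: le_trans (ler_wpM2l (ltW mp) e2) _.
by rewrite le_eqVlt; apply/orP; left; apply/eqP; field; rewrite !gt_eqF.
Qed.

End InverseBound.

(** * Uniform local estimates near x0 *)

Section Good.
Context {R : realType} {n r : nat}.
Implicit Types (f : 'I_r -> 'rV[R]_n -> R) (x z : 'rV[R]_n).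

Definition grad f l x : 'rV[R]_n := \row_i partial i (f l) x.
Definition gradF f (t : 'I_r -> R) x : 'rV[R]_n := \row_i \sum_l t l * partial i (f l) x.

(** The third estimate is curvature in usable form: the gradient of t . f separates points, at a
    rate proportional to each entry of t. The last one controls the pure derivatives up to order n +
    2 for the summation by parts. *)
Definition good f x0 (rho C : R) : Prop := [/\ 0 < rho <= 1 , 1 <= C &
  [/\ forall x x' (d : R), supd x x0 rho -> supd x' x0 rho -> supd x' x d -> forall l,
        `|f l x' - f l x - \sum_i grad f l x 0 i * (x' 0 i - x 0 i)| <= C * d ^+ 2,
      forall x x' (d : R), supd x x0 rho -> supd x' x0 rho -> supd x' x d -> forall l,
        supd (grad f l x') (grad f l x) (C * d),
      forall x x' (e : R) (t : 'I_r -> R), supd x x0 rho -> supd x' x0 rho ->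
        supd (gradF f t x') (gradF f t x) e -> forall l i, `|t l| * `|x' 0 i - x 0 i| <= C * e &
      forall x m i l, (m <= n.+2)%N -> supd x x0 rho -> `|iparts i m (f l) x| <= C]].

Lemma hessianE f k x0 (t : 'rV[R]_r) : (forall l, Ck k.+2 (f l)) ->
  hessian (fun x => \sum_l t 0 l * f l x) x0 = \sum_l t 0 l *: hessian (f l) x0.
Proof.
move=> hf; apply/matrixP => i j; rewrite mxE summxE.
have -> : partial j (fun x => \sum_l t 0 l * f l x) = fun x => \sum_l t 0 l * partial j (f l) x.
  apply/funext => x.
  have h : is_derive x (delta_mx 0 j : 'rV[R]_n) (fun x => \sum_l t 0 l * f l x)
      (\sum_l t 0 l * partial j (f l) x).
    apply: (@is_derive_comb R n r (fun l => t 0 l) f (fun l => partial j (f l))) => l.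
    exact: (Ck_is_derive _ _ (hf l)).
  by rewrite /partial (@derive_val _ _ _ _ _ _ _ h).
have h : is_derive x0 (delta_mx 0 i : 'rV[R]_n) (fun x => \sum_l t 0 l * partial j (f l) x)
    (\sum_l t 0 l * partial i (partial j (f l)) x0).
  apply: (@is_derive_comb R n r (fun l => t 0 l) (fun l => partial j (f l)) (fun l => partial i (partial j (f l)))) => l.
  exact: (Ck_is_derive _ _ (Ck_partial j (hf l))).
rewrite /partial (@derive_val _ _ _ _ _ _ _ h).
by apply: eq_bigr => l _; rewrite !mxE.
Qed.

(** [rho] is so small that second derivatives differ from those at x0 by at most [eta]. Freezing the
    Hessian at x0 in the inverse bound then costs at most half of the quantity being estimated, and
    this half is absorbed; hence the value of [eta]. *)
Lemma curv_good f l0 x0 : (n.+2 <= l0)%N -> (2 <= n)%N -> (forall l, Ck l0 (f l)) ->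
  curvature_condition f x0 -> exists rho C, good f x0 rho C.
Proof.
move=> hl n2 hf hc.
have f2 l : Ck 2 (f l) by apply: Ck_le (hf l); apply: leq_trans hl; rewrite !ltnS; lia.
pose H l := hessian (f l) x0.
have [C0 C00 hC0] : exists2 C : R, 0 < C & forall (t : 'rV[R]_r) (v : 'rV[R]_n) (e : R),
    (forall j, `|(v *m (\sum_l t 0 l *: H l)) 0 j| <= e) -> forall l i, `|t 0 l| * `|v 0 i| <= C * e.
  by apply: inv_bound => t /hc; rewrite (hessianE _ _ f2).
have [M1 [M11 M1a M1b]] : exists M1 : R, [/\ 1 <= M1,
    forall l i (m : nat), (m <= n.+2)%N -> `|iparts i m (f l) x0| + 1 <= M1 &
    forall l i j, `|partial i (partial j (f l)) x0| + 1 <= M1].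
  pose S1 : R := \sum_l \sum_i \sum_(m < n.+3) `|iparts i m (f l) x0|.
  pose S2 : R := \sum_l \sum_i \sum_j `|partial i (partial j (f l)) x0|.
  pose M1 : R := 1 + S1 + S2.
  have S10 : 0 <= S1 by do 3 (apply: sumr_ge0 => ? _).
  have S20 : 0 <= S2 by do 3 (apply: sumr_ge0 => ? _).
  have M1a l i (m : nat) : (m <= n.+2)%N -> `|iparts i m (f l) x0| + 1 <= M1.
    move=> hm; have hm' : (m < n.+3)%N by rewrite ltnS.
    suff : `|iparts i m (f l) x0| <= S1 by rewrite /M1; lra.
    apply: le_trans (ler_sum_term (F := fun l => \sum_i \sum_(m < n.+3) `|iparts i m (f l) x0|) l _).
      apply: le_trans (ler_sum_term (F := fun i => \sum_(m < n.+3) `|iparts i m (f l) x0|) i _).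
        exact: (ler_sum_term (F := fun m : 'I_n.+3 => `|iparts i m (f l) x0|) (Ordinal hm')).
      by move=> ?; apply: sumr_ge0.
    by move=> ?; do 2 (apply: sumr_ge0 => ? _).
  have M1b l i j : `|partial i (partial j (f l)) x0| + 1 <= M1.
    suff : `|partial i (partial j (f l)) x0| <= S2 by rewrite /M1; lra.
    apply: le_trans (ler_sum_term (F := fun l => \sum_i \sum_j `|partial i (partial j (f l)) x0|) l _).
      apply: le_trans (ler_sum_term (F := fun i => \sum_j `|partial i (partial j (f l)) x0|) i _).
        exact: (ler_sum_term (F := fun j => `|partial i (partial j (f l)) x0|) j).
      by move=> ?; apply: sumr_ge0.
    by move=> ?; do 2 (apply: sumr_ge0 => ? _).
  have M11 : 1 <= M1 by rewrite /M1; lra.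
  by exists M1.
have [eta eta0 heta] : exists2 eta, 0 < eta & C0 * n%:R * r%:R * eta <= 1 / 2.
  have np : 0 < n%:R :> R by rewrite ltr0n; apply: leq_trans n2.
  have rp : 0 <= r%:R :> R by [].
  have Cn : 0 < C0 * n%:R by rewrite mulr_gt0.
  have Dp : 0 < 2 * C0 * n%:R * (r%:R + 1) by rewrite !mulr_gt0 //; lra.
  exists (2 * C0 * n%:R * (r%:R + 1))^-1; first by rewrite invr_gt0.
  by rewrite ler_pdivrMr //; lra.
have nearA : \forall d \near (0 : R)^'+, forall lim : 'I_r * 'I_n * 'I_n.+3,
    forall z, supd z x0 d -> `|iparts lim.1.2 lim.2 (f lim.1.1) z - iparts lim.1.2 lim.2 (f lim.1.1) x0| <= 1.
  apply: filter_forall => -[[l i] m] /=; apply: cont_near => //.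
  apply: (@Ck_cont _ _ 0); apply: Ck_iparts; apply: Ck_le (hf l).
  by rewrite add0n; apply: leq_trans hl; rewrite -ltnS.
have nearB : \forall d \near (0 : R)^'+, forall lij : 'I_r * 'I_n * 'I_n,
    forall z, supd z x0 d -> `|partial lij.1.2 (partial lij.2 (f lij.1.1)) z - partial lij.1.2 (partial lij.2 (f lij.1.1)) x0| <= Num.min eta 1.
  apply: filter_forall => -[[l i] j] /=; apply: cont_near; last by rewrite lt_min eta0 ltr01.
  by apply: (@Ck_cont _ _ 0); apply: Ck_partial; apply: Ck_partial.
have [rho [/andP[rho0 rho1] hA hB]] : exists rho : R, [/\ 0 < rho <= 1,
    forall lim : 'I_r * 'I_n * 'I_n.+3,
    forall z, supd z x0 rho -> `|iparts lim.1.2 lim.2 (f lim.1.1) z - iparts lim.1.2 lim.2 (f lim.1.1) x0| <= 1 &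
    forall lij : 'I_r * 'I_n * 'I_n,
    forall z, supd z x0 rho -> `|partial lij.1.2 (partial lij.2 (f lij.1.1)) z - partial lij.1.2 (partial lij.2 (f lij.1.1)) x0| <= Num.min eta 1].
  near (0 : R)^'+ => d; exists d; split.
  - apply/andP; split; first by near: d; exact: nbhs_right_gt.
    by near: d; apply: nbhs_right_le; exact: ltr01.
  - by near: d.
  - by near: d.
have pb l i j z : supd z x0 rho -> `|partial i (partial j (f l)) z| <= M1.
  move=> hz; have := hB (l, i, j) z hz; rewrite /= le_min => /andP[_ h1].
  exact: norm_near h1 (M1b l i j).
have lipG l x x' d : supd x x0 rho -> supd x' x0 rho -> supd x' x d ->
    supd (grad f l x') (grad f l x) (n%:R * (M1 * d)).
  move=> hx hx' hd j; rewrite !mxE.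
  apply: (lip_path (gi := fun i => partial i (partial j (f l)))) => //.
    by move=> i y; exact: (Ck_is_derive _ _ (Ck_partial j (f2 l))).
  by move=> z i hz; apply: pb; exact: (btw_cube hz).
have nM : n%:R * M1 >= 0 by rewrite mulr_ge0 //; lra.
exists rho, (1 + M1 + n%:R * M1 + n%:R * (n%:R * M1) + 2 * C0).
have nnM : 0 <= n%:R * (n%:R * M1) by rewrite mulr_ge0.
split; [by rewrite rho0 rho1|by lra|split].
- move=> x x' d hx hx' hd l.
  have d0 : 0 <= d by apply: le_trans (normr_ge0 _) (hd (Ordinal (ltnW n2))).
  pose g z := f l z - \sum_i grad f l x 0 i * z 0 i.
  have -> : f l x' - f l x - \sum_i grad f l x 0 i * (x' 0 i - x 0 i) = g x' - g x.
    by rewrite /g; under eq_bigr do rewrite mulrBr; rewrite sumrB; ring.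
  have := @lip_path _ _ g (fun i z => partial i (f l) z - grad f l x 0 i) (n%:R * (M1 * d)) d x x'.
  move=> /(_ _ hd) h; apply: le_trans (h _ _) _.
  + move=> i y; apply: is_deriveB; first exact: (Ck_is_derive _ _ (f2 l)).
    apply: is_derive_affine => u; rewrite (eq_bigr (fun j => u * (grad f l x 0 j * (j == i)%:R) + grad f l x 0 j * y 0 j)); last first.
      by move=> j _; rewrite !mxE eqxx /=; ring.
    rewrite big_split /= -mulr_sumr; congr (_ * _ + _).
    rewrite (bigD1 i) //= eqxx mulr1 big1 ?addr0 // => j ji.
    by rewrite (negbTE ji) mulr0.
  + move=> z i hz; have hz' := btw_cube hz hx hx'.
    by have := lipG l x z d hx hz' (btw_supd hz hd) i; rewrite !mxE.
  have dd : 0 <= d ^+ 2 by apply: sqr_ge0.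
  have e1 : 0 <= (1 + M1 + n%:R * M1 + 2 * C0) * d ^+ 2 by rewrite mulr_ge0 //; lra.
  by move: e1; rewrite expr2; lra.
- move=> x x' d hx hx' hd l i; apply: le_trans (lipG l x x' d hx hx' hd i) _.
  have d0 : 0 <= d by apply: le_trans (normr_ge0 _) (hd i).
  have e1 : 0 <= (1 + M1 + n%:R * (n%:R * M1) + 2 * C0) * d by rewrite mulr_ge0 //; lra.
  by lra.
- move=> x x' e t hx hx' he l i.
  pose v : 'rV[R]_n := x' - x; pose t' : 'rV[R]_r := \row_l t l.
  pose m := \big[Num.max/0]_l `|t l|; pose d := \big[Num.max/0]_i `|v 0 i|.
  have hm k : `|t k| <= m by rewrite /m (bigD1 k) //= le_max lexx.
  have hd : supd x' x d by move=> k; rewrite /d (bigD1 k) //= le_max !mxE lexx.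
  have m0 : 0 <= m by apply: le_trans (hm l).
  have d0 : 0 <= d by apply: le_trans (normr_ge0 _) (hd i).
  have hdv k : `|v 0 k| <= d by have := hd k; rewrite !mxE.
  have maxP (I : finType) (F : I -> R) (k0 : I) (c : R) : (forall k, `|F k| <= c) -> \big[Num.max/0]_k `|F k| <= c.
    by move=> h; elim/big_ind: _ => [|a b ha hb|k _]; [exact: le_trans (normr_ge0 _) (h k0)|rewrite ge_max ha|].
  have key j : `|(v *m (\sum_l t' 0 l *: H l)) 0 j| <= e + n%:R * (r%:R * (m * eta) * d).
    pose g z := \sum_l t l * partial j (f l) z - (z *m (\sum_l t' 0 l *: H l)) 0 j.
    have -> : (v *m (\sum_l t' 0 l *: H l)) 0 j = (gradF f t x' 0 j - gradF f t x 0 j) - (g x' - g x).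
      by rewrite /g /v mulmxBl !mxE; ring.
    apply: le_trans (ler_normB _ _) _; apply: lerD; first exact: he.
    apply: (lip_path (gi := fun i z => \sum_l t l * partial i (partial j (f l)) z - (\sum_l t' 0 l *: H l) i j)) => //.
      move=> i' y; apply: is_deriveB.
        apply: (@is_derive_comb R n r t (fun l => partial j (f l)) (fun l => partial i' (partial j (f l)))) => k.
        exact: (Ck_is_derive _ _ (Ck_partial j (f2 k))).
      apply: is_derive_affine => u; rewrite mulmxDl mxE -scalemxAl mxE; congr (_ * _ + _).
      by rewrite -rowE mxE.
    move=> z i' hz; have hz' := btw_cube hz hx hx'.
    rewrite summxE -sumrB; apply: le_trans (ler_norm_sum _ _ _) _.
    apply: sum_le_ord => k; rewrite !mxE -mulrBr normrM; apply: ler_pM => //.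
    by have := hB (k, i', j) z hz'; rewrite /= le_min => /andP[].
  have h2 := hC0 t' v _ key.
  have h3 k k' : `|t k| * `|v 0 k'| <= C0 * (e + n%:R * (r%:R * (m * eta) * d)).
    by have := h2 k k'; rewrite mxE.
  have md : m * d <= C0 * (e + n%:R * (r%:R * (m * eta) * d)).
    set B := C0 * _ in h3 *.
    have [m00|mn0] := eqVneq m 0; first by rewrite m00 mul0r; apply: le_trans (h3 l i); rewrite mulr_ge0.
    have mp : 0 < m by rewrite lt_neqAle eq_sym mn0.
    rewrite mulrC -ler_pdivlMr //; apply: (maxP _ _ i) => k'.
    rewrite ler_pdivlMr // mulrC.
    have [v0|vn0] := eqVneq (v 0 k') 0; first by rewrite v0 normr0 mulr0; apply: le_trans (h3 l i); rewrite mulr_ge0.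
    have vp : 0 < `|v 0 k'| by rewrite normr_gt0.
    by rewrite -ler_pdivlMr //; apply: (maxP _ _ l) => k; rewrite ler_pdivlMr.
  have small : C0 * (n%:R * (r%:R * (m * eta) * d)) <= 1 / 2 * (m * d).
    have -> : C0 * (n%:R * (r%:R * (m * eta) * d)) = (C0 * n%:R * r%:R * eta) * (m * d) by ring.
    by rewrite ler_wpM2r ?mulr_ge0.
  have md2 : m * d <= 2 * C0 * e by move: md; rewrite mulrDr; lra.
  apply: le_trans (_ : m * d <= _); first by apply: ler_pM => //; have := hd i.
  have e0 : 0 <= e by apply: le_trans (normr_ge0 _) (he i).
  have : 0 <= (1 + M1 + n%:R * M1 + n%:R * (n%:R * M1)) * e by rewrite mulr_ge0 //; lra.
  by lra.
- move=> x m i l hm hx; have hm' : (m < n.+3)%N by rewrite ltnS.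
  have h1 := hA (l, i, Ordinal hm') x hx; rewrite /= in h1.
  by have := norm_near h1 (M1a l i m hm); lra.
Unshelve. all: by end_near.
Qed.

End Good.

(** * Affine lattice boxes *)

Section AffineBoxes.
Context {R : realType} {n : nat} {Y : finType}.
Variables (X G : Y -> 'rV[R]_n) (g : Y -> R) (G0 : Y -> 'rV[R]_n) (g0 : Y -> R).
Implicit Types (u : lat n) (y : Y).

Definition paff u y i : R := (u.1.1)%:~R * G y 0 i + G0 y 0 i - (u.1.2 0 i)%:~R.
Definition psaff u y : R :=
  (u.1.1)%:~R * g y + g0 y - \sum_i X y 0 i * (u.1.2 0 i)%:~R + (u.2)%:~R.

Lemma paff_sub u u' y i : paff u y i - paff u' y i = - tau (G y) (subl u u') i.
Proof. by rewrite tau_subl /paff /tau; ring. Qed.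

Lemma psaff_sub u u' y :
  psaff u y - psaff u' y = kap (G y) (X y) (dualg X G g y) (subl u u').
Proof.
have E v : kap (G y) (X y) (dualg X G g y) v = psaff v y - g0 y.
  rewrite /kap /psaff /dualg /dot /tau.
  have -> : \sum_i X y 0 i * ((v.1.2 0 i)%:~R - (v.1.1)%:~R * G y 0 i) =
    \sum_i X y 0 i * (v.1.2 0 i)%:~R - (v.1.1)%:~R * \sum_i X y 0 i * G y 0 i.
    by rewrite mulr_sumr -sumrB; apply: eq_bigr => i _; ring.
  by ring.
by rewrite kap_subl !E; ring.
Qed.

Definition affbox y (S T K : R) : set (lat n) :=
  [set u | [/\ `|(u.1.1)%:~R| <= S, (forall i, `|paff u y i| <= T) & `|psaff u y| <= K]].

Lemma affbox_subl y (S T K : R) u u0 : affbox y S T K u -> affbox y S T K u0 ->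
  inbox (G y) (X y) (dualg X G g y) (2 * S) (2 * T) (2 * K) (subl u u0).
Proof.
move=> [h1 h2 h3] [k1 k2 k3]; split.
- by rewrite /= rmorphB /=; apply: le_trans (ler_normB _ _) _; lra.
- move=> i; rewrite -normrN -paff_sub; apply: le_trans (ler_normB _ _) _.
  by have := h2 i; have := k2 i; lra.
- by rewrite -psaff_sub; apply: le_trans (ler_normB _ _) _; lra.
Qed.

Lemma finite_affbox y (S T K : R) : finite_set (affbox y S T K).
Proof.
have [[u0 h0]|h0] := pselect (exists u0, affbox y S T K u0); last first.
  by apply: (sub_finite_set (B := set0)) => // u hu; apply: h0; exists u.
apply: (sub_finite_set (B := (fun v => addm 1 v u0) @`
   inbox (G y) (X y) (dualg X G g y) (2 * S) (2 * T) (2 * K))).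
  move=> u hu; exists (subl u u0); first exact: affbox_subl hu h0.
  rewrite /addm /subl /scalel /=; case: u {hu} => [[a b] c] /=; congr (_, _, _); try ring.
  by apply/rowP => i; rewrite !mxE; ring.
by apply: finite_image; exact: finite_inbox.
Qed.

Lemma cnt_affbox y (S T K : R) : 0 <= S -> 0 <= T -> 0 <= K ->
  cnt (affbox y S T K) <= cnt (inbox (G y) (X y) (dualg X G g y) (2 * S) (2 * T) (2 * K)) :> R.
Proof.
move=> S0 T0 K0.
have [[u0 h0]|h0] := pselect (exists u0, affbox y S T K u0); last first.
  apply: cnt_le; first exact: finite_inbox.
  by move=> u hu; exfalso; apply: h0; exists u.
apply: (cnt_inj (f := fun u => subl u u0)); first exact: finite_inbox.
  by move=> u hu; exact: affbox_subl.
by move=> u v _ _ /subl_injl.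
Qed.

End AffineBoxes.

(** * Counting vectors that are small to first order *)

Section Counting.
Context {R : realType} {n : nat}.
Implicit Types (Y : finType).

Lemma int_lt1 (k : int) : `|k%:~R| < 1 :> R -> k = 0.
Proof. by rewrite -intr_norm -[1]/(1%:~R) ltr_int; lia. Qed.

Lemma expR_absorb (b K p : R) : 0 <= K -> 1 <= p -> K * expR (b * p) <= expR ((K + b) * p).
Proof.
by move=> K0 p1; rewrite mulrDl expRD ler_wpM2r ?expR_ge0 // le_expR_phi.
Qed.

Lemma min_inv_bounds (Q S T K : R) : 1 <= 2 * Q -> Q <= S -> 0 <= K -> T <= 1 / 2 -> K <= 1 / 2 ->
  S * K <= 1 -> T <= Q * Num.min 1 (1 / Q) /\ K <= Q * Num.min 1 (1 / Q) ^+ 2.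
Proof.
move=> Qs QS K0 T1 K1 SK; have Q0 : 0 < Q by lra.
have [Q1|Q1] := leP 1 Q.
  have i1 : 1 / Q <= 1 by rewrite ler_pdivrMr //; lra.
  rewrite (min_r i1).
  have -> : Q * (1 / Q) = 1 by field; rewrite gt_eqF.
  have -> : Q * (1 / Q) ^+ 2 = 1 / Q by field; rewrite gt_eqF.
  split; first by lra.
  rewrite ler_pdivlMr //; apply: le_trans SK; rewrite mulrC; exact: ler_wpM2r.
have i1 : 1 <= 1 / Q by rewrite ler_pdivlMr //; lra.
by rewrite (min_l i1) expr1n mulr1; lra.
Qed.

(** About log Z shells in the first coordinate, below which only the zero vector is left. In the
    shell at Q, [nu_bound] applies with radius min (1, 1/Q), which is large enough because S K <= 1,
    and the fibres over y contribute at most a constant times (L/Q)^n. *)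
Lemma sum_dualbox (C : R) : (1 < n)%N -> 1 <= C -> exists2 b : R, 0 < b &
  forall Y (X G : Y -> 'rV[R]_n) (g : Y -> R) (L Z S T K : R), system X G g L C ->
    1 <= Z -> @C1 R n C / @cD R n * Z <= L -> Z <= L -> 0 < S <= Z -> 0 <= T <= 1 / 2 -> 0 <= K <= 1 / 2 ->
    S * K <= 1 ->
  \sum_y cnt (inbox (X y) (G y) (g y) S T K) <= expR (b * phi n Z) * L ^+ n.
Proof.
move=> n2 hC; have [b b0 hb] := @nu_bound R n C n2 hC.
pose c3 := 2 * C * 2 ^+ n.
have c30 : 0 <= c3 by rewrite /c3 !mulr_ge0 ?exprn_ge0 //; lra.
exists (C + (c3 + (b + 2))); first by lra.
move=> Y X G g L Z S T K hS Z1 hL ZL /andP[S0 SZ] /andP[T0 T1] /andP[K0 K1] SK.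
have [_ L1 hY hX _] := hS; have p1 := phi_ge1 n Z1.
have C0 : 0 <= C by lra.
have [H HZ Hle] : exists2 H : nat, S / 2 ^+ H < 1 & H%:R <= 2 * expR (2 * phi n Z).
  have l0 : 0 <= ln Z by rewrite ln_ge0.
  exists (Num.truncn (2 * ln Z)).+2.
    rewrite ltr_pdivrMr ?exprn_gt0 // mul1r; apply: le_lt_trans SZ _.
    by apply: le_lt_trans (le_2pow Z1) _; rewrite ltr_eXn2l // ltr1n.
  have h1 := @ln_le_phi R n Z Z1.
  have h2 : (Num.truncn (2 * ln Z))%:R <= 2 * ln Z by rewrite truncn_le mulr_ge0.
  have -> : ((Num.truncn (2 * ln Z)).+2)%:R = (Num.truncn (2 * ln Z))%:R + 2 :> R by rewrite -addn2 natrD.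
  by lra.
have p2 (h : nat) : 0 < 2 ^+ h :> R by rewrite exprn_gt0.
have each (h : 'I_H) : \sum_y cnt [set u | inbox (X y) (G y) (g y) S T K u /\
    S / 2 ^+ h.+1 < `|(u.1.1)%:~R| <= S / 2 ^+ h] <= expR (b * phi n Z) * (C * (2 * L) ^+ n).
  set Q := S / 2 ^+ h.+1.
  have Q2 : S / 2 ^+ h = 2 * Q by rewrite /Q exprS; field; rewrite gt_eqF.
  have Q0 : 0 < Q by rewrite divr_gt0.
  have QS : Q <= S by rewrite ler_pdivrMr // ler_peMr ?exprn_ege1 ?ler1n // ltW.
  have E0 : 0 <= expR (b * phi n Z) * (C * (2 * L) ^+ n).
    by apply: mulr_ge0; [exact: expR_ge0|apply: mulr_ge0 => //; apply: exprn_ge0; lra].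
  have [Qs|Qs] := ltP (2 * Q) 1.
    rewrite big1 // => y _; apply/eqP; rewrite eq_le cnt_ge0 andbT.
    rewrite -[leRHS](_ : cnt (set0 : set (lat n)) = 0); last by rewrite /cnt fset_set0.
    apply: cnt_le => // u [_ /andP[u1]]; rewrite Q2 => u2.
    have k0 : u.1.1 = 0 by apply: int_lt1; lra.
    by move: u1; rewrite k0 normr0; lra.
  have shE y : [set u | inbox (X y) (G y) (g y) S T K u /\ Q < `|(u.1.1)%:~R| <= S / 2 ^+ h] =
      shellbox (X y) (G y) (g y) Q (2 * Q) S T K.
    by rewrite Q2; apply/seteqP; split=> u [].
  under eq_bigr => y _ do rewrite shE.
  pose r : R := Num.min 1 (1 / Q).
  have [hr1 hr2] : T <= Q * r /\ K <= Q * r ^+ 2 := @min_inv_bounds Q S T K Qs QS K0 T1 K1 SK.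
  apply: le_trans (@sum_shellbox_le _ _ _ _ _ _ L C Q r S T K Q0 T0 C0 _ hX hr1 hr2) _; first by lra.
  have QZ : Q <= Z by lra.
  have hnu := hb Y X G g L Z hS Z1 hL Q Q0 QZ.
  apply: le_trans (ler_wpM2r _ hnu) _.
    rewrite mulr_ge0 // exprn_ge0 // addr_ge0 // mulr_ge0 ?divr_ge0 ?mulr_ge0 //; lra.
  rewrite -[leLHS]mulrA ler_wpM2l ?expR_ge0 // [leLHS]mulrCA ler_wpM2l // -exprMn.
  have -> : Q * (1 + 2 * T / Q * L) = Q + 2 * T * L by field; rewrite gt_eqF.
  have TL : 2 * T * L <= L by rewrite ler_piMl //; lra.
  have TL0 : 0 <= 2 * T * L by rewrite !mulr_ge0 //; lra.
  by rewrite lerXn2r ?nnegrE //; lra.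
have tiny y : cnt [set u | inbox (X y) (G y) (g y) S T K u /\ `|(u.1.1)%:~R| <= S / 2 ^+ H] <= 1 :> R.
  apply: le_trans (cnt_tiny_box (X y) (G y) (g y) HZ (ltac:(lra) : T < 1) (ltac:(lra) : K < 1)).
  by apply: cnt_le; [exact: finite_inbox|move=> u [[h1 h2 h3] h4]; split].
have step y : cnt (inbox (X y) (G y) (g y) S T K) <= 1 + \sum_(h < H) cnt [set u | inbox (X y) (G y) (g y) S T K u /\
    S / 2 ^+ h.+1 < `|(u.1.1)%:~R| <= S / 2 ^+ h] :> R.
  apply: le_trans (lerD (tiny y) (lexx _)).
  apply: le_trans (shell_split S H (finite_inbox (X y) (G y) (g y) S T K)).
  apply: cnt_le; first by apply: sub_finite_set (finite_inbox (X y) (G y) (g y) S T K) => u [].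
  by move=> u hu; split=> //; case: hu.
apply: le_trans (ler_sum _ (fun y _ => step y)) _.
rewrite big_split /= exchange_big /= sumr_const.
apply: le_trans (lerD (hY : _ <= _) (sum_le_ord each)) _.
have Ln : 0 <= L ^+ n by rewrite exprn_ge0 //; lra.
have e1 : 1 <= expR ((c3 + (b + 2)) * phi n Z).
  have q0 : 0 <= (c3 + (b + 2)) * phi n Z by rewrite mulr_ge0 //; lra.
  by have := expR_ge1Dx ((c3 + (b + 2)) * phi n Z); lra.
have e2 : H%:R * (expR (b * phi n Z) * (C * (2 * L) ^+ n)) <= expR ((c3 + (b + 2)) * phi n Z) * L ^+ n.
  apply: le_trans (_ : c3 * expR ((b + 2) * phi n Z) * L ^+ n <= _).
    have -> : (b + 2) * phi n Z = b * phi n Z + 2 * phi n Z by ring.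
    rewrite expRD exprMn.
    have h5 : H%:R * (expR (b * phi n Z) * (C * (2 ^+ n * L ^+ n))) <=
      2 * expR (2 * phi n Z) * (expR (b * phi n Z) * (C * (2 ^+ n * L ^+ n))).
      by apply: ler_wpM2r => //; apply: mulr_ge0; [exact: expR_ge0|rewrite !mulr_ge0 // exprn_ge0].
    by apply: le_trans h5 _; rewrite /c3 le_eqVlt; apply/orP; left; apply/eqP; ring.
  by rewrite ler_wpM2r //; exact: expR_absorb.
have e3 : (1 + C) * expR ((c3 + (b + 2)) * phi n Z) <= expR ((C + (c3 + (b + 2))) * phi n Z).
  rewrite [(C + _) * _]mulrDl expRD ler_wpM2r ?expR_ge0 //.
  by apply: le_trans (expR_ge1Dx _); rewrite lerD2l ler_peMr.
apply: le_trans (ler_wpM2r Ln e3); apply: le_trans (lerD (lexx _) e2) _.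
rewrite -mulrDl ler_wpM2r //; set e := expR _ in e1 *.
have : C * 1 <= C * e by rewrite ler_wpM2l.
by lra.
Qed.

Section AffineCount.
Variables (Y : finType) (X G : Y -> 'rV[R]_n) (g : Y -> R) (L C : R).
Variables (G0 : Y -> 'rV[R]_n) (g0 : Y -> R) (D : R).

Definition aff_stable : Prop := forall (u : lat n) y y' d, `|(u.1.1)%:~R| <= 2 * D -> supd (X y') (X y) d ->
  (forall i, `|paff G G0 u y' i - paff G G0 u y i| <= C * D * d) /\
  `|psaff X g g0 u y' - psaff X g g0 u y - \sum_i paff G G0 u y i * (X y' 0 i - X y 0 i)| <= C * D * d ^+ 2.

Definition aff_separated : Prop := forall (u : lat n) y y' T, D <= `|(u.1.1)%:~R| ->
  (forall i, `|paff G G0 u y i| <= T) -> (forall i, `|paff G G0 u y' i| <= T) ->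
  supd (X y') (X y) (C * T / D).

(** The two tolerances fit together as value and gradient of a function whose second derivatives
    have size D: moving by sqrt (kp / D) changes them by amounts of the same order. *)
Definition Pset (kp : R) : set (lat n) := [set u | `|(u.1.1)%:~R| <= 2 * D /\
  exists y, (forall i, `|paff G G0 u y i| <= Num.sqrt (D * kp)) /\ `|psaff X g g0 u y| <= kp].

Lemma finite_Pset kp : finite_set (Pset kp).
Proof.
apply: (sub_finite_set (B := \bigcup_(y in [set: Y]) affbox X G g G0 g0 y (2 * D) (Num.sqrt (D * kp)) kp)).
  by move=> u [h [y [h1 h2]]]; exists y.
by apply: bigcup_finite; [exact: finite_finset|move=> y _; exact: finite_affbox].
Qed.

Definition pm (u : lat n) y : R := \big[Num.max/0]_i `|paff G G0 u y i|.

Lemma pm_ge0 u y : 0 <= pm u y.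
Proof. by rewrite /pm; elim/big_ind: _ => // a b ha hb; rewrite le_max ha. Qed.

Lemma paff_pm u y i : `|paff G G0 u y i| <= pm u y.
Proof. by rewrite /pm (bigD1 i) //= le_max lexx. Qed.

Lemma pm_le u y c : 0 <= c -> (forall i, `|paff G G0 u y i| <= c) -> pm u y <= c.
Proof. by move=> c0 h; rewrite /pm; elim/big_ind: _ => // a b ha hb; rewrite ge_max ha. Qed.

End AffineCount.

Lemma dual_params (N c D W kp Z : R) : 0 <= N -> 0 < c <= 1 / 16 -> 1 <= D <= Z -> 1 <= W ->
    0 < kp -> 1 <= D * kp ->
  [/\ 0 < c / (2 * ((N + 2) * kp)) <= Z, 0 <= c / (4 * W) <= 1 / 2, 0 <= c / (4 * D) <= 1 / 2 &
   c / (2 * ((N + 2) * kp)) * (c / (4 * D)) <= 1].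
Proof.
move=> N0 /andP[c0 c1] /andP[D1 DZ] W1 k0 Dk.
have c1' : c <= 1 by lra.
have c0' := ltW c0.
have D0 : 0 < D by lra.
have inv (t : R) : 1 <= t -> 0 <= c / (4 * t) <= 1 / 2.
  by move=> t1; rewrite divr_ge0 ?ler_pdivrMr //; lra.
have nk : D^-1 <= 2 * ((N + 2) * kp).
  rewrite -(ler_pM2l D0) mulfV ?gt_eqF //.
  have -> : D * (2 * ((N + 2) * kp)) = (2 * (N + 2)) * (D * kp) by ring.
  by rewrite -[1]mulr1; apply: ler_pM => //; lra.
have nk0 : 0 < 2 * ((N + 2) * kp) by apply: lt_le_trans nk; rewrite invr_gt0.
have s1 : c / (2 * ((N + 2) * kp)) <= D.
  rewrite ler_pdivrMr //; apply: le_trans c1' _.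
  have : D * D^-1 <= D * (2 * ((N + 2) * kp)) by rewrite ler_pM2l.
  by rewrite mulfV ?gt_eqF.
split; rewrite ?inv //.
  by rewrite divr_gt0 //= (le_trans s1).
apply: le_trans (ler_wpM2r _ s1) _; first by case/andP: (inv D D1).
rewrite mulrA ler_pdivrMr ?mulr_gt0 // mul1r.
by have : D * c <= D * 1 by [rewrite ler_pM2l]; lra.
Qed.

(** A vector that is small at y stays small at all points within r = W/(CD), where W^2 = D kp.
    Summing over y and dualising leads to boxes with first side of order 1/kp, to which
    [sum_dualbox] applies. The volume is of order D W^n kp, and division by r^n gives D^(n+1) kp. *)
Lemma count_P (C : R) : (1 < n)%N -> 1 <= C -> exists2 b : R, 0 < b &
  forall Y (X G : Y -> 'rV[R]_n) (g : Y -> R) (L : R) (G0 : Y -> 'rV[R]_n) (g0 : Y -> R) (D Z kp : R),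
    system X G g L C -> aff_stable X G g C G0 g0 D -> 1 <= D <= Z ->
    @C1 R n C / @cD R n * Z <= L -> C * Z <= L -> 1 / D <= kp -> Num.sqrt (D * kp) <= C * D ->
  cnt (Pset X G g G0 g0 D kp) <= expR (b * phi n Z) * (D ^+ n.+1 * kp).
Proof.
move=> n2 hC; have [b b0 hb] := sum_dualbox n2 hC.
have c0 := @cD_gt0 R n; have c1 := @cD_le R n; have cN0 := @cN_gt0 R n.
pose C2' : R := 4 / (@cN R n) ^+ n.+2.
have C20 : 0 <= C2' by rewrite divr_ge0 // exprn_ge0 // ltW.
have nn : 0 <= n%:R + 2 :> R by apply: addr_ge0.
pose K0 : R := C * C ^+ n * C2' * (4 * 4 ^+ n * (2 * (n%:R + 2))).
have K00 : 0 <= K0 by rewrite /K0; do 3 (apply: mulr_ge0 => //); rewrite ?exprn_ge0 //; lra.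
exists (K0 + b); first by lra.
move=> Y X G g L G0 g0 D Z kp hS hst /andP[D1 DZ] hL CZ k1 k2.
have [_ L1 hY hX hG] := hS; have [_ _ hlo _] := hX.
have D0 : 0 < D by lra.
have kp0 : 0 < kp by apply: lt_le_trans k1; rewrite divr_gt0.
set W := Num.sqrt (D * kp) in k2 *.
have W2 : W ^+ 2 = D * kp by rewrite /W sqr_sqrtr // mulr_ge0 // ltW.
have Dk : 1 <= D * kp by rewrite mulrC -ler_pdivrMr.
have W1 : 1 <= W by rewrite -sqrtr1 /W ler_sqrt //; lra.
have W0 : 0 < W by lra.
have CD0 : 0 < C * D by rewrite mulr_gt0 //; lra.
pose r := W / (C * D).
have r0 : 0 < r by rewrite divr_gt0.
have r1 : r <= 1 by rewrite ler_pdivrMr // mul1r.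
have L0 : 0 < L by lra.
have CDL : C * D <= L by apply: le_trans CZ; rewrite ler_wpM2l //; lra.
have rL : L^-1 <= r.
  rewrite /r ler_pdivlMr // mulrC ler_pdivrMr //; apply: le_trans CDL _.
  by rewrite ler_peMl // ltW.
have CDr : C * D * r = W by rewrite /r mulrC divfK // gt_eqF.
have Wr : W * r <= kp.
  have Cp : 0 < C by lra.
  have -> : W * r = kp / C by rewrite /r mulrA -expr2 W2; field; rewrite !gt_eqF.
  by rewrite ler_pdivrMr // ler_peMr // ltW.
have main : cnt (Pset X G g G0 g0 D kp) * ((r * L) ^+ n / C) <=
    \sum_y cnt (affbox X G g G0 g0 y (2 * D) (2 * W) ((n%:R + 2) * kp)).
  apply: (@double_count_ge _ _ _ (fun y u => affbox X G g G0 g0 y (2 * D) (2 * W) ((n%:R + 2) * kp) u)).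
  - exact: finite_Pset.
  - by move=> y; exact: finite_affbox.
  move=> u [hs [y [h1 h2]]].
  rewrite ler_pdivrMr; last by lra.
  rewrite [leRHS]mulrC; apply: le_trans (hlo y r _) _; first by rewrite rL r1.
  rewrite ler_pM2l; last by lra.
  rewrite ler_nat; apply/subset_leq_card/fintype.subsetP => y' /asboolP hy.
  apply/asboolP; have [q1 q2] := hst u y y' r hs hy.
  split=> //.
    move=> i; have := q1 i; have := h1 i; rewrite -/W CDr.
    have := ler_normD (paff G G0 u y' i - paff G G0 u y i) (paff G G0 u y i).
    by rewrite subrK; lra.
  have q3 : `|\sum_i paff G G0 u y i * (X y' 0 i - X y 0 i)| <= n%:R * kp.
    apply: le_trans (ler_norm_sum _ _ _) _; apply: sum_le_ord => i.
    rewrite normrM; apply: le_trans Wr; apply: ler_pM => //; exact: hy.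
  have q4 : C * D * r ^+ 2 <= kp by rewrite expr2 mulrA CDr.
  set a := \sum_i _ in q2 q3.
  have -> : psaff X g g0 u y' = (psaff X g g0 u y' - psaff X g g0 u y - a) + a + psaff X g g0 u y by ring.
  apply: le_trans (ler_normD _ _) _; apply: le_trans (lerD (ler_normD _ _) (lexx _)) _.
  by lra.
have bound y : cnt (affbox X G g G0 g0 y (2 * D) (2 * W) ((n%:R + 2) * kp)) <=
   C2' * (4 * D * (4 * W) ^+ n * (2 * ((n%:R + 2) * kp))) *
   cnt (inbox (X y) (G y) (g y) (@cD R n / (2 * ((n%:R + 2) * kp))) (@cD R n / (4 * W)) (@cD R n / (4 * D))).
  have nk : 0 < (n%:R + 2) * kp by rewrite mulr_gt0 // ltr_wpDl.
  apply: le_trans (cnt_affbox _ _ _ _ _ _ _ _ _) _; [lra|lra|exact: ltW|].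
  have -> : 2 * (2 * D) = 4 * D by ring.
  have -> : 2 * (2 * W) = 4 * W by ring.
  apply: le_trans (lattice_duality _ _ _ _ _ _) _; [lra|lra|lra|].
  have -> : dot (G y) (X y) - dualg X G g y = g y by rewrite /dualg dotC; ring.
  by rewrite lexx.
have hsum : \sum_y cnt (inbox (X y) (G y) (g y) (@cD R n / (2 * ((n%:R + 2) * kp))) (@cD R n / (4 * W)) (@cD R n / (4 * D)))
    <= expR (b * phi n Z) * L ^+ n.
  have c16 : 0 < @cD R n <= 1 / 16 by rewrite c0 c1.
  have DZ' : 1 <= D <= Z by rewrite D1.
  have [p1 p2 p3 p4] := dual_params (ler0n R n) c16 DZ' W1 kp0 Dk.
  apply: (hb Y X G g L Z) => //; first by case/andP: DZ'; exact: le_trans.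
  by apply: le_trans CZ; rewrite ler_peMl //; apply: le_trans DZ; exact: le_trans D1.
have BB0 : 0 <= C2' * (4 * D * (4 * W) ^+ n * (2 * ((n%:R + 2) * kp))).
  have k0 := ltW kp0; have d0 := ltW D0; have w0 := ltW W0.
  apply: mulr_ge0 => //; apply: mulr_ge0; last by apply: mulr_ge0 => //; exact: mulr_ge0.
  by apply: mulr_ge0; [exact: mulr_ge0|apply: exprn_ge0; exact: mulr_ge0].
have fin : cnt (Pset X G g G0 g0 D kp) * ((r * L) ^+ n / C) <=
    C2' * (4 * D * (4 * W) ^+ n * (2 * ((n%:R + 2) * kp))) * (expR (b * phi n Z) * L ^+ n).
  apply: le_trans main _; apply: le_trans (ler_sum _ (fun y _ => bound y)) _.
  by rewrite -mulr_sumr; exact: ler_wpM2l.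
have Cp : 0 < C by lra.
have rLn : 0 < (r * L) ^+ n / C.
  by apply: divr_gt0 => //; apply: exprn_gt0; exact: mulr_gt0.
rewrite -(ler_pM2r rLn); apply: le_trans fin _.
have rn : (r * L) ^+ n = W ^+ n * L ^+ n / (C ^+ n * D ^+ n).
  by rewrite /r exprMn expr_div_n exprMn mulrAC.
have Cn : C ^+ n != 0 by rewrite expf_neq0 // gt_eqF.
have Dn : D ^+ n != 0 by rewrite expf_neq0 // gt_eqF.
have E : C2' * (4 * D * (4 * W) ^+ n * (2 * ((n%:R + 2) * kp))) * (expR (b * phi n Z) * L ^+ n) =
   K0 * expR (b * phi n Z) * (D ^+ n.+1 * kp) * ((r * L) ^+ n / C).
  rewrite rn [(4 * W) ^+ n]exprMn [D ^+ n.+1]exprS /K0.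
  move: (expR _) (C ^+ n) (D ^+ n) (W ^+ n) (L ^+ n) (4 ^+ n) Cn Dn => e cn dn wn ln fn Cn Dn.
  by clear -Cn Dn Cp; field; rewrite Cn Dn gt_eqF.
rewrite E ler_pM2r //; apply: ler_wpM2r.
  by apply: mulr_ge0; [apply: exprn_ge0; exact: ltW|exact: ltW].
by apply: expR_absorb => //; apply: phi_ge1; lra.
Qed.

(** By separation the points with gradient at most 2^h / th are within C 2^h / (th D) of each other.
    Level h thus has about (2^h L / (th D))^n points of weight 2^(-hn), so that all levels
    contribute alike; hence the factor H + 1. *)
Lemma fiber_sum (C : R) Y (X G : Y -> 'rV[R]_n) (g : Y -> R) (L : R) (G0 : Y -> 'rV[R]_n) (D th : R)
    (H : nat) (u : lat n) :
  1 <= C -> half_system X G g L C -> aff_separated X G C G0 D -> 0 < D -> 0 < th -> th * D <= L ->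
  D <= `|(u.1.1)%:~R| -> (forall y, th * pm G G0 u y <= 2 ^+ H) ->
  \sum_y (1 + th * pm G G0 u y) ^- n <= (H.+1)%:R * (C * (4 * C) ^+ n * (L / (th * D)) ^+ n).
Proof.
move=> C1 [_ _ _ hup] hsep D0 th0 thL hu hH.
have L0 : 0 < L by apply: lt_le_trans thL; rewrite mulr_gt0.
have p2 (h : nat) : 0 < 2 ^+ h :> R by rewrite exprn_gt0.
have thD : 0 < th * D by rewrite mulr_gt0.
pose wt (h : nat) y : R := (`[< th * pm G G0 u y <= 2 ^+ h >])%:R * (2 / 2 ^+ h) ^+ n.
have wt0 h y : 0 <= wt h y by rewrite mulr_ge0 ?exprn_ge0 ?divr_ge0 // ltW.
have dom y : (1 + th * pm G G0 u y) ^- n <= \sum_(h < H.+1) wt h y.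
  have t0 : 0 <= th * pm G G0 u y by rewrite mulr_ge0 ?pm_ge0 // ltW.
  have ex : exists h, th * pm G G0 u y <= 2 ^+ h by exists H.
  case: (ex_minnP ex) => h hh hmin.
  have hH' : (h < H.+1)%N by rewrite ltnS; exact: hmin.
  apply: (@le_trans _ _ (wt h y)); last first.
    exact: (ler_sum_term (F := fun h : 'I_H.+1 => wt h y) (Ordinal hH') (fun j => wt0 j y)).
  rewrite /wt (asboolT hh) mul1r -[leLHS]exprVn lerXn2r ?nnegrE ?invr_ge0 ?divr_ge0 ?addr_ge0 ?(ltW (p2 h)) //.
  rewrite -[leRHS]invrK lef_pV2 ?posrE ?invr_gt0 ?divr_gt0 //; last by lra.
  rewrite invf_div ler_pdivrMr //.
  case: h hh hmin {hH'} => [|h] hh hmin; first by rewrite expr0; lra.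
  have : ~~ (th * pm G G0 u y <= 2 ^+ h) by apply/negP => /hmin; rewrite ltnn.
  by rewrite -ltNge exprS; lra.
apply: le_trans (ler_sum _ (fun y _ => dom y)) _; rewrite exchange_big /=.
apply: sum_le_ord => h; rewrite -mulr_suml.
have CL : 0 < C * L by rewrite mulr_gt0 //; lra.
have [[y0 hy0]|none] := pselect (exists y, th * pm G G0 u y <= 2 ^+ h); last first.
  rewrite big1 ?mul0r => [|y _]; last by rewrite asboolF // => hy; apply: none; exists y.
  by rewrite !mulr_ge0 ?exprn_ge0 ?divr_ge0 ?mulr_ge0 //; lra.
have pl y : th * pm G G0 u y <= 2 ^+ h -> forall i, `|paff G G0 u y i| <= 2 ^+ h / th.
  move=> hy i; apply: le_trans (paff_pm _ _ _ _ _) _.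
  by rewrite ler_pdivlMr // mulrC.
set T := 2 ^+ h / th in pl.
have T0 : 0 < T by rewrite divr_gt0.
have r0 : 0 <= C * T / D.
  by apply: divr_ge0; [apply: mulr_ge0; [lra|exact: ltW]|exact: ltW].
have cc : \sum_y (`[< th * pm G G0 u y <= 2 ^+ h >])%:R <= C * (1 + C * T / D * L) ^+ n.
  apply: le_trans (hup y0 _ r0).
  rewrite -natr_sum ler_nat -big_mkcond /= sum1_card.
  apply/subset_leq_card/fintype.subsetP => y; rewrite inE => /asboolP hy; apply/asboolP.
  exact: (hsep u y0 y T hu (pl y0 hy0) (pl y hy)).
apply: le_trans (ler_wpM2r _ cc) _; first by rewrite exprn_ge0 // divr_ge0 // ltW.
have h1 : 2 / 2 ^+ h <= 2 :> R by rewrite ler_pdivrMr // ler_peMr // exprn_ege1 // ler1n.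
have h2 : 1 <= L / (th * D) by rewrite ler_pdivlMr // mul1r.
have h3 : 1 <= C * (L / (th * D)) by rewrite -[1]mulr1; apply: ler_pM.
have key : (1 + C * T / D * L) * (2 / 2 ^+ h) <= 4 * C * (L / (th * D)).
  have -> : (1 + C * T / D * L) * (2 / 2 ^+ h) = 2 / 2 ^+ h + 2 * (C * (L / (th * D))).
    by rewrite /T; field; rewrite !gt_eqF.
  by lra.
have k0 : 0 <= (1 + C * T / D * L) * (2 / 2 ^+ h).
  apply: mulr_ge0; last by rewrite divr_ge0 // ltW.
  by apply: addr_ge0 => //; apply: mulr_ge0 => //; exact: ltW.
rewrite -[leLHS]mulrA -[leRHS]mulrA ler_wpM2l //; first by lra.
rewrite -[leLHS]exprMn -[leRHS]exprMn lerXn2r ?nnegrE //.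
exact: le_trans k0 key.
Qed.

End Counting.

(** * Summation over vectors and points together *)

Section NearSum.
Context {R : realType} {n : nat}.

(** The level of a pair (i, y) is the least h for which 2^h bounds 1, D |psaff| and pm^2. By
    [count_P] about D^n 2^h vectors reach level h, and there the hypotheses on V bring a factor of
    order D / (Q 2^h), so that levels contribute alike. The sum over y that remains is
    [fiber_sum]. *)
Lemma near_sum (C : R) : (1 < n)%N -> 1 <= C -> exists2 b : R, 0 < b &
  forall (Y : finType) (X G : Y -> 'rV[R]_n) (g : Y -> R) (L : R) (G0 : Y -> 'rV[R]_n) (g0 : Y -> R) (D Z th Q B : R)
    (Ix : finType) (ix : Ix -> int * 'rV[int]_n) (mm : Ix -> Y -> int) (V : Ix -> Y -> R),
    let lt i y : lat n := ((ix i).1, (ix i).2, mm i y) in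
    system X G g L C -> aff_stable X G g C G0 g0 D -> aff_separated X G C G0 D -> 1 <= D <= Z ->
    @C1 R n C / @cD R n * Z <= L -> C * Z <= L -> 0 < th -> th * D <= L -> 0 < Q -> D <= 2 * Q -> 0 <= B ->
    injective ix -> (forall i, D <= `|((ix i).1)%:~R : R| <= 2 * D) ->
    (forall i y, pm G G0 (lt i y) y ^+ 2 <= (C * D) ^+ 2 / 2) ->
    (forall i y, th * pm G G0 (lt i y) y <= (C * Z) ^+ 2) ->
    (forall i y, `|psaff X g g0 (lt i y) y| <= 1 / 2) ->
    (forall i y, [/\ V i y <= B * (1 + th * pm G G0 (lt i y) y) ^- n,
       V i y * (Q * `|psaff X g g0 (lt i y) y|) <= B * (1 + th * pm G G0 (lt i y) y) ^- n &
       V i y * (Q * (pm G G0 (lt i y) y ^+ 2 / D)) <= B * (1 + th * pm G G0 (lt i y) y) ^- n]) ->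
  \sum_i \sum_y V i y <= expR (b * phi n Z) * (B * D ^+ n * (L / (th * D)) ^+ n).
Proof.
move=> n2 hC; have [b b0 hb] := count_P n2 hC.
have lC : 0 <= ln C by rewrite ln_ge0.
pose c4 : R := 4 * (1 + 2 * ln C).
have c40 : 0 <= c4 by rewrite /c4; lra.
pose Kf : R := 4 * (C * (4 * C) ^+ n).
have Kf0 : 0 <= Kf by rewrite /Kf !mulr_ge0 ?exprn_ge0 //; lra.
exists (c4 * c4 * Kf + (b + 4)).
  have : 0 <= c4 * c4 * Kf by apply: mulr_ge0 => //; apply: mulr_ge0.
  by lra.
move=> Y X G g L G0 g0 D Z th Q B Ix ix mm V lt hS hst hsep /andP[D1 DZ] hL CZ th0 thL Q0 DQ B0 ixI hs hpm hth hpsi hV.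
have Z1 : 1 <= Z by lra.
have p1 := phi_ge1 n Z1; have lp := @ln_le_phi R n Z Z1.
have lZ : 0 <= ln Z by rewrite ln_ge0.
have D0 : 0 < D by lra.
have [_ _ _ hX _] := hS.
pose M := (C * Z) ^+ 2.
have CZ1 : 1 <= C * Z by rewrite -[1]mulr1; apply: ler_pM.
have M1 : 1 <= M by rewrite exprn_ege1.
have [H MH Hle] : exists2 H : nat, M <= 2 ^+ H & H.+1%:R <= c4 * expR (2 * phi n Z).
  exists (Num.truncn (2 * ln M)).+1; first exact: le_2pow.
  have lM : ln M = 2 * (ln C + ln Z).
    rewrite /M expr2 lnM ?posrE; [|lra|lra].
    rewrite lnM ?posrE; [ring|lra|lra].
  have h1 : ((Num.truncn (2 * ln M)).+2)%:R = (Num.truncn (2 * ln M))%:R + 2 :> R by rewrite -addn2 natrD.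
  have h2 : (Num.truncn (2 * ln M))%:R <= 2 * ln M by rewrite truncn_le mulr_ge0 // ln_ge0.
  have h3 : c4 * (1 + ln Z) <= c4 * expR (2 * phi n Z) by rewrite ler_wpM2l.
  rewrite h1; apply: le_trans h3; move: h2; rewrite lM /c4.
  have : 0 <= ln C * ln Z by rewrite mulr_ge0.
  by lra.
pose kp (h : nat) : R := 2 ^+ h / D.
pose PP (h : nat) : pred Ix := [pred i | `[< Num.sqrt (2 ^+ h) <= C * D /\ exists m, Pset X G g G0 g0 D (kp h) ((ix i).1, (ix i).2, m) >]].
(* Level 0 gives no lower bound on [psaff] or [pm], so only the first bound on V is available
   there. *)
pose cc (h : nat) : R := if h is 0 then 1 else 2 * D / (Q * 2 ^+ h).
pose w i y : R := (1 + th * pm G G0 (lt i y) y) ^- n.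
have thp i y : 0 < 1 + th * pm G G0 (lt i y) y.
  by have : 0 <= th * pm G G0 (lt i y) y; [rewrite mulr_ge0 ?pm_ge0 // ltW|lra].
have w0 i y : 0 <= w i y by rewrite invr_ge0 exprn_ge0 // ltW.
have p2 (h : nat) : 0 < 2 ^+ h :> R by rewrite exprn_gt0.
have cc0 h : 0 <= cc h by case: h => [|h] //=; rewrite divr_ge0 ?mulr_ge0 ?(ltW (p2 _)) //; lra.
have Dkp h : D * kp h = 2 ^+ h by rewrite /kp mulrC divfK // gt_eqF.
have card_PP h : Num.sqrt (2 ^+ h) <= C * D -> (#|PP h|)%:R <= expR (b * phi n Z) * (D ^+ n * 2 ^+ h).
  move=> hW; rewrite -cnt_fin.
  have ch i : exists m : int, PP h i -> Pset X G g G0 g0 D (kp h) ((ix i).1, (ix i).2, m).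
    have [/asboolP[_ [m hm]]|] := boolP (PP h i); first by exists m.
    by exists 0.
  have [mf hmf] := boolp.choice ch.
  apply: (@le_trans _ _ (cnt (Pset X G g G0 g0 D (kp h)))).
    apply: (cnt_inj (f := fun i => ((ix i).1, (ix i).2, mf i))); first exact: finite_Pset.
      by move=> i hi; exact: hmf.
    move=> i i' _ _ [e1 e2 _]; apply: ixI; case: (ix i) e1 e2 => a c /=; case: (ix i') => a' c' /= -> ->.
    by [].
  have -> : D ^+ n * 2 ^+ h = D ^+ n.+1 * kp h by rewrite exprSr -mulrA Dkp.
  apply: (hb Y X G g L G0 g0 D Z (kp h)) => //; first by rewrite D1 DZ.
    by rewrite /kp ler_pM2r ?invr_gt0 // exprn_ege1 // ler1n.
  by rewrite Dkp.
have CD0 : 0 <= C * D by apply: mulr_ge0; lra.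
have CDM : (C * D) ^+ 2 <= M.
  have CDZ : C * D <= C * Z by apply: ler_wpM2l => //; lra.
  by apply: lerXn2r => //; exact: le_trans CDZ.
have dom i y : V i y <= \sum_(h < H.+1) (PP h i)%:R * (cc h * (B * w i y)).
  have [v1 v2 v3] := hV i y; rewrite -/(w i y) in v1 v2 v3.
  set p := pm _ _ _ _ in v3; set K := `|psaff X g g0 (lt i y) y| in v2.
  have p0 : 0 <= p by exact: pm_ge0.
  have hp : p ^+ 2 <= (C * D) ^+ 2 / 2 by exact: hpm.
  have hK : K <= 1 / 2 by exact: hpsi.
  have CD1 : D <= (C * D) ^+ 2 / 2 * 2.
    have DC : D <= C * D by rewrite ler_peMl // ltW.
    rewrite divfK ?pnatr_eq0 //; apply: (le_trans DC); rewrite expr2.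
    have DC1 : 1 <= C * D by exact: le_trans D1 DC.
    by rewrite ler_peMr.
  pose q : R := Num.max 1 (Num.max (D * K) (p ^+ 2)).
  have qM : q <= (C * D) ^+ 2.
    rewrite /q !ge_max; apply/andP; split; first by lra.
    apply/andP; split; last by have := sqr_ge0 (C * D); lra.
    by have : D * K <= D * 1 by [rewrite ler_wpM2l //; lra]; lra.
  have ex : exists h, q <= 2 ^+ h.
    by exists H; apply: le_trans MH; exact: le_trans qM CDM.
  case: (ex_minnP ex) => h hh hmin.
  have hH : (h < H.+1)%N.
    by rewrite ltnS; apply: hmin; apply: le_trans MH; exact: le_trans qM CDM.
  have Bw : 0 <= B * w i y by rewrite mulr_ge0.
  suff [a1 a2] : PP h i /\ V i y <= cc h * (B * w i y).
    apply: le_trans (ler_sum_term (F := fun h : 'I_H.+1 => (PP h i)%:R * (cc h * (B * w i y))) (Ordinal hH) _) => /=.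
      by rewrite a1 mul1r.
    by move=> j; rewrite !mulr_ge0.
  have h2 : 2 ^+ h <= (C * D) ^+ 2.
    case: h hh hmin {hH} => [|h] hh hmin; first by rewrite expr0; apply: le_trans qM; rewrite le_max lexx.
    have : ~~ (q <= 2 ^+ h) by apply/negP => /hmin; rewrite ltnn.
    rewrite -ltNge => hlt; rewrite exprS.
    move: hlt; rewrite /q !lt_max => /orP[h1|/orP[h1|h1]].
    - by have := exprn_ege1 h (ler1n R 2); lra.
    - have DK : D * K <= D * (1 / 2) by rewrite ler_wpM2l //; lra.
      by lra.
    - by lra.
  split.
    apply/asboolP; split.
      by rewrite -(@ler_pXn2r _ 2) ?nnegrE ?sqrtr_ge0 // sqr_sqrtr // ltW.
    exists (mm i y); split; first by case/andP: (hs i).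
    exists y; split.
      move=> j; rewrite Dkp -(@ler_pXn2r _ 2) ?nnegrE ?sqrtr_ge0 // sqr_sqrtr ?(ltW (p2 h)) //.
      apply: (@le_trans _ _ (p ^+ 2)); first by rewrite lerXn2r ?nnegrE // paff_pm.
      by apply: le_trans hh; rewrite /q !le_max lexx !orbT.
    rewrite /kp ler_pdivlMr // mulrC; apply: le_trans hh.
    by rewrite /q !le_max lexx !orbT.
  case: h hh hmin {hH h2} => [|h] hh hmin; first by rewrite /= mul1r.
  have : ~~ (q <= 2 ^+ h) by apply/negP => /hmin; rewrite ltnn.
  rewrite -ltNge => hlt.
  have QD : 0 < Q * 2 ^+ h / D by rewrite divr_gt0 ?mulr_gt0.
  suff : V i y * (Q * 2 ^+ h / D) <= B * w i y.
    rewrite -ler_pdivlMr // => h3; apply: le_trans h3 _.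
    rewrite le_eqVlt; apply/orP; left; apply/eqP; rewrite /= exprS; field.
    by rewrite !gt_eqF.
  have [V0|V0] := leP (V i y) 0.
    by apply: le_trans Bw; rewrite mulr_le0_ge0 // ltW.
  have V0' := ltW V0.
  move: hlt; rewrite /q !lt_max => /orP[h1|/orP[h1|h1]].
  - by have := exprn_ege1 h (ler1n R 2); lra.
  - apply: le_trans v2; rewrite ler_wpM2l // -mulrA ler_pM2l // ler_pdivrMr // mulrC.
    exact: ltW.
  - apply: le_trans v3; rewrite ler_wpM2l // -mulrA ler_pM2l // ler_pM2r ?invr_gt0 //.
    exact: ltW.
pose F : R := (H.+1)%:R * (C * (4 * C) ^+ n * (L / (th * D)) ^+ n).
have L0 : 0 < L by apply: lt_le_trans thL; rewrite mulr_gt0.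
have LD0 : 0 <= (L / (th * D)) ^+ n by rewrite exprn_ge0 // divr_ge0 ?mulr_ge0 // ltW.
have F0 : 0 <= F by apply: mulr_ge0 => //; apply: mulr_ge0 => //; apply: mulr_ge0; [lra|apply: exprn_ge0; lra].
have fib i : \sum_y w i y <= F.
  have E y : pm G G0 (lt i y) y = pm G G0 ((ix i).1, (ix i).2, 0) y by [].
  rewrite /w; under eq_bigr => y _ do rewrite E.
  apply: (fiber_sum hC hX hsep) => //; first by case/andP: (hs i).
  by move=> y; rewrite -E; apply: le_trans (hth i y) MH.
apply: le_trans (ler_sum _ (fun i _ => ler_sum _ (fun y _ => dom i y))) _.
have -> : \sum_i \sum_y \sum_(h < H.+1) (PP h i)%:R * (cc h * (B * w i y)) =
   \sum_(h < H.+1) cc h * B * \sum_(i | PP h i) \sum_y w i y.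
  rewrite (eq_bigr (fun i => \sum_(h < H.+1) (PP h i)%:R * (cc h * B * \sum_y w i y))); last first.
    move=> i _; rewrite exchange_big /=; apply: eq_bigr => h _.
    by rewrite !mulr_sumr; apply: eq_bigr => y _; ring.
  rewrite exchange_big /=; apply: eq_bigr => h _.
  rewrite mulr_sumr [RHS]big_mkcond; apply: eq_bigr => i _.
  by case: (PP h i); rewrite ?mul1r ?mul0r.
have each (h : 'I_H.+1) : cc h * B * \sum_(i | PP h i) \sum_y w i y <=
    4 * (B * expR (b * phi n Z) * D ^+ n * F).
  have R0 : 0 <= B * expR (b * phi n Z) * D ^+ n * F.
    by apply: mulr_ge0 => //; apply: mulr_ge0; [apply: mulr_ge0; rewrite ?expR_ge0|exact/exprn_ge0/ltW].
  have [hW|hW] := leP (Num.sqrt (2 ^+ h)) (C * D); last first.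
    rewrite big_pred0 ?mulr0; first by rewrite mulr_ge0.
    by move=> i; apply/asboolP => -[]; move: hW; rewrite ltNge => /negP.
  have s1 : \sum_(i | PP h i) \sum_y w i y <= expR (b * phi n Z) * (D ^+ n * 2 ^+ h) * F.
    apply: le_trans (ler_sum _ (fun i _ => fib i)) _.
    by rewrite sumr_const -[leLHS]mulr_natl ler_wpM2r // card_PP.
  have cB : 0 <= cc h * B by rewrite mulr_ge0.
  apply: le_trans (ler_wpM2l cB s1) _.
  have -> : cc h * B * (expR (b * phi n Z) * (D ^+ n * 2 ^+ h) * F) =
    (cc h * 2 ^+ h) * (B * expR (b * phi n Z) * D ^+ n * F) by ring.
  rewrite ler_wpM2r //; case: (nat_of_ord h) => [|k] /=; first by rewrite mul1r expr0; lra.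
  have -> : 2 * D / (Q * 2 ^+ k.+1) * 2 ^+ k.+1 = 2 * D / Q.
    by field; rewrite !gt_eqF.
  by rewrite ler_pdivrMr //; lra.
apply: le_trans (sum_le_ord each) _.
set E := expR (b * phi n Z) in each *.
have -> : H.+1%:R * (4 * (B * E * D ^+ n * F)) =
  (H.+1%:R * H.+1%:R) * (Kf * E * (B * D ^+ n * (L / (th * D)) ^+ n)).
  by rewrite /F /Kf; ring.
have R1 : 0 <= B * D ^+ n * (L / (th * D)) ^+ n by apply: mulr_ge0 => //; apply: mulr_ge0 => //; exact/exprn_ge0/ltW.
have HH : H.+1%:R * H.+1%:R <= (c4 * expR (2 * phi n Z)) * (c4 * expR (2 * phi n Z)) by apply: ler_pM.
have E0 : 0 <= E by exact: expR_ge0.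
apply: le_trans (ler_wpM2r _ HH) _; first by rewrite mulr_ge0 // mulr_ge0.
rewrite [leLHS]mulrA ler_wpM2r //.
have -> : c4 * expR (2 * phi n Z) * (c4 * expR (2 * phi n Z)) * (Kf * E) =
  (c4 * c4 * Kf) * expR ((b + 4) * phi n Z).
  have -> : (b + 4) * phi n Z = b * phi n Z + 2 * phi n Z + 2 * phi n Z by ring.
  by rewrite !expRD -/E; ring.
by apply: expR_absorb => //; apply: mulr_ge0 => //; apply: mulr_ge0.
Qed.

End NearSum.

(** * Lattice points in a cube *)

Section Cube.
Context {R : realType} {n : nat}.

Lemma card1_le T (t0 : 'I_T) (s : R) : 0 <= s ->
  (#|[pred t : 'I_T | `|(t%:R : R) - t0%:R| <= s]|)%:R <= 2 * s + 1.
Proof.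
move=> s0; pose k := Num.truncn s.
have hk (t : 'I_T) : `|(t%:R : R) - t0%:R| <= s -> (t <= t0 + k)%N /\ (t0 <= t + k)%N.
  move=> h; have h2 : s < k%:R + 1 by have := truncnS_gt s; rewrite natr1.
  split; rewrite -ltnS -(ltr_nat R) -natr1 natrD; move: h; rewrite ler_norml; lra.
pose f (t : 'I_T) : 'I_(2 * k).+1 := inord (t + k - t0).
have fE (t : 'I_T) : `|(t%:R : R) - t0%:R| <= s -> f t = (t + k - t0)%N :> nat.
  by move=> /hk[h1 h2]; rewrite /f inordK //; lia.
rewrite -(card_in_imset (f := f)).
  apply: (@le_trans _ _ ((2 * k).+1%:R)); first by rewrite ler_nat -[X in (_ <= X)%N]card_ord max_card.
  by rewrite -natr1 natrM; have : k%:R <= s by [rewrite truncn_le]; lra.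
move=> t t'; rewrite !inE => ht ht' /(congr1 val) /=; rewrite (fE t ht) (fE t' ht').
move: (hk t ht) (hk t' ht') => [? ?] [? ?] e; apply: val_inj => /=; lia.
Qed.

Lemma card1_ge N (t0 : 'I_(2 * N).+1) (s : R) (k : nat) : k%:R <= s -> (k <= N)%N ->
  (k.+1 <= #|[pred t : 'I_(2 * N).+1 | (`|(t%:R : R) - t0%:R| <= s)%R]|)%N.
Proof.
move=> ks kN.
have H (g : 'I_k.+1 -> 'I_(2 * N).+1) : injective g -> (forall j, `|((g j)%:R : R) - t0%:R| <= s) ->
    (k.+1 <= #|[pred t : 'I_(2 * N).+1 | (`|(t%:R : R) - t0%:R| <= s)%R]|)%N.
  move=> gi hg; rewrite -[X in (X <= _)%N]card_ord -(card_imset _ gi).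
  by apply/subset_leq_card/fintype.subsetP => _ /imsetP[j _ ->]; rewrite inE hg.
have jk (j : 'I_k.+1) : j%:R <= s by apply: le_trans ks; rewrite ler_nat -ltnS.
have [h|h] := leqP t0 N.
  have E (j : 'I_k.+1) : (inord (t0 + j) : 'I_(2 * N).+1) = (t0 + j)%N :> nat.
    by rewrite inordK //; have := ltn_ord j; lia.
  apply: (H (fun j => inord (t0 + j))) => [j j' /(congr1 val) /=|j].
    by rewrite !E => /addnI; exact: val_inj.
  by rewrite E natrD addrAC subrr add0r ger0_norm.
have E (j : 'I_k.+1) : (inord (t0 - j) : 'I_(2 * N).+1) = (t0 - j)%N :> nat.
  by rewrite inordK //; have := ltn_ord j; have := ltn_ord t0; lia.
apply: (H (fun j => inord (t0 - j))) => [j j' /(congr1 val) /=|j].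
  rewrite !E => e; apply: val_inj => /=; have := ltn_ord j; have := ltn_ord j'; lia.
rewrite E natrB; last by have := ltn_ord j; lia.
by rewrite addrAC subrr add0r normrN ger0_norm.
Qed.

Variables (x0 : 'rV[R]_n) (rho : R) (L : nat).
Hypotheses (rho0 : 0 < rho) (rho1 : rho <= 1) (hL : 4 <= rho * L%:R).

(** The decrement leaves room for the rounding of the centre in [cubeb], so that all points stay
    within rho of x0. *)
Definition cubeN : nat := (Num.truncn (rho * L%:R)).-1.
Definition cubeb : 'rV[int]_n := \row_i (Num.floor (L%:R * x0 0 i) - cubeN%:Z).
Definition ylat (v : {ffun 'I_n -> 'I_(2 * cubeN).+1}) : 'rV[int]_n := bpos cubeb v.
Definition lpt (a : 'rV[int]_n) : 'rV[R]_n := \row_i ((a 0 i)%:~R / L%:R).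

Let L0 : 0 < L%:R :> R.
Proof. by have h := hL; have := rho0; case: (L) h => [|k] //; rewrite mulr0; lra. Qed.

Lemma cubeN_bounds : cubeN%:R + 1 <= rho * L%:R /\ rho * L%:R < cubeN%:R + 2.
Proof.
have h := hL.
have h1 : (Num.truncn (rho * L%:R))%:R <= rho * L%:R by rewrite truncn_le; lra.
have h2 : rho * L%:R < (Num.truncn (rho * L%:R)).+1%:R by exact: truncnS_gt.
have t0 : (0 < Num.truncn (rho * L%:R))%N.
  by case: (Num.truncn _) h2 => //; lra.
have e : (Num.truncn (rho * L%:R))%:R = cubeN%:R + 1 :> R by rewrite natr1 /cubeN prednK.
have e2 : (Num.truncn (rho * L%:R)).+1%:R = (Num.truncn (rho * L%:R))%:R + 1 :> R by rewrite natr1.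
by split; lra.
Qed.

Lemma ylatE v i : (ylat v 0 i)%:~R = (Num.floor (L%:R * x0 0 i))%:~R - cubeN%:R + (v i)%:R :> R.
Proof. by rewrite !mxE rmorphD rmorphB /=. Qed.

Lemma lpt_cube v : supd (lpt (ylat v)) x0 rho.
Proof.
move=> i; rewrite mxE ylatE; have [h1 _] := cubeN_bounds; have l0 := L0.
have f1 : (Num.floor (L%:R * x0 0 i))%:~R <= L%:R * x0 0 i by exact: ge_floor.
have f2 : L%:R * x0 0 i < (Num.floor (L%:R * x0 0 i))%:~R + 1.
  by have := lt_succ_floor (L%:R * x0 0 i); rewrite intrD.
have v1 : (v i)%:R <= 2 * cubeN%:R :> R by rewrite -natrM ler_nat -ltnS.
have v0 : 0 <= (v i)%:R :> R by [].
rewrite -(ler_pM2r l0) -[X in _ * X <= _]gtr0_norm // -normrM mulrBl divfK ?gt_eqF // ler_norml.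
by apply/andP; split; lra.
Qed.

Lemma ylat_surj (a : 'rV[int]_n) (rho' : R) : rho' * L%:R + 3 <= rho * L%:R ->
  supd (lpt a) x0 rho' -> exists v, ylat v = a.
Proof.
move=> hr ha; apply: bpos_surj => i; have l0 := L0; have [_ h2] := cubeN_bounds.
have := ha i; rewrite mxE -(ler_pM2r l0) -[X in _ * X <= _]gtr0_norm // -normrM mulrBl divfK ?gt_eqF //.
have f1 : (Num.floor (L%:R * x0 0 i))%:~R <= L%:R * x0 0 i by exact: ge_floor.
have f2 : L%:R * x0 0 i < (Num.floor (L%:R * x0 0 i))%:~R + 1.
  by have := lt_succ_floor (L%:R * x0 0 i); rewrite intrD.
rewrite ler_norml => /andP[h3 h4].
have q1 : (Num.floor (L%:R * x0 0 i))%:~R - cubeN%:R <= (a 0 i)%:~R :> R by lra.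
have q2 : (a 0 i)%:~R <= (Num.floor (L%:R * x0 0 i))%:~R + cubeN%:R :> R by lra.
move: q1 q2; rewrite -[cubeN%:R]/(cubeN%:~R) -rmorphB -rmorphD /= !ler_int !mxE; lia.
Qed.

Lemma supd_lpt v v' r : supd (lpt (ylat v')) (lpt (ylat v)) r <->
  (forall i, `|(v' i)%:R - (v i)%:R : R| <= r * L%:R).
Proof.
have l0 := L0; have E i : `|lpt (ylat v') 0 i - lpt (ylat v) 0 i| * L%:R = `|(v' i)%:R - (v i)%:R : R|.
  have lE (u : {ffun 'I_n -> 'I_(2 * cubeN).+1}) : lpt (ylat u) 0 i = (ylat u 0 i)%:~R / L%:R by rewrite mxE.
  rewrite -[X in _ * X]gtr0_norm // -normrM !lE mulrBl !divfK ?gt_eqF // !ylatE.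
  by congr `|_|; ring.
by split=> h i; [rewrite -E ler_pM2r|rewrite -(ler_pM2r l0) E].
Qed.

Local Notation X := (fun v => lpt (ylat v)).

Lemma near_card v r : #|nearY X r v| =
  (\prod_i #|[pred t : 'I_(2 * cubeN).+1 | (`|(t%:R : R) - (v i)%:R| <= r * L%:R)%R]|)%N.
Proof.
rewrite -(big_enum _ _ predT) /= -[RHS](big_map (fun i => #|[pred t : 'I_(2 * cubeN).+1 | `|(t%:R : R) - (v i)%:R| <= r * L%:R]|) predT id).
rewrite -foldrE -card_family; apply: eq_card => v'.
apply/asboolP/familyP => [/supd_lpt h i|h]; first by rewrite inE h.
by apply/supd_lpt => i; have := h i; rewrite inE.
Qed.

Lemma near_le v r : 0 <= r -> (#|nearY X r v|)%:R <= 2 ^+ n * (1 + r * L%:R) ^+ n.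
Proof.
move=> r0; rewrite near_card natr_prod -exprMn -[X in _ ^+ X](card_ord n) -prodr_const.
apply: ler_prod => i _; rewrite ler0n /=; apply: le_trans (card1_le _ _) _.
  by rewrite mulr_ge0.
by lra.
Qed.

Lemma near_ge v r : 0 <= r <= 1 -> (r * L%:R) ^+ n <= (2 / rho) ^+ n * (#|nearY X r v|)%:R.
Proof.
move=> /andP[r0 r1]; have hLL := hL; have [_ h2] := cubeN_bounds.
rewrite near_card natr_prod -[X in (r * _) ^+ X](card_ord n) -[X in (2 / _) ^+ X](card_ord n) -!prodr_const -big_split.
apply: ler_prod => i _; rewrite mulr_ge0 //=.
pose k := minn cubeN (Num.truncn (r * L%:R)).
have k1 : k%:R <= r * L%:R.
  apply: (@le_trans _ _ (Num.truncn (r * L%:R))%:R); first by rewrite ler_nat geq_minr.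
  by rewrite truncn_le mulr_ge0.
have := @card1_ge cubeN (v i) _ k k1 (geq_minl _ _).
rewrite -(ler_nat R); set c := #|_|%:R => hc.
rewrite mulrAC ler_pdivlMr //.
have k2 : r * L%:R * rho <= 2 * k.+1%:R.
  rewrite /k /minn; case: ifP => _.
    have : r * (rho * L%:R) <= 1 * (rho * L%:R) by rewrite ler_wpM2r //; lra.
    by rewrite -natr1; lra.
  have : r * L%:R < (Num.truncn (r * L%:R)).+1%:R by exact: truncnS_gt.
  have : r * L%:R * rho <= r * L%:R * 1 by rewrite ler_wpM2l // mulr_ge0.
  have : 0 <= r * L%:R by rewrite mulr_ge0.
  by lra.
by lra.
Qed.

End Cube.
Arguments ylat {R n} x0 rho L v.
Arguments lpt {R n} L a.

(** * The system of a function on the cube *)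

Section CubeSystem.
Context {R : realType} {n r : nat}.

(** For the dual half, curvature bounds the distance of two points by that of their gradients, and
    the dual Taylor remainder from y to y' is the primal one from y' to y. *)
Lemma cube_system (f : 'I_r -> 'rV[R]_n -> R) x0 (rho C : R) : good f x0 rho C ->
  exists2 C' : R, 1 <= C' & forall (L : nat) l, 4 <= rho * L%:R ->
    system (fun v => lpt L (ylat x0 rho L v)) (fun v => grad f l (lpt L (ylat x0 rho L v)))
      (fun v => f l (lpt L (ylat x0 rho L v))) L%:R C'.
Proof.
move=> [/andP[rho0 rho1] C1 [hT hLip hinj _]].
have C0 : 0 <= C by lra.
pose c1 : R := (2 * C / rho) ^+ n; pose c2 : R := (2 * (1 + C)) ^+ n.
have c10 : 0 <= c1 by rewrite exprn_ge0 // divr_ge0 ?mulr_ge0 // ltW.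
have c20 : 0 <= c2 by rewrite exprn_ge0 // mulr_ge0 //; lra.
have nC : 0 <= n%:R * C ^+ 3 by rewrite mulr_ge0 ?exprn_ge0.
exists (1 + C + C ^+ 3 + c1 + c2).
  by have := exprn_ge0 3 C0; lra.
move=> L l hL; set C' := _ + c2.
have C30 := exprn_ge0 3 C0.
have C'1 : C <= C' by rewrite /C'; lra.
have C'c1 : c1 <= C' by rewrite /C'; lra.
have C'c2 : c2 <= C' by rewrite /C'; lra.
have C'3 : C ^+ 3 <= C' by rewrite /C'; lra.
have C'1' : 1 <= C' by rewrite /C'; lra.
move: C' C'1 C'c1 C'c2 C'3 C'1' => C' C'1 C'c1 C'c2 C'3 C'1'.
set X := fun v => lpt L (ylat x0 rho L v).
have L1 : 4 <= L%:R :> R.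
  have : rho * L%:R <= 1 * L%:R by rewrite ler_wpM2r.
  by lra.
have hX v : supd (X v) x0 rho by exact: lpt_cube.
have up v s : 0 <= s -> (#|nearY X s v|)%:R <= C' * (1 + s * L%:R) ^+ n.
  move=> s0; apply: le_trans (near_le x0 rho0 hL v s0) _.
  rewrite ler_wpM2r ?exprn_ge0 ?addr_ge0 ?mulr_ge0 //; apply: le_trans C'c2.
  by rewrite /c2 lerXn2r ?nnegrE //; lra.
have injX v v' d : supd (grad f l (X v')) (grad f l (X v)) d -> supd (X v') (X v) (C * d).
  move=> hd i; have := hinj (X v) (X v') d (fun k => (k == l)%:R) (hX v) (hX v').
  have gE z : gradF f (fun k => (k == l)%:R) z = grad f l z.
    apply/rowP => j; rewrite !mxE (bigD1 l) //= eqxx mul1r big1 ?addr0 // => k kl.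
    by rewrite (negbTE kl) mul0r.
  by rewrite !gE => /(_ hd l i); rewrite eqxx normr1 mul1r.
split=> //; first by lra.
- rewrite card_ffun !card_ord natrX.
  have [h1 _] := cubeN_bounds hL.
  apply: (@le_trans _ _ ((2 * L%:R) ^+ n)).
    rewrite lerXn2r ?nnegrE // -natr1 natrM.
    have : rho * L%:R <= 1 * L%:R by rewrite ler_wpM2r.
    by lra.
  rewrite exprMn ler_wpM2r ?exprn_ge0 //; apply: le_trans C'c2.
  by rewrite /c2 lerXn2r ?nnegrE //; lra.
- split.
  + move=> v v' d hd; apply: le_trans (hT (X v) (X v') d (hX v) (hX v') hd l) _.
    by rewrite ler_wpM2r ?sqr_ge0.
  + move=> v v' d hd i; apply: le_trans (hLip (X v) (X v') d (hX v) (hX v') hd l i) _.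
    by rewrite ler_wpM2r // (le_trans (normr_ge0 _) (hd i)).
  + move=> v s /andP[s1 s2]; have s0 : 0 <= s by apply: le_trans s1; rewrite invr_ge0.
    apply: le_trans (near_ge x0 rho0 rho1 hL v _) _; first by rewrite s0.
    rewrite ler_wpM2r //; apply: le_trans C'c1; rewrite /c1 lerXn2r ?nnegrE ?divr_ge0 ?mulr_ge0 ?(ltW rho0) //.
    by rewrite ler_pM2r ?invr_gt0 //; lra.
  + exact: up.
- split.
  + move=> v v' d hd; have hd' := injX v v' d hd.
    have := hT (X v') (X v) (C * d) (hX v') (hX v).
    have hs : supd (X v) (X v') (C * d) by move=> i; rewrite distrC; exact: hd'.
    move=> /(_ hs l) h.
    have E : dualg X (fun v => grad f l (X v)) (fun v => f l (X v)) v' -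
        dualg X (fun v => grad f l (X v)) (fun v => f l (X v)) v -
        \sum_i X v 0 i * (grad f l (X v') 0 i - grad f l (X v) 0 i) =
       f l (X v) - f l (X v') - \sum_i grad f l (X v') 0 i * (X v 0 i - X v' 0 i).
      rewrite /dualg /dot.
      have -> : \sum_i X v 0 i * (grad f l (X v') 0 i - grad f l (X v) 0 i) =
         \sum_i X v 0 i * grad f l (X v') 0 i - \sum_i X v 0 i * grad f l (X v) 0 i.
        by rewrite -sumrB; apply: eq_bigr => i _; ring.
      have -> : \sum_i grad f l (X v') 0 i * (X v 0 i - X v' 0 i) =
         \sum_i X v 0 i * grad f l (X v') 0 i - \sum_i X v' 0 i * grad f l (X v') 0 i.
        by rewrite -sumrB; apply: eq_bigr => i _; ring.
      by ring.
    rewrite E; apply: le_trans h _; rewrite exprMn mulrA -exprS.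
    by rewrite ler_wpM2r ?sqr_ge0.
  + move=> v v' d hd i; apply: le_trans (injX v v' d hd i) _.
    by rewrite ler_wpM2r // (le_trans (normr_ge0 _) (hd i)).
  + move=> v s /andP[s1 s2]; have s0 : 0 <= s by apply: le_trans s1; rewrite invr_ge0.
    have Cp : 0 < C by lra.
    have t0 : 0 <= s / C <= 1.
      by rewrite divr_ge0 //= ler_pdivrMr // mul1r; lra.
    have sub : (#|nearY X (s / C) v| <= #|nearY (fun v => grad f l (X v)) s v|)%N.
      apply/subset_leq_card/fintype.subsetP => v' /asboolP h; apply/asboolP.
      move=> i; have := hLip (X v) (X v') (s / C) (hX v) (hX v') h l i.
      by rewrite mulrC divfK // gt_eqF.
    have h := near_ge x0 rho0 rho1 hL v t0.
    have E : (s * L%:R) ^+ n = C ^+ n * (s / C * L%:R) ^+ n.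
      by rewrite -exprMn; congr (_ ^+ _); field; rewrite gt_eqF.
    rewrite E; apply: le_trans (ler_wpM2l (exprn_ge0 n C0) h) _.
    rewrite mulrA -exprMn; apply: ler_pM => //; last by rewrite ler_nat.
      by rewrite exprn_ge0 // mulr_ge0 // divr_ge0 // ltW.
    by apply: le_trans C'c1; rewrite /c1 le_eqVlt; apply/orP; left; apply/eqP; congr (_ ^+ _); ring.
  + move=> v s s0; have sub : (#|nearY (fun v => grad f l (X v)) s v| <= #|nearY X (C * s) v|)%N.
      by apply/subset_leq_card/fintype.subsetP => v' /asboolP h; apply/asboolP; exact: injX.
    apply: (@le_trans _ _ (#|nearY X (C * s) v|)%:R); first by rewrite ler_nat.
    have Cs : 0 <= C * s by rewrite mulr_ge0.
    apply: le_trans (near_le x0 rho0 hL v Cs) _.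
    apply: le_trans (ler_wpM2r (exprn_ge0 n _) C'c2); last by rewrite addr_ge0 ?mulr_ge0.
    rewrite /c2 -!exprMn lerXn2r ?nnegrE ?mulr_ge0 ?addr_ge0 ?mulr_ge0 //; try lra.
    have sL : 0 <= s * L%:R by rewrite mulr_ge0.
    by have : C * s * L%:R = C * (s * L%:R) by [ring]; move: sL; move: (s * _) => q; nra.
Qed.

End CubeSystem.

(** * Smoothness of the localised amplitudes *)

Section Amplitude.
Context {R : realType} {n r : nat}.

Lemma CSmM a (C C' : R) g h : CSm a C g -> CSm a C' h -> CSm a (2 * (2 ^+ a * (C * C'))) (fun t => g t * h t).
Proof.
move=> [g1 g2] [h1 h2]; split.
  have -> : (fun t => complex.Re (g t * h t)) = (fun t => complex.Re (g t)) * (fun t => complex.Re (h t)) +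
     - ((fun t => complex.Im (g t)) * (fun t => complex.Im (h t))).
    by apply/funext => t; rewrite -[RHS]/(complex.Re (g t) * complex.Re (h t) - complex.Im (g t) * complex.Im (h t)); case: (g t) => ? ?; case: (h t).
  by rewrite mulr_natl mulr2n; apply: SmD; [exact: SmM|apply: SmN; exact: SmM].
have -> : (fun t => complex.Im (g t * h t)) = (fun t => complex.Re (g t)) * (fun t => complex.Im (h t)) +
     (fun t => complex.Im (g t)) * (fun t => complex.Re (h t)).
  by apply/funext => t; rewrite -[RHS]/(complex.Re (g t) * complex.Im (h t) + complex.Im (g t) * complex.Re (h t)); case: (g t) => ? ?; case: (h t).
by rewrite mulr_natl mulr2n; apply: SmD; exact: SmM.
Qed.

Lemma Sm_ext a (C : R) g h : g =1 h -> Sm a C g -> Sm a C h.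
Proof. by move=> /funext ->. Qed.

Lemma Sm_sum a (I : Type) (s : seq I) (C : I -> R) (g : I -> R -> R) :
  (forall i, Sm a (C i) (g i)) -> Sm a (\sum_(i <- s) C i) (fun t => \sum_(i <- s) g i t).
Proof.
move=> h; elim: s => [|i s IH].
  rewrite big_nil; apply: (@Sm_ext _ _ (cst 0)); first by move=> t; rewrite big_nil.
  by apply: Sm_cst; rewrite normr0.
rewrite big_cons; apply: (@Sm_ext _ _ (g i + (fun t => \sum_(j <- s) g j t))); last exact: SmD.
by move=> t; rewrite big_cons.
Qed.

Definition ln_ (z0 : 'rV[R]_n) (i : 'I_n) (e t : R) : 'rV[R]_n := z0 + (t * e) *: delta_mx 0 i.

Lemma is_derive_ln g gi z0 i e (t : R) : (forall y, is_derive y (delta_mx 0 i : 'rV[R]_n) g (gi y)) ->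
  is_derive t (1 : R) (fun t : R => g (ln_ z0 i e t)) (e * gi (ln_ z0 i e t)).
Proof.
move=> h; have h1 := is_derive_line z0 h (t * e).
have h2 : is_derive t (1 : R) (fun t : R => t * e) e.
  have := @is_deriveZ _ _ _ id e t 1 _ (is_derive_id _ _).
  have -> : e \*: id = (fun t : R => t * e) by apply/funext => u; rewrite /= mulrC.
  by move=> /is_derive_eq; apply; rewrite /GRing.scale /= mulr1.
by have := @is_derive1_comp _ (fun t : R => g (z0 + t *: delta_mx 0 i)) (fun t : R => t * e) t _ _ h1 h2; rewrite mulrC.
Qed.

(** The form kap (g - c) is made for the induction: the derivative step replaces g by a partial
    derivative, kap by kap e and c by 0. Only the value itself profits from the subtraction of c. *)
Lemma Sm_line a z0 i (e : R) : 0 <= e -> forall g (kap c B : R), Ck a g ->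
  (forall t, `|t| <= 2 -> `|kap * (g (ln_ z0 i e t) - c)| <= B) ->
  (forall m t, (0 < m <= a)%N -> `|t| <= 2 -> `|kap| * e ^+ m * `|iparts i m g (ln_ z0 i e t)| <= B) ->
  Sm a B (fun t => kap * (g (ln_ z0 i e t) - c)).
Proof.
move=> e0; elim: a => [|a IH] g kap c B hg h0 hm; split=> //.
exists (fun t => (kap * e) * (partial i g (ln_ z0 i e t) - 0)); split.
  move=> t; have h1 := is_derive_ln z0 e t (fun y => Ck_is_derive i y hg).
  have := @is_deriveZ _ _ _ _ kap t 1 _ (@is_deriveB _ _ _ _ _ t 1 _ _ h1 (is_derive_cst c _ _)).
  by move=> /is_derive_eq; apply; rewrite /GRing.scale /= !subr0 mulrA.
apply: IH; first exact: Ck_partial.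
  by move=> t ht; have := hm 1%N t isT ht; rewrite subr0 !normrM expr1 (ger0_norm e0).
move=> m t /andP[m0 ma] ht; have := hm m.+1 t ma ht.
by rewrite normrM (ger0_norm e0) exprS /iparts iterSr !mulrA.
Qed.

Lemma ln_upd (x u : 'rV[R]_n) i e t : x + e *: upd u i t = ln_ (x + e *: upd u i 0) i e t.
Proof.
apply/rowP => j; rewrite !mxE eqxx /=; case: eqP => [->|_]; first by rewrite mulr0 addr0 mulr1 mulrC.
by rewrite mulr0 addr0.
Qed.

Lemma sum_upd (c : 'I_n -> R) (u : 'rV[R]_n) i t :
  \sum_j c j * upd u i t 0 j = \sum_j c j * upd u i 0 0 j + c i * t.
Proof.
rewrite (bigD1 i) //= [in RHS](bigD1 i) //= !mxE eqxx mulr0 add0r addrC; congr (_ + _).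
by apply: eq_bigr => j ji; rewrite !mxE (negbTE ji).
Qed.

Variables (f : 'I_r -> 'rV[R]_n -> R) (x0 : 'rV[R]_n) (rho C : R) (w : 'rV[R]_n -> R) (Cw : R).
Hypotheses (hgood : good f x0 rho C) (hf : forall l, Ck n.+2 (f l)) (hw : Ck n.+2 w).
Hypotheses (hCw : forall i m z, (m <= n.+2)%N -> `|iparts i m w z| <= Cw) (n0 : (0 < n)%N).

Definition Fj (J : 'I_r -> R) (z : 'rV[R]_n) : R := \sum_l J l * f l z.
Definition dFj (J : 'I_r -> R) (x : 'rV[R]_n) i : R := \sum_l J l * partial i (f l) x.

(** The summand at scale e around x, without the value and the linear part of the phase at x. The
    phase that remains is bounded when Q D e^2 <= 1; the linear part becomes the twist in [Aq]. *)
Definition amp1 J q e x (u : 'rV[R]_n) : R[i] := (w (x + e *: u))%:C%C *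
  cis (q * (Fj J (x + e *: u) - Fj J x - \sum_i (e * dFj J x i) * u 0 i)).
(** The phase added when q increases by 1, with k in place of the gradient, see [Aq_succ]; there k
    is the integer dual vector. *)
Definition phinc J (k : 'I_n -> R) e x (u : 'rV[R]_n) : R :=
  Fj J (x + e *: u) - Fj J x - \sum_i (e * k i) * u 0 i.
Definition amp2 J q k e x u : R[i] := amp1 J q e x u * (cis (phinc J k e x u) - 1).

Lemma phase_derive J (q ga be : R) z0 i e t :
  is_derive t (1 : R) (fun t : R => 2 * pi * (q * (Fj J (ln_ z0 i e t) - be - ga * t)))
   (2 * pi * q * (e * dFj J (ln_ z0 i e t) i - ga)).
Proof.
have hF y : is_derive y (delta_mx 0 i : 'rV[R]_n) (Fj J) (dFj J y i).
  apply: (@is_derive_comb R n r J f (fun l => partial i (f l))) => l.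
  exact: (Ck_is_derive _ _ (hf l)).
have h1 := is_derive_ln z0 e t hF.
have h2 := @is_deriveZ _ _ _ id ga t 1 _ (is_derive_id _ _).
have h3 := @is_deriveB _ _ _ _ _ t 1 _ _ (@is_deriveB _ _ _ _ _ t 1 _ _ h1 (is_derive_cst be _ _)) h2.
have := @is_deriveZ _ _ _ _ (2 * pi * q) t 1 _ h3.
have -> : (2 * pi * q) \*: ((fun t : R => Fj J (ln_ z0 i e t)) - cst be - ga \*: id) =
  (fun t : R => 2 * pi * (q * (Fj J (ln_ z0 i e t) - be - ga * t))).
  by apply/funext => u /=; rewrite /GRing.scale /= mulrA.
by move=> /is_derive_eq; apply; rewrite /GRing.scale /= mulr1 subr0.
Qed.

Lemma Sm_dphase (J : 'I_r -> R) (q D e : R) (x u : 'rV[R]_n) (i : 'I_n) : 0 <= q -> 0 <= e <= 1 -> 4 * e <= rho ->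
  supd x x0 (rho / 2) -> (forall j, j != i -> `|u 0 j| <= 1) -> (forall l, `|J l| <= 2 * D) ->
  Sm n.+1 (r%:R * (32 * C * (q * D * e ^+ 2)))
    (fun t => 2 * pi * q * (e * dFj J (ln_ (x + e *: upd u i 0) i e t) i - e * dFj J x i)).
Proof.
have [/andP[rho0 rho1] C1 [_ hLip _ hb]] := hgood.
move=> q0 /andP[e0 e1] er hx hu hJ; have pi4 := pihalf_lt2 R; have p0 := pi_ge0 R.
have zb t : `|t| <= 2 -> supd (ln_ (x + e *: upd u i 0) i e t) x (2 * e) /\
    supd (ln_ (x + e *: upd u i 0) i e t) x0 rho.
  move=> ht; have h : supd (ln_ (x + e *: upd u i 0) i e t) x (2 * e).
    move=> j; rewrite -ln_upd !mxE addrAC subrr add0r normrM (ger0_norm e0) mulrC ler_wpM2r //.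
    by case: eqP => // /eqP ji; apply: le_trans (hu j ji) _; lra.
  split=> // j; have := h j; have := hx j.
  have := ler_normD (ln_ (x + e *: upd u i 0) i e t 0 j - x 0 j) (x 0 j - x0 0 j).
  by rewrite addrA subrK; lra.
have hxr : supd x x0 rho by move=> j; apply: le_trans (hx j) _; lra.
apply: (@Sm_ext _ _ (fun t => \sum_l (2 * pi * q * e * J l) * (partial i (f l) (ln_ (x + e *: upd u i 0) i e t) - partial i (f l) x))).
  move=> t; rewrite /dFj !mulr_sumr -sumrB mulr_sumr; apply: eq_bigr => l _; ring.
have -> : r%:R * (32 * C * (q * D * e ^+ 2)) = \sum_(l < r) 32 * C * (q * D * e ^+ 2).
  by rewrite sumr_const card_ord -[RHS]mulr_natl.
apply: Sm_sum => l.
have kb : `|2 * pi * q * e * J l| <= 16 * (q * D * e).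
  rewrite !normrM (ger0_norm q0) (ger0_norm e0) (ger0_norm p0) ger0_norm //.
  have a0 : 0 <= q * e by rewrite mulr_ge0.
  have D0 : 0 <= D by have := hJ l; have := normr_ge0 (J l); lra.
  apply: (@le_trans _ _ ((8 * (q * e)) * (2 * D))).
    rewrite -[2 * pi * q * e]mulrA; apply: ler_pM => //; rewrite ?mulr_ge0 //.
    by rewrite ler_wpM2r //; lra.
  by rewrite le_eqVlt; apply/orP; left; apply/eqP; ring.
have K0 : 0 <= 16 * (q * D * e) by apply: le_trans kb.
apply: Sm_line; [exact: e0|exact: (Ck_partial i (hf l))| |].
  move=> t ht; have [h1 h2] := zb t ht; rewrite normrM.
  have := hLip x _ _ hxr h2 h1 l i; rewrite !mxE => h3.
  apply: le_trans (ler_pM (normr_ge0 _) (normr_ge0 _) kb h3) _.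
  by rewrite le_eqVlt; apply/orP; left; apply/eqP; ring.
move=> m t /andP[m0 mn] ht; have [h1 h2] := zb t ht.
have h3 : `|iparts i m (partial i (f l)) (ln_ (x + e *: upd u i 0) i e t)| <= C.
  have := hb (ln_ (x + e *: upd u i 0) i e t) m.+1 i l; rewrite /iparts iterSr; exact.
have h4 : e ^+ m <= e by case: m m0 {mn h3} => // m _; rewrite exprS ler_piMr // exprn_ile1.
apply: (@le_trans _ _ (16 * (q * D * e) * e * C)).
  apply: ler_pM => //; first by rewrite mulr_ge0 // exprn_ge0.
  by apply: ler_pM => //; exact: exprn_ge0.
have h0 : 0 <= C * (16 * (q * D * e) * e).
  by apply: mulr_ge0; [lra|apply: mulr_ge0].
have -> : 16 * (q * D * e) * e * C = C * (16 * (q * D * e) * e) by ring.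
have -> : 32 * C * (q * D * e ^+ 2) = C * (16 * (q * D * e) * e) + C * (16 * (q * D * e) * e) by ring.
by rewrite lerDl.
Qed.

Lemma small_phase_const (a b c d e S : R) : S <= a * (32 * b * c) -> 0 <= a * (b * c) ->
  0 <= a * (b * d) -> 0 <= e * c -> 0 <= e * d -> 0 <= c -> 0 <= d ->
  S + 8 * d <= (a * (64 * b) + 16 * e + 16) * c + (a * (64 * b) + 16 * e + 16) * d.
Proof.
move=> h1 h2 h3 h4 h5 h6 h7; have -> : (a * (64 * b) + 16 * e + 16) * c + (a * (64 * b) + 16 * e + 16) * d =
  64 * (a * (b * c)) + 64 * (a * (b * d)) + 16 * (e * c) + 16 * (e * d) + 16 * c + 16 * d by ring.
have E : a * (32 * b * c) = 32 * (a * (b * c)) by ring.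
by move: h1; rewrite E => h1; lra.
Qed.

(** The second-order part of [phinc] is O(D e^2), hence O(1/Q), and its linear part is O(e p).
    [Sm_trig_small] turns their sum into the factor (1 + Q e p) / Q. *)
Lemma amp_bounds (B0 : R) : 0 <= B0 -> exists2 B : R, 1 <= B &
  forall (J : 'I_r -> R) (Q q D e : R) (x u : 'rV[R]_n) (i : 'I_n), 1 <= Q -> 0 <= q <= 2 * Q -> 0 <= e <= 1 -> 4 * e <= rho ->
    Q * D * e ^+ 2 <= 1 -> supd x x0 (rho / 2) -> (forall j, j != i -> `|u 0 j| <= 1) ->
    0 <= D -> (forall l, `|J l| <= 2 * D) ->
  CSm n.+2 B (fun t => amp1 J q e x (upd u i t)) /\
  forall (k : 'I_n -> R) (p : R), (forall j, `|dFj J x j - k j| <= p) -> e * p <= B0 ->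
    CSm n.+2 (B * ((1 + Q * e * p) / Q)) (fun t => amp2 J q k e x (upd u i t)).
Proof.
move=> B00; have [/andP[rho0 rho1] C1 [hT hLip _ hb]] := hgood.
have C0 : 0 <= C by lra.
have pi4 := pihalf_lt2 R; have p0 := pi_ge0 R.
pose M1 := r%:R * (32 * C * 2); have M10 : 0 <= M1 by rewrite /M1 !mulr_ge0.
have [K1 K11 hK1] := Sm_trig n.+1 M10.
pose Kc := r%:R * (64 * C) + 16 * n%:R + 16.
have Kc0 : 0 <= Kc by rewrite /Kc !addr_ge0 ?mulr_ge0.
have [K2 K21 hK2] := @Sm_trig_small R n.+1 (Kc * (1 + B0)) ltac:(by rewrite mulr_ge0 //; lra).
have Cw0 : 0 <= Cw by apply: le_trans (normr_ge0 _) (hCw (Ordinal n0) 0 (leq0n _)).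
pose Ba := 2 ^+ n.+2 * (Cw * K1).
have Ba0 : 0 <= Ba by apply: mulr_ge0; [exact: exprn_ge0|apply: mulr_ge0 => //; lra].
pose Bb := 2 * (2 ^+ n.+2 * (Ba * (K2 * Kc))).
have Bb0 : 0 <= Bb.
  apply: mulr_ge0 => //; apply: mulr_ge0; first exact: exprn_ge0.
  by apply: mulr_ge0 => //; apply: mulr_ge0 => //; lra.
exists (1 + Ba + Bb); first by lra.
move=> J Q q D e x u i Q1 /andP[q0 q2] /andP[e0 e1] er hQ hx hu D0 hJ.
have e01 : 0 <= e <= 1 by rewrite e0.
have qD : q * D * e ^+ 2 <= 2.
  have : q * (D * e ^+ 2) <= 2 * Q * (D * e ^+ 2) by rewrite ler_wpM2r ?mulr_ge0 ?sqr_ge0.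
  by lra.
set z := ln_ (x + e *: upd u i 0) i e.
have hxr : supd x x0 rho by move=> j; apply: le_trans (hx j) _; lra.
have zb t : `|t| <= 2 -> supd (z t) x (2 * e) /\ supd (z t) x0 rho.
  move=> ht; have h : supd (z t) x (2 * e).
    move=> j; rewrite /z -ln_upd !mxE addrAC subrr add0r normrM (ger0_norm e0) mulrC ler_wpM2r //.
    by case: eqP => // /eqP ji; apply: le_trans (hu j ji) _; lra.
  split=> // j; have := h j; have := hx j.
  have := ler_normD (z t 0 j - x 0 j) (x 0 j - x0 0 j).
  by rewrite addrA subrK; lra.
have S1 : Sm n.+1 M1 (fun t => 2 * pi * q * (e * dFj J (z t) i - e * dFj J x i)).
  apply: Sm_mono (Sm_dphase q0 e01 er hx hu hJ).
  by rewrite /M1 ler_wpM2l // ler_wpM2l // mulr_ge0.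
pose be (c : 'I_n -> R) := Fj J x + \sum_j (e * c j) * upd u i 0 0 j.
have phE (a : R) (c : 'I_n -> R) t : a * (Fj J (x + e *: upd u i t) - Fj J x - \sum_j (e * c j) * upd u i t 0 j) =
    a * (Fj J (z t) - be c - (e * c i) * t).
  by rewrite ln_upd -/(z t) (sum_upd (fun j => e * c j)) /be; ring.
have hPhi t := phase_derive J q (e * dFj J x i) (be (dFj J x)) (x + e *: upd u i 0) i e t.
have [c1 s1] := hK1 _ _ hPhi S1.
have Sw : Sm n.+2 Cw (fun t => w (z t)).
  apply: (@Sm_ext _ _ (fun t => 1 * (w (z t) - 0))); first by move=> t; rewrite subr0 mul1r.
  apply: Sm_line => //; first by move=> t _; rewrite subr0 mul1r; exact: (hCw i (z t) (leq0n _)).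
  move=> m t /andP[_ mn] _; rewrite normr1 mul1r -[leRHS]mul1r; apply: ler_pM => //.
  - exact: exprn_ge0.
  - exact: exprn_ile1.
  - exact: hCw.
have A1 : CSm n.+2 Ba (fun t => amp1 J q e x (upd u i t)).
  have -> : (fun t => amp1 J q e x (upd u i t)) = (fun t => (w (z t))%:C%C *
      cis (q * (Fj J (z t) - be (dFj J x) - (e * dFj J x i) * t))).
    by apply/funext => t; rewrite /amp1 (phE q) ln_upd -/(z t).
  by apply: CSm_scale.
split.
  by case: A1 => a1 a2; split; [apply: Sm_mono a1|apply: Sm_mono a2]; lra.
move=> k p hp ep.
have pp : 0 <= p by apply: le_trans (normr_ge0 _) (hp i).
have Qep : 0 <= Q * e * p by rewrite !mulr_ge0 //; lra.
set c := Kc * ((1 + Q * e * p) / Q).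
have Q0 : 0 < Q by lra.
have cB : 0 <= c <= Kc * (1 + B0).
  apply/andP; split; first by rewrite /c mulr_ge0 // divr_ge0 //; lra.
  rewrite /c ler_wpM2l // ler_pdivrMr //.
  have : Q * (e * p) <= Q * B0 by rewrite ler_wpM2l //; lra.
  by lra.
have De : D * e ^+ 2 <= Q^-1 by rewrite -(ler_pM2l Q0) mulfV ?gt_eqF // mulrA.
have ep' : e * p = Q * e * p / Q by field; rewrite gt_eqF.
have Qi : 0 < Q^-1 by rewrite invr_gt0.
have cE : c = Kc * Q^-1 + Kc * (e * p) by rewrite /c ep'; field; rewrite gt_eqF.
have ep0 : 0 <= e * p by rewrite mulr_ge0.
have S2 : Sm n.+1 c (fun t => 2 * pi * 1 * (e * dFj J (z t) i - e * k i)).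
  apply: (@Sm_ext _ _ ((fun t => 2 * pi * 1 * (e * dFj J (z t) i - e * dFj J x i)) + cst (2 * pi * 1 * (e * (dFj J x i - k i))))).
    move=> t; transitivity (2 * pi * 1 * (e * dFj J (z t) i - e * dFj J x i) + 2 * pi * 1 * (e * (dFj J x i - k i))) => //.
    by ring.
  have hc : `|2 * pi * 1 * (e * (dFj J x i - k i))| <= 8 * (e * p).
    rewrite !normrM (ger0_norm p0) (ger0_norm e0) normr1 mulr1 ger0_norm //.
    by apply: ler_pM; rewrite ?mulr_ge0 //; [lra|apply: ler_wpM2l].
  have o1 : 0 <= 1 :> R by [].
  have S4 := Sm_dphase o1 e01 er hx hu hJ.
  apply: (Sm_mono _ (SmD S4 (Sm_cst n.+1 hc))).
    have h1 : r%:R * (32 * C * (1 * D * e ^+ 2)) <= r%:R * (32 * C * Q^-1).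
      by rewrite ler_wpM2l // ler_wpM2l ?mulr_ge0 // mul1r.
    have h2 : 0 <= r%:R * (C * Q^-1) by rewrite !mulr_ge0 // ltW.
    have h3 : 0 <= r%:R * (C * (e * p)) by rewrite !mulr_ge0.
    have h4 : 0 <= n%:R * Q^-1 by rewrite mulr_ge0 // ltW.
    have h5 : 0 <= n%:R * (e * p) by rewrite mulr_ge0.
    by rewrite cE; exact: small_phase_const h1 h2 h3 h4 h5 (ltW Qi) ep0.
have hEta t := phase_derive J 1 (e * k i) (be k) (x + e *: upd u i 0) i e t.
have bEta t : `|t| <= 2 -> `|2 * pi * (1 * (Fj J (z t) - be k - e * k i * t))| <= c.
  move=> ht; have [h1 h2] := zb t ht.
  rewrite -(phE 1) mul1r ln_upd -/(z t) normrM ger0_norm ?mulr_ge0 //.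
  have E : Fj J (z t) - Fj J x - \sum_j (e * k j) * upd u i t 0 j =
    \sum_l J l * (f l (z t) - f l x - \sum_j grad f l x 0 j * (z t 0 j - x 0 j)) +
    \sum_j (dFj J x j - k j) * (z t 0 j - x 0 j).
    have zx j : z t 0 j - x 0 j = e * upd u i t 0 j by rewrite /z -ln_upd !mxE addrAC subrr add0r.
    have -> : \sum_l J l * (f l (z t) - f l x - \sum_j grad f l x 0 j * (z t 0 j - x 0 j)) =
       Fj J (z t) - Fj J x - \sum_j dFj J x j * (z t 0 j - x 0 j).
      rewrite /Fj -sumrB.
      have -> : \sum_j dFj J x j * (z t 0 j - x 0 j) = \sum_l J l * \sum_j grad f l x 0 j * (z t 0 j - x 0 j).
        under [RHS]eq_bigr do rewrite mulr_sumr.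
        rewrite exchange_big /=; apply: eq_bigr => j _; rewrite /dFj mulr_suml.
        by apply: eq_bigr => l _; rewrite [grad f l x 0 j]mxE mulrA.
      by rewrite -sumrB; apply: eq_bigr => l _; ring.
    have -> : \sum_j (dFj J x j - k j) * (z t 0 j - x 0 j) =
       \sum_j dFj J x j * (z t 0 j - x 0 j) - \sum_j (e * k j) * upd u i t 0 j.
      by rewrite -sumrB; apply: eq_bigr => j _; rewrite zx; ring.
    by ring.
  have t1 : `|\sum_l J l * (f l (z t) - f l x - \sum_j grad f l x 0 j * (z t 0 j - x 0 j))| <= r%:R * (8 * C * Q^-1).
    apply: le_trans (ler_norm_sum _ _ _) _; apply: sum_le_ord => l; rewrite normrM.
    apply: le_trans (ler_pM (normr_ge0 _) (normr_ge0 _) (hJ l) (hT x (z t) _ hxr h2 h1 l)) _.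
    have : 8 * C * (D * e ^+ 2) <= 8 * C * Q^-1 by rewrite ler_wpM2l // mulr_ge0.
    by rewrite exprMn; lra.
  have t2 : `|\sum_j (dFj J x j - k j) * (z t 0 j - x 0 j)| <= n%:R * (p * (2 * e)).
    apply: le_trans (ler_norm_sum _ _ _) _; apply: sum_le_ord => j; rewrite normrM.
    by apply: ler_pM.
  apply: (@le_trans _ _ (8 * (r%:R * (8 * C * Q^-1) + n%:R * (p * (2 * e))))).
    apply: ler_pM; rewrite ?mulr_ge0 //; first by lra.
    rewrite E; apply: le_trans (ler_normD _ _) _; lra.
  have h2' : 0 <= r%:R * (C * (e * p)) by rewrite !mulr_ge0.
  have h4 : 0 <= n%:R * Q^-1 by rewrite mulr_ge0 // ltW.
  by rewrite cE /Kc; lra.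
have [c2 s2] := hK2 c _ _ cB hEta bEta S2.
have A2 : CSm n.+2 (K2 * c) (fun t => cis (phinc J k e x (upd u i t)) - 1).
  have -> : (fun t => cis (phinc J k e x (upd u i t)) - 1) =
     (fun t => cis (1 * (Fj J (z t) - be k - e * k i * t)) - 1).
    by apply/funext => t; rewrite /phinc -(phE 1) mul1r.
  split.
    by apply: Sm_ext c2 => t; rewrite -[LHS]/(cos _ - 1) raddfB.
  by apply: Sm_ext s2 => t; rewrite raddfB /= subr0.
have [a1 a2] := CSmM A1 A2.
have Bc : 2 * (2 ^+ n.+2 * (Ba * (K2 * c))) <= (1 + Ba + Bb) * ((1 + Q * e * p) / Q).
  have -> : 2 * (2 ^+ n.+2 * (Ba * (K2 * c))) = Bb * ((1 + Q * e * p) / Q) by rewrite /Bb /c; ring.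
  by rewrite ler_wpM2r ?divr_ge0 //; lra.
by split; [exact: Sm_mono a1|exact: Sm_mono a2].
Qed.

End Amplitude.

(** * Discrete Poisson summation and local averaging *)

Section Poisson.
Context {R : realType} {n : nat}.
Implicit Types phi : 'rV[int]_n -> R[i].

(** Index t stands for the integer t - L; the window is a complete residue system modulo M with
    representatives at most M/2 in absolute value. *)
Definition inwin (L M t : nat) : bool := (L - M./2 <= t < L - M./2 + M)%N.

Lemma cis_window (L M : nat) (y : int) : (0 < M <= L)%N ->
  \sum_(t < (2 * L).+1 | inwin L M t) cis (- ((t%:Z - L%:Z)%:~R / M%:R) * y%:~R : R) =
  if (M%:Z %| y)%Z then M%:R else 0.
Proof.
move=> /andP[M0 ML]; set a := (L - M./2)%N.
have Mn : M%:R != 0 :> R by rewrite pnatr_eq0 -lt0n.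
pose F t : R[i] := cis (- ((t%:Z - L%:Z)%:~R / M%:R) * y%:~R : R).
have hM := odd_double_half M.
have aM : (a + M <= (2 * L).+1)%N by rewrite /a; move: hM; rewrite -muln2; lia.
have -> : \sum_(t < (2 * L).+1 | inwin L M t) F t = \sum_(a <= t < a + M) F t.
  rewrite -(big_mkord (inwin L M) F) (big_nat_widen _ _ (2 * L).+1 predT F aM) (big_nat_widenl a 0 _ _ _ (leq0n a)).
  by apply: eq_bigl => t; rewrite /inwin -/a andbC.
rewrite -{1}[a]add0n big_addn addKn big_mkord.
have -> : \sum_(t < M) F (t + a)%N = \sum_(t < M) cis (- ((a%:R - L%:R) / M%:R) * y%:~R : R) * cis ((- y)%:~R * t%:R / M%:R : R).
  apply: eq_bigr => t _; rewrite -cisD /F; congr cis.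
  have -> : ((t + a)%N%:Z - L%:Z)%:~R = t%:R + a%:R - L%:R :> R by rewrite rmorphB /= -!pmulrn natrD.
  by rewrite rmorphN /=; field.
rewrite -mulr_sumr cis_orth // (_ : (M%:Z %| - y)%Z = (M%:Z %| y)%Z); last by rewrite !dvdzE abszN.
case: ifP => [/dvdzP[c ->]|_]; last by rewrite mulr0.
have -> : - ((a%:R - L%:R) / M%:R) * (c * M%:Z)%:~R = ((L%:Z - a%:Z) * c)%:~R :> R.
  by rewrite !rmorphM rmorphB /= -!pmulrn; field.
by rewrite cis_int mul1r.
Qed.

(** Divisibility by M is detected with characters. The representatives are centred so that the phase
    of a far dual vector stays away from the next period in [far_T]. *)
Lemma poisson_window phi B L M : bnd B phi -> (0 < M <= L)%N ->
  zs (fun a => phi (M%:Z *: a)) = (M%:R ^+ n)^-1 *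
    \sum_(v : {ffun 'I_n -> 'I_(2 * L).+1} | [forall i, inwin L M (v i)])
     zs (tw (fun i => - ((@cpos n L v 0 i)%:~R / M%:R)) phi).
Proof.
move=> hphi ML; have /andP[M0 _] := ML.
have Mn : M%:R != 0 :> R[i] by rewrite pnatr_eq0 -lt0n.
have Mz : M%:Z != 0 by rewrite -lt0n.
pose th (v : {ffun 'I_n -> 'I_(2 * L).+1}) i : R := - ((@cpos n L v 0 i)%:~R / M%:R).
pose ind (y : 'rV[int]_n) : R[i] := if [forall i, (M%:Z %| y 0%R i)%Z] then 1 else 0.
have P y : \sum_(v : {ffun 'I_n -> 'I_(2 * L).+1} | [forall i, inwin L M (v i)]) cis (zdot (th v) y) = M%:R ^+ n * ind y.
  transitivity (\prod_(i < n) \sum_(t < (2 * L).+1 | inwin L M t) cis (- ((t%:Z - L%:Z)%:~R / M%:R) * (y 0 i)%:~R : R)).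
    rewrite bigA_distr_big; apply: eq_big => v; first exact/forallP/ffun_onP.
    move=> _; rewrite /zdot cis_sum; apply: eq_bigr => i _.
    by rewrite /th !mxE addrC.
  rewrite (eq_bigr (fun i => if (M%:Z %| y 0%R i)%Z then M%:R else 0)); last by move=> i _; exact: cis_window.
  rewrite /ind; case: ifP => [/forallP h|/negbT/forallPn[i hi]].
    by rewrite (eq_bigr (fun _ => M%:R)) ?prodr_const ?card_ord ?mulr1 // => i _; rewrite h.
  by rewrite (bigD1 i) //= (negbTE hi) mul0r mulr0.
pose F y := phi y * ind y.
have FM a : F (M%:Z *: a) = phi (M%:Z *: a).
  rewrite /F /ind (_ : [forall i, _]) ?mulr1 //; apply/forallP => i.
  by rewrite mxE dvdz_mulr.
have -> : zs (fun a => phi (M%:Z *: a)) = zs F.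
  transitivity (zs (fun a => F (M%:Z *: a))); first by congr zs; apply/funext => a; rewrite FM.
  rewrite /zs -(@fsbig_widen _ _ _ _ ((fun a => M%:Z *: a) @` [set: 'rV[int]_n]) [set: _] F) //.
    rewrite fsbig_image // => a a' _ _ /matrixP h; apply/matrixP => o i.
    by have := h o i; rewrite !mxE => /(mulfI Mz).
  move=> y [_ ny] /=; rewrite /F /ind; case: ifP => [/forallP h|_]; last by rewrite mulr0.
  exfalso; apply: ny; exists (\row_i (y 0%R i %/ M)%Z) => //.
  by apply/rowP => i; rewrite !mxE mulrC divzK.
have bF : bnd B F by move=> y hy; apply: hphi; apply: contraNneq hy => h; rewrite /F h mul0r.
rewrite {1}/zs (zs_bnd bF).
have E v : zs (tw (th v) phi) = \sum_u phi (@cpos n B u) * cis (zdot (th v) (@cpos n B u)).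
  by rewrite /zs (zs_bnd (@bnd_tw _ _ B (th v) phi hphi)).
rewrite (eq_bigr _ (fun v _ => E v)) exchange_big /= mulr_sumr; apply: eq_bigr => u _.
by rewrite -mulr_sumr P /F mulrCA mulKf // expf_neq0.
Qed.

(** All translates of [phi] have the same sum, so averaging over translates with weight [kap] cuts
    [phi] into pieces localised at the scale of [kap]. *)
Lemma averaging (kap : 'rV[int]_n -> R[i]) phi (E N : nat) (b : 'rV[int]_n) : bnd E kap ->
 (forall y a, kap a != 0 -> phi (y + a) != 0 -> forall i, b 0 i <= y 0 i < b 0 i + N%:Z) ->
 zs kap * zs phi = \sum_(v : {ffun 'I_n -> 'I_N}) zs (fun a => kap a * phi (bpos b v + a)).
Proof.
move=> hk h.
have E1 v : zs (fun a => kap a * phi (bpos b v + a)) = \sum_u kap (@cpos n E u) * phi (@bpos n b N v + @cpos n E u).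
  rewrite /zs (@zs_bnd _ _ E) // => a ha; apply: hk; apply: contraNneq ha => ->.
  by rewrite mul0r.
rewrite (eq_bigr _ (fun v _ => E1 v)) exchange_big /= {1}/zs (zs_bnd hk) mulr_suml; apply: eq_bigr => u _.
rewrite -mulr_sumr; have [->|k0] := eqVneq (kap (@cpos n E u)) 0; first by rewrite !mul0r.
congr (_ * _); rewrite /zs -(zs_shift (@cpos n E u) phi) (@zsE _ _ b N) // => y.
exact: h.
Qed.

Definition kmass A E : R := \sum_(u : {ffun 'I_n -> 'I_(2 * E).+1}) kern A E (@cpos n E u).

Lemma kern_bnd A E : (0 < E)%N -> bnd E (fun a : 'rV[int]_n => (kern A E a)%:C%C : R[i]).
Proof.
move=> E0 a ha; apply: (@kern_out R n A) => //; apply: contraNneq ha => ->.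
by rewrite rmorph0.
Qed.

Lemma zs_kern A E : (0 < E)%N -> zs (fun a : 'rV[int]_n => (kern A E a)%:C%C : R[i]) = (kmass A E)%:C%C.
Proof. by move=> E0; rewrite /zs (zs_bnd (@kern_bnd A E E0)) rmorph_sum. Qed.

Lemma kmass_ge A E : (0 < E)%N -> ((3 / 4) ^+ A.+1 / 2 * E%:R) ^+ n <= kmass A E.
Proof.
move=> E0; have ER : 0 < E%:R :> R by rewrite ltr0n.
have k0 : 0 <= (3 / 4 : R) ^+ A.+1 by rewrite exprn_ge0.
have -> : kmass A E = \prod_(i < n) \sum_(t < (2 * E).+1) rho0 A ((t%:R - E%:R) / E%:R).
  rewrite bigA_distr_bigA; apply: eq_bigr => u _; rewrite /kern; apply: eq_bigr => j _.
  by rewrite !mxE rmorphD rmorphN /= addrC.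
rewrite -[X in _ ^+ X <= _](card_ord n) -prodr_const; apply: ler_prod => i _.
apply/andP; split; first by rewrite mulr_ge0 // divr_ge0.
pose t0 : 'I_(2 * E).+1 := inord E.
have t0E : t0 = E :> nat by rewrite inordK //; lia.
have hE := odd_double_half E.
have h1 : (E./2)%:R <= E%:R / 2 :> R.
  by rewrite ler_pdivlMr // -natrM ler_nat muln2 -[leqRHS]hE leq_addl.
have h0 : (E./2 <= E)%N by move: hE; rewrite -muln2; lia.
have hc := @card1_ge R E t0 _ _ h1 h0.
apply: (@le_trans _ _ (\sum_(t < (2 * E).+1 | `|(t%:R : R) - t0%:R| <= E%:R / 2) (3 / 4) ^+ A.+1)).
  rewrite sumr_const -[leRHS]mulr_natl mulrAC -mulrA mulrC ler_wpM2r //.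
  apply: (@le_trans _ _ (E./2.+1)%:R); last by rewrite ler_nat.
  by rewrite ler_pdivrMr // -natrM ler_nat; move: hE; rewrite -muln2; lia.
rewrite big_mkcond; apply: ler_sum => t _; case: ifP => [ht|_]; last exact: rho0_ge0.
apply: rho0_ge; rewrite normrM normfV (gtr0_norm ER) ler_pdivrMr //.
have e : t0%:R = E%:R :> R by rewrite t0E.
by move: ht; rewrite e; lra.
Qed.

End Poisson.

(** * Abel summation against a geometric progression *)

Section Abel.
Context {R : realType}.

(** The worst case is |x| = 3/4, at distance 1/4 from the integers. *)
Lemma dist_int_third (x : R) : `|x| <= 3 / 4 -> `|x| / 3 <= dist_int x.
Proof.
move=> hx; have [m [-> _]] := dist_intP x.
have [->|m0] := eqVneq m 0; first by rewrite subr0; have := normr_ge0 x; lra.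
have : 1 <= `|m%:~R : R|.
  by rewrite -intr_norm -[1]/(1%:~R) ler_int -gtz0_ge1 normr_gt0.
have := ler_normB x (x - m%:~R); have -> : x - (x - m%:~R) = m%:~R by ring.
by lra.
Qed.

Lemma abel_sum (c G e : nat -> R[i]) N : G 1%N = e 0%N -> (forall t, G t.+2 = G t.+1 + e t.+1) ->
  \sum_(t < N.+1) c t * e t = c N * G N.+1 - \sum_(t < N) (c t.+1 - c t) * G t.+1.
Proof.
move=> h1 h2; elim: N => [|N IH]; first by rewrite big_ord1 big_ord0 subr0 h1.
rewrite big_ord_recr /= IH [\sum_(t < N.+1) _]big_ord_recr /= h2; ring.
Qed.

Lemma abel_geom (c : nat -> R[i]) (x V W : R) (q N : nat) : 0 <= V -> 0 <= W ->
  (forall t, (t < N)%N -> nrm (c t) <= V) -> (forall t, (t.+1 < N)%N -> nrm (c t.+1 - c t) <= W) ->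
  dist_int x * nrm (\sum_(t < N) c t * cis ((q + t)%:R * x)) <= V + N%:R * W.
Proof.
move=> V0 W0 hV hW; case: N hV hW => [|N] hV hW.
  by rewrite big_ord0 nrm0 mulr0 mul0r addr0.
pose G k := \sum_(t < k) cis ((q + t)%:R * x).
have hG k : dist_int x * nrm (G k) <= 1.
  have -> : G k = cis (q%:R * x) * \sum_(t < k) cis (t%:R * x).
    by rewrite mulr_sumr; apply: eq_bigr => t _; rewrite -cisD natrD mulrDl.
  by rewrite nrmM nrm_cis mul1r; exact: geom_cis_le.
have d0 := dist_int_ge0 x.
rewrite (@abel_sum c G (fun t => cis ((q + t)%:R * x))); first last.
- by move=> t; rewrite /G big_ord_recr.
- by rewrite /G big_ord1.
have hb z k (B : R) : nrm z <= B -> dist_int x * nrm (z * G k) <= B.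
  move=> hz; rewrite nrmM mulrCA; apply: le_trans hz.
  by rewrite -[leRHS]mulr1; apply: ler_wpM2l; [exact: nrm_ge0|exact: hG].
apply: (@le_trans _ _ (dist_int x * nrm (c N * G N.+1) + \sum_(t < N) dist_int x * nrm ((c t.+1 - c t) * G t.+1))).
  rewrite -mulr_sumr -mulrDr ler_wpM2l //; apply: le_trans (nrmD _ _) _.
  by rewrite nrmN lerD2l; exact: nrm_sum.
apply: lerD; first by apply: hb; exact: hV.
apply: (@le_trans _ _ (N%:R * W)); last by rewrite ler_wpM2r // ler_nat.
by apply: sum_le_ord => t; apply: hb; apply: hW; rewrite ltnS.
Qed.

End Abel.

(** * Tails over dual vectors and monotonicity in the constants *)

Section LatticeHelpers.
Context {R : realType} {n : nat}.

Lemma zs_mull (c : R[i]) M (phi : 'rV[int]_n -> R[i]) : bnd M phi -> c * zs phi = zs (fun a => c * phi a).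
Proof.
move=> h; have h2 : bnd M (fun a => c * phi a).
  by move=> a ha; apply: h; apply: contraNneq ha => ->; rewrite mulr0.
by rewrite /zs (zs_bnd h) (zs_bnd h2) mulr_sumr.
Qed.

Lemma near_reindex (V : zmodType) (K L : nat) (Phi : 'rV[int]_n -> V) : (K <= L)%N ->
  \sum_(v : {ffun 'I_n -> 'I_(2 * L).+1} | [forall i, (`|@cpos n L v 0%R i| <= K)%N]) Phi (cpos v) =
  \sum_(u : {ffun 'I_n -> 'I_(2 * K).+1}) Phi (cpos u).
Proof.
move=> KL; pose psi a := if [forall i, (`|(a : 'rV[int]_n) 0%R i| <= K)%N] then Phi a else 0.
have h : bnd K psi.
  by move=> a; rewrite /psi; case: ifP => [/forallP h _ j|_]; [exact: h|rewrite eqxx].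
have E := zs_bnd (bnd_leq KL h); rewrite (zs_bnd h) in E.
rewrite big_mkcond /= -[LHS]E; apply: eq_bigr => u _; rewrite /psi.
case: ifP => // /negbT/negP[]; apply/forallP => i; rewrite !mxE.
by have := ltn_ord (u i); clear E h psi; move: (u i) => /= s; lia.
Qed.

Definition kmax L (v : {ffun 'I_n -> 'I_(2 * L).+1}) : nat := (\max_(i < n) `|@cpos n L v 0%R i|)%N.

Lemma card_kmax L (v0 : 'I_(2 * L).+1) t : v0 = L :> nat ->
  (#|[pred v : {ffun 'I_n -> 'I_(2 * L).+1} | (kmax v <= t)%N]|)%:R <= (2 * t%:R + 1) ^+ n :> R.
Proof.
move=> v0E; apply: (@le_trans _ _ ((\prod_(i < n) #|[pred s : 'I_(2 * L).+1 | (`|(s%:R : R) - v0%:R| <= t%:R)%R]|)%N)%:R).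
  rewrite ler_nat -[X in (_ <= X)%N](big_map (fun i : 'I_n => #|[pred s : 'I_(2 * L).+1 | (`|(s%:R : R) - v0%:R| <= t%:R)%R]|) predT id).
  rewrite -foldrE -[index_enum _]enumT -card_family; apply/subset_leq_card/fintype.subsetP => v; rewrite inE => hv.
  apply/familyP => i; rewrite inE v0E.
  have : (`|@cpos n L v 0%R i| <= t)%N by apply: leq_trans hv; exact: (leq_bigmax_cond i).
  rewrite -(ler_nat R) natr_absz intr_norm !mxE rmorphD rmorphN /=.
  by rewrite addrC.
rewrite natr_prod -[X in _ <= _ ^+ X](card_ord n) -prodr_const; apply: ler_prod => i _.
by rewrite ler0n /=; exact: card1_le.
Qed.

Lemma inv_sq_tail (K N : nat) : (0 < K)%N ->
  \sum_(t < N | (K < t)%N) (t%:R ^+ 2)^-1 <= K%:R^-1 - (maxn K N.-1)%:R^-1 :> R.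
Proof.
move=> K0; elim: N => [|N IH]; first by rewrite big_ord0 maxn0 subrr.
rewrite big_mkcond big_ord_recr /= -big_mkcond.
have [KN|NK] := ltnP K N; last first.
  rewrite addr0; apply: le_trans IH _.
  by rewrite (maxn_idPl _) ?subrr //; apply: leq_trans NK; exact: leq_pred.
have e1 : maxn K N.-1 = N.-1 by apply/maxn_idPr; case: (N) KN.
rewrite e1 in IH.
have N1 : (0 < N.-1)%N by case: (N) KN => [|[|m]] //; lia.
have a0 : 0 < N.-1%:R :> R by rewrite ltr0n.
have NE : N%:R = N.-1%:R + 1 :> R by rewrite natr1 prednK //; lia.
have b0 : 0 < N%:R :> R by rewrite NE; lra.
have h : (N%:R ^+ 2)^-1 <= N.-1%:R^-1 - N%:R^-1 :> R.
  have -> : N.-1%:R^-1 - N%:R^-1 = (N.-1%:R * N%:R)^-1 :> R.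
    by rewrite NE; field; rewrite -NE !gt_eqF.
  rewrite lef_pV2 ?posrE ?mulr_gt0 ?exprn_gt0 // expr2 ler_pM2r //.
  by rewrite ler_nat leq_pred.
by lra.
Qed.

(** At most (3t)^n vectors have largest entry t, so the exponent n + 2 leaves the tail of the sum of
    1/t^2. *)
Lemma far_sum (K L : nat) : (0 < K)%N ->
  \sum_(v : {ffun 'I_n -> 'I_(2 * L).+1} | (K < kmax v)%N) ((kmax v)%:R ^+ n.+2)^-1 <= 3 ^+ n / K%:R :> R.
Proof.
move=> K0; have kL (v : {ffun 'I_n -> 'I_(2 * L).+1}) : (kmax v < L.+1)%N.
  rewrite ltnS; apply/bigmax_leqP => i _; rewrite !mxE.
  have := ltn_ord (v i); lia.
rewrite (partition_big (fun v : {ffun 'I_n -> 'I_(2 * L).+1} => Ordinal (kL v)) (fun t : 'I_L.+1 => (K < t)%N)) //=.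
apply: (@le_trans _ _ (\sum_(t < L.+1 | (K < t)%N) 3 ^+ n * (t%:R ^+ 2)^-1)); last first.
  rewrite -mulr_sumr ler_wpM2l ?exprn_ge0 //; apply: le_trans (inv_sq_tail _ K0) _.
  by rewrite gerBl invr_ge0.
apply: ler_sum => t Kt; have t0 : (0 < t)%N by apply: leq_ltn_trans Kt.
have tR : 1 <= t%:R :> R by rewrite ler1n.
apply: (@le_trans _ _ (\sum_(v : {ffun 'I_n -> 'I_(2 * L).+1} | (kmax v <= t)%N) (t%:R ^+ n.+2)^-1)).
  rewrite [leLHS]big_mkcond [leRHS]big_mkcond; apply: ler_sum => v _.
  case: ifP => [/andP[_ /eqP/(congr1 val) /= e]|_]; first by rewrite -e leqnn.
  by case: ifP => _ //; rewrite invr_ge0 exprn_ge0.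
rewrite sumr_const -[leLHS]mulr_natl.
pose v0 : 'I_(2 * L).+1 := inord L.
have v0E : v0 = L :> nat by rewrite inordK //; lia.
apply: le_trans (ler_wpM2r _ (card_kmax t v0E)) _; first by rewrite invr_ge0 exprn_ge0.
have h : (2 * t%:R + 1) ^+ n <= (3 * t%:R) ^+ n :> R by rewrite lerXn2r ?nnegrE //; lra.
apply: le_trans (ler_wpM2r _ h) _; first by rewrite invr_ge0 exprn_ge0.
rewrite exprMn (_ : t%:R ^+ n.+2 = t%:R ^+ n * t%:R ^+ 2); last by rewrite -exprD addn2.
rewrite -mulrA ler_wpM2l ?exprn_ge0 // invfM mulrA mulfV ?mul1r //.
by rewrite expf_neq0 // gt_eqF //; lra.
Qed.

Lemma system_mono (Y : finType) (X G : Y -> 'rV[R]_n) (g : Y -> R) (L C C' : R) : C <= C' ->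
  system X G g L C -> system X G g L C'.
Proof.
move=> CC [C1 L1 hY h1 h2].
have hs X' G' g' : half_system X' G' g' L C -> half_system X' G' g' L C'.
  move=> [a b c d]; split.
  - by move=> y y' e he; apply: le_trans (a y y' e he) _; rewrite ler_wpM2r // sqr_ge0.
  - move=> y y' e he i; apply: le_trans (b y y' e he i) _; rewrite ler_wpM2r //.
    exact: le_trans (normr_ge0 _) (he i).
  - by move=> y r hr; apply: le_trans (c y r hr) _; rewrite ler_wpM2r.
  - move=> y r hr; apply: le_trans (d y r hr) _; rewrite ler_wpM2r // exprn_ge0 //.
    by rewrite addr_ge0 // mulr_ge0 //; lra.
split; [lra|by []| |exact: hs|exact: hs].
by apply: le_trans hY _; rewrite ler_wpM2r // exprn_ge0 //; lra.
Qed.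

(** [L] cancels from the final bound, so a factorial is affordable. *)
Lemma exists_common_multiple (Q : nat) (Lam : R) :
  exists L : nat, [/\ (0 < L)%N, forall q, (0 < q <= Q)%N -> (q %| L)%N & Lam <= L%:R].
Proof.
exists (Q`! * (Num.truncn Lam).+1)%N; split.
- by rewrite muln_gt0 fact_gt0.
- by move=> q hq; apply: dvdn_mulr; exact: dvdn_fact.
apply: le_trans (ltW (truncnS_gt Lam)) _.
by rewrite ler_nat leq_pmull // fact_gt0.
Qed.

Lemma good_shrink r (f : 'I_r -> 'rV[R]_n -> R) x0 (rho rho' C : R) : 0 < rho' <= rho ->
  good f x0 rho C -> good f x0 rho' C.
Proof.
move=> /andP[r0 r1] [/andP[_ h1] C1 [a b c d]].
have m x : supd x x0 rho' -> supd x x0 rho by move=> h i; apply: le_trans (h i) r1.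
split => //; first by rewrite r0; lra.
split.
- by move=> x x' e /m h /m h'; exact: a.
- by move=> x x' e /m h /m h'; exact: b.
- by move=> x x' e t /m h /m h'; exact: c.
- by move=> x k i l hk /m; exact: d.
Qed.

End LatticeHelpers.

(** * Localised dual sums *)

Section Twisted.
Context {R : realType} {n r : nat}.
Variables (f : 'I_r -> 'rV[R]_n -> R) (x0 : 'rV[R]_n) (rho C : R) (w : 'rV[R]_n -> R).
Hypotheses (rho0 : 0 < rho) (rho1 : rho <= 1) (hsupp : forall x, w x != 0 -> supd x x0 (rho / 4)).
Variables (J : 'I_r -> R) (L : nat).
Hypothesis hL : 48 <= rho * L%:R.

Definition wph (q : R) (y : 'rV[int]_n) : R[i] := (w (lpt L y))%:C%C * cis (q * Fj f J (lpt L y)).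
Definition thk (q : R) (k : 'rV[int]_n) (i : 'I_n) : R := - (q * (k 0 i)%:~R / L%:R).
Definition pk (k : 'rV[int]_n) x i : R := dFj f J x i - (k 0 i)%:~R.
Definition Psi (k : 'rV[int]_n) x : R := Fj f J x - \sum_i x 0 i * (k 0 i)%:~R.
(** The local sum at y for the function F - k . x: its value [Psi] at y is split off, its gradient
    [pk] becomes the twist, and [amp1] carries the rest. *)
Definition Aq (E : nat) (q : R) k y : R[i] := zs (tw (fun i => q * pk k (lpt L y) i / L%:R)
  (fun a => (kern n.+2 E a)%:C%C * amp1 f w J q (E%:R / L%:R) (lpt L y) (scl E a))).

Let LR : 0 < L%:R :> R.
Proof. by have h := hL; have h0 := rho0; case: (L) h => [|k] //; rewrite mulr0; lra. Qed.

Let hL2 : 4 <= rho / 2 * L%:R.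
Proof. by have h := hL; lra. Qed.

Lemma lptE (y : 'rV[int]_n) i : lpt L y 0 i = (y 0 i)%:~R / L%:R :> R.
Proof. by rewrite mxE. Qed.

Lemma lptD y a : lpt L (y + a) = lpt L y + lpt L a :> 'rV[R]_n.
Proof. by apply/rowP => i; rewrite !mxE rmorphD mulrDl. Qed.

Lemma lpt_scl E a : (0 < E)%N -> lpt L a = (E%:R / L%:R) *: scl E a :> 'rV[R]_n.
Proof.
move=> E0; apply/rowP => i; rewrite !mxE.
have e0 : E%:R != 0 :> R by rewrite pnatr_eq0 -lt0n.
have l0 : L%:R != 0 :> R by rewrite gt_eqF.
by field; rewrite e0 l0.
Qed.

Lemma wph_bnd : exists B, forall q, bnd B (wph q).
Proof.
exists (\max_(i < n) (Num.truncn ((`|x0 0%R i| + 1) * L%:R)).+1)%N => q y hy j.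
have : w (lpt L y) != 0 by apply: contraNneq hy => h; rewrite /wph h rmorph0 mul0r.
move=> /hsupp /(_ j); rewrite mxE => h.
apply: leq_trans (leq_bigmax_cond j _) => //.
rewrite -(ler_nat R) natr_absz intr_norm; apply: le_trans (ltW (truncnS_gt _)).
rewrite -ler_pdivrMr // -[X in _ / X](gtr0_norm LR) -normf_div.
have := ler_normD ((y 0 j)%:~R / L%:R - x0 0 j) (x0 0 j); rewrite subrK.
by have h1 := rho1; lra.
Qed.

(** Expanding F - k . x around y separates e(q Psi), whose sum over q is geometric, from [Aq], which
    varies slowly with q. *)
Lemma T_avg (E : nat) (q : R) (k : 'rV[int]_n) : (0 < E)%N -> 8 * (E%:R / L%:R) <= rho ->
  (@kmass R n n.+2 E)%:C%C * zs (tw (thk q k) (wph q)) =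
  \sum_v cis (q * Psi k (lpt L (ylat x0 (rho / 2) L v))) * Aq E q k (ylat x0 (rho / 2) L v).
Proof.
move=> E0 hE; have l0 := LR; have hl := hL; have r0 := rho0.
have ER : 0 < E%:R :> R by rewrite ltr0n.
rewrite -zs_kern //.
rewrite (@averaging _ _ _ _ E (2 * cubeN (rho / 2) L).+1 (cubeb x0 (rho / 2) L)); first last.
- move=> y a ha hw.
  have hw' : w (lpt L (y + a)) != 0 by apply: contraNneq hw => h; rewrite /tw /wph h rmorph0 !mul0r.
  have hs := hsupp hw'.
  have [v <-] : exists v, ylat x0 (rho / 2) L v = y.
    have rr : rho / 2 <= 1 by have := rho1; lra.
    have r2 : 0 < rho / 2 by lra.
    apply: (@ylat_surj _ _ x0 (rho / 2) L r2 rr hL2 y (rho / 4 + rho / 8)); first by lra.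
    move=> i; have := hs i; rewrite lptD !mxE => h.
    have ha' : `|(a 0 i)%:~R / L%:R : R| <= rho / 8.
      have h1 : `|(a 0 i)%:~R| <= E%:R :> R.
        by rewrite -intr_norm -natr_absz ler_nat; exact: (kern_bnd E0 ha).
      rewrite normf_div (gtr0_norm l0); apply: (@le_trans _ _ (E%:R / L%:R)); last by lra.
      by rewrite ler_pM2r ?invr_gt0.
    have -> : (y 0 i)%:~R / L%:R - x0 0 i = ((y 0 i)%:~R / L%:R + (a 0 i)%:~R / L%:R - x0 0 i) - (a 0 i)%:~R / L%:R by ring.
    by apply: le_trans (ler_normB _ _) _; lra.
  by move=> i; rewrite !mxE; have := ltn_ord (v i); lia.
- exact: kern_bnd.
apply: eq_bigr => v _; rewrite -/(ylat x0 (rho / 2) L v); set y := ylat _ _ _ v.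
have bE : bnd E (tw (fun i => q * pk k (lpt L y) i / L%:R)
  (fun a => (kern n.+2 E a)%:C%C * amp1 f w J q (E%:R / L%:R) (lpt L y) (scl E a))).
  apply: bnd_tw => a ha; apply: (@kern_bnd R n n.+2 E E0).
  by apply: contraNneq ha => ->; rewrite mul0r.
rewrite /Aq (zs_mull _ bE); congr zs; apply/funext => a.
rewrite /tw /wph /amp1 lptD -(lpt_scl a E0) zdotD.
set x := lpt L y; set W := (w _)%:C%C; set K := (kern _ _ _)%:C%C; set F1 := Fj f J (x + _).
have e1 : zdot (thk q k) y = - (q * \sum_i x 0 i * (k 0 i)%:~R).
  by rewrite /zdot mulr_sumr -sumrN; apply: eq_bigr => i _; rewrite /thk /x lptE; field; rewrite gt_eqF.
have e2 : zdot (thk q k) a = zdot (fun i => q * pk k x i / L%:R) a -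
    q * \sum_i (E%:R / L%:R * dFj f J x i) * scl E a 0 i.
  rewrite /zdot mulr_sumr -sumrB; apply: eq_bigr => i _.
  by rewrite /thk /pk mxE; field; rewrite !gt_eqF.
have -> : W * cis (q * F1) * cis (zdot (thk q k) y + zdot (thk q k) a) =
  W * (cis (q * Psi k x) * cis (q * (F1 - Fj f J x - \sum_i (E%:R / L%:R * dFj f J x i) * scl E a 0 i)) *
    cis (zdot (fun i => q * pk k x i / L%:R) a)).
  rewrite -!mulrA -!cisD; congr (_ * cis _); rewrite e1 e2 /Psi.
  by rewrite /x; ring.
by ring.
Qed.

End Twisted.

(** * Sums over a dyadic range of q, and the choice of parameters *)

Section Shell.
Context {R : realType} {n r : nat}.

(** The trivial bound, and the one from partial summation. The weight (q/L)^n changes by at most n/Q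
    times its maximum from one q to the next; this is the n in n + 2. *)
Lemma abel_shell (Q L : nat) (A : nat -> R[i]) (psi a1 a2 : R) : (0 < n)%N -> (0 < Q)%N -> (0 < L)%N ->
  0 <= a1 <= a2 -> (forall q, (Q./2 < q <= Q)%N -> nrm (A q) <= a1) ->
  (forall q, (Q./2 < q < Q)%N -> nrm (A q.+1 - A q) <= a2 / Q%:R) ->
  let S := \sum_(Q./2.+1 <= q < Q.+1) (((q%:R / L%:R) ^+ n)%:C%C * A q) * cis (q%:R * psi) in
  nrm S <= Q%:R * ((Q%:R / L%:R) ^+ n * a1) /\ dist_int psi * nrm S <= (n%:R + 2) * ((Q%:R / L%:R) ^+ n * a2).
Proof.
move=> n0 Q0 L0 /andP[a10 a12] h1 h2 S.
have LR : 0 < L%:R :> R by rewrite ltr0n.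
have QR : 0 < Q%:R :> R by rewrite ltr0n.
set N := (Q.+1 - Q./2.+1)%N; set q1 := Q./2.+1.
have NQ : (N <= Q)%N by rewrite /N; lia.
pose c t : R[i] := (((q1 + t)%:R / L%:R) ^+ n)%:C%C * A (q1 + t)%N.
have SE : S = \sum_(t < N) c t * cis ((q1 + t)%:R * psi).
  rewrite /S -[Q./2.+1]add0n big_addn -/N big_mkord; apply: eq_bigr => t _.
  by rewrite addnC.
have QL0 : 0 <= (Q%:R / L%:R) ^+ n :> R by rewrite exprn_ge0 // divr_ge0.
have qL q : (q <= Q)%N -> 0 <= (q%:R / L%:R : R) ^+ n <= (Q%:R / L%:R) ^+ n.
  move=> hq; rewrite exprn_ge0 ?divr_ge0 //= lerXn2r ?nnegrE ?divr_ge0 //.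
  by rewrite ler_pM2r ?invr_gt0 // ler_nat.
have hc t : (t < N)%N -> nrm (c t) <= (Q%:R / L%:R) ^+ n * a1.
  move=> tN; have tQ : (q1 + t <= Q)%N by move: tN; rewrite /N /q1; lia.
  have /andP[u0 u1] := qL _ tQ.
  rewrite /c nrmM nrm_real ger0_norm //; apply: ler_pM => //; first exact: nrm_ge0.
  by apply: h1; rewrite tQ andbT /q1; lia.
split.
  rewrite SE; apply: le_trans (nrm_sum _ _ _) _.
  apply: (@le_trans _ _ (N%:R * ((Q%:R / L%:R) ^+ n * a1))); last first.
    by apply: ler_wpM2r; [exact: mulr_ge0|rewrite ler_nat].
  by apply: sum_le_ord => t; rewrite nrmM nrm_cis mulr1; exact: hc.
have a20 : 0 <= a2 by apply: le_trans a12.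
pose W := (n%:R + 1) * ((Q%:R / L%:R) ^+ n * (a2 / Q%:R)).
have W0 : 0 <= W.
  by rewrite /W mulr_ge0 ?addr_ge0 // mulr_ge0 // divr_ge0.
have hW t : (t.+1 < N)%N -> nrm (c t.+1 - c t) <= W.
  move=> tN; have tQ : (q1 + t < Q)%N by move: tN; rewrite /N /q1; lia.
  rewrite /c addnS; set q := (q1 + t)%N in tQ *.
  have -> : (((q.+1)%:R / L%:R) ^+ n)%:C%C * A q.+1 - ((q%:R / L%:R) ^+ n)%:C%C * A q =
    ((((q.+1)%:R / L%:R)%:C%C) ^+ n - ((q%:R / L%:R)%:C%C) ^+ n) * A q.+1 + ((q%:R / L%:R) ^+ n)%:C%C * (A q.+1 - A q) :> R[i].
    by rewrite !rmorphXn /=; ring.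
  apply: le_trans (nrmD _ _) _; rewrite !nrmM nrm_real.
  have hq1 : nrm (A q.+1) <= a2.
    by apply: le_trans a12; apply: h1; rewrite tQ andbT /q /q1; lia.
  have hq2 : nrm (A q.+1 - A q) <= a2 / Q%:R by apply: h2; rewrite tQ andbT /q /q1; lia.
  have /andP[u0 u1] := qL q (ltnW tQ); rewrite ger0_norm //.
  have hp : nrm ((((q.+1)%:R / L%:R)%:C%C) ^+ n - ((q%:R / L%:R)%:C%C) ^+ n : R[i]) <= n%:R * ((Q%:R / L%:R) ^+ n / Q%:R).
    have b q' : (q' <= Q)%N -> nrm ((q'%:R / L%:R)%:C%C : R[i]) <= Q%:R / L%:R.
      by move=> hq; rewrite nrm_real ger0_norm ?divr_ge0 // ler_pM2r ?invr_gt0 // ler_nat.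
    apply: le_trans (pow_diff_le _ (b _ tQ) (b _ (ltnW tQ))) _.
    rewrite -rmorphB nrm_real -mulrBl -natr1 addrAC subrr add0r ger0_norm ?divr_ge0 // -mulrA ler_wpM2l //.
    rewrite le_eqVlt; apply/orP; left; apply/eqP.
    rewrite -[in RHS](prednK n0) exprS; move: ((Q%:R / L%:R) ^+ n.-1) => z.
    by field; rewrite !gt_eqF.
  have -> : W = n%:R * ((Q%:R / L%:R) ^+ n / Q%:R) * a2 + (Q%:R / L%:R) ^+ n * (a2 / Q%:R) by rewrite /W; ring.
  by apply: lerD; apply: ler_pM => //; exact: nrm_ge0.
have V0 : 0 <= (Q%:R / L%:R) ^+ n * a1 by exact: mulr_ge0.
rewrite SE; apply: le_trans (abel_geom psi q1 V0 W0 hc hW) _.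
have h3 : N%:R * W <= Q%:R * W by rewrite ler_wpM2r // ler_nat.
have h4 : Q%:R * W = (n%:R + 1) * ((Q%:R / L%:R) ^+ n * a2) by rewrite /W; field; rewrite gt_eqF.
have h5 : (Q%:R / L%:R) ^+ n * a1 <= (Q%:R / L%:R) ^+ n * a2 by rewrite ler_wpM2l.
rewrite h4 in h3; apply: le_trans (lerD h5 h3) _.
by rewrite le_eqVlt; apply/orP; left; apply/eqP; ring.
Qed.

(** E/L is about rho / (8 sqrt (QD)), the order of the largest scale at which the quadratic part of
    the phase stays bounded. L is large enough that E is also at least n + 2. *)
Lemma choose_params (rho Cn c1 D : R) (K0 Q : nat) : 0 < rho <= 1 -> 1 <= Cn -> 0 <= c1 -> (0 < Q)%N -> 1 <= D <= 2 * Q%:R ->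
  exists L E : nat, [/\ (0 < L)%N, forall q, (0 < q <= Q)%N -> (q %| L)%N, 48 <= rho * L%:R, c1 * (2 * Q%:R) <= L%:R &
   [/\ Cn * (2 * Q%:R) <= L%:R, Q%:R * D <= L%:R, 4 * Q%:R * (Cn * D) <= L%:R, (Q * (2 * K0 + 2) <= L)%N &
   [/\ (n.+2 <= E)%N, E%:R / L%:R <= rho / 8, Q%:R * D * (E%:R / L%:R) ^+ 2 <= 1, E%:R / L%:R * D <= 2 &
     Q%:R / (Q%:R * (E%:R / L%:R) / 6) <= 96 / rho * Num.sqrt (Q%:R * D)]]].
Proof.
move=> /andP[r0 r1] hC hc1 Q0 /andP[D1 D2].
have QR : 1 <= Q%:R :> R by rewrite ler1n.
have QD1 : 1 <= Q%:R * D.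
  have h : Q%:R * 1 <= Q%:R * D by rewrite ler_wpM2l.
  by lra.
have [s [s1 s2 sE]] : exists s : R, [/\ 1 <= s, s ^+ 2 = Q%:R * D & s = Num.sqrt (Q%:R * D)].
  exists (Num.sqrt (Q%:R * D)); split=> //; last by rewrite sqr_sqrtr //; lra.
  rewrite -(@ler_pXn2r _ 2) ?nnegrE ?sqrtr_ge0 // expr1n sqr_sqrtr; lra.
rewrite -sE.
have s0 : 0 < s by lra.
have [l1 l2 l3 l4] : [/\ 0 <= c1 * (2 * Q%:R), 0 <= Cn * (2 * Q%:R), 0 <= 4 * Q%:R * (Cn * D) & 0 <= (Q * (2 * K0 + 2))%:R :> R].
  by split=> //; [apply: mulr_ge0|apply: mulr_ge0|apply: mulr_ge0; apply: mulr_ge0]; lra.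
have l5 : 0 <= 48 / rho by rewrite divr_ge0 // ltW.
have l6 : 0 <= 8 * (n%:R + 4) * s / rho by rewrite divr_ge0 ?mulr_ge0 ?addr_ge0 // ltW.
have [L [L0 Ldvd hL]] := exists_common_multiple Q (c1 * (2 * Q%:R) + Cn * (2 * Q%:R) + 4 * Q%:R * (Cn * D) +
  (Q * (2 * K0 + 2))%:R + 48 / rho + 8 * (n%:R + 4) * s / rho + Q%:R * D).
move: l1 l2 l3 l4 l5 l6 hL.
move: (c1 * (2 * Q%:R)) (Cn * (2 * Q%:R)) (4 * Q%:R * (Cn * D)) => t1 t2 t3 l1 l2 l3 l4 l5 l6 hL.
have LR : 0 < L%:R :> R by rewrite ltr0n.
have L6 : 8 * (n%:R + 4) * s / rho <= L%:R by lra.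
have L5 : 48 / rho <= L%:R by lra.
pose x := rho / 8 * L%:R / s.
have x1 : n%:R + 4 <= x.
  rewrite /x ler_pdivlMr //; move: L6; rewrite ler_pdivrMr //; lra.
have x0 : 0 <= x by have : 0 <= n%:R :> R by []; lra.
have [E [E1 E2]] : exists E : nat, (E%:R : R) <= x /\ x < E%:R + 1.
  exists (Num.truncn x); rewrite truncn_le // natr1; split=> //; exact: truncnS_gt.
have n0 : 0 <= n%:R :> R by [].
have E3 : n%:R + 3 <= E%:R :> R by lra.
have E4 : x / 2 <= E%:R by lra.
have xL : x / L%:R = rho / 8 / s by rewrite /x; field; rewrite !gt_eqF.
have e1 : E%:R / L%:R <= rho / 8 / s by rewrite -xL ler_pM2r ?invr_gt0.
have e2 : rho / 16 / s <= E%:R / L%:R.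
  have -> : rho / 16 / s = x / 2 / L%:R by rewrite /x; field; rewrite !gt_eqF.
  by rewrite ler_pM2r ?invr_gt0.
have e0 : 0 < E%:R / L%:R :> R.
  by apply: lt_le_trans e2; rewrite !divr_gt0.
have e3 : E%:R / L%:R * s <= rho / 8 by rewrite -ler_pdivlMr.
have e4 : rho / 16 <= E%:R / L%:R * s by rewrite -ler_pdivrMr.
exists L, E; move: (E%:R / L%:R) e0 e1 e2 e3 e4 => e e0 e1 e2 e3 e4; split => //.
- by move: L5; rewrite ler_pdivrMr // mulrC.
- by lra.
split; [by lra|by lra|by lra| |].
  by rewrite -(ler_nat R); lra.
have es0 : 0 <= e * s by rewrite mulr_ge0 // ltW.
split.
- by rewrite -(ler_nat R) -addn2 natrD; lra.
- by apply: le_trans e3; rewrite ler_peMr // ltW.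
- rewrite -s2 -exprMn mulrC; apply: exprn_ile1 => //; lra.
- have Ds : D <= 2 * s.
    rewrite -(@ler_pXn2r _ 2) ?nnegrE ?mulr_ge0 //; try lra.
    have : D * D <= 2 * Q%:R * D by rewrite ler_wpM2r //; lra.
    by rewrite exprMn s2 expr2; lra.
  have : e * D <= e * (2 * s) by rewrite ler_wpM2l // ltW.
  by lra.
have Qn : Q%:R != 0 :> R by rewrite gt_eqF //; lra.
have -> : Q%:R / (Q%:R * e / 6) = 6 / e by field; rewrite Qn gt_eqF.
rewrite ler_pdivrMr //.
have -> : 96 / rho * s * e = 96 / rho * (e * s) by ring.
have : 96 / rho * (rho / 16) <= 96 / rho * (e * s) by rewrite ler_wpM2l // divr_ge0 // ltW.
have -> : 96 / rho * (rho / 16) = 6 by field; rewrite gt_eqF.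
by [].
Qed.

Lemma inwin_half L M t : (M <= L)%N -> inwin L M t -> `|(t%:R - L%:R : R)| <= M%:R / 2.
Proof.
move=> ML /andP[h1 h2]; have hM := odd_double_half M.
have oM : (odd M <= 1)%N by case: (odd M).
have [h3 h4] : (L * 2 <= t * 2 + M)%N /\ (t * 2 <= L * 2 + M)%N by move: hM oM; rewrite -muln2; lia.
move: h3 h4; rewrite -!(ler_nat R) !natrD !natrM => h3 h4.
by rewrite ler_norml; apply/andP; split; lra.
Qed.

Lemma near_inwin L M (t : 'I_(2 * L).+1) K : (M <= L)%N -> (2 * K + 2 <= M)%N -> (`|(t%:Z - L%:Z)%R| <= K)%N -> inwin L M t.
Proof.
move=> ML KM ht; have hM := odd_double_half M.
have oM : (odd M <= 1)%N by case: (odd M).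
by rewrite /inwin; move: hM oM; rewrite -muln2; lia.
Qed.

End Shell.

(** * Bounds for the localised sums and for their variation in q *)

Section AqBounds.
Context {R : realType} {n r : nat}.
Variables (f : 'I_r -> 'rV[R]_n -> R) (x0 : 'rV[R]_n) (rho C : R) (w : 'rV[R]_n -> R) (Cw : R).
Hypotheses (hgood : good f x0 rho C) (hf : forall l, Ck n.+2 (f l)) (hw : Ck n.+2 w).
Hypotheses (hCw : forall i m z, (m <= n.+2)%N -> `|iparts i m w z| <= Cw) (n0 : (0 < n)%N).

Lemma Psi_taylor J (k : 'rV[int]_n) x x' : Psi f J k x' - Psi f J k x - \sum_i pk f J k x i * (x' 0 i - x 0 i) =
  \sum_l J l * (f l x' - f l x - \sum_i grad f l x 0 i * (x' 0 i - x 0 i)).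
Proof.
have -> : \sum_i pk f J k x i * (x' 0 i - x 0 i) = \sum_i dFj f J x i * (x' 0 i - x 0 i) -
    (\sum_i x' 0 i * (k 0 i)%:~R - \sum_i x 0 i * (k 0 i)%:~R).
  by rewrite -!sumrB; apply: eq_bigr => i _; rewrite /pk; ring.
have -> : \sum_i dFj f J x i * (x' 0 i - x 0 i) = \sum_l J l * \sum_i grad f l x 0 i * (x' 0 i - x 0 i).
  under [RHS]eq_bigr do rewrite mulr_sumr.
  rewrite exchange_big /=; apply: eq_bigr => j _; rewrite /dFj mulr_suml.
  by apply: eq_bigr => l _; rewrite [grad f l x 0 j]mxE mulrA.
have -> : \sum_l J l * (f l x' - f l x - \sum_i grad f l x 0 i * (x' 0 i - x 0 i)) =
    Fj f J x' - Fj f J x - \sum_l J l * \sum_i grad f l x 0 i * (x' 0 i - x 0 i).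
  by rewrite /Fj -!sumrB; apply: eq_bigr => l _; ring.
by rewrite /Psi; ring.
Qed.

(** One more factor of the phase appears when q grows by 1; combined with the change of the twist,
    its linear part in the gradient is replaced by the one in k, which is [phinc]. *)
Lemma Aq_succ J (L E : nat) (q : R) k y : (0 < L)%N -> (0 < E)%N ->
  Aq f w J L E (q + 1) k y - Aq f w J L E q k y = zs (tw (fun i => q * pk f J k (lpt L y) i / L%:R)
   (fun a => (kern n.+2 E a)%:C%C * amp2 f w J q (fun i => (k 0 i)%:~R) (E%:R / L%:R) (lpt L y) (scl E a))).
Proof.
move=> L0 E0; have l0 : L%:R != 0 :> R by rewrite pnatr_eq0 -lt0n.
have e0 : E%:R != 0 :> R by rewrite pnatr_eq0 -lt0n.
have b g th : bnd E (tw th (fun a => (kern n.+2 E a)%:C%C * g a) : 'rV[int]_n -> R[i]).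
  apply: bnd_tw => a ha; apply: (@kern_bnd R n n.+2 E E0).
  by apply: contraNneq ha => ->; rewrite mul0r.
rewrite /Aq /zs !(zs_bnd (b _ _)) -sumrB; apply: eq_bigr => v _; set a := cpos v.
rewrite /tw /amp2 /amp1 /phinc; set x := lpt L y; set F1 := Fj f J _.
set S1 := \sum_i (E%:R / L%:R * dFj f J x i) * _; set S2 := \sum_i _ * _; set W := (w _)%:C%C.
set z := zdot (fun i => q * pk f J k x i / L%:R) a.
have e1 : zdot (fun i => (q + 1) * pk f J k x i / L%:R) a = z + (S1 - S2).
  rewrite /z /zdot /S1 /S2 -sumrB -big_split /=; apply: eq_bigr => i _.
  by rewrite /pk [scl E a 0 i]mxE; field; rewrite e0 l0.
rewrite e1 cisD.
have -> : (q + 1) * (F1 - Fj f J x - S1) = q * (F1 - Fj f J x - S1) + (F1 - Fj f J x - S1) by ring.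
have -> : F1 - Fj f J x - S2 = (F1 - Fj f J x - S1) + (S1 - S2) by ring.
by rewrite !cisD; ring.
Qed.

(** [osc] with n + 2 differences. The 6 in [th] is 3 times 2: the phase is at most 3/4, so it is at
    most three times its distance to the integers, and q is at least Q/2. *)
Lemma Aq_bounds (Cn : R) : 0 <= Cn -> exists2 K1 : R, 0 <= K1 &
  forall (J : 'I_r -> R) (Q q E L : nat) (D : R) k y, let e : R := E%:R / L%:R in let th := Q%:R * e / 6 in
  (0 < Q)%N -> (q <= Q)%N -> (Q <= 2 * q)%N -> 1 <= D -> (forall l, `|J l| <= 2 * D) ->
  (0 < L)%N -> (n.+2 <= E)%N -> e <= rho / 8 -> Q%:R * D * e ^+ 2 <= 1 -> supd (lpt L y) x0 (rho / 2) ->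
  (forall i, `|q%:R * pk f J k (lpt L y) i / L%:R| <= 3 / 4) ->
  (forall i, nrm (Aq f w J L E q%:R k y) * (1 + th * `|pk f J k (lpt L y) i|) ^+ n.+2 <= K1 * E%:R ^+ n) /\
  forall p, (forall i, `|pk f J k (lpt L y) i| <= p) -> e * p <= Cn ->
   forall i, nrm (Aq f w J L E q.+1%:R k y - Aq f w J L E q%:R k y) * (1 + th * `|pk f J k (lpt L y) i|) ^+ n.+2 <=
     K1 * ((1 + th * p) / Q%:R) * E%:R ^+ n.
Proof.
move=> Cn0; have [/andP[rho0 rho1] _ _] := hgood.
have [KO KO0 hO] := @osc R n n.+2.
have [B B1 hB] := amp_bounds hgood hf hw hCw n0 Cn0.
have KB0 : 0 <= KO * B by rewrite mulr_ge0 //; lra.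
exists (6 * (KO * B)); first by rewrite mulr_ge0.
move=> J Q q E L D k y e th Q0 qQ Qq D1 hJ L0 nE he1 he2 hx hp; set x := lpt L y in hx hp *.
have LR : 0 < L%:R :> R by rewrite ltr0n.
have E0 : (0 < E)%N by apply: leq_trans nE.
have QR : 1 <= Q%:R :> R by rewrite ler1n.
have e0 : 0 <= e by rewrite divr_ge0.
have qR : Q%:R <= 2 * q%:R :> R by rewrite -natrM ler_nat.
have use g (B' : R) : 0 <= B' -> (forall (u : 'rV[R]_n) (i : 'I_n), (forall j, j != i -> `|u 0 j| <= 1) -> CSm n.+2 B' (fun t => g (upd u i t))) ->
   forall i, nrm (zs (tw (fun i => q%:R * pk f J k x i / L%:R) (fun a => (kern n.+2 E a)%:C%C * g (scl E a)))) *
     (1 + th * `|pk f J k x i|) ^+ n.+2 <= KO * B' * E%:R ^+ n.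
  move=> B0 hg i; apply: le_trans (hO E B' g (fun i => q%:R * pk f J k x i / L%:R) E0 nE hg i).
  have th0 : 0 <= th * `|pk f J k x i| by rewrite mulr_ge0 // divr_ge0 // mulr_ge0 //; lra.
  have d0 := dist_int_ge0 (q%:R * pk f J k x i / L%:R).
  have d1 : th * `|pk f J k x i| <= E%:R * dist_int (q%:R * pk f J k x i / L%:R).
    apply: (@le_trans _ _ (E%:R * (`|q%:R * pk f J k x i / L%:R| / 3))); last first.
      by rewrite ler_wpM2l // dist_int_third.
    rewrite !normrM normfV (gtr0_norm LR) ger0_norm // /th /e.
    have -> : Q%:R * (E%:R / L%:R) / 6 * `|pk f J k x i| = (E%:R / L%:R * `|pk f J k x i| / 6) * Q%:R by ring.
    have -> : E%:R * (q%:R * `|pk f J k x i| / L%:R / 3) = (E%:R / L%:R * `|pk f J k x i| / 6) * (2 * q%:R) by field; rewrite gt_eqF.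
    by rewrite ler_wpM2l // divr_ge0 // mulr_ge0 // divr_ge0.
  rewrite ler_wpM2l ?nrm_ge0 // lerXn2r ?nnegrE ?addr_ge0 ?mulr_ge0 //; lra.
have hq2 : 0 <= (q%:R : R) <= 2 * Q%:R.
  have : q%:R <= Q%:R :> R by rewrite ler_nat.
  by rewrite ler0n; lra.
have he01 : 0 <= e <= 1 by rewrite e0; lra.
have he4 : 4 * e <= rho by lra.
have D0 : 0 <= D by lra.
split.
  move=> i; have B0 : 0 <= B by lra.
  apply: le_trans (use _ B B0 _ i) _.
    by move=> u j hu; have [] := hB J Q%:R q%:R D e x u j QR hq2 he01 he4 he2 hx hu D0 hJ.
  by apply: ler_wpM2r; [exact: exprn_ge0|lra].
move=> p hpp ep i.
have p0 : 0 <= p by apply: le_trans (normr_ge0 _) (hpp i).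
have Qep : 0 <= Q%:R * e * p by rewrite !mulr_ge0.
have B'0 : 0 <= B * ((1 + Q%:R * e * p) / Q%:R) by rewrite mulr_ge0 ?divr_ge0 //; lra.
rewrite -[q.+1%:R]natr1 (Aq_succ _ _ _ _ L0 E0).
apply: le_trans (use _ _ B'0 _ i) _.
  move=> u j hu; have [_ h] := hB J Q%:R q%:R D e x u j QR hq2 he01 he4 he2 hx hu D0 hJ.
  exact: h.
apply: ler_wpM2r; first exact: exprn_ge0.
have -> : KO * (B * ((1 + Q%:R * e * p) / Q%:R)) = (KO * B) * ((1 + Q%:R * e * p) / Q%:R) by ring.
have -> : 6 * (KO * B) * ((1 + th * p) / Q%:R) = (KO * B) * ((6 + Q%:R * e * p) / Q%:R) by rewrite /th; field; rewrite gt_eqF //; lra.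
apply: ler_wpM2l => //; apply: ler_wpM2r; first by rewrite invr_ge0.
by lra.
Qed.

End AqBounds.

(** * Poisson summation for the fractions a/q *)

Section RatPoisson.
Context {R : realType} {n r : nat}.
Variables (f : 'I_r -> 'rV[R]_n -> R) (x0 : 'rV[R]_n) (rho : R) (w : 'rV[R]_n -> R).
Hypotheses (rho0 : 0 < rho) (rho1 : rho <= 1) (hsupp : forall x, w x != 0 -> supd x x0 (rho / 4)).

(** With M = L/q one has a/q = (M a)/L, so the sum over a runs over the multiples of M on the fine
    lattice. *)
Lemma ratpt_poisson J (L q : nat) : 48 <= rho * L%:R -> (0 < q)%N -> (q %| L)%N -> (0 < L)%N ->
  zs (fun a => (w (ratpt a q))%:C%C * cis (q%:R * Fj f J (ratpt a q))) =
  ((q%:R / L%:R) ^+ n)%:C%C * \sum_(v : {ffun 'I_n -> 'I_(2 * L).+1} | [forall i, inwin L (L %/ q) (v i)])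
    zs (tw (thk L q%:R (cpos v)) (wph f w J L q%:R)).
Proof.
move=> hL q0 /dvdnP[M LE] L0; have M0 : (0 < M)%N by move: L0; rewrite LE; case: (M).
rewrite LE mulnK // -LE.
have [B hB] := wph_bnd f rho0 rho1 hsupp J hL.
have ML : (0 < M <= L)%N by rewrite M0 LE leq_pmulr.
have qR : q%:R != 0 :> R by rewrite pnatr_eq0 -lt0n.
have MR : M%:R != 0 :> R by rewrite pnatr_eq0 -lt0n.
have LR : L%:R = M%:R * q%:R :> R by rewrite LE natrM.
have E : (fun a => (w (ratpt a q))%:C%C * cis (q%:R * Fj f J (ratpt a q))) = (fun a => wph f w J L q%:R (M%:Z *: a)).
  apply/funext => a; rewrite /wph.
  have -> : lpt L (M%:Z *: a) = ratpt a q :> 'rV[R]_n.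
    by apply/rowP => i; rewrite !mxE rmorphM /= LR -pmulrn; field; rewrite qR MR.
  by [].
rewrite E (poisson_window (hB q%:R) ML).
have -> : ((q%:R / L%:R) ^+ n)%:C%C = (M%:R ^+ n)^-1 :> R[i].
  have -> : q%:R / L%:R = M%:R^-1 :> R by rewrite LR; field; rewrite qR MR.
  by rewrite rmorphXn /= fmorphV /= exprVn rmorph_nat.
congr (_ * _); apply: eq_bigr => v _; congr zs; congr tw; apply/funext => i.
by rewrite /thk LR; field; rewrite qR MR.
Qed.

Definition Sq J (Q : nat) : R[i] := \sum_(Q./2.+1 <= q < Q.+1)
  zs (fun a => (w (ratpt a q))%:C%C * cis (q%:R * Fj f J (ratpt a q))).

End RatPoisson.

(** * Exponential sums in which one frequency varies *)

Section ExpSum.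
Context {R : realType} {n r : nat}.
Variables (f : 'I_r -> 'rV[R]_n -> R) (x0 : 'rV[R]_n) (rho C : R) (w : 'rV[R]_n -> R) (Cw : R).
Hypotheses (hgood : good f x0 rho C) (hf : forall l, Ck n.+2 (f l)) (hw : Ck n.+2 w).
Hypotheses (hCw : forall i m z, (m <= n.+2)%N -> `|iparts i m w z| <= Cw) (n2 : (1 < n)%N).
Hypothesis hsupp : forall x, w x != 0 -> supd x x0 (rho / 4).

Definition JJ (J' : 'I_r -> int) (l : 'I_r) (j : int) (l' : 'I_r) : R := (if l' == l then j else J' l')%:~R.

Lemma gradF_dFj J x i : gradF f J x 0 i = dFj f J x i.
Proof. by rewrite mxE. Qed.

Lemma grad_le l x i : supd x x0 rho -> `|partial i (f l) x| <= C.
Proof.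
have [_ _ [_ _ _ hb]] := hgood => hx; have := hb x 1%N i l isT hx.
by rewrite /iparts.
Qed.

Lemma dFj_le J D x i : 0 <= D -> (forall l, `|J l| <= 2 * D) -> supd x x0 rho -> `|dFj f J x i| <= 2 * r%:R * C * D.
Proof.
move=> D0 hJ hx; apply: le_trans (ler_norm_sum _ _ _) _.
have -> : 2 * r%:R * C * D = r%:R * (2 * D * C) by ring.
by apply: sum_le_ord => l; rewrite normrM; apply: ler_pM => //; exact: grad_le.
Qed.

Section Affine.
Variables (J' : 'I_r -> int) (l : 'I_r) (L : nat) (D : R).
Hypotheses (D0 : 0 <= D) (hJ' : forall l', `|(J' l')%:~R : R| <= 2 * D) (hL : 48 <= rho * L%:R).

Definition Yt := {ffun 'I_n -> 'I_(2 * cubeN (rho / 2) L).+1}.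
Definition Xp (v : Yt) : 'rV[R]_n := lpt L (ylat x0 (rho / 2) L v).
Definition Gp (v : Yt) : 'rV[R]_n := grad f l (Xp v).
Definition gp (v : Yt) : R := f l (Xp v).
Definition G0p (v : Yt) : 'rV[R]_n := \row_i \sum_(l' | l' != l) (J' l')%:~R * partial i (f l') (Xp v).
Definition g0p (v : Yt) : R := \sum_(l' | l' != l) (J' l')%:~R * f l' (Xp v).

Lemma JJ_le j : `|j%:~R : R| <= 2 * D -> forall l', `|JJ J' l j l'| <= 2 * D.
Proof. by move=> hj l'; rewrite /JJ; case: eqP => // _; exact: hJ'. Qed.

Lemma paffE (u : lat n) v i : paff Gp G0p u v i = pk f (JJ J' l u.1.1) u.1.2 (Xp v) i.
Proof.
rewrite /paff /pk /dFj (bigD1 l) //= /JJ eqxx /Gp /G0p !mxE; congr (_ + _ - _).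
by apply: eq_bigr => l' /negbTE ->.
Qed.

Lemma psaffE (u : lat n) v : psaff Xp gp g0p u v = Psi f (JJ J' l u.1.1) u.1.2 (Xp v) + (u.2)%:~R.
Proof.
rewrite /psaff /Psi /Fj (bigD1 l) //= /JJ eqxx /gp /g0p; congr (_ + _ - _ + _).
by apply: eq_bigr => l' /negbTE ->.
Qed.

Lemma Xp_rho v : supd (Xp v) x0 (rho / 2).
Proof.
have [/andP[r0 r1] _ _] := hgood; apply: lpt_cube; first by rewrite divr_gt0.
by have h := hL; lra.
Qed.

Lemma Xp_rho1 v : supd (Xp v) x0 rho.
Proof. by have [/andP[r0 r1] _ _] := hgood; move=> i; apply: le_trans (Xp_rho v i) _; lra. Qed.

Lemma aff_stable_JJ Cn : 2 * r%:R * C <= Cn -> aff_stable Xp Gp gp Cn G0p g0p D.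
Proof.
have [_ C1 [hT hLip _ _]] := hgood; move=> hCn u y y' d hu hd.
split.
  move=> i; have d1 : 0 <= d by exact: le_trans (normr_ge0 _) (hd i).
  rewrite !paffE /pk opprB addrA subrK /dFj -sumrB.
  apply: (@le_trans _ _ (r%:R * (2 * D * (C * d)))).
    apply: le_trans (ler_norm_sum _ _ _) _; apply: sum_le_ord => l'.
    rewrite -mulrBr normrM; apply: ler_pM => //; first exact: JJ_le.
    by have := hLip (Xp y) (Xp y') d (Xp_rho1 y) (Xp_rho1 y') hd l' i; rewrite !mxE.
  have -> : r%:R * (2 * D * (C * d)) = 2 * r%:R * C * (D * d) by ring.
  by rewrite -[leRHS]mulrA; apply: ler_wpM2r => //; exact: mulr_ge0.
rewrite !psaffE; under eq_bigr do rewrite paffE.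
have -> : Psi f (JJ J' l u.1.1) u.1.2 (Xp y') + u.2%:~R - (Psi f (JJ J' l u.1.1) u.1.2 (Xp y) + u.2%:~R) =
  Psi f (JJ J' l u.1.1) u.1.2 (Xp y') - Psi f (JJ J' l u.1.1) u.1.2 (Xp y) by ring.
rewrite Psi_taylor; apply: (@le_trans _ _ (r%:R * (2 * D * (C * d ^+ 2)))).
  apply: le_trans (ler_norm_sum _ _ _) _; apply: sum_le_ord => l'.
  rewrite normrM; apply: ler_pM => //; first exact: JJ_le.
  exact: (hT _ _ d (Xp_rho1 y) (Xp_rho1 y') hd l').
have -> : r%:R * (2 * D * (C * d ^+ 2)) = 2 * r%:R * C * (D * d ^+ 2) by ring.
by rewrite -[leRHS]mulrA; apply: ler_wpM2r => //; apply: mulr_ge0 => //; exact: sqr_ge0.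
Qed.

(** If the gradient is at most T at both points, its increment is at most 2T, and the inverse bound
    at the coordinate l, where the frequency is at least D, separates the points. Curvature of all
    linear combinations of the f_k enters here. *)
Lemma aff_separated_JJ Cn : 0 < D -> 2 * C <= Cn -> aff_separated Xp Gp Cn G0p D.
Proof.
have [_ C1 [_ _ hinj _]] := hgood; move=> Dp hCn u y y' T hu h1 h2 i.
have T0 : 0 <= T by exact: le_trans (normr_ge0 _) (h1 i).
have hg : supd (gradF f (JJ J' l u.1.1) (Xp y')) (gradF f (JJ J' l u.1.1) (Xp y)) (2 * T).
  move=> j; rewrite !gradF_dFj.
  have -> : dFj f (JJ J' l u.1.1) (Xp y') j - dFj f (JJ J' l u.1.1) (Xp y) j = paff Gp G0p u y' j - paff Gp G0p u y j.
    by rewrite !paffE /pk; ring.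
  by apply: le_trans (ler_normB _ _) _; have := h1 j; have := h2 j; lra.
have := hinj _ _ _ _ (Xp_rho1 y) (Xp_rho1 y') hg l i; rewrite /JJ eqxx => h.
rewrite ler_pdivlMr // mulrC; apply: (@le_trans _ _ (C * (2 * T))).
  by apply: le_trans h; apply: ler_wpM2r.
have -> : C * (2 * T) = 2 * C * T by ring.
by apply: ler_wpM2r.
Qed.

End Affine.

Lemma half_lt_leq (Q q : nat) : (Q./2 < q)%N -> (Q <= 2 * q)%N.
Proof.
have oQ : (odd Q <= 1)%N by case: (odd Q).
by have := odd_double_half Q; move: oQ; rewrite -muln2; lia.
Qed.

(** p is the largest component of the gradient, so decay in that coordinate is the full decay. The
    second bound has one power of 1 + th p less, because the variation of [Aq] in q is larger by
    this factor. *)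
Lemma V_bounds (Cn : R) : 0 <= Cn -> exists2 K1 : R, 0 <= K1 &
  forall (J : 'I_r -> R) (Q E L : nat) (D p : R) (k : 'rV[int]_n) y, let e : R := E%:R / L%:R in let th := Q%:R * e / 6 in
  (0 < Q)%N -> 1 <= D -> (forall l, `|J l| <= 2 * D) ->
  (0 < L)%N -> (n.+2 <= E)%N -> e <= rho / 8 -> Q%:R * D * e ^+ 2 <= 1 -> supd (lpt L y) x0 (rho / 2) ->
  (forall i, `|pk f J k (lpt L y) i| <= p) -> (exists i, `|pk f J k (lpt L y) i| = p) ->
  e * p <= Cn -> 4 * Q%:R * p <= 3 * L%:R ->
  let S := \sum_(Q./2.+1 <= q < Q.+1) (((q%:R / L%:R) ^+ n)%:C%C * Aq f w J L E q%:R k y) * cis (q%:R * Psi f J k (lpt L y)) in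
  nrm S <= Q%:R * ((Q%:R / L%:R) ^+ n * (K1 * E%:R ^+ n * (1 + th * p) ^- n.+2)) /\
  dist_int (Psi f J k (lpt L y)) * nrm S <= (n%:R + 2) * ((Q%:R / L%:R) ^+ n * (K1 * E%:R ^+ n * (1 + th * p) ^- n.+1)).
Proof.
move=> Cn0; have n0 : (0 < n)%N by apply: ltn_trans n2.
have [K1 K10 hA] := Aq_bounds hgood hf hw hCw n0 Cn0; exists K1 => //.
move=> J Q E L D p k y e th Q0 D1 hJ L0 nE he1 he2 hx hp [i0 hi0] hep hQp S.
have LR : 0 < L%:R :> R by rewrite ltr0n.
have QR : 0 < Q%:R :> R by rewrite ltr0n.
have p0 : 0 <= p by rewrite -hi0.
have th0 : 0 <= th by rewrite !divr_ge0 // mulr_ge0 // divr_ge0.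
set P := 1 + th * p; have P1 : 1 <= P by rewrite /P lerDl mulr_ge0.
have P0 : 0 < P by apply: lt_le_trans P1.
have KE : 0 <= K1 * E%:R ^+ n by rewrite mulr_ge0 ?exprn_ge0.
have bq q : (Q./2 < q <= Q)%N -> nrm (Aq f w J L E q%:R k y) <= K1 * E%:R ^+ n * P ^- n.+2 /\
    nrm (Aq f w J L E q.+1%:R k y - Aq f w J L E q%:R k y) <= K1 * E%:R ^+ n * P ^- n.+1 / Q%:R.
  move=> /andP[q1 q2]; have qq := half_lt_leq q1.
  have hq34 i : `|q%:R * pk f J k (lpt L y) i / L%:R| <= 3 / 4.
    rewrite !normrM normfV (gtr0_norm LR) ger0_norm // ler_pdivrMr //.
    have : q%:R * `|pk f J k (lpt L y) i| <= Q%:R * p by apply: ler_pM => //; rewrite ler_nat.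
    by move: hQp; rewrite -mulrA; lra.
  have [a1 a2] := hA J Q q E L D k y Q0 q2 qq D1 hJ L0 nE he1 he2 hx hq34.
  have := a1 i0; have := a2 p hp hep i0; rewrite hi0 -/e -/th -/P => b2 b1; split.
    by rewrite ler_pdivlMr ?exprn_gt0.
  have -> : K1 * E%:R ^+ n * P ^- n.+1 / Q%:R = K1 * (P / Q%:R) * E%:R ^+ n / P ^+ n.+2.
    have := exprn_gt0 n.+1 P0; rewrite [P ^+ n.+2]exprS; move: (P ^+ n.+1) => z z0.
    by field; rewrite !gt_eqF.
  by rewrite ler_pdivlMr ?exprn_gt0.
have a12 : 0 <= K1 * E%:R ^+ n * P ^- n.+2 <= K1 * E%:R ^+ n * P ^- n.+1.
  rewrite mulr_ge0 ?invr_ge0 ?exprn_ge0 ?(ltW P0) //= ler_wpM2l // lef_pV2 ?posrE ?exprn_gt0 //.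
  by rewrite [leRHS]exprS ler_peMl // exprn_ge0 // ltW.
apply: (abel_shell (Psi f J k (lpt L y)) n0 Q0 L0 a12) => q hq; first by have [] := bq q hq.
by case/andP: hq => q1 q2; have [_] := bq q (introT andP (conj q1 (ltnW q2))).
Qed.

(** For these k the gradient of j . f is at most half of the largest entry of k, so the decay of
    order n + 2 in [pk] is decay in k and can be summed by [far_sum]. The phase stays below 3/4: at
    most 1/2 comes from k by the centred window and 1/4 from the gradient by the size of L. *)
Lemma far_T (l0 : 'I_r) : exists2 KF : R, 0 <= KF & forall (J : 'I_r -> R) (Q q E L K0 : nat) (D : R),
  let e : R := E%:R / L%:R in let th := Q%:R * e / 6 in
  (0 < q)%N -> (q <= Q)%N -> (Q <= 2 * q)%N -> (q %| L)%N -> 1 <= D -> (forall l, `|J l| <= 2 * D) -> 48 <= rho * L%:R ->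
  (0 < L)%N -> (n.+2 <= E)%N -> e <= rho / 8 -> Q%:R * D * e ^+ 2 <= 1 ->
  2 * (2 * r%:R * C * D) <= K0%:R -> 4 * Q%:R * (2 * r%:R * C * D) <= L%:R -> (0 < K0)%N ->
  \sum_(v : {ffun 'I_n -> 'I_(2 * L).+1} | [forall i, inwin L (L %/ q) (v i)] && (K0 < kmax v)%N)
     nrm (zs (tw (thk L q%:R (cpos v)) (wph f w J L q%:R))) <= KF * L%:R ^+ n * (2 / th) ^+ n.+2 / K0%:R.
Proof.
have n0 : (0 < n)%N by apply: ltn_trans n2.
have [/andP[r0 r1] C1 _] := hgood.
have [K1 K10 hA] := Aq_bounds hgood hf hw hCw n0 (lexx 0).
have hg2 : good f x0 (rho / 2) C.
  by apply: good_shrink hgood; rewrite divr_gt0 //= ler_pdivrMr //; lra.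
have [Cs Cs1 hsys] := cube_system hg2.
pose c3 : R := ((3 / 4) ^+ n.+3 / 2) ^+ n.
have c30 : 0 < c3 by rewrite exprn_gt0 // divr_gt0 // exprn_gt0 // divr_gt0.
have KF0 : 0 <= Cs * K1 / c3 * 3 ^+ n.
  by rewrite mulr_ge0 ?exprn_ge0 // divr_ge0 ?mulr_ge0 ?(ltW c30) //; lra.
exists (Cs * K1 / c3 * 3 ^+ n) => //.
move=> J Q q E L K0 D e th q0 qQ Qq qL D1 hJ hL L0 nE he1 he2 hK0 hQL K00.
have LR : 0 < L%:R :> R by rewrite ltr0n.
have Q0 : (0 < Q)%N by apply: leq_trans qQ.
have E0 : (0 < E)%N by apply: leq_trans nE.
have ER : 0 < E%:R :> R by rewrite ltr0n.
have QR : 0 < Q%:R :> R by rewrite ltr0n.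
have e0 : 0 < e by rewrite divr_gt0.
have th0 : 0 < th by rewrite divr_gt0 // mulr_gt0.
have H0 := @kmass_ge R n n.+2 E E0; set H := kmass _ _ in H0.
rewrite exprMn -/c3 in H0.
have HE : 0 < H by apply: lt_le_trans H0; rewrite mulr_gt0 // exprn_gt0.
have cardY : #|Yt L|%:R <= Cs * L%:R ^+ n :> R.
  by have [] := hsys L l0 (ltac:(lra) : 4 <= rho / 2 * L%:R).
have hv (v : {ffun 'I_n -> 'I_(2 * L).+1}) : [forall i, inwin L (L %/ q) (v i)] -> (K0 < kmax v)%N ->
    nrm (zs (tw (thk L q%:R (cpos v)) (wph f w J L q%:R))) <=
    Cs * L%:R ^+ n * K1 / c3 * (2 / th) ^+ n.+2 * ((kmax v)%:R ^+ n.+2)^-1.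
  move=> /forallP hwin hk; set t : R := (kmax v)%:R.
  have t0 : 0 < t by rewrite ltr0n; apply: leq_ltn_trans hk.
  have [i hi] : exists i, `|(@cpos n L v 0 i)%:~R : R| = t.
    have c0 : (0 < #|'I_n|)%N by rewrite card_ord.
    have [i hi] := bigop.eq_bigmax (fun i : 'I_n => `|@cpos n L v 0%R i|%N) c0.
    by exists i; rewrite -intr_norm -natr_absz /t /kmax hi.
  have tK : 2 * (2 * r%:R * C * D) <= t.
    by apply: le_trans hK0 _; rewrite ler_nat ltnW.
  have yb (y : Yt L) : nrm (Aq f w J L E q%:R (cpos v) (ylat x0 (rho / 2) L y)) <= K1 * E%:R ^+ n * (2 / th) ^+ n.+2 * (t ^+ n.+2)^-1.
    have hx := Xp_rho hL y; have hx1 := Xp_rho1 hL y; rewrite /Xp in hx hx1.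
    have D0 : 0 <= D by lra.
    have hd j := dFj_le j D0 hJ hx1.
    have h34 j : `|q%:R * pk f J (cpos v) (lpt L (ylat x0 (rho / 2) L y)) j / L%:R| <= 3 / 4.
      have hML : (L %/ q <= L)%N by exact: leq_div.
      have := @inwin_half R _ _ _ hML (hwin j); set kj := `|(_ - _)|.
      have -> : kj = `|(@cpos n L v 0 j)%:~R : R| by rewrite /kj !mxE rmorphD rmorphN /= addrC.
      have Mq : (L %/ q)%:R * q%:R = L%:R :> R by rewrite -natrM divnK.
      move=> hk2; have qR : 0 <= q%:R :> R by [].
      rewrite !normrM normfV (gtr0_norm LR) (ger0_norm qR) ler_pdivrMr //.
      apply: (@le_trans _ _ (q%:R * ((2 * r%:R * C * D) + (L %/ q)%:R / 2))).
        rewrite ler_wpM2l // /pk; apply: le_trans (ler_normB _ _) _.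
        exact: lerD (hd j) hk2.
      rewrite mulrDr; have h1 : q%:R * (2 * r%:R * C * D) <= Q%:R * (2 * r%:R * C * D).
        apply: ler_wpM2r; last by rewrite ler_nat.
        by rewrite !mulr_ge0 //; lra.
      have -> : q%:R * ((L %/ q)%:R / 2) = L%:R / 2 :> R by rewrite -Mq; ring.
      by move: hQL; rewrite -[4 * _ * _]mulrA; lra.
    have [a1 _] := hA J Q q E L D (cpos v) _ Q0 qQ Qq D1 hJ L0 nE he1 he2 hx h34.
    have hp : t / 2 <= `|pk f J (cpos v) (lpt L (ylat x0 (rho / 2) L y)) i|.
      have := lerB_dist (@cpos n L v 0 i)%:~R (dFj f J (lpt L (ylat x0 (rho / 2) L y)) i).
      by rewrite hi distrC -/(pk _ _ _ _ _); have := hd i; lra.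
    have := a1 i; rewrite -/e -/th.
    set N1 := nrm _; set p1 := `|_| in hp * => b1.
    have : N1 * (th * (t / 2)) ^+ n.+2 <= K1 * E%:R ^+ n.
      apply: le_trans b1; rewrite ler_wpM2l ?nrm_ge0 //.
      have tp : th * (t / 2) <= 1 + th * p1.
        have : th * (t / 2) <= th * p1 by rewrite ler_wpM2l // ltW.
        by lra.
      have t20 : 0 <= th * (t / 2) by apply: mulr_ge0; [exact: ltW|apply: divr_ge0 => //; exact: ltW].
      by rewrite lerXn2r ?nnegrE //; apply: le_trans tp.
    rewrite -ler_pdivlMr; last by rewrite exprn_gt0 // mulr_gt0 // divr_gt0.
    move=> h; apply: le_trans h _.
    rewrite -mulrA ler_wpM2l ?mulr_ge0 ?exprn_ge0 // -!exprVn -exprMn.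
    rewrite le_eqVlt; apply/orP; left; apply/eqP; congr (_ ^+ _); field.
    by rewrite !gt_eqF.
  have TE := T_avg f r0 r1 hsupp J hL q%:R (cpos v) E0 (ltac:(by move: he1; rewrite /e; lra) : 8 * (E%:R / L%:R) <= rho).
  have : H * nrm (zs (tw (thk L q%:R (cpos v)) (wph f w J L q%:R))) <= #|Yt L|%:R * (K1 * E%:R ^+ n * (2 / th) ^+ n.+2 * (t ^+ n.+2)^-1).
    have -> : H = nrm (H%:C%C : R[i]) by rewrite nrm_real ger0_norm // ltW.
    rewrite -nrmM TE; apply: le_trans (nrm_sum _ _ _) _.
    apply: (@le_trans _ _ (\sum_(y : Yt L) K1 * E%:R ^+ n * (2 / th) ^+ n.+2 * (t ^+ n.+2)^-1)).
      by apply: ler_sum => y _; rewrite nrmM nrm_cis mul1r.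
    by rewrite sumr_const -[leLHS]mulr_natl.
  set N2 := nrm _; set Z1 := (2 / th) ^+ n.+2; set Z2 := (t ^+ n.+2)^-1 => h1.
  have Z10 : 0 <= Z1 by rewrite exprn_ge0 // divr_ge0 // ltW.
  have Z20 : 0 <= Z2 by rewrite invr_ge0 exprn_ge0 // ltW.
  have En0 : 0 < E%:R ^+ n :> R by rewrite exprn_gt0.
  have h2 : (c3 * E%:R ^+ n) * N2 <= Cs * L%:R ^+ n * (K1 * E%:R ^+ n * Z1 * Z2).
    apply: (@le_trans _ _ (H * N2)); first by apply: ler_wpM2r; [exact: nrm_ge0|exact: H0].
    apply: le_trans h1 _; apply: ler_wpM2r; last exact: cardY.
    by apply: mulr_ge0 => //; apply: mulr_ge0 => //; apply: mulr_ge0 => //; exact: ltW.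
  rewrite -(ler_pM2l (mulr_gt0 c30 En0)); apply: le_trans h2 _.
  rewrite le_eqVlt; apply/orP; left; apply/eqP; field.
  by rewrite gt_eqF.
apply: (@le_trans _ _ (\sum_(v : {ffun 'I_n -> 'I_(2 * L).+1} | (K0 < kmax v)%N)
   Cs * L%:R ^+ n * K1 / c3 * (2 / th) ^+ n.+2 * ((kmax v)%:R ^+ n.+2)^-1)).
  rewrite [leLHS]big_mkcond [leRHS]big_mkcond; apply: ler_sum => v _.
  case: ifP => [/andP[h1 h2]|_]; first by rewrite h2; exact: hv.
  case: ifP => _ //; have c := ltW c30; have t := ltW th0; have cs : 0 <= Cs by lra.
  apply: mulr_ge0; last by rewrite invr_ge0 exprn_ge0.
  apply: mulr_ge0; last by rewrite exprn_ge0 // divr_ge0.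
  by apply: divr_ge0 => //; apply: mulr_ge0 => //; apply: mulr_ge0 => //; exact: exprn_ge0.
rewrite -mulr_sumr.
have c := ltW c30; have t := ltW th0; have cs : 0 <= Cs by lra.
apply: le_trans (ler_wpM2l _ (@far_sum R n K0 L K00)) _.
  apply: mulr_ge0; last by rewrite exprn_ge0 // divr_ge0.
  by apply: divr_ge0 => //; apply: mulr_ge0 => //; apply: mulr_ge0 => //; exact: exprn_ge0.
rewrite le_eqVlt; apply/orP; left; apply/eqP; ring.
Qed.

End ExpSum.

(** * The exponential sum bound on average over one frequency *)

Section ExpSumBound.
Context {R : realType} {n r : nat}.
Variables (f : 'I_r -> 'rV[R]_n -> R) (x0 : 'rV[R]_n) (rho C : R) (w : 'rV[R]_n -> R) (Cw : R).
Hypotheses (hgood : good f x0 rho C) (hf : forall l, Ck n.+2 (f l)) (hw : Ck n.+2 w).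
Hypotheses (hCw : forall i m z, (m <= n.+2)%N -> `|iparts i m w z| <= Cw) (n2 : (1 < n)%N).
Hypothesis hsupp : forall x, w x != 0 -> supd x x0 (rho / 4).

Lemma pm_attained (Y : finType) (G G0 : Y -> 'rV[R]_n) (u : lat n) y : exists i, `|paff G G0 u y i| = pm G G0 u y.
Proof.
have n0 : (0 < n)%N by apply: ltn_trans n2.
case: (@arg_maxP _ R 'I_n (Ordinal n0) predT (fun i => `|paff G G0 u y i|) isT) => i _ hi.
exists i; apply: le_anti; rewrite paff_pm /=; apply: pm_le; first exact: normr_ge0.
by move=> j; exact: hi.
Qed.

Definition Vn J (L E Q : nat) (k : 'rV[int]_n) (y : 'rV[int]_n) : R :=
  (@kmass R n n.+2 E)^-1 * nrm (\sum_(Q./2.+1 <= q < Q.+1)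
    (((q%:R / L%:R) ^+ n)%:C%C * Aq f w J L E q%:R k y) * cis (q%:R * Psi f J k (lpt L y))).

Lemma Sq_split J (Q E L K0 : nat) (F : R) : (0 < Q)%N -> (forall q, (0 < q <= Q)%N -> (q %| L)%N) ->
  (0 < L)%N -> 48 <= rho * L%:R -> (0 < E)%N -> E%:R / L%:R <= rho / 8 -> (Q * (2 * K0 + 2) <= L)%N ->
  (forall q, (Q./2 < q <= Q)%N ->
    \sum_(v : {ffun 'I_n -> 'I_(2 * L).+1} | [forall i, inwin L (L %/ q) (v i)] && (K0 < kmax v)%N)
     nrm (zs (tw (thk L q%:R (cpos v)) (wph f w J L q%:R))) <= F) ->
  nrm (Sq f w J Q) <= \sum_(u : {ffun 'I_n -> 'I_(2 * K0).+1}) \sum_(y : Yt rho L) Vn J L E Q (cpos u) (ylat x0 (rho / 2) L y) +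
    Q%:R * ((Q%:R / L%:R) ^+ n * F).
Proof.
move=> Q0 hdvd L0 hL E0 he hK hF.
have [/andP[r0 r1] C1 _] := hgood.
have LR : 0 < L%:R :> R by rewrite ltr0n.
have H0 : 0 < @kmass R n n.+2 E.
  have c : 0 < (3 / 4 : R) ^+ n.+3 / 2 by apply: divr_gt0 => //; apply: exprn_gt0; apply: divr_gt0.
  apply: lt_le_trans (kmass_ge _ E0).
  by apply: exprn_gt0; apply: mulr_gt0 => //; rewrite ltr0n.
have he8 : 8 * (E%:R / L%:R) <= rho by lra.
pose c q : R[i] := ((q%:R / L%:R) ^+ n)%:C%C.
pose T q k := zs (tw (thk L q%:R k) (wph f w J L q%:R)).
pose far q := \sum_(v : {ffun 'I_n -> 'I_(2 * L).+1} | [forall i, inwin L (L %/ q) (v i)] && (K0 < kmax v)%N) T q (cpos v).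
have KL : (K0 <= L)%N by apply: leq_trans hK; nia.
have split q : (Q./2.+1 <= q < Q.+1)%N -> zs (fun a => (w (ratpt a q))%:C%C * cis (q%:R * Fj f J (ratpt a q))) =
    c q * (\sum_(u : {ffun 'I_n -> 'I_(2 * K0).+1}) T q (cpos u)) + c q * far q.
  move=> /andP[q1 q2]; have q0 : (0 < q)%N by apply: leq_trans q1.
  have hq : (q %| L)%N by apply: hdvd; rewrite q0.
  rewrite (ratpt_poisson f r0 r1 hsupp J hL q0 hq L0) -mulrDr; congr (_ * _).
  rewrite (bigID (fun v => (kmax v <= K0)%N)) /=; congr (_ + _); last first.
    by apply: eq_bigl => v; rewrite -ltnNge.
  rewrite -(near_reindex (T q) KL); apply: eq_bigl => v; apply/andP/forallP.
    by move=> [_ /bigmax_leqP h] i; exact: h.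
  move=> h; split; last by apply/bigmax_leqP => i _; exact: h.
  apply/forallP => i; apply: (@near_inwin L (L %/ q) (v i) K0); first exact: leq_div.
    rewrite leq_divRL // mulnC; apply: leq_trans hK; rewrite leq_mul2r; apply/orP; right.
    by rewrite -ltnS.
  by have := h i; rewrite !mxE addrC.
rewrite /Sq (eq_big_nat _ _ split) big_split /=; apply: le_trans (nrmD _ _) _; apply: lerD.
  have E1 q : c q * (\sum_(u : {ffun 'I_n -> 'I_(2 * K0).+1}) T q (cpos u)) =
     \sum_(u : {ffun 'I_n -> 'I_(2 * K0).+1}) \sum_(y : Yt rho L) ((@kmass R n n.+2 E)^-1)%:C%C *
       ((c q * Aq f w J L E q%:R (cpos u) (ylat x0 (rho / 2) L y)) * cis (q%:R * Psi f J (cpos u) (lpt L (ylat x0 (rho / 2) L y)))).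
    rewrite mulr_sumr; apply: eq_bigr => u _; rewrite -mulr_sumr.
    have TE := T_avg f r0 r1 hsupp J hL q%:R (cpos u) E0 he8.
    rewrite (eq_bigr (fun y : Yt rho L => c q * (cis (q%:R * Psi f J (cpos u) (lpt L (ylat x0 (rho / 2) L y))) * Aq f w J L E q%:R (cpos u) (ylat x0 (rho / 2) L y)))); last by move=> y _; ring.
    rewrite -mulr_sumr -TE /T [RHS]mulrCA; congr (_ * _).
    by rewrite mulrA -rmorphM /= mulVf ?rmorph1 ?mul1r // gt_eqF.
  rewrite (eq_bigr _ (fun q _ => E1 q)) exchange_big /=; apply: le_trans (nrm_sum _ _ _) _.
  apply: ler_sum => u _; rewrite exchange_big /=; apply: le_trans (nrm_sum _ _ _) _.
  apply: ler_sum => y _; rewrite -mulr_sumr nrmM nrm_real ger0_norm // invr_ge0.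
  exact: ltW.
apply: le_trans (nrm_sum _ _ _) _.
apply: (@le_trans _ _ (\sum_(Q./2.+1 <= q < Q.+1) (Q%:R / L%:R) ^+ n * F)).
  apply: ler_sum_nat => q hq; rewrite nrmM nrm_real ger0_norm ?exprn_ge0 ?divr_ge0 //.
  have hq2 : (q <= Q)%N by case/andP: hq.
  apply: ler_pM; rewrite ?exprn_ge0 ?divr_ge0 ?nrm_ge0 //.
    by rewrite lerXn2r ?nnegrE ?divr_ge0 // ler_pM2r ?invr_gt0 // ler_nat.
  by apply: le_trans (nrm_sum _ _ _) _; apply: hF.
have F0 : 0 <= F by apply: le_trans (hF Q _); [exact: sumr_ge0 (fun _ _ => nrm_ge0 _)|rewrite leqnn andbT; lia].
rewrite sumr_const_nat -[leLHS]mulr_natl ler_wpM2r //; last by rewrite ler_nat; lia.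
by rewrite mulr_ge0 // exprn_ge0 // divr_ge0.
Qed.

Lemma shift_abs (K0 z : nat) : (z < (2 * K0).+1)%N -> (`|(- K0%:Z + z%:Z)%R| <= K0)%N.
Proof. by lia. Qed.

Lemma lin_pk (a b' k z D : R) : a <= z -> b' <= k -> k <= 2 * z + 1 -> 1 <= D -> a + b' <= 3 * z + D.
Proof. by move=> h1 h2 h3 h4; lra. Qed.

Lemma lin_card (a D : R) : a <= 2 * D -> 1 <= D -> 2 * a + 1 <= 5 * D.
Proof. by move=> h1 h2; lra. Qed.

Lemma lin_double (a D : R) : 1 <= a -> 0 <= D -> D <= 2 * (a * D).
Proof. by move=> h1 h2; have h3 : 1 * D <= a * D; [exact: ler_wpM2r|lra]. Qed.

Lemma lin_half (D q : R) : D <= 2 * q -> 1 / 2 * D <= q.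
Proof. by move=> h1; lra. Qed.

Lemma lin_prod (u a t : R) : 1 / 2 <= u -> u <= a * t -> 1 <= 2 * a * t.
Proof. by move=> h1 h2; rewrite -mulrA; lra. Qed.

Lemma lin_le (a c : R) : 0 <= a -> 2 * a <= c -> a <= c.
Proof. by move=> h1 h2; lra. Qed.

Lemma lin_const (a c : R) : 0 <= a -> 0 <= c -> [/\ 1 <= a + 3 + c, a + 2 <= a + 3 + c & c <= a + 3 + c].
Proof. by move=> h1 h2; split; lra. Qed.

Lemma card_int_range (T : finType) (jj : T -> int) (A : nat) : injective jj ->
  (forall i, (`|jj i| <= A)%N) -> (#|T| <= (2 * A).+1)%N.
Proof.
move=> ji hA; pose fj i : 'I_(2 * A).+1 := inord `|(jj i + A%:Z)%R|.
have fE i : fj i = `|(jj i + A%:Z)%R|%N :> nat.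
  by rewrite inordK //; move: (hA i); move: (jj i) => z; clear; lia.
have fi : injective fj.
  move=> i i' /(congr1 val) /=; rewrite !fE => h; apply: ji.
  by move: h (hA i) (hA i'); move: (jj i) (jj i') => z z'; clear; lia.
by have := leq_card fj fi; rewrite card_ord.
Qed.

(** The bound is the stationary phase size (QD)^(n/2) summed over q, as for a single j; that it
    holds for all j in a dyadic range together is the cancellation in q. Near dual vectors go
    through [near_sum], whose conditions use up the decay of order n + 2: n powers for the sum over
    y and two to absorb Q p^2 / D. Far ones are covered by [far_T]. *)
Lemma exp_sum (l0 : 'I_r) : exists b K : R, [/\ 0 <= b, 0 <= K &
  forall (Q : nat) (l : 'I_r) (D : R) (J' : 'I_r -> int) (Ij : finType) (jj : Ij -> int), (0 < Q)%N ->
   1 <= D <= 2 * Q%:R -> (forall l', `|(J' l')%:~R : R| <= 2 * D) -> injective jj ->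
   (forall i, D <= `|(jj i)%:~R : R| <= 2 * D) ->
  \sum_i nrm (Sq f w (JJ J' l (jj i)) Q) <= expR (b * phi n (2 * Q%:R)) * (K * (Q%:R * Num.sqrt (Q%:R * D) ^+ n))].
Proof.
have n0 : (0 < n)%N by apply: ltn_trans n2.
have [/andP[r0 r1] C1' _] := hgood.
have hg2 : good f x0 (rho / 2) C.
  by apply: good_shrink hgood; rewrite divr_gt0 //= ler_pdivrMr //; lra.
have [Cs Cs1 hsys] := cube_system hg2.
have rR : 1 <= r%:R :> R by rewrite ler1n; case: (r) l0 => [[]|].
pose cF : R := 2 * r%:R * C.
have cF1 : 1 <= cF.
  have : 1 * 1 <= r%:R * C by apply: ler_pM.
  by rewrite /cF; lra.
pose c5 : R := 3 * cF + 1.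
pose Cn := Cs + cF + 2 * C + 2 * c5.
have Cn1 : 1 <= Cn by rewrite /Cn /c5; lra.
have [Cn2 Cn3 Cn4 Cn5] : [/\ Cs <= Cn, cF <= Cn, 2 * C <= Cn & 2 * c5 <= Cn] by rewrite /Cn /c5; split; lra.
have c50 : 0 <= c5 by rewrite /c5; lra.
move: Cn Cn1 Cn2 Cn3 Cn4 Cn5 => Cn Cn1 Cn2 Cn3 Cn4 Cn5.
have Cn0 : 0 <= Cn by lra.
have [b b0 hnear] := near_sum n2 Cn1.
have [K1 K10 hV] := V_bounds hgood hf hw hCw n2 Cn0.
have [KF KF0 hF] := far_T hgood hf hw hCw n2 hsupp l0.
have [c3 c30 hc3] : exists2 c3 : R, 0 < c3 & forall E : nat, (0 < E)%N -> c3 * E%:R ^+ n <= @kmass R n n.+2 E.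
  exists (((3 / 4) ^+ n.+3 / 2) ^+ n); first by rewrite exprn_gt0 // divr_gt0 // exprn_gt0 // divr_gt0.
  by move=> E E0; rewrite -exprMn; exact: kmass_ge.
have [g g0 gE] : exists2 g : R, 0 < g & g = 96 / rho by exists (96 / rho) => //; rewrite divr_gt0.
pose Kn := K1 / c3 * (n%:R + 3 + g ^+ 2) * g ^+ n.
pose Kf := 5 * KF * 2 ^+ n.+2 * g ^+ n * (2 * g ^+ 2).
have kc : 0 <= K1 / c3 by rewrite divr_ge0 // ltW.
have [n31 n32 n33] := lin_const (ler0n R n) (sqr_ge0 g).
have n3 : 0 <= n%:R + 3 + g ^+ 2 by rewrite !addr_ge0 // sqr_ge0.
have Kn0 : 0 <= Kn by rewrite /Kn; apply: mulr_ge0; [exact: mulr_ge0|exact/exprn_ge0/ltW].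
have Kf0 : 0 <= Kf.
  apply: mulr_ge0; last by apply: mulr_ge0 => //; exact: sqr_ge0.
  by apply: mulr_ge0; [apply: mulr_ge0; [apply: mulr_ge0|exact: exprn_ge0]|exact/exprn_ge0/ltW].
exists b, (Kn + Kf); split; [exact: ltW|exact: addr_ge0|].
move=> Q l D J' Ij jj Q0 hD hJ' ji hj; have /andP[D1 D2] := hD.
have D0 : 0 <= D by lra.
have Dp : 0 < D by lra.
have QR : 1 <= Q%:R :> R by rewrite ler1n.
have Qp : 0 < Q%:R :> R by lra.
have [K0 [hK1 hK2 K00]] : exists K0 : nat, [/\ 2 * (cF * D) <= K0%:R, K0%:R <= 2 * (cF * D) + 1 & (0 < K0)%N].
  have c : 0 <= 2 * (cF * D) by rewrite !mulr_ge0 //; lra.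
  exists (Num.truncn (2 * (cF * D))).+1; split => //; first exact/ltW/truncnS_gt.
  by rewrite -natr1 lerD2r truncn_le.
have r01 : 0 < rho <= 1 by rewrite r0.
have cC1 : 0 <= @C1 R n Cn / @cD R n.
  by rewrite divr_ge0 //; [have := @C1_ge R n Cn Cn1; lra|exact/ltW/cD_gt0].
have [L [E [L0 hdvd hL hZ [hCZ hQD hQC hQK [nE he1 he2 he3 hg]]]]] := choose_params (n := n) K0 r01 Cn1 cC1 Q0 hD.
have E0 : (0 < E)%N by apply: leq_trans nE.
have LR : 0 < L%:R :> R by rewrite ltr0n.
have ER : 0 < E%:R :> R by rewrite ltr0n.
have e0 : 0 < E%:R / L%:R :> R by rewrite divr_gt0.
set s := Num.sqrt (Q%:R * D) in hg *; rewrite -gE in hg.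
have s0 : 0 <= s by exact: sqrtr_ge0.
have s2 : s ^+ 2 = Q%:R * D by rewrite sqr_sqrtr // mulr_ge0 // ltW.
have H0 := hc3 E E0.
have H1 : 0 < @kmass R n n.+2 E by apply: lt_le_trans H0; rewrite mulr_gt0 // exprn_gt0.
pose th : R := Q%:R * (E%:R / L%:R) / 6.
have th0 : 0 < th by rewrite divr_gt0 // mulr_gt0.
(* So th is at least of order sqrt (Q/D), which later turns Q p^2 / D into a multiple of (th
   p)^2. *)
have hg2' : Q%:R / D <= (g * th) ^+ 2.
  rewrite ler_pdivrMr // exprMn.
  have h : Q%:R <= g * s * th by rewrite -ler_pdivrMr.
  move: h th0; generalize th => t h t0.
  have h2 : Q%:R ^+ 2 <= (g * s * t) ^+ 2.
    by rewrite lerXn2r ?nnegrE ?(ltW Qp) //; apply: le_trans h; exact: ltW.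
  rewrite -(ler_pM2l Qp); move: h2; rewrite !exprMn s2 expr2.
  by have -> : Q%:R * (g ^+ 2 * t ^+ 2 * D) = g ^+ 2 * (Q%:R * D) * t ^+ 2 by ring.
have Yp := @Xp_rho R n r f x0 rho C hgood L hL.
have Yp1 := @Xp_rho1 R n r f x0 rho C hgood L hL.
have hJi i : forall l', `|JJ J' l (jj i) l' : R| <= 2 * D.
  by apply: JJ_le hJ' _ _; case/andP: (hj i).
pose F := KF * L%:R ^+ n * (2 / th) ^+ n.+2 / K0%:R.
have cFE : 2 * r%:R * C * D = cF * D by [].
have cFn : 4 * Q%:R * (2 * r%:R * C * D) <= L%:R.
  apply: le_trans hQC; rewrite cFE; apply: ler_wpM2l; first by rewrite mulr_ge0 // ltW.
  exact: ler_wpM2r.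
have Si i : nrm (Sq f w (JJ J' l (jj i)) Q) <= \sum_(u : {ffun 'I_n -> 'I_(2 * K0).+1}) \sum_(y : Yt rho L)
     Vn (JJ J' l (jj i)) L E Q (cpos u) (ylat x0 (rho / 2) L y) + Q%:R * ((Q%:R / L%:R) ^+ n * F).
  apply: Sq_split => // q /andP[q1 q2].
  have q0 : (0 < q)%N by apply: leq_trans q1.
  apply: (hF (JJ J' l (jj i)) Q q E L K0 D) => //; first exact: half_lt_leq.
  by apply: hdvd; rewrite q0.
apply: le_trans (ler_sum _ (fun i _ => Si i)) _.
rewrite big_split /= pair_bigA /= sumr_const.
rewrite [(Kn + Kf) * _]mulrDl [expR _ * (_ + _)]mulrDr; apply: lerD; last first.
  have cI : #|Ij|%:R <= 5 * D.
    pose A := Num.truncn (2 * D).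
    have hA : A%:R <= 2 * D by rewrite truncn_le mulr_ge0.
    have hA2 (i : Ij) : (`|jj i| <= A)%N.
      rewrite -ltnS -(ltr_nat R) natr_absz intr_norm; apply: le_lt_trans (truncnS_gt _).
      by case/andP: (hj i).
    have := card_int_range ji hA2; rewrite -(ler_nat R) => h; apply: le_trans h _.
    by rewrite -natr1 natrM; exact: lin_card hA D1.
  rewrite -[leLHS]mulr_natl; have eR : 1 <= expR (b * phi n (2 * Q%:R)) :> R.
    have Q2 : 1 <= 2 * Q%:R :> R by apply: le_trans QR _; rewrite ler_peMl // ler1n.
    have p1 := @phi_ge1 R n (2 * Q%:R) Q2.
    have bp : 0 <= b * phi n (2 * Q%:R) by apply: mulr_ge0; [exact: ltW|exact: le_trans ler01 p1].
    by apply: le_trans (expR_ge1Dx _); rewrite lerDl.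
  have R0 : 0 <= Kf * (Q%:R * s ^+ n) by rewrite mulr_ge0 // mulr_ge0 ?exprn_ge0 // ltW.
  apply: (@le_trans _ _ (Kf * (Q%:R * s ^+ n))); last by rewrite ler_peMl.
  have K0D : D <= K0%:R.
    by apply: le_trans hK1; exact: lin_double cF1 D0.
  have K0p : 0 < K0%:R :> R by rewrite ltr0n.
  have Qth : (Q%:R / th) ^+ n <= g ^+ n * s ^+ n.
    have := hg; rewrite -/th; move: th0; generalize th => t t0 ht.
    rewrite -exprMn; apply: lerXn2r => //; rewrite nnegrE; first by apply: divr_ge0; exact: ltW.
    by apply: mulr_ge0 => //; exact: ltW.
  have th2 : (th ^+ 2)^-1 <= 2 * g ^+ 2.
    rewrite -[(th ^+ 2)^-1]mul1r ler_pdivrMr ?exprn_gt0 //.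
    have h12 : 1 / 2 <= Q%:R / D by rewrite ler_pdivlMr //; exact: lin_half.
    by move: hg2'; generalize th => t; rewrite exprMn; exact: lin_prod h12.
  have E1 : Q%:R * ((Q%:R / L%:R) ^+ n * F) = (KF * 2 ^+ n.+2 * Q%:R) * ((Q%:R / th) ^+ n * (th ^+ 2)^-1) / K0%:R.
    rewrite /F; move: th0; generalize th => t t0; rewrite !expr_div_n.
    have -> : t ^+ n.+2 = t ^+ n * t ^+ 2 by rewrite -exprD addn2.
    have a1 : L%:R ^+ n != 0 :> R by rewrite expf_neq0 // gt_eqF.
    have a2 : t ^+ n != 0 by rewrite expf_neq0 // gt_eqF.
    have a3 : t ^+ 2 != 0 by rewrite expf_neq0 // gt_eqF.
    move: (L%:R ^+ n) (t ^+ n) (t ^+ 2) (Q%:R ^+ n) (2 ^+ n.+2) a1 a2 a3 => z1 z2 z3 z4 z5 a1 a2 a3.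
    by field; rewrite a1 a2 a3 gt_eqF.
  have c0 : 0 <= KF * 2 ^+ n.+2 * Q%:R by apply: mulr_ge0; [apply: mulr_ge0 => //; exact: exprn_ge0|exact: ltW].
  rewrite E1; apply: (@le_trans _ _ ((5 * D) * ((KF * 2 ^+ n.+2 * Q%:R) * ((g ^+ n * s ^+ n) * (2 * g ^+ 2)) / K0%:R))).
    apply: ler_pM => //.
      apply: divr_ge0; last exact: ltW.
      apply: mulr_ge0 => //; apply: mulr_ge0; last by rewrite invr_ge0 exprn_ge0 // ltW.
      by rewrite exprn_ge0 // divr_ge0 // ltW.
    rewrite ler_pM2r ?invr_gt0 //; apply: ler_wpM2l => //; apply: ler_pM => //.
      by rewrite exprn_ge0 // divr_ge0 // ltW.
    by rewrite invr_ge0 exprn_ge0 // ltW.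
  have -> : (5 * D) * ((KF * 2 ^+ n.+2 * Q%:R) * ((g ^+ n * s ^+ n) * (2 * g ^+ 2)) / K0%:R) = (Kf * (Q%:R * s ^+ n)) * (D / K0%:R).
    by rewrite /Kf; ring.
  by rewrite ler_piMr // ler_pdivrMr // mul1r.
pose Ix := (Ij * {ffun 'I_n -> 'I_(2 * K0).+1})%type.
pose ix (i : Ix) : int * 'rV[int]_n := (jj i.1, cpos i.2).
pose Ps (i : Ix) (y : Yt rho L) := Psi f (JJ J' l (jj i.1)) (cpos i.2) (lpt L (ylat x0 (rho / 2) L y)).
have hm0 (iy : Ix * Yt rho L) : exists m : int, dist_int (Ps iy.1 iy.2) = `|Ps iy.1 iy.2 - m%:~R|.
  by have [m [h _]] := dist_intP (Ps iy.1 iy.2); exists m.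
have [mf hmf] := boolp.choice hm0.
(* The last coordinate is minus a nearest integer to [Psi], so that |psaff| is the distance of [Psi]
   to the integers. *)
pose mm (i : Ix) (y : Yt rho L) := - mf (i, y).
pose G := @Gp R n r f x0 rho l L; pose G0 := @G0p R n r f x0 rho J' l L.
pose lt i y : lat n := ((ix i).1, (ix i).2, mm i y).
have pE i y j : paff G G0 (lt i y) y j = pk f (JJ J' l (jj i.1)) (cpos i.2) (lpt L (ylat x0 (rho / 2) L y)) j by exact: paffE.
have psE i y : `|psaff (@Xp R n x0 rho L) (@gp R n r f x0 rho l L) (@g0p R n r f x0 rho J' l L) (lt i y) y| = dist_int (Ps i y).
  by rewrite psaffE (hmf (i, y)) /= /mm rmorphN.
have pmD i y : pm G G0 (lt i y) y <= c5 * D.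
  apply: pm_le; first exact: mulr_ge0.
  move=> j; rewrite pE /pk; apply: le_trans (ler_normB _ _) _.
  have h1 := dFj_le hgood j D0 (hJi i.1) (Yp1 y).
  have h2 : `|(@cpos n K0 i.2 0 j)%:~R : R| <= K0%:R.
    rewrite -intr_norm -natr_absz ler_nat !mxE; have := ltn_ord (i.2 j).
    exact: shift_abs.
  rewrite cFE in h1; rewrite (_ : c5 * D = 3 * (cF * D) + D); last by rewrite /c5; ring.
  exact: lin_pk h1 h2 hK2 D1.
pose W := (Q%:R / L%:R) ^+ n * (K1 / c3).
have W0 : 0 <= W by rewrite /W mulr_ge0 // exprn_ge0 // divr_ge0 // ltW.
(* The factor n + 3 + g^2 dominates the constants 1, n + 2 and g^2 of the three conditions on V. *)
pose B := Q%:R * W * (n%:R + 3 + g ^+ 2).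
have B0 : 0 <= B by rewrite /B mulr_ge0 // mulr_ge0 // ltW.
have HW : (@kmass R n n.+2 E)^-1 * ((Q%:R / L%:R) ^+ n * (K1 * E%:R ^+ n)) <= W.
  rewrite /W mulrCA ler_wpM2l ?exprn_ge0 ?divr_ge0 ?(ltW Qp) // mulrC ler_pdivrMr //.
  rewrite mulrAC ler_pdivlMr // mulrAC -[leLHS]mulrA; exact: ler_wpM2l.
have Vb i y : let p := pm G G0 (lt i y) y in let V := Vn (JJ J' l (jj i.1)) L E Q (cpos i.2) (ylat x0 (rho / 2) L y) in
   0 <= V /\ V <= Q%:R * W * (1 + th * p) ^- n.+2 /\ dist_int (Ps i y) * V <= (n%:R + 2) * W * (1 + th * p) ^- n.+1.
  move=> p V; have p0 : 0 <= p := pm_ge0 _ _ _ _.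
  have hp j : `|pk f (JJ J' l (jj i.1)) (cpos i.2) (lpt L (ylat x0 (rho / 2) L y)) j| <= p by rewrite -pE; exact: paff_pm.
  have ha : exists j, `|pk f (JJ J' l (jj i.1)) (cpos i.2) (lpt L (ylat x0 (rho / 2) L y)) j| = p.
    by have [j hjj] := pm_attained G G0 (lt i y) y; exists j; rewrite -pE.
  have pD := pmD i y; rewrite -/p in pD.
  have ep : E%:R / L%:R * p <= Cn.
    apply: le_trans Cn5; apply: (@le_trans _ _ (E%:R / L%:R * (c5 * D))); first by rewrite ler_wpM2l // ltW.
    rewrite mulrCA [2 * _]mulrC; exact: ler_wpM2l.
  have Qpp : 4 * Q%:R * p <= 3 * L%:R.
    apply: (@le_trans _ _ L%:R); last by rewrite ler_peMl // ler1n.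
    apply: le_trans hQC; apply: ler_wpM2l; first by rewrite mulr_ge0 // ltW.
    by apply: le_trans pD _; apply: ler_wpM2r => //; exact: lin_le c50 Cn5.
  have [v1 v2] := hV (JJ J' l (jj i.1)) Q E L D p (cpos i.2) _ Q0 D1 (hJi i.1) L0 nE he1 he2 (Yp y) hp ha ep Qpp.
  have Hi : 0 <= (@kmass R n n.+2 E)^-1 by rewrite invr_ge0 ltW.
  have P0 : 0 < 1 + th * p by rewrite ltr_wpDr // mulr_ge0 // ltW.
  rewrite -/th in v1 v2; rewrite /V /Vn; split; first by rewrite mulr_ge0 // nrm_ge0.
  split.
    apply: le_trans (ler_wpM2l Hi v1) _.
    set a := (1 + th * p) ^- n.+2; have a0 : 0 <= a by rewrite invr_ge0 exprn_ge0 // ltW.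
    rewrite [leLHS](_ : _ = (Q%:R * ((@kmass R n n.+2 E)^-1 * ((Q%:R / L%:R) ^+ n * (K1 * E%:R ^+ n)))) * a); last by ring.
    by apply: ler_wpM2r => //; apply: ler_wpM2l => //; exact: ltW.
  rewrite mulrCA; apply: le_trans (ler_wpM2l Hi v2) _.
  set a := (1 + th * p) ^- n.+1; have a0 : 0 <= a by rewrite invr_ge0 exprn_ge0 // ltW.
  rewrite [leLHS](_ : _ = ((n%:R + 2) * ((@kmass R n n.+2 E)^-1 * ((Q%:R / L%:R) ^+ n * (K1 * E%:R ^+ n)))) * a); last by ring.
  by apply: ler_wpM2r => //; apply: ler_wpM2l => //; rewrite addr_ge0.
have hsysl := system_mono Cn2 (hsys L l (ltac:(lra) : 4 <= rho / 2 * L%:R)).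
have thQ : th <= Q%:R.
  rewrite /th ler_pdivrMr //; apply: ler_wpM2l; first exact: ltW.
  by move: he1; lra.
have thL : th * D <= L%:R by apply: le_trans hQD; exact: ler_wpM2r.
have ixI : injective ix.
  by move=> [i u] [i' u'] [/ji -> /bpos_inj ->].
have Z1 : 1 <= D <= 2 * Q%:R := hD.
have := @hnear _ (@Xp R n x0 rho L) G (@gp R n r f x0 rho l L) L%:R G0 (@g0p R n r f x0 rho J' l L) D (2 * Q%:R) th Q%:R B Ix ix mm
  (fun i y => Vn (JJ J' l (jj i.1)) L E Q (cpos i.2) (ylat x0 (rho / 2) L y)) hsysl
  (@aff_stable_JJ R n r f x0 rho C hgood J' l L D D0 hJ' hL Cn Cn3) (@aff_separated_JJ R n r f x0 rho C hgood J' l L D hL Cn Dp Cn4)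
  Z1 hZ hCZ th0 thL Qp D2 B0 ixI (fun i => hj i.1).
move=> H; apply: le_trans (H _ _ _ _) _.
- move=> i y; have pD := pmD i y; have p0 := pm_ge0 G G0 (lt i y) y.
  have h2 : pm G G0 (lt i y) y <= Cn * D / 2.
    by apply: le_trans pD _; rewrite ler_pdivlMr // mulrAC; apply: ler_wpM2r => //; rewrite mulrC.
  have h3 : pm G G0 (lt i y) y ^+ 2 <= (Cn * D / 2) ^+ 2 by rewrite lerXn2r ?nnegrE //; apply: le_trans h2.
  apply: le_trans h3 _; rewrite expr_div_n; have := sqr_ge0 (Cn * D); set z := (_ ^+ 2) => z0.
  by rewrite ler_pdivrMr // -mulrA; lra.
- move=> i y; have pD := pmD i y; have p0 := pm_ge0 G G0 (lt i y) y.
  apply: (@le_trans _ _ ((Cn * (2 * Q%:R)) * (Cn * (2 * Q%:R)))); last by rewrite expr2.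
  apply: ler_pM => //; first exact: ltW.
    by apply: le_trans thQ _; rewrite mulrA ler_peMl //; apply: le_trans Cn1 _; rewrite ler_peMr // ler1n.
  by apply: le_trans pD _; apply: ler_pM => //; exact: lin_le c50 Cn5.
- by move=> i y; rewrite psE; exact: dist_int_half.
- move=> i y; have [V0 [v1 v2]] := Vb i y; rewrite -/(lt i y) psE.
  set V := Vn _ _ _ _ _ _ in V0 v1 v2 *; set p := pm _ _ _ _ in v1 v2 *.
  have p0 : 0 <= p by exact: pm_ge0.
  have tp0 : 0 <= th * p by rewrite mulr_ge0 // ltW.
  set P := 1 + th * p in v1 v2 *.
  have P1 : 1 <= P by rewrite /P lerDl.
  have Pp : 0 < P by exact: lt_le_trans P1.
  have Pi : 0 < P^-1 by rewrite invr_gt0.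
  have Pi1 : P^-1 <= 1 by rewrite invf_le1.
  have a0 : 0 <= P ^- n by rewrite -exprVn exprn_ge0 // ltW.
  have a1 : P ^- n.+1 <= P ^- n by rewrite -!exprVn exprS ler_piMl // exprn_ge0 // ltW.
  have a2 : P ^- n.+2 <= P ^- n.
    by apply: le_trans a1; rewrite -!exprVn [leLHS]exprS ler_piMl // exprn_ge0 // ltW.
  have QW0 : 0 <= Q%:R * W by rewrite mulr_ge0 // ltW.
  have gg := sqr_ge0 g.
  split.
  + apply: le_trans v1 _; rewrite /B -[leRHS]mulrA; apply: ler_wpM2l => //.
    by apply: le_trans a2 _; rewrite ler_peMl.
  + rewrite [leLHS](_ : _ = Q%:R * (dist_int (Ps i y) * V)); last by ring.
    apply: le_trans (ler_wpM2l (ltW Qp) v2) _.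
    rewrite [leLHS](_ : _ = (Q%:R * W) * ((n%:R + 2) * P ^- n.+1)); last by ring.
    rewrite /B -[leRHS]mulrA; apply: ler_wpM2l => //; apply: ler_pM => //.
      by rewrite -exprVn exprn_ge0 // ltW.
  + have h1 : Q%:R * (p ^+ 2 / D) <= g ^+ 2 * P ^+ 2.
      have -> : Q%:R * (p ^+ 2 / D) = Q%:R / D * p ^+ 2 by ring.
      apply: le_trans (ler_wpM2r (sqr_ge0 p) hg2') _.
      rewrite [leLHS](_ : _ = g ^+ 2 * (th * p) ^+ 2); last by ring.
      by apply: ler_wpM2l => //; rewrite lerXn2r ?nnegrE ?(ltW Pp) //; rewrite /P lerDr.
    have x0' : 0 <= Q%:R * (p ^+ 2 / D) by rewrite mulr_ge0 ?(ltW Qp) // divr_ge0 // sqr_ge0.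
    apply: le_trans (ler_pM V0 x0' v1 h1) _.
    have -> : Q%:R * W * P ^- n.+2 * (g ^+ 2 * P ^+ 2) = Q%:R * W * (g ^+ 2 * P ^- n).
      have P0 : P != 0 by rewrite gt_eqF.
      have -> : P ^+ n.+2 = P ^+ n * P ^+ 2 by rewrite -exprD addn2.
      have z1 : P ^+ n != 0 by exact: expf_neq0.
      have z2 : P ^+ 2 != 0 by exact: expf_neq0.
      by move: (P ^+ n) (P ^+ 2) z1 z2 => u1 u2 z1 z2; field; rewrite z1 z2.
    rewrite /B -[leRHS]mulrA; apply: ler_wpM2l => //; apply: ler_wpM2r => //.
apply: ler_wpM2l; first exact: expR_ge0.
have -> : B * D ^+ n * (L%:R / (th * D)) ^+ n = K1 / c3 * (n%:R + 3 + g ^+ 2) * Q%:R * (Q%:R / th) ^+ n.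
  rewrite /B /W; move: th0; generalize th => t t0; rewrite !expr_div_n exprMn.
  have a1 : L%:R ^+ n != 0 :> R by rewrite expf_neq0 // gt_eqF.
  have a2 : t ^+ n != 0 by rewrite expf_neq0 // gt_eqF.
  have a3 : D ^+ n != 0 by rewrite expf_neq0 // gt_eqF.
  move: (n%:R + 3 + g ^+ 2) (K1 / c3) (L%:R ^+ n) (t ^+ n) (D ^+ n) (Q%:R ^+ n) a1 a2 a3 => y1 y2 z1 z2 z3 z4 a1 a2 a3.
  by field; rewrite a1 a2 a3.
rewrite /Kn [leRHS](_ : _ = K1 / c3 * (n%:R + 3 + g ^+ 2) * Q%:R * (g * s) ^+ n); last by rewrite exprMn; ring.
apply: ler_wpM2l; first by apply: mulr_ge0; [exact: mulr_ge0|exact: ltW].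
have := hg; rewrite -/th; move: th0; generalize th => t t0 ht.
apply: lerXn2r => //; rewrite nnegrE; first by apply: divr_ge0; exact: ltW.
by apply: mulr_ge0 => //; exact: ltW.
Qed.

End ExpSumBound.

(** * The counting error over one dyadic range of q *)

Section ShellError.
Context {R : realType} {n r : nat}.
Variables (f : 'I_r -> 'rV[R]_n -> R) (w : 'rV[R]_n -> R) (A : nat) (Cw b K : R).
Hypotheses (n2 : (1 < n)%N) (r1 : (0 < r)%N) (b0 : 0 <= b) (K0 : 0 <= K).
Hypotheses (hA : forall x, w x != 0 -> forall i, `|x 0 i| <= A%:R) (hw : forall x, 0 <= w x <= Cw).
Hypothesis hexp : forall (Q : nat) (l : 'I_r) (D : R) (J' : 'I_r -> int) (Ij : finType) (jj : Ij -> int), (0 < Q)%N ->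
   1 <= D <= 2 * Q%:R -> (forall l', `|(J' l')%:~R : R| <= 2 * D) -> injective jj ->
   (forall i, D <= `|(jj i)%:~R : R| <= 2 * D) ->
  \sum_i nrm (Sq f w (JJ J' l (jj i)) Q) <= expR (b * phi n (2 * Q%:R)) * (K * (Q%:R * Num.sqrt (Q%:R * D) ^+ n)).

Definition Nq (d : R) (q : nat) : R :=
  \sum_(a \in [set a : 'rV[int]_n | forall k, dist_int (q%:R * f k (ratpt a q)) <= d]) w (ratpt a q).
Definition Wq (q : nat) : R := \sum_(a \in [set: 'rV[int]_n]) w (ratpt a q).
Definition Nsh (d : R) (Q : nat) : R := \sum_(Q./2.+1 <= q < Q.+1) Nq d q.
Definition Wsh (Q : nat) : R := \sum_(Q./2.+1 <= q < Q.+1) Wq q.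

Lemma ratpt_bnd (V : zmodType) (psi : 'rV[int]_n -> V) (Q q : nat) : (q <= Q)%N -> (0 < q)%N ->
  (forall a, psi a != 0 -> w (ratpt a q) != 0) -> bnd (A * Q) psi.
Proof.
move=> qQ q0 h a /h /hA ha j; have := ha j; rewrite !mxE mulrC normrM normfV.
have qp : 0 < q%:R :> R by rewrite ltr0n.
rewrite (gtr0_norm qp) ler_pdivrMr // -intr_norm -natr_absz -natrM ler_nat => h1.
by apply: leq_trans h1 _; rewrite leq_mul2l qQ orbT.
Qed.

Lemma sum_shell_idx (V : zmodType) (T : finType) (Q : nat) (F : nat -> T -> V) :
  \sum_(i : 'I_Q.+1 * T) (if (Q./2 < i.1)%N then F i.1 i.2 else 0) = \sum_(Q./2.+1 <= q < Q.+1) \sum_v F q v.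
Proof.
rewrite -(pair_bigA _ (fun (q : 'I_Q.+1) v => if (Q./2 < q)%N then F q v else 0)) /=.
rewrite (big_nat_widenl _ 0) // big_mkord [RHS]big_mkcond /=; apply: eq_bigr => q _.
by case: ifP => // _; rewrite big1.
Qed.

Section OneShell.
Variables (Q m : nat) (d : R).
Hypotheses (Q0 : (0 < Q)%N) (m0 : (0 < m)%N) (mQ : (m <= Q)%N) (hd : 0 <= d <= 1 / 2).

Let T := ('I_Q.+1 * {ffun 'I_n -> 'I_(2 * (A * Q)).+1})%type.
Definition wt (i : T) : R := if (Q./2 < i.1)%N then w (ratpt (cpos i.2) i.1) else 0.
Definition xt (i : T) (k : 'I_r) : R := (i.1)%:R * f k (ratpt (cpos i.2) i.1).

Lemma wt_ge0 i : 0 <= wt i.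
Proof. by rewrite /wt; case: ifP => // _; case/andP: (hw (ratpt (cpos i.2) i.1)). Qed.

Lemma Nsh_sum : Nsh d Q = \sum_i wt i * \prod_k (dist_int (xt i k) <= d)%R%:R.
Proof.
pose F q (v : {ffun 'I_n -> 'I_(2 * (A * Q)).+1}) : R := w (ratpt (cpos v) q) * \prod_k (dist_int (q%:R * f k (ratpt (cpos v) q)) <= d)%R%:R.
transitivity (\sum_(i : T) (if (Q./2 < i.1)%N then F i.1 i.2 else 0)); last first.
  by apply: eq_bigr => i _; rewrite /wt; case: ifP => // _; rewrite mul0r.
rewrite (@sum_shell_idx _ _ Q F) /Nsh; apply: eq_big_nat => q /andP[q1 q2].
have q0 : (0 < q)%N by apply: leq_trans q1.
pose psi a : R := w (ratpt a q) * \prod_k (dist_int (q%:R * f k (ratpt a q)) <= d)%R%:R.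
have h : bnd (A * Q) psi.
  by apply: (ratpt_bnd (q := q)) => // a; apply: contraNneq => e; rewrite /psi e mul0r.
rewrite -[RHS](zs_bnd h) /Nq.
rewrite -(fsbig_widen [set a : 'rV[int]_n | forall k, dist_int (q%:R * f k (ratpt a q)) <= d] setT psi) //.
  apply: eq_fsbigr => a /set_mem /= ha.
  by rewrite /psi big1 ?mulr1 // => k _; rewrite ha.
move=> a [_ /= na]; rewrite /psi; suff [k hk] : exists k, ~~ (dist_int (q%:R * f k (ratpt a q)) <= d).
  by rewrite (bigD1 k) //= (negbTE hk) mul0r mulr0.
apply: contrapT => h2; apply: na => k; apply: contrapT => h3; apply: h2; exists k; exact/negP.
Qed.

Lemma Wsh_sum : Wsh Q = \sum_i wt i.
Proof.
pose F q (v : {ffun 'I_n -> 'I_(2 * (A * Q)).+1}) : R := w (ratpt (cpos v) q).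
rewrite /wt (@sum_shell_idx _ _ Q F) /Wsh; apply: eq_big_nat => q /andP[q1 q2].
have q0 : (0 < q)%N by apply: leq_trans q1.
rewrite /Wq (@zs_bnd _ _ (A * Q) (fun a => w (ratpt a q))) //.
exact: (ratpt_bnd (q := q)).
Qed.

Lemma Wsh_le : Wsh Q <= Cw * (2 * A%:R + 1) ^+ n * Q%:R ^+ n.+1.
Proof.
have Cw0 : 0 <= Cw by have /andP[h1 h2] := hw 0; exact: le_trans h2.
have QR : 1 <= Q%:R :> R by rewrite ler1n.
have c0 : 0 <= Cw * (2 * A%:R + 1) ^+ n * Q%:R ^+ n.
  by apply: mulr_ge0; [apply: mulr_ge0 => //|]; apply: exprn_ge0 => //; rewrite addr_ge0 ?mulr_ge0.
rewrite /Wsh; apply: (@le_trans _ _ (\sum_(Q./2.+1 <= q < Q.+1) Cw * (2 * A%:R + 1) ^+ n * Q%:R ^+ n)); last first.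
  have -> : Cw * (2 * A%:R + 1) ^+ n * Q%:R ^+ n.+1 = Q%:R * (Cw * (2 * A%:R + 1) ^+ n * Q%:R ^+ n) by rewrite exprS; ring.
  rewrite sumr_const_nat -[leLHS]mulr_natl; apply: ler_wpM2r => //.
  by rewrite ler_nat; lia.
apply: ler_sum_nat => q /andP[q1 q2]; have q0 : (0 < q)%N by apply: leq_trans q1.
rewrite /Wq (@zs_bnd _ _ (A * Q) (fun a => w (ratpt a q))); last exact: (ratpt_bnd (q := q)).
apply: (@le_trans _ _ (\sum_(v : {ffun 'I_n -> 'I_(2 * (A * Q)).+1}) Cw)).
  by apply: ler_sum => v _; case/andP: (hw (ratpt (cpos v) q)).
rewrite sumr_const card_ffun !card_ord -[leLHS]mulr_natl mulrC -mulrA; apply: ler_wpM2l => //.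
rewrite natrX -exprMn; apply: lerXn2r; rewrite ?nnegrE ?mulr_ge0 ?addr_ge0 ?mulr_ge0 //.
have -> : (2 * A%:R + 1) * Q%:R = 2 * (A%:R * Q%:R) + Q%:R :> R by ring.
have -> : (2 * (A * Q)).+1%:R = 2 * (A%:R * Q%:R) + 1 :> R.
  by rewrite -(natr1 (2 * (A * Q))) (natrM _ 2) (natrM _ A).
by rewrite lerD2l.
Qed.

Lemma tS_Sq (J : {ffun 'I_r -> 'I_(2 * (2 * m)).+1}) :
  tS wt xt J = Sq f w (fun k => (@fr (2 * m) (J k))%:~R) Q.
Proof.
pose F q (v : {ffun 'I_n -> 'I_(2 * (A * Q)).+1}) : R[i] := (w (ratpt (cpos v) q))%:C%C *
  cis (q%:R * Fj f (fun k => (@fr (2 * m) (J k))%:~R) (ratpt (cpos v) q)).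
transitivity (\sum_(i : T) (if (Q./2 < i.1)%N then F i.1 i.2 else 0)).
  apply: eq_bigr => i _; rewrite /wt; case: ifP => _; last by rewrite rmorph0 mul0r.
  rewrite /F; congr (_ * cis _); rewrite /Fj mulr_sumr; apply: eq_bigr => k _.
  by rewrite /xt mulrCA.
rewrite (@sum_shell_idx _ _ Q F) /Sq; apply: eq_big_nat => q /andP[q1 q2].
have q0 : (0 < q)%N by apply: leq_trans q1.
rewrite /zs (@zs_bnd _ _ (A * Q)) //.
apply: (ratpt_bnd (q := q)) => // a; apply: contraNneq => ->.
by rewrite rmorph0 mul0r.
Qed.

Let S := trunc_log 2 (2 * m).

Lemma dyadic x : (0 < x <= 2 * m)%N -> exists s : 'I_S.+1, (2 ^ s <= x <= 2 * 2 ^ s)%N.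
Proof.
move=> /andP[x0 x1]; have h : (trunc_log 2 x < S.+1)%N by rewrite ltnS leq_trunc_log.
exists (Ordinal h) => /=; rewrite trunc_logP //=.
by have := @trunc_log_ltn 2 x isT; rewrite expnS => /ltnW.
Qed.

Let bet (j : 'I_(2 * (2 * m)).+1) : R := (Num.max 1 `|(@fr (2 * m) j)%:~R|)^-1.

Lemma bet_ge0 j : 0 <= bet j.
Proof. by rewrite invr_ge0 le_max ler01. Qed.

Lemma fr_shift_abs (j : 'I_(2 * (2 * m)).+1) : `|(@fr (2 * m) j)%:~R : R| = `|(j%:R : R) - (2 * m)%:R|.
Proof. by rewrite /fr rmorphB /= -!pmulrn. Qed.

Lemma fr_le (j : 'I_(2 * (2 * m)).+1) : (`|@fr (2 * m) j| <= 2 * m)%N.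
Proof. by rewrite /fr; have := ltn_ord j; lia. Qed.

(** A harmonic sum cut dyadically, so that a coordinate that is summed freely costs only a
    logarithm. *)
Lemma sum_bet : \sum_j bet j <= 5 * S.+1%:R.
Proof.
have p2 (s : nat) : 0 < 2 ^+ s :> R by rewrite exprn_gt0.
have h j : bet j <= \sum_(s < S.+1) (2 ^+ s)^-1 * (`|(@fr (2 * m) j)%:~R : R| <= 2 * 2 ^+ s)%R%:R.
  have b1 (s : 'I_S.+1) : 2 ^+ s <= Num.max 1 `|(@fr (2 * m) j)%:~R : R| -> `|(@fr (2 * m) j)%:~R : R| <= 2 * 2 ^+ s ->
      bet j <= \sum_(s < S.+1) (2 ^+ s)^-1 * (`|(@fr (2 * m) j)%:~R : R| <= 2 * 2 ^+ s)%R%:R.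
    move=> s1 s2; apply: le_trans (ler_sum_term (F := fun s : 'I_S.+1 => (2 ^+ s)^-1 * (`|(@fr (2 * m) j)%:~R : R| <= 2 * 2 ^+ s)%R%:R) s _).
      by rewrite s2 mulr1 /bet lef_pV2 // posrE // lt_max ltr01.
    by move=> s'; rewrite mulr_ge0 // invr_ge0 ltW.
  have [z|z] := posnP `|@fr (2 * m) j|%N.
    apply: (b1 ord0); first by rewrite expr0 le_max lexx.
    by rewrite -intr_norm -natr_absz z expr0 mulr1.
  have [s /andP[s1 s2]] : exists s : 'I_S.+1, (2 ^ s <= `|@fr (2 * m) j| <= 2 * 2 ^ s)%N.
    by apply: dyadic; rewrite z fr_le.
  apply: (b1 s); first by rewrite le_max -intr_norm -natr_absz -natrX ler_nat s1 orbT.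
  by rewrite -intr_norm -natr_absz -natrX -natrM ler_nat.
apply: le_trans (ler_sum _ (fun j _ => h j)) _.
rewrite exchange_big /= mulrC; apply: sum_le_ord => s; rewrite -mulr_sumr mulrC ler_pdivrMr //.
pose t0 : 'I_(2 * (2 * m)).+1 := inord (2 * m).
have t0E : t0 = (2 * m)%N :> nat by rewrite inordK //; lia.
have c : 0 <= 2 * 2 ^+ s :> R by rewrite mulr_ge0 // ltW.
have := card1_le t0 c; rewrite t0E => hc.
apply: (@le_trans _ _ (2 * (2 * 2 ^+ s) + 1)); last first.
  by have : 1 <= 2 ^+ s :> R by [rewrite exprn_ege1 // ler1n]; lra.
apply: le_trans hc; rewrite -sum1_card natr_sum [leRHS]big_mkcond /=; apply: ler_sum => j _.
by rewrite fr_shift_abs inE; case: ifP.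
Qed.

(** Every nonzero frequency vector qualifies for some pair (l, s), with l a coordinate of largest
    absolute value. *)
Definition dy (l : 'I_r) (s : nat) (J : {ffun 'I_r -> 'I_(2 * (2 * m)).+1}) : bool :=
  ((2 ^ s <= `|@fr (2 * m) (J l)|)%N && [forall k, (`|@fr (2 * m) (J k)| <= 2 * 2 ^ s)%N]).

Let j0 : 'I_(2 * (2 * m)).+1 := inord (2 * m).

(** At l the coefficient is at most 2^-s. The other coordinates are frozen by [pr], which forgets
    coordinate l by setting it to frequency 0, and are summed with their harmonic weights; for each
    choice of them the sum over coordinate l is bounded by [hexp]. *)
Lemma sum_dy l (s : 'I_S.+1) :
  \sum_(J | dy l s J) (\prod_k @beta R m d (J k)) * nrm (tS wt xt J) <=
  (5 * S.+1%:R) ^+ r * ((2 ^+ s)^-1 * (expR (b * phi n (2 * Q%:R)) * (K * (Q%:R * Num.sqrt (Q%:R * 2 ^+ s) ^+ n)))).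
Proof.
set D : R := 2 ^+ s; set ES := expR _ * _.
have D1 : 1 <= D by rewrite exprn_ege1 // ler1n.
have D0 : 0 < D by lra.
have ES0 : 0 <= ES by rewrite /ES mulr_ge0 ?expR_ge0 // mulr_ge0 // mulr_ge0 // exprn_ge0 // sqrtr_ge0.
have D2 : 1 <= D <= 2 * Q%:R.
  rewrite D1 /=; apply: (@le_trans _ _ (2 * m)%:R).
    rewrite /D -natrX ler_nat; apply: leq_trans (_ : 2 ^ S <= _)%N.
      by rewrite leq_exp2l // -ltnS.
    by apply: trunc_logP => //; rewrite muln_gt0.
  by rewrite natrM ler_wpM2l // ler_nat.
pose pr (J : {ffun 'I_r -> 'I_(2 * (2 * m)).+1}) := [ffun k => if k == l then j0 else J k].
pose bb (k : 'I_r) (j : 'I_(2 * (2 * m)).+1) : R := if k == l then (j == j0)%:R else bet j.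
have bb0 k j : 0 <= bb k j by rewrite /bb; case: eqP => // _; exact: bet_ge0.
have hJ J : dy l s J -> \prod_k @beta R m d (J k) <= D^-1 * \prod_k bb k (pr J k).
  move=> /andP[hl hk].
  have be j : 0 <= @beta R m d j <= bet j.
    by rewrite beta_ge0 //= /beta ge_min lexx orbT.
  rewrite (bigD1 l) //= [X in _ <= _ * X](bigD1 l) //= {1}/bb /pr ffunE !eqxx mul1r.
  apply: ler_pM.
  - by case/andP: (be (J l)).
  - by apply: prodr_ge0 => k _; case/andP: (be (J k)).
  - case/andP: (be (J l)) => _ h; apply: le_trans h _.
    have mx0 : 0 < Num.max 1 `|(@fr (2 * m) (J l))%:~R : R| by rewrite lt_max ltr01.
    rewrite /bet lef_pV2 ?posrE //.
    by rewrite le_max -intr_norm -natr_absz /D -natrX ler_nat hl orbT.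
  - apply: ler_prod => k kl; have /andP[h1 h2] := be (J k); rewrite h1 /=.
    by rewrite ffunE /bb (negbTE kl).
apply: (@le_trans _ _ (\sum_(J | dy l s J) (D^-1 * \prod_k bb k (pr J k)) * nrm (tS wt xt J))).
  by apply: ler_sum => J hdy; apply: ler_wpM2r; [exact: nrm_ge0|exact: hJ].
rewrite (partition_big pr predT) //=.
have inner J' : \sum_(J | dy l s J && (pr J == J')) (D^-1 * \prod_k bb k (pr J k)) * nrm (tS wt xt J) <=
    \prod_k bb k (J' k) * (D^-1 * ES).
  have P0 : 0 <= \prod_k bb k (J' k) by apply: prodr_ge0 => k _.
  have Di : 0 <= D^-1 by rewrite invr_ge0 ltW.
  rewrite (eq_bigr (fun J => (D^-1 * \prod_k bb k (J' k)) * nrm (tS wt xt J))); last first.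
    by move=> J /andP[_ /eqP ->].
  rewrite -mulr_sumr mulrAC [leLHS]mulrC; apply: ler_wpM2l => //.
  apply: ler_wpM2l => //.
  have [[J1 hJ1]|ne] := pselect (exists J, dy l s J && (pr J == J')); last first.
    by rewrite big_pred0 // => J; apply/negP => h; apply: ne; exists J.
  pose Ij := {J | dy l s J && (pr J == J')}.
  pose jj (J : Ij) := @fr (2 * m) (val J l).
  rewrite (eq_bigl (fun J => J \in [pred J | dy l s J && (pr J == J')])) //.
  rewrite big_sub /=.
  have prE (J : Ij) k : J' k = if k == l then j0 else val J k.
    by case/andP: (valP J) => _ /eqP e; transitivity (pr (val J) k); [rewrite e|rewrite ffunE].
  have tE (J : Ij) : nrm (tS wt xt (val J)) = nrm (Sq f w (JJ (fun k => @fr (2 * m) (J' k)) l (jj J)) Q).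
    rewrite tS_Sq; congr (nrm (Sq f w _ Q)); apply/funext => k; rewrite /JJ /jj (prE J).
    by case: eqP => // ->.
  rewrite (eq_bigr _ (fun J _ => tE J)).
  apply: hexp => //.
  - move=> k; have /andP[/andP[_ /forallP h] /eqP <-] := hJ1; rewrite ffunE; case: eqP => _.
      by rewrite (@fr0 R m d m0 hd) normr0 mulr_ge0 // ltW.
    by rewrite -intr_norm -natr_absz /D -natrX -natrM ler_nat; exact: h.
  - move=> J J2 /fr_inj e; apply: val_inj; apply/ffunP => k.
    have [->|kl] := eqVneq k l; first exact: e.
    by have := prE J k; rewrite (prE J2 k) (negbTE kl) => ->.
  - move=> J; have /andP[/andP[h1 /forallP h2] _] := valP J.
    by rewrite /jj -intr_norm -natr_absz /D -natrX -natrM !ler_nat h1 h2.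
apply: le_trans (ler_sum _ (fun J' _ => inner J')) _.
rewrite -mulr_suml; apply: ler_wpM2r; first by rewrite mulr_ge0 // invr_ge0 ltW.
rewrite -bigA_distr_bigA -[X in _ ^+ X](card_ord r) -prodr_const; apply: ler_prod => k _.
apply/andP; split; first by apply: sumr_ge0 => j _.
rewrite /bb; case: eqP => _; last exact: sum_bet.
rewrite (bigD1 j0) //= eqxx big1 ?addr0; last by move=> j /negbTE ->.
have h : 1 <= S.+1%:R :> R by rewrite ler1n.
by apply: (@le_trans _ _ (1 : R)); [exact: lexx|lra].
Qed.

Lemma sum_offzero (X : {ffun 'I_r -> 'I_(2 * (2 * m)).+1} -> R) : (forall J, 0 <= X J) ->
  \sum_(J | J != tJ0 r m) X J <= \sum_(l < r) \sum_(s < S.+1) \sum_(J | dy l s J) X J.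
Proof.
move=> X0; have h J : J != tJ0 r m -> X J <= \sum_(l < r) \sum_(s < S.+1) (dy l s J)%:R * X J.
  move=> hJ; have l0 : 'I_r := Ordinal r1.
  have [l hl] : exists l, forall k, (`|@fr (2 * m) (J k)| <= `|@fr (2 * m) (J l)|)%N.
    by case: (@arg_maxnP _ l0 predT (fun k => `|@fr (2 * m) (J k)|%N) isT) => l _ hl; exists l => k; exact: hl.
  have z : (0 < `|@fr (2 * m) (J l)|)%N.
    rewrite lt0n; apply: contraNneq hJ => z; apply/eqP/ffunP => k; rewrite ffunE.
    by apply: (@fr_inj (2 * m)); rewrite (@fr0 R m d m0 hd); have := hl k; rewrite z; lia.
  have [s /andP[s1 s2]] : exists s : 'I_S.+1, (2 ^ s <= `|@fr (2 * m) (J l)| <= 2 * 2 ^ s)%N.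
    by apply: dyadic; rewrite z fr_le.
  have hdy : dy l s J.
    by rewrite /dy /= s1; apply/forallP => k; apply: leq_trans (hl k) s2.
  apply: le_trans (ler_sum_term (F := fun l : 'I_r => \sum_(s < S.+1) (dy l s J)%:R * X J) l _); last first.
    by move=> l'; apply: sumr_ge0 => s' _; rewrite mulr_ge0.
  apply: le_trans (ler_sum_term (F := fun s : 'I_S.+1 => (dy l s J)%:R * X J) s _); last first.
    by move=> s'; rewrite mulr_ge0.
  by rewrite hdy mul1r.
apply: (@le_trans _ _ (\sum_J \sum_(l < r) \sum_(s < S.+1) (dy l s J)%:R * X J)).
  rewrite big_mkcond; apply: ler_sum => J _; case: ifP => [/h //|_].
  by apply: sumr_ge0 => l _; apply: sumr_ge0 => s _; rewrite mulr_ge0.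
rewrite exchange_big /=; apply: ler_sum => l _; rewrite exchange_big /=; apply: ler_sum => s _.
rewrite [leRHS]big_mkcond; apply: ler_sum => J _.
by case: ifP => _; rewrite ?mul1r ?mul0r.
Qed.

Lemma shell_error (K6 : R) : 2 <= K6 -> (forall j,
  [/\ nrm (@cT R m d j) <= K6 * @beta R m d j, nrm (@cE R m d j) <= K6 * m%:R^-1 &
      nrm (@cT R m d j + @cE R m d j) <= K6 * @beta R m d j]) ->
  `|Nsh d Q - (2 * d) ^+ r * Wsh Q| <= (3 * (r%:R + 1) * K6 ^+ r.+1) *
   ((d + m%:R^-1) ^+ r.-1 * m%:R^-1 * (Cw * (2 * A%:R + 1) ^+ n * Q%:R ^+ n.+1) +
    r%:R * (S.+1%:R * ((5 * S.+1%:R) ^+ r * (expR (b * phi n (2 * Q%:R)) *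
      (K * (Q%:R * (Num.sqrt Q%:R ^+ n * Num.sqrt (2 * m%:R) ^+ (n - 2)))))))).
Proof.
move=> K62 hK; have /andP[d0 d1] := hd.
rewrite Nsh_sum Wsh_sum; have := trig_bound xt m0 hd wt_ge0 K62 hK.
move=> h; apply: le_trans h _; apply: ler_wpM2l.
  by apply: mulr_ge0; [apply: mulr_ge0 => //; rewrite addr_ge0|apply: exprn_ge0; lra].
rewrite -Wsh_sum; apply: lerD.
  by apply: ler_wpM2l Wsh_le; apply: mulr_ge0; rewrite ?invr_ge0 // exprn_ge0 // addr_ge0 // invr_ge0.
apply: le_trans (sum_offzero _) _.
  move=> J; apply: mulr_ge0; last exact: nrm_ge0.
  by apply: prodr_ge0 => k _; exact: beta_ge0.
apply: sum_le_ord => l; apply: sum_le_ord => s; apply: le_trans (sum_dy l s) _.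
apply: ler_wpM2l; first by rewrite exprn_ge0 // mulr_ge0.
rewrite mulrCA; apply: ler_wpM2l; first exact: expR_ge0.
rewrite mulrCA; apply: ler_wpM2l => //; rewrite mulrCA; apply: ler_wpM2l => //.
have D0 : 0 < 2 ^+ s :> R by rewrite exprn_gt0.
rewrite sqrtrM // exprMn mulrCA; apply: ler_wpM2l; first by rewrite exprn_ge0 // sqrtr_ge0.
(* With D = 2^s, the quotient D^(n/2) / D = D^((n-2)/2) does not decrease in D, so every s is
   bounded by the largest frequency 2m. *)
have -> : Num.sqrt (2 ^+ s) ^+ n = (2 ^+ s) * Num.sqrt (2 ^+ s) ^+ (n - 2) :> R.
  have e : 2 ^+ s = Num.sqrt (2 ^+ s) ^+ 2 :> R by rewrite sqr_sqrtr // ltW.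
  by rewrite {2}e -exprD subnKC.
rewrite mulKf ?gt_eqF //; apply: lerXn2r; rewrite ?nnegrE ?sqrtr_ge0 //.
rewrite ler_sqrt ?mulr_ge0 // -natrM -natrX ler_nat; apply: leq_trans (_ : 2 ^ S <= _)%N.
  by rewrite leq_exp2l // -ltnS.
by apply: trunc_logP => //; rewrite muln_gt0.
Qed.

End OneShell.
End ShellError.

(** * The choice of the degree *)

Section TotalError.
Context {R : realType} {n r : nat}.
Variables (f : 'I_r -> 'rV[R]_n -> R) (w : 'rV[R]_n -> R) (A : nat) (Cw b K : R).
Hypotheses (n2 : (1 < n)%N) (r1 : (0 < r)%N) (b0 : 0 <= b) (K0 : 0 <= K).
Hypotheses (hA : forall x, w x != 0 -> forall i, `|x 0 i| <= A%:R) (hw : forall x, 0 <= w x <= Cw).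
Hypothesis hexp : forall (Q : nat) (l : 'I_r) (D : R) (J' : 'I_r -> int) (Ij : finType) (jj : Ij -> int), (0 < Q)%N ->
   1 <= D <= 2 * Q%:R -> (forall l', `|(J' l')%:~R : R| <= 2 * D) -> injective jj ->
   (forall i, D <= `|(jj i)%:~R : R| <= 2 * D) ->
  \sum_i nrm (Sq f w (JJ J' l (jj i)) Q) <= expR (b * phi n (2 * Q%:R)) * (K * (Q%:R * Num.sqrt (Q%:R * D) ^+ n)).

Lemma double_pred (k : nat) : (1 < k)%N -> (k + (k - 2) = 2 * k.-1)%N.
Proof. by lia. Qed.

Lemma ln2_ge : 1 / 2 <= ln 2 :> R.
Proof.
rewrite -[1 / 2]expRK ler_ln ?posrE ?expR_gt0 //.
have h : expR (1 / 2) * expR (- (1 / 2)) = 1 :> R by rewrite -expRD subrr expR0.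
have h2 := expR_ge1Dx (- (1 / 2) : R).
have e0 : 0 < expR (1 / 2) :> R by exact: expR_gt0.
have h3 : expR (1 / 2) * (1 / 2) <= expR (1 / 2) * expR (- (1 / 2)) :> R by apply: ler_wpM2l; [exact: ltW|lra].
by rewrite h in h3; lra.
Qed.

Lemma trunc_log_phi (m Q : nat) : (0 < m)%N -> (m <= Q)%N ->
  (trunc_log 2 (2 * m)).+1%:R <= 2 * expR (2 * phi n (2 * Q%:R)) :> R.
Proof.
move=> m0 mQ; have mR : 0 < m%:R :> R by rewrite ltr0n.
have Q1 : 1 <= Q%:R :> R by rewrite ler1n; exact: leq_trans mQ.
have Q2 : 1 <= 2 * Q%:R :> R by lra.
have h : (2 ^ (trunc_log 2 (2 * m)))%:R <= 2 * Q%:R :> R.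
  rewrite -natrM ler_nat; apply: leq_trans (_ : 2 * m <= _)%N; last by rewrite leq_mul2l.
  by apply: trunc_logP => //; rewrite muln_gt0.
have h1 : ln ((2 ^ (trunc_log 2 (2 * m)))%:R) <= ln (2 * Q%:R) :> R.
  have p2 : 0 < (2 ^ (trunc_log 2 (2 * m)))%:R :> R by rewrite ltr0n expn_gt0.
  have p3 : 0 < 2 * Q%:R :> R by lra.
  by rewrite ler_ln ?posrE.
have e1 : ln ((2 ^ (trunc_log 2 (2 * m)))%:R) = (trunc_log 2 (2 * m))%:R * ln 2 :> R by rewrite natrX lnXn // mulr_natl.
rewrite e1 in h1.
have l2 := ln2_ge; have lp := @ln_le_phi R n (2 * Q%:R) Q2.
have S0 : 0 <= (trunc_log 2 (2 * m))%:R :> R by [].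
rewrite -natr1; move: h1 lp S0.
set S := (trunc_log _ _)%:R; set l := ln (2 * Q%:R); set e := expR _ => h1 lp S0.
have : S * (1 / 2) <= S * ln 2 by apply: ler_wpM2l.
by lra.
Qed.

(** The degree m is about Q t^2. By t^n = dd^(r-1) the zero frequency error dd^(r-1) Q^(n+1) / m and
    the exponential sums Q^(n/2+1) m^((n-2)/2) are then both of size Q^n t^(n-2). The condition 1 <=
    Q t^2 dd keeps 1/m below a constant times dd. *)
Lemma shell_bound : exists b' K' : R, [/\ 0 < b', 0 <= K' & forall (Q : nat) (d dd t : R), (0 < Q)%N ->
   0 <= d <= 1 / 2 -> d <= dd <= 1 -> 0 < t <= 1 -> t ^+ n = dd ^+ r.-1 -> 1 <= Q%:R * t ^+ 2 * dd ->
  `|Nsh f w d Q - (2 * d) ^+ r * Wsh w Q| <= expR (b' * phi n (2 * Q%:R)) * (K' * (Q%:R ^+ n * t ^+ (n - 2)))].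
Proof.
have [K6 K62 hK6] := @coef_bounds R.
have Cw0 : 0 <= Cw by have /andP[h1 h2] := hw 0; exact: le_trans h2.
pose c0 : R := Cw * (2 * A%:R + 1) ^+ n.
have c00 : 0 <= c0 by rewrite mulr_ge0 // exprn_ge0 // addr_ge0 // mulr_ge0.
pose C6 : R := 3 * (r%:R + 1) * K6 ^+ r.+1.
have C60 : 0 <= C6 by apply: mulr_ge0; [apply: mulr_ge0 => //; rewrite addr_ge0|apply: exprn_ge0; lra].
pose a1 : R := 3 ^+ r.-1 * (2 * c0).
have a10 : 0 <= a1 by apply: mulr_ge0; [exact: exprn_ge0|exact: mulr_ge0].
pose a2 : R := r%:R * (2 * (10 ^+ r * (K * 2 ^+ (n - 2)))).
have a20 : 0 <= a2 by do 3 (apply: mulr_ge0 => //; rewrite ?exprn_ge0 //); apply: mulr_ge0 => //; exact: exprn_ge0.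
exists (b + 2 * (r%:R + 1)), (C6 * (a1 + a2)); split.
- by apply: ltr_wpDl => //; apply: mulr_gt0 => //; apply: ltr_wpDl.
- by apply: mulr_ge0 => //; exact: addr_ge0.
move=> Q d dd t Q0 hd /andP[ddd dd1] /andP[t0 t1] tn hQ.
have QR : 0 < Q%:R :> R by rewrite ltr0n.
have Q1 : 1 <= Q%:R :> R by rewrite ler1n.
have /andP[d0 _] := hd.
have dd0 : 0 <= dd by exact: le_trans ddd.
pose X := Q%:R * t ^+ 2.
have t20 : 0 < t ^+ 2 by rewrite exprn_gt0.
have X0 : 0 < X by rewrite mulr_gt0.
have X1 : 1 <= X by apply: le_trans hQ _; rewrite ler_piMr // ltW.
have XQ : X <= Q%:R by rewrite /X ler_piMr ?(ltW QR) //; apply: exprn_ile1; rewrite ?(ltW t0).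
have Xd : X^-1 <= dd by rewrite -[X^-1]mul1r ler_pdivrMr // mulrC.
have [m [m0 mX Xm]] : exists m : nat, [/\ (0 < m)%N, m%:R <= X & X <= 2 * m%:R].
  have h2 := truncnS_gt X; rewrite -natr1 in h2.
  have m1 : (0 < Num.truncn X)%N by case: (Num.truncn X) h2 => //; lra.
  exists (Num.truncn X); split => //; first by rewrite truncn_le // ltW.
  by have : 1 <= (Num.truncn X)%:R :> R by [rewrite ler1n]; lra.
have mQ : (m <= Q)%N by rewrite -(ler_nat R); exact: le_trans XQ.
have mR : 0 < m%:R :> R by rewrite ltr0n.
have mi : m%:R^-1 <= 2 * X^-1 by rewrite -[m%:R^-1]mul1r ler_pdivrMr // mulrAC ler_pdivlMr // mul1r.
have := @shell_error R n r f w A Cw b K n2 r1 b0 K0 hA hw hexp Q m d Q0 m0 mQ hd K6 K62 (fun j => hK6 m d j m0 hd).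
move=> h; apply: le_trans h _; rewrite -/C6 -/c0.
have p1 := @phi_ge1 R n (2 * Q%:R) (ltac:(lra) : 1 <= 2 * Q%:R).
set ph := phi n (2 * Q%:R) in p1 *.
have ee : expR ((b + 2 * (r%:R + 1)) * ph) = expR (2 * ph) ^+ r.+1 * expR (b * ph).
  by rewrite -expRM_natr -expRD; congr expR; rewrite -natr1; ring.
have e21 : 1 <= expR (2 * ph) by have := expR_ge1Dx (2 * ph); lra.
have eb1 : 1 <= expR (b * ph).
  by have : 0 <= b * ph by [apply: mulr_ge0 => //; lra]; have := expR_ge1Dx (b * ph); lra.
have E1 : 1 <= expR ((b + 2 * (r%:R + 1)) * ph).
  by rewrite ee; apply: mulr_ege1 => //; exact: exprn_ege1.
have tn2 : 0 <= Q%:R ^+ n * t ^+ (n - 2) by apply: mulr_ge0; apply: exprn_ge0; exact: ltW.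
have T1 : (d + m%:R^-1) ^+ r.-1 * m%:R^-1 * (c0 * Q%:R ^+ n.+1) <= a1 * (Q%:R ^+ n * t ^+ (n - 2)).
  have mi0 : 0 <= m%:R^-1 :> R by rewrite invr_ge0 ltW.
  have h1 : (d + m%:R^-1) ^+ r.-1 <= (3 * dd) ^+ r.-1 by apply: lerXn2r; rewrite ?nnegrE; try apply: addr_ge0 => //; [apply: mulr_ge0|lra].
  apply: (@le_trans _ _ ((3 * dd) ^+ r.-1 * (2 * X^-1) * (c0 * Q%:R ^+ n.+1))).
    apply: ler_wpM2r; first by apply: mulr_ge0 => //; apply: exprn_ge0; exact: ltW.
    by apply: ler_pM => //; apply: exprn_ge0; exact: addr_ge0.
  rewrite exprMn -tn /a1 /X (exprS Q%:R n).
  have -> : t ^+ n = t ^+ 2 * t ^+ (n - 2) by rewrite -exprD subnKC.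
  rewrite le_eqVlt; apply/orP; left; apply/eqP.
  move: (t ^+ 2) t20 (t ^+ (n - 2)) (Q%:R ^+ n) (3 ^+ r.-1) => z1 z1p z2 z3 z4.
  by field; rewrite !gt_eqF.
have T2 : r%:R * ((trunc_log 2 (2 * m)).+1%:R * ((5 * (trunc_log 2 (2 * m)).+1%:R) ^+ r * (expR (b * ph) *
      (K * (Q%:R * (Num.sqrt Q%:R ^+ n * Num.sqrt (2 * m%:R) ^+ (n - 2))))))) <=
    expR ((b + 2 * (r%:R + 1)) * ph) * (a2 * (Q%:R ^+ n * t ^+ (n - 2))).
  have hS := trunc_log_phi m0 mQ; rewrite -/ph in hS.
  move: hS; set S := (trunc_log _ _).+1%:R => hS; have S0 : 0 <= S by [].
  have sq : Num.sqrt (2 * m%:R) <= 2 * (Num.sqrt Q%:R * t).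
    rewrite -(@ler_pXn2r _ 2) ?nnegrE ?sqrtr_ge0 //; last by apply: mulr_ge0 => //; apply: mulr_ge0; [exact: sqrtr_ge0|exact: ltW].
    rewrite sqr_sqrtr; last by apply: mulr_ge0.
    rewrite !exprMn sqr_sqrtr ?(ltW QR) // -/X; lra.
  have s0 : 0 <= Num.sqrt Q%:R :> R by exact: sqrtr_ge0.
  have h1 : Q%:R * (Num.sqrt Q%:R ^+ n * Num.sqrt (2 * m%:R) ^+ (n - 2)) <= 2 ^+ (n - 2) * (Q%:R ^+ n * t ^+ (n - 2)).
    apply: (@le_trans _ _ (Q%:R * (Num.sqrt Q%:R ^+ n * (2 * (Num.sqrt Q%:R * t)) ^+ (n - 2)))).
      apply: ler_wpM2l; first exact: ltW.
      apply: ler_wpM2l; first exact: exprn_ge0.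
      by apply: lerXn2r => //; rewrite nnegrE ?sqrtr_ge0 //; apply: mulr_ge0 => //; apply: mulr_ge0 => //; exact: ltW.
    rewrite !exprMn.
    have e : Q%:R * (Num.sqrt Q%:R ^+ n * Num.sqrt Q%:R ^+ (n - 2)) = Q%:R ^+ n :> R.
      rewrite -exprD (double_pred n2).
      by rewrite exprM sqr_sqrtr ?(ltW QR) // -exprS prednK // (ltn_trans _ n2).
    rewrite le_eqVlt; apply/orP; left; apply/eqP; rewrite -e; ring.
  rewrite ee /a2.
  have h2 : (5 * S) ^+ r <= (10 * expR (2 * ph)) ^+ r.
    by apply: lerXn2r; rewrite ?nnegrE ?mulr_ge0 ?expR_ge0 //; lra.
  apply: (@le_trans _ _ (r%:R * ((2 * expR (2 * ph)) * ((10 * expR (2 * ph)) ^+ r * (expR (b * ph) * (K * (2 ^+ (n - 2) * (Q%:R ^+ n * t ^+ (n - 2))))))))).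
    have g1 : K * (Q%:R * (Num.sqrt Q%:R ^+ n * Num.sqrt (2 * m%:R) ^+ (n - 2))) <= K * (2 ^+ (n - 2) * (Q%:R ^+ n * t ^+ (n - 2))) by exact: ler_wpM2l.
    have g0 : 0 <= K * (Q%:R * (Num.sqrt Q%:R ^+ n * Num.sqrt (2 * m%:R) ^+ (n - 2))).
      apply: mulr_ge0; first exact: K0.
      apply: mulr_ge0; first exact: ltW.
      by apply: mulr_ge0; apply: exprn_ge0; exact: sqrtr_ge0.
    have g2 := ler_wpM2l (expR_ge0 (b * ph)) g1.
    have g3 : 0 <= expR (b * ph) * (K * (Q%:R * (Num.sqrt Q%:R ^+ n * Num.sqrt (2 * m%:R) ^+ (n - 2)))) by apply: mulr_ge0 => //; exact: expR_ge0.
    have S5 : 0 <= (5 * S) ^+ r by apply: exprn_ge0; exact: mulr_ge0.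
    apply: ler_wpM2l => //; apply: ler_pM => //; first exact: mulr_ge0.
    exact: ler_pM.
  rewrite le_eqVlt; apply/orP; left; apply/eqP; rewrite exprMn exprS; ring.
set E := expR ((b + _) * ph) in E1 T2 *; set Y := Q%:R ^+ n * _ in tn2 T1 T2 *.
have -> : E * (C6 * (a1 + a2) * Y) = C6 * (E * (a1 * Y) + E * (a2 * Y)) by ring.
apply: ler_wpM2l => //; apply: lerD T2; apply: le_trans T1 _.
by rewrite ler_peMl // mulr_ge0.
Qed.

End TotalError.

(** * Summation over the dyadic ranges *)

Section TotalBound.
Context {R : realType} {n r : nat}.
Variables (f : 'I_r -> 'rV[R]_n -> R) (w : 'rV[R]_n -> R) (b K : R).
Hypotheses (n2 : (1 < n)%N) (r1 : (0 < r)%N) (b0 : 0 < b) (K0 : 0 <= K).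
Hypothesis hsh : forall (Q : nat) (d dd t : R), (0 < Q)%N ->
   0 <= d <= 1 / 2 -> d <= dd <= 1 -> 0 < t <= 1 -> t ^+ n = dd ^+ r.-1 -> 1 <= Q%:R * t ^+ 2 * dd ->
  `|Nsh f w d Q - (2 * d) ^+ r * Wsh w Q| <= expR (b * phi n (2 * Q%:R)) * (K * (Q%:R ^+ n * t ^+ (n - 2))).

Lemma phi_mono (X Y : R) : 1 <= X -> X <= Y -> phi n X <= phi n Y.
Proof.
move=> X1 XY; have lXY : ln X <= ln Y by rewrite ler_ln ?posrE //; lra.
have l0 : 0 <= ln X by exact: ln_ge0.
rewrite /phi; case: ifP => _; rewrite lerD2l; first exact: ler_wsqrtr.
by rewrite ler_ln ?posrE; lra.
Qed.

(** Q^n t^(n-2) = Q^2 (Q t)^(n-2), where Q t does not decrease and Q^2 alone gains a factor 4. *)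
Lemma dyadic_decay (Q' Q : nat) (t' t : R) : (2 * Q' <= Q)%N -> 0 < t' -> 0 < t ->
  Q'%:R * t' ^+ 2 <= Q%:R * t ^+ 2 -> Q'%:R ^+ n * t' ^+ (n - 2) <= (Q%:R ^+ n * t ^+ (n - 2)) / 2.
Proof.
move=> hQ t'0 t0 h.
have e (q : R) (s : R) : q ^+ n * s ^+ (n - 2) = q ^+ 2 * (q * s) ^+ (n - 2).
  by rewrite exprMn mulrA -exprD subnKC.
have q0 : 0 <= Q'%:R :> R by exact: ler0n.
have Q0 : 0 <= Q%:R :> R by exact: ler0n.
have qQ : 2 * Q'%:R <= Q%:R :> R by rewrite -natrM ler_nat.
have h1 : Q'%:R * t' <= Q%:R * t.
  rewrite -(@ler_pXn2r _ 2) ?nnegrE ?mulr_ge0 ?(ltW t0) ?(ltW t'0) //.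
  rewrite !exprMn !(expr2 (_%:R)) -!mulrA; apply: ler_pM => //; last by lra.
  by rewrite mulr_ge0 // sqr_ge0.
rewrite !e; apply: (@le_trans _ _ ((Q%:R / 2) ^+ 2 * (Q%:R * t) ^+ (n - 2))).
  apply: ler_pM; [exact: exprn_ge0|by apply: exprn_ge0; rewrite mulr_ge0 // ltW| |].
    by apply: lerXn2r; rewrite ?nnegrE //; lra.
  by apply: lerXn2r; rewrite ?nnegrE ?mulr_ge0 ?(ltW t0) ?(ltW t'0).
have P0 : 0 <= Q%:R ^+ 2 * (Q%:R * t) ^+ (n - 2).
  by apply: mulr_ge0; [exact: exprn_ge0|apply: exprn_ge0; apply: mulr_ge0 => //; exact: ltW].
have -> : (Q%:R / 2) ^+ 2 * (Q%:R * t) ^+ (n - 2) = Q%:R ^+ 2 * (Q%:R * t) ^+ (n - 2) / 4.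
  by rewrite expr_div_n; have -> : 2 ^+ 2 = 4 :> R by [ring]; ring.
by lra.
Qed.

(** Strong induction on halving Q: the part up to Q/2 is at most twice a shell bound that is half as
    large, and the top shell adds one more, so the factor 2 reproduces itself. *)
Lemma dyadic_total (d : R) (dd t : nat -> R) : 0 <= d <= 1 / 2 ->
  (forall Q, (0 < Q)%N -> [/\ d <= dd Q <= 1, 0 < t Q <= 1, t Q ^+ n = dd Q ^+ r.-1 & 1 <= Q%:R * t Q ^+ 2 * dd Q]) ->
  (forall Q' Q, (0 < Q')%N -> (Q' <= Q)%N -> Q'%:R * t Q' ^+ 2 <= Q%:R * t Q ^+ 2) ->
  forall Q, (0 < Q)%N -> `|\sum_(1 <= q < Q.+1) Nq f w d q - (2 * d) ^+ r * \sum_(1 <= q < Q.+1) Wq w q| <=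
    2 * (expR (b * phi n (2 * Q%:R)) * (K * (Q%:R ^+ n * t Q ^+ (n - 2)))).
Proof.
move=> hd ht hm; elim/ltn_ind => Q IH Q0.
have [h1 h2 h3 h4] := ht Q Q0.
have HS := hsh Q0 hd h1 h2 h3 h4; have /andP[t0 t1] := h2.
have B0 : 0 <= expR (b * phi n (2 * Q%:R)) * (K * (Q%:R ^+ n * t Q ^+ (n - 2))).
  apply: mulr_ge0; first exact: expR_ge0.
  by apply: mulr_ge0 => //; apply: mulr_ge0; apply: exprn_ge0 => //; exact: ltW.
have hh : (Q./2.+1 <= Q.+1)%N by rewrite ltnS -divn2; exact: leq_div.
have sp (F : nat -> R) : \sum_(1 <= q < Q.+1) F q = \sum_(1 <= q < Q./2.+1) F q + \sum_(Q./2.+1 <= q < Q.+1) F q.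
  by rewrite (@big_cat_nat _ _ _ Q./2.+1).
rewrite !sp -/(Nsh f w d Q) -/(Wsh w Q).
have [q0|q0] := posnP Q./2.
  by rewrite q0 !big_geq // !add0r; apply: le_trans HS _; lra.
have qQ : (Q./2 < Q)%N by rewrite -divn2 ltn_Pdiv.
have := IH _ qQ q0.
set S1 := \sum_(_ <= _ < _) _; set S2 := \sum_(_ <= _ < _) _ => H.
have -> : S1 + Nsh f w d Q - (2 * d) ^+ r * (S2 + Wsh w Q) =
   (S1 - (2 * d) ^+ r * S2) + (Nsh f w d Q - (2 * d) ^+ r * Wsh w Q) by ring.
apply: le_trans (ler_normD _ _) _; apply: le_trans (lerD H HS) _.
have [_ /andP[t'0 _] _ _] := ht _ q0.
have D := @dyadic_decay Q./2 Q (t Q./2) (t Q) _ t'0 t0 (hm _ _ q0 (ltnW qQ)).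
have {}D : Q./2%:R ^+ n * t Q./2 ^+ (n - 2) <= Q%:R ^+ n * t Q ^+ (n - 2) / 2.
  by apply: D; rewrite mul2n -{2}(odd_double_half Q) leq_addl.
have q1 : 1 <= Q./2%:R :> R by rewrite ler1n.
have qQR : Q./2%:R <= Q%:R :> R by rewrite ler_nat ltnW.
have pm' : expR (b * phi n (2 * Q./2%:R)) <= expR (b * phi n (2 * Q%:R)).
  by rewrite ler_expR; apply: ler_wpM2l; [exact: ltW|apply: phi_mono; lra].
have e0 : 0 <= Q./2%:R ^+ n * t Q./2 ^+ (n - 2).
  by apply: mulr_ge0; apply: exprn_ge0 => //; exact: ltW.
have F1 : expR (b * phi n (2 * Q./2%:R)) * (K * (Q./2%:R ^+ n * t Q./2 ^+ (n - 2))) <=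
  expR (b * phi n (2 * Q%:R)) * (K * (Q%:R ^+ n * t Q ^+ (n - 2) / 2)).
  by apply: ler_pM => //; [exact: mulr_ge0|exact: ler_wpM2l].
move: F1; have -> : expR (b * phi n (2 * Q%:R)) * (K * (Q%:R ^+ n * t Q ^+ (n - 2) / 2)) =
  expR (b * phi n (2 * Q%:R)) * (K * (Q%:R ^+ n * t Q ^+ (n - 2))) / 2 by ring.
move: (expR _ * _) (expR _ * _) => u v; lra.
Qed.

Let N : R := n%:R.
Let S : R := r%:R - 1.
Let theta : R := N / (N + 2 * S).

Let N2 : 2 <= N. Proof. by rewrite /N ler_nat. Qed.
Let S0 : 0 <= S. Proof. by rewrite /S subr_ge0 ler1n. Qed.

(* [width] is the larger of [delta] and the critical size [Q ^ (-theta)], and [radius]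
   is tied to it by [radius ^ n = width ^ (r - 1)]; this balances the zero frequency
   error against the exponential sums. *)
Definition width (d : R) (Q : nat) : R := Num.max d (Q%:R `^ (- theta)).
Definition radius (d : R) (Q : nat) : R := width d Q `^ (S / N).

(** At the critical width the degree Q t^2 equals the inverse of the width; this equation determines
    theta = n / (n + 2(r - 1)). *)
Lemma critical_radius (Q : nat) : (0 < Q)%N -> Q%:R * ((Q%:R `^ (- theta)) `^ (S / N)) ^+ 2 = Q%:R `^ theta.
Proof.
move=> Q0; have QR : Q%:R != 0 :> R by rewrite pnatr_eq0 -lt0n.
rewrite -powR_mulrn ?powR_ge0 // -!powRrM -{1}[Q%:R]powRr1 ?ler0n //.
rewrite -powRD; last by rewrite QR implybT.
congr (_ `^ _); rewrite /theta; field.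
by have h1 := N2; have h2 := S0; rewrite !gt_eqF //; lra.
Qed.

Lemma radius_bounds (d : R) (Q : nat) : 0 <= d <= 1 / 2 -> (0 < Q)%N ->
  [/\ d <= width d Q <= 1, 0 < radius d Q <= 1, radius d Q ^+ n = width d Q ^+ r.-1,
      Q%:R `^ theta <= Q%:R * radius d Q ^+ 2 & 1 <= Q%:R * radius d Q ^+ 2 * width d Q].
Proof.
move=> /andP[d0 d1] Q0; have hN := N2; have hS := S0.
have Q1 : 1 <= Q%:R :> R by rewrite ler1n.
have QR : 0 < Q%:R :> R by rewrite ltr0n.
have th0 : 0 <= theta by apply: divr_ge0; lra.
have u0 : 0 < Q%:R `^ (- theta) :> R by exact: powR_gt0.
have u1 : Q%:R `^ (- theta) <= 1 :> R.
  have h : Q%:R `^ (- theta) <= Q%:R `^ 0 :> R by apply: ler_powR => //; rewrite oppr_le0.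
  by rewrite powRr0 in h.
have w1 : width d Q <= 1 by rewrite /width ge_max u1 andbT; lra.
have wd : d <= width d Q by rewrite /width le_max lexx.
have wu : Q%:R `^ (- theta) <= width d Q by rewrite /width le_max lexx orbT.
have w0 : 0 < width d Q by exact: lt_le_trans wu.
have p0 : 0 <= S / N by apply: divr_ge0; lra.
have t0 : 0 < radius d Q by exact: powR_gt0.
have hQt : Q%:R `^ theta <= Q%:R * radius d Q ^+ 2.
  rewrite -critical_radius //; apply: ler_wpM2l; first exact: ltW.
  apply: lerXn2r; rewrite ?nnegrE ?powR_ge0 //.
  by apply: ge0_ler_powR => //; rewrite nnegrE ltW.
split=> //.
- by rewrite wd w1.
- rewrite t0 /=; have e1 : 1 `^ (S / N) = 1 :> R by rewrite /powR oner_eq0 ln1 mulr0 expR0.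
  have h : width d Q `^ (S / N) <= 1 `^ (S / N) by apply: ge0_ler_powR => //; rewrite nnegrE // ltW.
  by rewrite e1 in h.
- rewrite -powR_mulrn ?(ltW t0) // -powRrM -[RHS]powR_mulrn ?(ltW w0) //; congr (_ `^ _).
  have -> : (r.-1)%:R = S by rewrite /S -[in RHS](prednK r1) -natr1 addrK.
  by rewrite -/N divfK // gt_eqF //; lra.
- have e1 : Q%:R `^ theta * Q%:R `^ (- theta) = 1 :> R.
    by rewrite powRN divff // gt_eqF // powR_gt0.
  apply: (@le_trans _ _ (Q%:R `^ theta * Q%:R `^ (- theta))); first by rewrite e1.
  by apply: ler_pM; rewrite ?powR_ge0.
Qed.

(** While the width is critical, Q radius^2 is Q^theta and grows. Once the width equals d it does so
    for all larger Q, and the radius is constant from then on. *)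
Lemma radius_mono (d : R) (Q' Q : nat) : 0 <= d <= 1 / 2 -> (0 < Q')%N -> (Q' <= Q)%N ->
  Q'%:R * radius d Q' ^+ 2 <= Q%:R * radius d Q ^+ 2.
Proof.
move=> hd Q'0 hQ; have Q0 : (0 < Q)%N by exact: leq_trans hQ.
have hN := N2; have hS := S0.
have th0 : 0 <= theta by apply: divr_ge0; lra.
have hQR : Q'%:R <= Q%:R :> R by rewrite ler_nat.
have Q'R : 0 < Q'%:R :> R by rewrite ltr0n.
have QR : 0 < Q%:R :> R by rewrite ltr0n.
have hp : Q'%:R `^ theta <= Q%:R `^ theta :> R.
  by apply: ge0_ler_powR => //; rewrite nnegrE ltW.
have [h|h] := leP (Q'%:R `^ (- theta)) d; last first.
  have -> : radius d Q' = (Q'%:R `^ (- theta)) `^ (S / N).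
    by rewrite /radius /width max_r // ltW.
  rewrite critical_radius //; apply: le_trans hp _.
  by have [_ _ _ h1 _] := radius_bounds hd Q0.
have h2 : Q%:R `^ (- theta) <= d.
  apply: le_trans h; rewrite !powRN lef_pV2 ?posrE ?powR_gt0 //.
have -> : radius d Q' = radius d Q by rewrite /radius /width !max_l.
by apply: ler_wpM2r => //; exact: sqr_ge0.
Qed.

(** Both cases of the bound are values of one expression in the radius, which removes the case
    distinction from the dyadic summation. *)
Lemma error_boundE (c1 c2 : R) (Q : nat) (d : R) : 0 <= d <= 1 / 2 -> (0 < Q)%N ->
  error_bound n r c1 c2 Q d = Q%:R ^+ n * radius d Q ^+ (n - 2) * En n c1 c2 Q.
Proof.
move=> hd Q0; have hN := N2; have hS := S0.
have QR : Q%:R != 0 :> R by rewrite pnatr_eq0 -lt0n.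
have e : (n - 2)%:R = N - 2 :> R by rewrite natrB.
have eT : radius d Q ^+ (n - 2) = radius d Q `^ (N - 2) by rewrite -e powR_mulrn ?powR_ge0.
rewrite eT /error_bound /= -/N -/S -/theta /radius /width -powRrM.
case: (leP (Q%:R `^ (- theta)) d) => h.
  by rewrite [in LHS](mulrC (_ `^ _)); congr (_ * _ `^ _ * _); rewrite mulrAC.
rewrite -powRrM -[Q%:R ^+ n]powR_mulrn ?ler0n // -powRD; last by rewrite QR implybT.
congr (_ `^ _ * _); rewrite -/N /theta; field.
by rewrite !gt_eqF //; lra.
Qed.

(** The left side never vanishes, whereas for n >= 3 [En] vanishes at Q = 1. From Q = 2 on, log Q >=
    1/2 gives 1 + log (2Q) <= 5 log Q, the origin of ln 5. *)
Lemma exp_phi_En (Q : nat) : (0 < Q)%N -> ((3 <= n)%N -> (2 <= Q)%N) ->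
  expR (b * phi n (2 * Q%:R)) <= expR (b * (2 + ln 5)) * En n b b Q.
Proof.
move=> Q0 Qn; have Q1 : 1 <= Q%:R :> R by rewrite ler1n.
have QR : 0 < Q%:R :> R by rewrite ltr0n.
have y0 : 0 <= ln Q%:R :> R by exact: ln_ge0.
have l2 : ln 2 <= 1 :> R.
  have e1 := expR_ge1Dx (1 : R).
  by rewrite -[leRHS]expRK ler_ln ?posrE ?expR_gt0 //; lra.
have l5 : 0 <= ln 5 :> R by apply: ln_ge0; lra.
have lM : ln (2 * Q%:R) = ln 2 + ln Q%:R :> R by rewrite lnM ?posrE.
rewrite /phi /En; case: ifP => n2'.
  rewrite -expRD ler_expR -mulrDr; apply: ler_wpM2l; first exact: ltW.
  have s0 := sqrtr_ge0 (ln Q%:R : R); have s2 := sqr_sqrtr y0.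
  have : Num.sqrt (ln (2 * Q%:R)) <= 1 + Num.sqrt (ln Q%:R) :> R.
    rewrite -[leRHS]ger0_norm; last by lra.
    rewrite -sqrtr_sqr; apply: ler_wsqrtr; rewrite lM sqrrD expr1n mul1r s2 mulr2n; lra.
  by lra.
have Q2 : 2 <= Q%:R :> R.
  by rewrite ler_nat; apply: Qn; rewrite ltn_neqAle eq_sym n2' n2.
have y1 : 1 / 2 <= ln Q%:R :> R.
  have h2 := @ln2_ge R; apply: le_trans h2 _; rewrite ler_ln ?posrE //.
have yp : 0 < ln Q%:R :> R by lra.
have -> : ln Q%:R `^ b = expR (b * ln (ln Q%:R)) :> R by rewrite /powR gt_eqF.
rewrite -expRD ler_expR -mulrDr; apply: ler_wpM2l; first exact: ltW.
have h : ln (1 + ln (2 * Q%:R)) <= ln (5 * ln Q%:R) :> R.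
  rewrite lM ler_ln ?posrE; last 2 first.
  - by have h2 := @ln2_ge R; lra.
  - by lra.
  by lra.
rewrite [X in _ <= X]lnM ?posrE // in h.
by lra.
Qed.

Lemma total_bound : exists c1 c2 C : R, [/\ 0 < c1, 0 < c2, 0 < C &
  forall (Q : nat) (delta : R), (1 <= Q)%N -> ((3 <= n)%N -> (2 <= Q)%N) -> 0 <= delta <= 1 / 2 ->
    `|N_w f w Q delta - (2 * delta) ^+ r * N_0 w Q| <= C * error_bound n r c1 c2 Q delta].
Proof.
pose C0 : R := expR (b * (2 + ln 5)).
have C00 : 0 <= C0 by exact: expR_ge0.
exists b, b, (2 * (C0 * K) + 1); split => //.
  by apply: ltr_wpDl => //; apply: mulr_ge0 => //; exact: mulr_ge0.
move=> Q d Q0 Qn hd.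
have H : `|N_w f w Q d - (2 * d) ^+ r * N_0 w Q| <=
    2 * (expR (b * phi n (2 * Q%:R)) * (K * (Q%:R ^+ n * radius d Q ^+ (n - 2)))).
  have hb q : (0 < q)%N -> [/\ d <= width d q <= 1, 0 < radius d q <= 1, radius d q ^+ n = width d q ^+ r.-1 &
      1 <= q%:R * radius d q ^+ 2 * width d q] by move=> q0; case: (radius_bounds hd q0).
  have eN : N_w f w Q d = \sum_(1 <= q < Q.+1) Nq f w d q by [].
  have eW : N_0 w Q = \sum_(1 <= q < Q.+1) Wq w q by [].
  rewrite eN eW; exact: (dyadic_total hd hb (fun q' q => @radius_mono d q' q hd) Q0).
apply: le_trans H _; rewrite error_boundE //.
have hE := exp_phi_En Q0 Qn; rewrite -/C0 in hE.
have Y0 : 0 <= Q%:R ^+ n * radius d Q ^+ (n - 2).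
  by apply: mulr_ge0; apply: exprn_ge0 => //; exact: powR_ge0.
move: (_ * _ ^+ (n - 2)) Y0 => Y Y0.
have E0 : 0 <= En n b b Q.
  by rewrite -(pmulr_rge0 _ (expR_gt0 (b * (2 + ln 5)))); apply: le_trans hE; exact: expR_ge0.
have h1 : expR (b * phi n (2 * Q%:R)) * (K * Y) <= C0 * En n b b Q * (K * Y) by apply: ler_wpM2r => //; exact: mulr_ge0.
have h2 : 0 <= Y * En n b b Q by exact: mulr_ge0.
have -> : (2 * (C0 * K) + 1) * (Y * En n b b Q) = 2 * (C0 * En n b b Q * (K * Y)) + Y * En n b b Q by ring.
by move: h1 h2; move: (expR _ * _) (C0 * _ * _) (Y * _) => u1 u2 u3; lra.
Qed.

End TotalBound.

(** * The weight function and the conclusion *)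

Section Weight.
Context {R : realType} {n : nat}.
Implicit Types (w : 'rV[R]_n -> R).

Lemma iparts_off_supp w (i : 'I_n) m x : ~ supp w x -> iparts i m w x = 0.
Proof.
elim: m x => [|m IH] x hx.
  by apply: contrapT => /eqP h; apply: hx; exact: subset_closure.
rewrite /iparts iterS -/(iparts i m w) /partial.
have op : open (~` supp w) by apply: closed_openC; exact: closed_closure.
have h : \near x, iparts i m w x = cst (0 : R) x.
  have /filterS : nbhs x (~` supp w) by exact: open_nbhs_nbhs.
  by apply=> y hy; exact: IH.
by rewrite (near_eq_derive (delta_mx 0 i) h) derive_cst.
Qed.

(** The derivatives are continuous, hence bounded on the compact support, and they vanish on its
    complement, which is open. *)
Lemma iparts_bounded w : (0 < n)%N -> Cc_infty w ->
  exists Cw : R, forall i m z, (m <= n.+2)%N -> `|iparts i m w z| <= Cw.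
Proof.
move=> n0 [hw hc].
have h1 (p : 'I_n * 'I_n.+3) : exists M : R, forall z, `|iparts p.1 p.2 w z| <= M.
  have hcont : continuous (iparts p.1 p.2 w).
    by apply: (@Ck_cont _ _ 0); apply: Ck_iparts; exact: hw.
  have hK := continuous_compact (continuous_subspaceT hcont) hc.
  case: (compact_bounded hK) => M [_ hM].
  exists (`|M| + 1) => z.
  have [hz|hz] := pselect (supp w z); last first.
    by rewrite (iparts_off_supp _ _ hz) normr0 addr_ge0.
  apply: (hM (`|M| + 1)); last by exists z.
  by rewrite ltr_pwDr // ler_norm.
have [M hM] := boolp.choice h1.
exists (\sum_p `|M p|) => i m z hm.
apply: le_trans (hM (i, Ordinal (hm : (m < n.+3)%N)) z) _.
apply: le_trans (ler_norm _) _.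
exact: (ler_sum_term (F := fun p => `|M p|)).
Qed.

End Weight.

Lemma good_total (R : realType) (n r : nat) (f : 'I_r -> 'rV[R]_n -> R) (x0 : 'rV[R]_n) (rho C : R)
    (w : 'rV[R]_n -> R) : (1 < n)%N -> (0 < r)%N -> (forall k, Ck n.+2 (f k)) -> good f x0 rho C ->
  Cc_infty w -> (forall x, 0 <= w x) -> supp w `<=` ball x0 (rho / 4) ->
  exists c1 c2 C : R, [/\ 0 < c1, 0 < c2, 0 < C &
  forall (Q : nat) (delta : R), (1 <= Q)%N -> ((3 <= n)%N -> (2 <= Q)%N) -> 0 <= delta <= 1 / 2 ->
    `|N_w f w Q delta - (2 * delta) ^+ r * N_0 w Q| <= C * error_bound n r c1 c2 Q delta].
Proof.
move=> n2 r1 hf hg hcc w0 hs.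
have n0 : (0 < n)%N by exact: ltnW.
have [Cw hCw] := iparts_bounded n0 hcc.
have hw2 : Ck n.+2 w by case: hcc => h _; exact: h.
have hs4 x : w x != 0 -> supd x x0 (rho / 4).
  move=> hx i; have /hs : supp w x by exact: subset_closure.
  by move=> [_ /(_ 0 i)] /ltW; rewrite distrC.
have [b [K [b0 K0 hexp]]] := exp_sum hg hf hw2 hCw n2 hs4 (Ordinal r1).
have [/andP[rho0 rho1] _ _] := hg.
pose A := (Num.truncn (\sum_i `|x0 0 i| + 1)).+1.
have hA x : w x != 0 -> forall i, `|x 0 i| <= A%:R.
  move=> hx i; apply: le_trans (ltW (truncnS_gt _)).
  have h1 := hs4 _ hx i; have h2 := ler_sum_term (F := fun i => `|x0 0 i|) i (fun j => normr_ge0 _).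
  have h3 := ler_normD (x 0 i - x0 0 i) (x0 0 i); rewrite subrK in h3.
  by lra.
have hw x : 0 <= w x <= Cw.
  by rewrite w0 /=; apply: le_trans (ler_norm _) _; exact: (hCw (Ordinal n0) 0 x).
have [b' [K' [b'0 K'0 hsh]]] := shell_bound n2 r1 b0 K0 hA hw hexp.
exact: total_bound n2 r1 b'0 K'0 hsh.
Qed.

Theorem theorem1p1 (R : realType) (n r l : nat) (f : 'I_r -> 'rV[R]_n -> R)
    (hn : (2 <= n)%N) (hr : (1 <= r)%N)
    (hl : Num.max (n%:R + 1) (n%:R / 2 + 4) < l%:R :> R)
    (hf : forall k, Ck l (f k)) :
  exists U : 'rV[R]_n -> set 'rV[R]_n,
    (forall x0, curvature_condition f x0 -> open_nbhs x0 (U x0)) /\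
    forall w : 'rV[R]_n -> R, Cc_infty w -> (forall x, 0 <= w x) ->
    exists c1 c2 C : R, [/\ 0 < c1, 0 < c2, 0 < C &
      forall x0, curvature_condition f x0 -> supp w `<=` U x0 ->
      forall (Q : nat) (delta : R),
        (1 <= Q)%N -> ((3 <= n)%N -> (2 <= Q)%N) -> 0 <= delta <= 1 / 2 ->
        `|N_w f w Q delta - (2 * delta) ^+ r * N_0 w Q|
          <= C * error_bound n r c1 c2 Q delta].

Proof.
have hnl : (n.+2 <= l)%N.
  have /andP[h _] : (n%:R + 1 < l%:R :> R) && (n%:R / 2 + 4 < l%:R :> R) by rewrite -gt_max.
  by rewrite natr1 ltr_nat in h.
have hf2 k : Ck n.+2 (f k) by exact: Ck_le (hf k).
(* The weight is confined to a ball of radius rho/4 to leave room for the base points y, which fill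
   the cube of radius rho/2, and for the local sums around them. *)
pose P x0 (V : set 'rV[R]_n) := open_nbhs x0 V /\ (curvature_condition f x0 ->
  exists rho C : R, good f x0 rho C /\ V `<=` ball x0 (rho / 4)).
have hP x0 : exists V, P x0 V.
  have [hc|hc] := pselect (curvature_condition f x0); last first.
    by exists setT; split => //; split => //; exact: openT.
  have [rho [C hg]] := curv_good hnl hn hf hc.
  have [/andP[rho0 _] _ _] := hg.
  have r4 : 0 < rho / 4 by rewrite divr_gt0.
  exists (ball x0 (rho / 4))°; split; first exact: (open_nbhs_ball x0 (PosNum r4)).
  by move=> _; exists rho, C; split => //; exact: interior_subset.
have [U hU] := boolp.choice hP.
exists U; split=> [x0 _|w hw w0]; first by have [] := hU x0.
(* The constants have to be chosen before x0. If some x0 fits w, its constants serve for every other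
   one, because the estimate does not mention x0; if none fits, any constants do. *)
have [[x0 [hc hs]]|hno] := pselect (exists x0, curvature_condition f x0 /\ supp w `<=` U x0); last first.
  by exists 1, 1, 1; split => // x0 hc hs; case: hno; exists x0.
have [_ /(_ hc) [rho [C [hg hV]]]] := hU x0.
have [c1 [c2 [C' [h1 h2 h3 h]]]] := good_total hn hr hf2 hg hw w0 (subset_trans hs hV).
by exists c1, c2, C'; split => // _ _ _ Q d Q1 Qn hd; exact: h.
Qed.
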